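(* There is a universal constant $C$ (one may take $C = 18\sqrt{2} < 26$) such that the following holds. Let $\mu = e^{-V}dx$ be a probability measure on $\mathbb{R}^n$ with $\operatorname{Hess} V \geq \mathrm{I}_n$, let $1 \le k \leq n$, let $\epsilon \geq 0$, and assume that there exist $k$ functions $u_1,\dots,u_k \in H^1(\mu)$ such that for every $i \in \{1,\dots,k\}$ $$\int u_i\, d\mu = 0, \qquad \int u_i^2\, d\mu = 1, \qquad \int \nabla u_i \cdot \nabla u_j\, d\mu = 0 \quad \forall j \neq i,$$ and $$\int |\nabla u_i|^2\, d\mu \leq 1 + \epsilon.$$ Then there exist a linear subspace $\mathcal{V} \subset \mathbb{R}^n$ with $\dim(\mathcal{V}) = k$ and a vector $p \in \mathcal{V}$ such that $$W_1(\mu, \gamma_{p,\mathcal{V}} \otimes \bar{\mu}) \leq C\, k^{3/2} \sqrt{\epsilon},$$ where $\gamma_{p,\mathcal{V}}$ is the standard Gaussian measure on $\mathcal{V}$ with barycenter $p$, and $\bar{\mu}$ is the marginal distribution of $\mu$ on $\mathcal{V}^{\perp}$, which enjoys the same convexity property as $\mu$ (i.e. $\bar\mu = e^{-W}dz$ on $\mathcal{V}^\perp$ with $\operatorname{Hess} W \geq \mathrm{I}_{n-k}$).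
   Context: $H^1(\mu) := \{f : \int (|f|^2 + |\nabla f|^2)\, d\mu < \infty\}$ is the weighted Sobolev space with respect to $\mu$. $W_1$ is the $L^1$ Kantorovich-Wasserstein distance on probability measures on $\mathbb{R}^n$ (Euclidean cost). The standard Gaussian measure on a $k$-dimensional subspace $\mathcal{V}$ with barycenter $p \in \mathcal V$ is the Gaussian measure on $\mathcal{V}$ with mean $p$ and identity covariance. The product $\gamma_{p,\mathcal{V}} \otimes \bar{\mu}$ is viewed as a measure on $\mathbb{R}^n = \mathcal{V} \oplus \mathcal{V}^{\perp}$. *)

(* Defs.v *)
From HB Require Import structures.
From mathcomp Require Import all_boot all_order all_algebra.
From mathcomp Require Import all_classical all_reals all_analysis.
From mathcomp Require Import measurable_realfun.

Set Implicit Arguments.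
Unset Strict Implicit.
Unset Printing Implicit Defensive.

Import Order.TTheory GRing.Theory Num.Theory.
Import numFieldNormedType.Exports.

Local Open Scope classical_set_scope.
Local Open Scope ring_scope.

(* The library norm [`|x|] on ['rV[R]_n] is the sup norm; it is used below only
   through the topology, which is the Euclidean one. *)

Definition dot {R : realType} {n : nat} (x y : 'rV[R]_n) : R :=
  \sum_(i < n) x 0 i * y 0 i.

Definition enorm {R : realType} {n : nat} (x : 'rV[R]_n) : R :=
  Num.sqrt (dot x x).

Definition rV_display : measure_display.
Proof. exact: default_measure_display. Qed.

Section measurable_rV.
Context {R : realType} {n : nat}.

(* The product sigma-algebra, generated by the coordinates, as for
   [n.-tuple T]; it is the Borel sigma-algebra. *)
Definition rV_measurable : set (set 'rV[R]_n) :=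
  g_sigma_preimage (fun (i : 'I_n) (x : 'rV[R]_n) => x 0 i : measurableTypeR R).

Let rV_set0 : rV_measurable set0.
Proof. exact: sigma_algebra0. Qed.

Let rV_setC A : rV_measurable A -> rV_measurable (~` A).
Proof. exact: sigma_algebraC. Qed.

Let rV_bigcup (F : _^nat) :
  (forall i, rV_measurable (F i)) -> rV_measurable (\bigcup_i (F i)).
Proof. exact: sigma_algebra_bigcup. Qed.

HB.instance Definition _ := @isMeasurable.Build rV_display
  'rV[R]_n rV_measurable rV_set0 rV_setC rV_bigcup.

End measurable_rV.

Lemma measurable_coord {R : realType} {n : nat} (i : 'I_n) :
  measurable_fun [set: 'rV[R]_n]
    (fun x : 'rV[R]_n => x 0 i : measurableTypeR R).
Proof.
move=> _ Y mY; rewrite setTI; apply: sub_sigma_algebra => /=.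
rewrite -bigcup_seq/=; exists i => /=; first by rewrite mem_index_enum.
by exists Y => //; rewrite setTI.
Qed.

Lemma measurable_rVP {d} {T : measurableType d} {R : realType} {n : nat}
    (f : T -> 'rV[R]_n) :
  measurable_fun [set: T] f <->
  forall i, measurable_fun [set: T] (fun t => f t 0 i : measurableTypeR R).
Proof.
split=> [mf i|mf]; first exact: (measurableT_comp (measurable_coord i) mf).
move=> _ A mA; rewrite setTI.
suff : (@measurable _ 'rV[R]_n : set (set 'rV[R]_n)) `<=`
    [set B | measurable (f @^-1` B)] by exact.
apply: smallest_sub; first split => /=.
- by rewrite preimage_set0.
- by move=> B mB; rewrite setTD preimage_setC; exact: measurableC.
- by move=> F mF; rewrite preimage_bigcup; exact: bigcup_measurable.
- move=> B; rewrite -bigcup_seq/= => -[i _ [C mC <-]].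
  by rewrite setTI -comp_preimage -[X in measurable X]setTI; exact: mf.
Qed.

Definition rV_cons {R : realType} {n : nat}
    (p : measurableTypeR R * 'rV[R]_n) : 'rV[R]_n.+1 :=
  \row_(i < n.+1) oapp (fun j => p.2 0 j) p.1 (unlift ord0 i).

Definition rV_uncons {R : realType} {n : nat}
    (x : 'rV[R]_n.+1) : measurableTypeR R * 'rV[R]_n :=
  (x 0 ord0, \row_(j < n) x 0 (lift ord0 j)).

Lemma rV_consK {R : realType} {n : nat} :
  cancel (@rV_cons R n) (@rV_uncons R n).
Proof.
move=> [a v]; rewrite /rV_uncons mxE unlift_none/=; congr pair.
by apply/rowP => j; rewrite !mxE liftK.
Qed.

Lemma measurable_rV_cons {R : realType} {n : nat} :
  measurable_fun setT (@rV_cons R n).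
Proof.
apply/measurable_rVP => i.
case: (unliftP ord0 i) => [j ->|->].
- rewrite (_ : (fun _ => _) = (fun x : 'rV[R]_n => x 0 j : measurableTypeR R)
    \o snd); last by apply/funext => t /=; rewrite mxE liftK.
  exact: measurableT_comp (measurable_coord j) measurable_snd.
- rewrite (_ : (fun _ => _) = fst) //.
  by apply/funext => t /=; rewrite mxE unlift_none.
Qed.

Lemma measurable_rV_uncons {R : realType} {n : nat} :
  measurable_fun setT (@rV_uncons R n).
Proof.
apply: measurable_fun_pair; first exact: measurable_coord.
apply/measurable_rVP => i.
rewrite (_ : (fun _ => _) = fun x : 'rV[R]_n.+1 => x 0 (lift ord0 i)); last first.
  by apply/funext => x; rewrite mxE.
exact: measurable_coord.
Qed.

Section lebesgue_step.
Context {R : realType} {n : nat}.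
Variable m : {sigma_finite_measure set 'rV[R]_n -> \bar R}.

Definition lebesgue_step : set 'rV[R]_n.+1 -> \bar R :=
  pushforward (@lebesgue_measure R \x m)%E rV_cons.

Let step0 : lebesgue_step set0 = 0%E.
Proof. by rewrite /lebesgue_step /pushforward preimage_set0 measure0. Qed.

Let mcons A : measurable A -> measurable (@rV_cons R n @^-1` A).
Proof. by move=> mA; rewrite -[X in measurable X]setTI; exact: measurable_rV_cons. Qed.

Let step_ge0 A : (0 <= lebesgue_step A)%E.
Proof. by rewrite /lebesgue_step /pushforward; exact: measure_ge0. Qed.

Let step_sigma_additive : semi_sigma_additive lebesgue_step.
Proof.
move=> F mF tF mUF; rewrite /lebesgue_step /pushforward preimage_bigcup.
apply: measure_semi_sigma_additive.
- by move=> i; exact: mcons.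
- apply/trivIsetP => /= i j _ _ ij; rewrite -preimage_setI.
  by move/trivIsetP : tF => /(_ _ _ _ _ ij) ->//; rewrite preimage_set0.
- by rewrite -preimage_bigcup; exact: mcons.
Qed.

HB.instance Definition _ := isMeasure.Build _ _ _ lebesgue_step
  step0 step_ge0 step_sigma_additive.

Let step_sigma_finite : sigma_finite setT lebesgue_step.
Proof.
have /sigma_finiteP[F [TF ndF Foo]] := sigma_finiteT (@lebesgue_measure R).
have /sigma_finiteP[G [TG ndG Goo]] := sigma_finiteT m.
exists (fun i => rV_uncons @^-1` (F i `*` G i)).
  rewrite -preimage_bigcup (_ : \bigcup_i _ = setT) ?preimage_setT//.
  apply/seteqP; split => // -[x y] _.
  have [a _ Fax] : (\bigcup_i F i) x by rewrite -TF.
  have [b _ Gby] : (\bigcup_i G i) y by rewrite -TG.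
  exists (maxn a b) => //; split => /=.
    by move: x Fax; exact/subsetPset/ndF/leq_maxl.
  by move: y Gby; exact/subsetPset/ndG/leq_maxr.
move=> i; have [mF Fi] := Foo i; have [mG Gi] := Goo i; split.
  rewrite -[X in measurable X]setTI; apply: measurable_rV_uncons => //.
  exact: measurableX.
rewrite /lebesgue_step /pushforward -comp_preimage.
rewrite (_ : _ \o _ = id) ?preimage_id; last first.
  by apply/funext => p /=; exact: rV_consK.
by rewrite product_measure1E// lte_mul_pinfty// ge0_fin_numE.
Qed.

HB.instance Definition _ := Measure_isSigmaFinite.Build _ _ _ lebesgue_step
  step_sigma_finite.

End lebesgue_step.

(* Lebesgue measure on [R^n]: the [n]-fold product of the Lebesgue measure on
   the line; on [R^0] it is the unit mass at the only point. *)
Fixpoint lebesgue_rV (R : realType) (n : nat) :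
    {sigma_finite_measure set 'rV[R]_n -> \bar R} :=
  match n with
  | 0 => dirac (0 : 'rV[R]_0)
  | m.+1 => lebesgue_step (lebesgue_rV R m)
  end.

Lemma measurable_mulmxr {R : realType} {m n : nat} (A : 'M[R]_(m, n)) :
  measurable_fun [set: 'rV[R]_m] (fun x : 'rV[R]_m => x *m A).
Proof.
apply/measurable_rVP => i.
rewrite (_ : (fun _ => _) = fun x : 'rV[R]_m => \sum_j x 0 j * A j i); last first.
  by apply/funext => x; rewrite mxE.
apply: measurable_sum => j; apply: measurable_funM => //.
exact: measurable_coord.
Qed.

Lemma dotE {R : realType} {n : nat} (x y : 'rV[R]_n) :
  dot x y = (x *m y^T) 0 0.
Proof. by rewrite mxE; apply: eq_bigr => i _; rewrite mxE. Qed.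

Definition orth_compl {R : realType} {n : nat} (U : {vspace 'rV[R]_n}) :
    {vspace 'rV[R]_n} :=
  lker (linfun (mulmxr (\matrix_(i < \dim U) (vbasis U)`_i)^T)).

Lemma memv_orth_compl {R : realType} {n : nat} (U : {vspace 'rV[R]_n}) x :
  x \in orth_compl U <-> forall y, y \in U -> dot x y = 0.
Proof.
rewrite memv_ker lfunE /=; split=> [/eqP xU y /coord_vbasis ->|xU].
- rewrite dotE linear_sum mulmx_sumr summxE big1// => i _.
  rewrite linearZ /= -scalemxAr mxE; apply/eqP; rewrite mulf_eq0; apply/orP; right.
  move/rowP : xU => /(_ i); rewrite !mxE => xU; apply/eqP; rewrite -[RHS]xU.
  by apply: eq_bigr => j _; rewrite !mxE.
- apply/eqP/rowP => i; rewrite !mxE -[RHS](xU (vbasis U)`_i).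
    by apply: eq_bigr => j _; rewrite !mxE.
  by apply: vbasis_mem; rewrite mem_nth ?size_tuple.
Qed.

(* The rows are the vectors of some orthonormal basis of [U]. *)
Definition is_frame {R : realType} {n : nat} (U : {vspace 'rV[R]_n})
    (A : 'M[R]_(\dim U, n)) : Prop :=
  A *m A^T = 1%:M /\ forall i, row i A \in U.

Lemma frame_exists {R : realType} {n : nat} (U : {vspace 'rV[R]_n}) :
  exists A, is_frame (U := U) A.
Proof.
rewrite /is_frame; move: {-1}(\dim U) (erefl (\dim U)) => m.
elim: m U => [|m IH] U dU.
  by exists 0; split => [|[]//]; rewrite [LHS]flatmx0 [RHS]flatmx0.
pose v := vpick U.
have v0 : v != 0 by rewrite vpick0 -dimv_eq0 dU.
have vv : 0 < dot v v.
  rewrite lt_neqAle eq_sym sumr_ge0 ?andbT; last by move=> i _; exact: sqr_ge0.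
  apply: contra v0 => /eqP vv0; apply/eqP/rowP => i; rewrite mxE.
  have /psumr_eq0P : \sum_(i < n) v 0 i * v 0 i = 0 by exact: vv0.
  move=> /(_ (fun i _ => sqr_ge0 _)) /(_ i isT) /eqP.
  by rewrite mulf_eq0 orbb => /eqP.
pose a := (Num.sqrt (dot v v))^-1 *: v.
have aU : a \in U by rewrite memvZ// memv_pick.
have aa : a *m a^T = 1%:M.
  apply/matrixP => i j; rewrite !ord1 linearZ /= -scalemxAr -scalemxAl scalerA.
  rewrite [LHS]mxE -dotE mxE eqxx -[X in _ * X]sqr_sqrtr ?ltW// -invfM -expr2.
  by rewrite mulVf// expf_neq0// gt_eqF// sqrtr_gt0.
pose f : 'Hom('rV[R]_n, 'rV[R]_1) := linfun (mulmxr a^T).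
have fa : f a = 1%:M by rewrite lfunE /= aa.
have dU' : \dim (U :&: lker f) = m.
  have := limg_ker_dim f U; rewrite dU.
  suff -> : \dim (f @: U) = 1%N by rewrite addn1 => -[].
  apply/eqP; rewrite eqn_leq; apply/andP; split.
    by rewrite (leq_trans (dimvS (subvf _)))// dimvf /dim/= muln1.
  rewrite lt0n dimv_eq0; apply/eqP => fU0.
  have : f a \in (f @: U)%VS by exact: memv_img.
  rewrite fU0 memv0 fa => /eqP/matrixP/(_ 0 0); rewrite !mxE eqxx => /eqP.
  by rewrite oner_eq0.
have [A [AA AU]] := IH _ dU'.
have Aa : A *m a^T = 0.
  apply/matrixP => i j; rewrite ord1; move: (AU i); rewrite memv_cap => /andP[_].
  rewrite memv_ker lfunE /= -row_mul => /eqP/rowP/(_ 0).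
  by rewrite !mxE.
suff : exists B : 'M[R]_(1 + m, n),
  B *m B^T = 1%:M /\ forall i, row i B \in U by [].
exists (col_mx a A); split.
  rewrite tr_col_mx mul_col_row aa AA Aa.
  have -> : a *m A^T = 0 by rewrite -[LHS]trmxK trmx_mul trmxK Aa trmx0.
  by rewrite -scalar_mx_block.
move=> i; case: (splitP i) => j ij.
- rewrite (_ : i = lshift m j); last exact: val_inj.
  suff -> : row (lshift m j) (col_mx a A) = a by [].
  by apply/rowP => x; rewrite mxE col_mxEu ord1.
- rewrite (_ : i = rshift 1 j); last exact: val_inj.
  suff -> : row (rshift 1 j) (col_mx a A) = row j A.
    by move: (AU j); rewrite memv_cap => /andP[].
  by apply/rowP => x; rewrite [LHS]mxE col_mxEd mxE.
Qed.

Definition frame {R : realType} {n : nat} (U : {vspace 'rV[R]_n}) :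
    'M[R]_(\dim U, n) := xget 0 (is_frame (U := U)).

Lemma frameP {R : realType} {n : nat} (U : {vspace 'rV[R]_n}) :
  is_frame (frame U).
Proof. exact: (xgetPex _ (frame_exists U)). Qed.

Definition orth_proj {R : realType} {n : nat} (U : {vspace 'rV[R]_n})
    (x : 'rV[R]_n) : 'rV[R]_n :=
  x *m (frame U)^T *m frame U.

(* Lebesgue measure of the Euclidean space [U], carried to [U] by the isometry
   given by an orthonormal basis; it does not depend on that basis. *)
Definition lebesgue_on {R : realType} {n : nat} (U : {vspace 'rV[R]_n}) :
    set 'rV[R]_n -> \bar R :=
  pushforward (lebesgue_rV R (\dim U)) (fun z => z *m frame U).

Definition has_density {R : realType} {n : nat} (m l : set 'rV[R]_n -> \bar R)
    (f : 'rV[R]_n -> R) : Prop :=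
  forall A, measurable A -> m A = (\int[l]_(x in A) (f x)%:E)%E.

Definition gaussian_on {R : realType} {n : nat} (p : 'rV[R]_n)
    (U : {vspace 'rV[R]_n}) : set 'rV[R]_n -> \bar R :=
  fun A => (\int[lebesgue_on U]_(x in A)
    ((Num.sqrt (2 * pi) ^+ \dim U)^-1 * expR (- (enorm (x - p) ^+ 2 / 2)))%:E)%E.

Definition marginal_on {R : realType} {n : nat} (U : {vspace 'rV[R]_n})
    (m : set 'rV[R]_n -> \bar R) : set 'rV[R]_n -> \bar R :=
  pushforward m (orth_proj U).

(* For [m1], [m2] carried by complementary subspaces [U1], [U2]: the product
   measure on [U1 * U2], transported to [R^n] by the identification
   [(y, z) |-> y + z]. *)
Definition tensor {R : realType} {n : nat} (m1 m2 : set 'rV[R]_n -> \bar R) :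
    set 'rV[R]_n -> \bar R :=
  pushforward (m1 \x m2)%E (fun yz : 'rV[R]_n * 'rV[R]_n => yz.1 + yz.2).

Definition coupling {R : realType} {n : nat} (m1 m2 : set 'rV[R]_n -> \bar R)
    (P : probability ('rV[R]_n * 'rV[R]_n)%type R) : Prop :=
  forall A, measurable A ->
    P (A `*` setT) = m1 A /\ P (setT `*` A) = m2 A.

Definition W1 {R : realType} {n : nat} (m1 m2 : set 'rV[R]_n -> \bar R) :
    \bar R :=
  ereal_inf [set c | exists2 P, coupling m1 m2 P &
    c = (\int[P]_xy (enorm (xy.1 - xy.2))%:E)%E].

Definition smooth {R : realType} {n : nat} (f : 'rV[R]_n -> R) : Prop :=
  forall (s : seq 'rV[R]_n) (x : 'rV[R]_n),
    differentiable (foldr (fun v g => 'D_v g) f s) x.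

Definition test_function {R : realType} {n : nat} (f : 'rV[R]_n -> R) : Prop :=
  smooth f /\ compact (closure [set x | f x != 0]).

Definition loc_integrable {R : realType} {n : nat} (l : set 'rV[R]_n -> \bar R)
    (f : 'rV[R]_n -> R) : Prop :=
  measurable_fun setT f /\
  forall K, compact K -> (\int[l]_(x in K) `|f x|%:E < +oo)%E.

Definition is_weak_gradient {R : realType} {n : nat} (u : 'rV[R]_n -> R)
    (g : 'rV[R]_n -> 'rV[R]_n) : Prop :=
  [/\ loc_integrable (lebesgue_rV R n) u,
      forall i, loc_integrable (lebesgue_rV R n) (fun x => g x 0 i) &
      forall f, test_function f -> forall i,
        (\int[lebesgue_rV R n]_x (u x * 'D_(delta_mx 0 i) f x)%:E =
         - \int[lebesgue_rV R n]_x (g x 0 i * f x)%:E)%E].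

(* Weak gradients are unique up to Lebesgue-null sets, so the choice made here
   is immaterial in integrals against absolutely continuous measures. *)
Definition weak_gradient {R : realType} {n : nat} (u : 'rV[R]_n -> R) :
    'rV[R]_n -> 'rV[R]_n := xget (fun=> 0) (is_weak_gradient u).

Definition H1 {R : realType} {n : nat} (mu : set 'rV[R]_n -> \bar R) :
    set ('rV[R]_n -> R) :=
  [set u | (exists g, is_weak_gradient u g) /\
    (\int[mu]_x (u x ^+ 2 + enorm (weak_gradient u x) ^+ 2)%:E < +oo)%E].

(* [Hess V >= I] on the subspace [U] with Lebesgue measure [l], in the sense of
   distributions: for every [xi] in [U] the distribution
   [<(Hess V) xi, xi> - |xi|^2] is nonnegative. For [V] of class C^2 this is the
   pointwise inequality between symmetric matrices. Restrictions to [U] of test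
   functions on [R^n] are exactly the test functions on [U]. *)
Definition Hess_ge_Id {R : realType} {n : nat} (l : set 'rV[R]_n -> \bar R)
    (U : {vspace 'rV[R]_n}) (V : 'rV[R]_n -> R) : Prop :=
  loc_integrable l V /\
  forall f, test_function f -> (forall x, 0 <= f x) ->
  forall xi, xi \in U ->
    ((enorm xi ^+ 2)%:E * \int[l]_x (f x)%:E
      <= \int[l]_x (V x * 'D_xi ('D_xi f) x)%:E)%E.

(* Main.v *)
Require Import Defs.
From HB Require Import structures.
From mathcomp Require Import all_boot all_order all_algebra.
From mathcomp Require Import all_classical all_reals all_analysis.
From mathcomp Require Import measurable_realfun.
From mathcomp Require Import ring lra.

Set Implicit Arguments.
Unset Strict Implicit.
Unset Printing Implicit Defensive.

Import Order.TTheory GRing.Theory Num.Theory.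
Import numFieldNormedType.Exports.

Local Open Scope classical_set_scope.
Local Open Scope ring_scope.

(* [V] agrees a.e. with a continuous function that is strongly midpoint-convex, so
   Prekopa-Leindler type arguments apply to [F = e^-V] and replace second-order
   calculus; they yield the Poincare inequality. Adding an independent Gaussian to
   [X ~ mu] and studying the posterior mean of [u] given the sum makes Poincare
   stable: Var u - |Cov(u, X)|^2 <= 38 (E |grad u|^2 - Var u). Hence the vectors
   [Cov(u_i, X)] span a subspace along whose unit vectors the variance of [mu] is at
   least [1 - 39 k eps]. In coordinates that start with this subspace, the Knothe map
   [KN] sends a Gaussian vector [g] to [X]; it is triangular, each coordinate is
   1-Lipschitz in its own variable, and a Gaussian rotation argument bounds how much
   the coordinates outside the subspace depend on the first [k] variables. Coupling
   [KN g] with the translated [g_i] inside the subspace, and with [KN] recomputed from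
   resampled [g_1, .., g_k] outside, has quadratic cost at most
   [3 k^2 * 39 k eps <= (18 sqrt 2)^2 k^3 eps]. *)

(** Neither [V] nor the weak gradients can be differentiated against [mu]. Gradient information
    therefore enters as the two-point bound [|u (x + d) - u (x - d)| <= 2 * enorm d * (L x + C *
    enorm d)]: mollified functions satisfy it, and it is what Prekopa-Leindler can compare.
    Stability rests on the posterior being twice as log-concave as [mu], so its Poincare constant is
    1/2 and conditioning removes at most about half of the variance of a nearly extremal [u]. The
    model is a linear [u] under a Gaussian law, whose posterior mean is [u / 2] evaluated at the
    observed sum; hence [u] is compared with twice the smoothed posterior mean, and that with a
    linear function. The transport is triangular because the rotation argument only bounds, by
    [2 * j], the total energy over all outputs produced by moving the first [j] inputs: the first
    [j] outputs see no other inputs and have variance close to one, so they exhaust this budget and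
    leave little to the rest. The constant 39 is [38 / (1 - 1 / 39)]: 38 from stability, the
    denominator from near-orthonormality of the [u_i]. *)

Local Notation measf := (measurable_fun setT).

(** * Integrals and expectations of real-valued functions *)

Definition intg d (T : measurableType d) (R : realType)
    (m : {measure set T -> \bar R}) (f : T -> R) : Prop :=
  m.-integrable setT (EFin \o f).

Definition Ex d (T : measurableType d) (R : realType)
    (m : {measure set T -> \bar R}) (f : T -> R) : R :=
  \int[m]_x f x.

Section expectation.
Context d (T : measurableType d) (R : realType) (m : {measure set T -> \bar R}).
Implicit Types f g : T -> R.

Lemma ExE f : intg m f -> (\int[m]_x (f x)%:E)%E = (Ex m f)%:E.
Proof. by move=> mf; rewrite /Ex /Rintegral fineK//; exact: integrable_fin_num mf. Qed.

Lemma intg_meas f : intg m f -> measf f.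
Proof. by move=> /(measurable_int)/measurable_EFinP. Qed.

Lemma intg_le f g : measf f -> (forall x, `|f x| <= g x) ->
  intg m g -> intg m f.
Proof.
move=> mf fg; apply: le_integrable => //; first exact/measurable_EFinP.
by move=> x _ /=; rewrite lee_fin (le_trans (fg x))// ler_norm.
Qed.

Lemma intgD f g : intg m f -> intg m g -> intg m (fun x => f x + g x).
Proof. by move=> mf mg; exact: (integrableD _ mf mg). Qed.

Lemma intgZ c f : intg m f -> intg m (fun x => c * f x).
Proof. by move=> mf; exact: (integrableZl _ c mf). Qed.

Lemma intgN f : intg m f -> intg m (fun x => - f x).
Proof. by move=> /(@intgZ (-1)); congr intg; apply/funext => x; rewrite mulN1r. Qed.

Lemma intgB f g : intg m f -> intg m g -> intg m (fun x => f x - g x).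
Proof. by move=> mf mg; exact: intgD mf (intgN mg). Qed.

Lemma intg0 : intg m (fun=> 0).
Proof. exact: integrable0. Qed.

Lemma intg_sum I (s : seq I) (P : pred I) (f : I -> T -> R) :
  (forall i, P i -> intg m (f i)) -> intg m (fun x => \sum_(i <- s | P i) f i x).
Proof.
move=> mf; elim: s => [|i s IH].
  by under [X in intg m X]funext do rewrite big_nil; exact: intg0.
under [X in intg m X]funext do rewrite big_cons.
by case Pi: (P i) => //; apply: intgD => //; exact: mf.
Qed.

Lemma intg_abs f : intg m f -> intg m (fun x => `|f x|).
Proof. by move=> mf; apply: (integrable_norm _). Qed.

Lemma ExD f g : intg m f -> intg m g ->
  Ex m (fun x => f x + g x) = Ex m f + Ex m g.
Proof. by move=> mf mg; exact: RintegralD. Qed.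

Lemma ExZ c f : intg m f -> Ex m (fun x => c * f x) = c * Ex m f.
Proof. by move=> mf; exact: RintegralZl. Qed.

Lemma ExN f : intg m f -> Ex m (fun x => - f x) = - Ex m f.
Proof.
move=> mf; rewrite -[RHS]mulN1r -ExZ//.
by congr Ex; apply/funext => x; rewrite mulN1r.
Qed.

Lemma ExB f g : intg m f -> intg m g ->
  Ex m (fun x => f x - g x) = Ex m f - Ex m g.
Proof. by move=> mf mg; exact: RintegralB. Qed.

Lemma Ex0 : Ex m (fun=> 0) = 0.
Proof. by rewrite /Ex /Rintegral integral0. Qed.

Lemma Ex_sum I (s : seq I) (P : pred I) (f : I -> T -> R) :
  (forall i, P i -> intg m (f i)) ->
  Ex m (fun x => \sum_(i <- s | P i) f i x) = \sum_(i <- s | P i) Ex m (f i).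
Proof.
move=> mf; elim: s => [|i s IH].
  by rewrite big_nil; under [X in Ex m X]funext do rewrite big_nil; exact: Ex0.
rewrite big_cons; under [X in Ex m X]funext do rewrite big_cons.
by case Pi: (P i) => //; rewrite ExD ?IH//; [exact: mf|exact: intg_sum].
Qed.

Lemma Ex_le f g : intg m f -> intg m g -> (forall x, f x <= g x) ->
  Ex m f <= Ex m g.
Proof. by move=> mf mg fg; apply: le_Rintegral. Qed.

Lemma Ex_ge0 f : (forall x, 0 <= f x) -> 0 <= Ex m f.
Proof. by move=> f0; apply: Rintegral_ge0. Qed.

Lemma Ex_abs f : intg m f -> `|Ex m f| <= Ex m (fun x => `|f x|).
Proof. by move=> mf; apply: le_normr_Rintegral. Qed.

Lemma intg_fin f : measf f -> (forall x, 0 <= f x) ->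
  (\int[m]_x (f x)%:E < +oo)%E -> intg m f.
Proof.
move=> mf f0 foo; apply/integrableP; split; first exact/measurable_EFinP.
by under eq_integral do rewrite /= ger0_norm//.
Qed.

Lemma intg_mul_bdd f g C : intg m f -> measf g ->
  (forall x, `|g x| <= C) -> intg m (fun x => g x * f x).
Proof.
move=> mf mg gC; apply: (@intg_le _ (fun x => C * `|f x|)).
- by apply: measurable_funM => //; exact: intg_meas mf.
- by move=> x; rewrite normrM ler_wpM2r.
- exact/intgZ/intg_abs.
Qed.

Lemma intg_sqr_mul f g : measf f -> measf g ->
  intg m (fun x => f x ^+ 2) -> intg m (fun x => g x ^+ 2) ->
  intg m (fun x => f x * g x).
Proof.
move=> mf mg f2 g2; apply: intg_le (intgD f2 g2); first exact: measurable_funM.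
move=> x; rewrite ler_norml; have := sqr_ge0 (f x - g x).
by have := sqr_ge0 (f x + g x); move: (f x) (g x) => a b; nra.
Qed.

Lemma intg_sqrD f g : measf f -> measf g ->
  intg m (fun x => f x ^+ 2) -> intg m (fun x => g x ^+ 2) ->
  intg m (fun x => (f x + g x) ^+ 2).
Proof.
move=> mf mg f2 g2; apply: (@intg_le _ (fun x => 2 * f x ^+ 2 + 2 * g x ^+ 2)).
- by apply: measurable_funX; exact: measurable_funD.
- move=> x; rewrite ger0_norm ?sqr_ge0//; have := sqr_ge0 (f x - g x).
  by move: (f x) (g x) => a b; nra.
- by apply: intgD; exact: intgZ.
Qed.

Lemma intg_sqrZ c f : intg m (fun x => f x ^+ 2) ->
  intg m (fun x => (c * f x) ^+ 2).
Proof.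
by move=> /(@intgZ (c ^+ 2)); congr intg; apply/funext => x; rewrite exprMn.
Qed.

Lemma Ex_sqrD f g : measf f -> measf g ->
  intg m (fun x => f x ^+ 2) -> intg m (fun x => g x ^+ 2) ->
  Ex m (fun x => (f x + g x) ^+ 2) =
  Ex m (fun x => f x ^+ 2) + 2 * Ex m (fun x => f x * g x) + Ex m (fun x => g x ^+ 2).
Proof.
move=> mf mg f2 g2; have fg := intg_sqr_mul mf mg f2 g2.
rewrite -ExZ// -ExD//; last exact: intgZ.
rewrite -ExD//; last by apply: intgD => //; exact: intgZ.
by congr Ex; apply/funext => x; ring.
Qed.

(** The discriminant argument shared by the Cauchy-Schwarz inequalities for expectations, for [dot]
    and for covariances. *)
Lemma quad_discr (a b c : R) : 0 <= c ->
  (forall t : R, 0 <= a + t * (2 * b) + t ^+ 2 * c) -> b ^+ 2 <= a * c.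
Proof.
move=> c0 H; have [cE|cN] := eqVneq c 0.
  have [->|b0] := eqVneq b 0; first by rewrite cE mulr0 expr0n.
  (* Without quadratic term and with [b] nonzero, this [t] gives the affine function the value
     -1. *)
  have := H (- (a + 1) / (2 * b)); rewrite cE mulr0 addr0 divfK; first by lra.
  by rewrite mulf_neq0.
have cp : 0 < c by rewrite lt_neqAle eq_sym cN.
have := H (- b / c).
have -> : a + - b / c * (2 * b) + (- b / c) ^+ 2 * c = (a * c - b ^+ 2) / c.
  by field.
by rewrite pmulr_lge0 ?invr_gt0// subr_ge0.
Qed.

Lemma cauchy_schwarz f g : measf f -> measf g ->
  intg m (fun x => f x ^+ 2) -> intg m (fun x => g x ^+ 2) ->
  Ex m (fun x => f x * g x) ^+ 2 <= Ex m (fun x => f x ^+ 2) * Ex m (fun x => g x ^+ 2).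
Proof.
move=> mf mg f2 g2; apply: quad_discr; first by apply: Ex_ge0 => x; exact: sqr_ge0.
move=> t; have mtg : measf (fun x => t * g x).
  by apply: measurable_funM => //; exact: measurable_cst.
have E := Ex_sqrD mf mtg f2 (intg_sqrZ t g2).
have : 0 <= Ex m (fun x => (f x + t * g x) ^+ 2).
  by apply: Ex_ge0 => x; exact: sqr_ge0.
have e1 : Ex m (fun x => (t * g x) ^+ 2) = t ^+ 2 * Ex m (fun x => g x ^+ 2).
  by rewrite -ExZ//; congr Ex; apply/funext => x; rewrite exprMn.
have e2 : Ex m (fun x => f x * (t * g x)) = t * Ex m (fun x => f x * g x).
  rewrite -ExZ; last exact: intg_sqr_mul.
  by congr Ex; apply/funext => x; ring.
by rewrite E e1 e2; lra.
Qed.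

Lemma Ex_dct (f : nat -> T -> R) (h g : T -> R) :
  (forall k, measf (f k)) ->
  (forall x, f k x @[k --> \oo] --> h x) ->
  intg m g -> (forall k x, `|f k x| <= g x) ->
  intg m h /\ Ex m (f k) @[k --> \oo] --> Ex m h.
Proof.
move=> mf fh ig fg.
have mh : measf h by apply: measurable_fun_cvg mf _ => x _; exact: fh.
have [ih _ cv] : [/\ m.-integrable setT (EFin \o h),
   [sequence \int[m]_x (`|(f n x)%:E - (h x)%:E|)]_n%E @ \oo --> 0%E
   & [sequence \int[m]_x (f n x)%:E]_n%E @ \oo --> (\int[m]_x (h x)%:E)%E].
  apply: (@dominated_convergence _ _ _ m setT _ (fun n x => (f n x)%:E)
     (EFin \o h) (EFin \o g)) => //.
  - by move=> k; exact/measurable_EFinP.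
  - exact/measurable_EFinP.
  - by apply/aeW => x _; apply: cvg_EFin; [exact: nearW|exact: fh].
  - by apply/aeW => x n _ /=; rewrite lee_fin.
split => //; move: cv; rewrite (ExE ih) => /fine_cvg/=.
by [].
Qed.

End expectation.

Section probability_expectation.
Context d (T : measurableType d) (R : realType) (P : probability T R).

Lemma intg_cst c : intg P (fun=> c).
Proof. exact: finite_measure_integrable_cst. Qed.

Lemma Ex_cst c : Ex P (fun=> c) = c.
Proof. by rewrite /Ex Rintegral_cst// /= -?[P setT]/(P setT) probability_setT/= mulr1. Qed.

Lemma intg_bdd (f : T -> R) C : measf f -> (forall x, `|f x| <= C) -> intg P f.
Proof. by move=> mf fC; apply: intg_le mf fC _; exact: intg_cst. Qed.

Lemma intg_sqr (f : T -> R) : measf f -> intg P (fun x => f x ^+ 2) -> intg P f.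
Proof.
move=> mf f2; apply: intg_le (intgD f2 (intg_cst 1)) => // x.
by rewrite ler_norml; move: (f x) => a; nra.
Qed.

(** Integrates the tangent-line bound [expR (f x) >= expR z * (1 + f x - z)] at the mean [z]. *)
Lemma jensen_expR (f : T -> R) : intg P f -> intg P (fun x => expR (f x)) ->
  expR (Ex P f) <= Ex P (fun x => expR (f x)).
Proof.
move=> If Ie; set z := Ex P f.
have -> : expR z = Ex P (fun x => expR z * ((1 - z) + f x)).
  rewrite ExZ; last by apply: intgD => //; exact: intg_cst.
  rewrite ExD//; last exact: intg_cst.
  by rewrite Ex_cst -/z subrK mulr1.
apply: Ex_le => //.
  by apply: intgZ; apply: intgD => //; exact: intg_cst.
move=> x; have -> : expR (f x) = expR z * expR (f x - z).
  by rewrite -expRD; congr expR; ring.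
rewrite ler_wpM2l ?expR_ge0//.
by have := expR_ge1Dx (f x - z); lra.
Qed.

Lemma jensen_expR_ereal (f : T -> R) : intg P f ->
  ((expR (Ex P f))%:E <= \int[P]_x (expR (f x))%:E)%E.
Proof.
move=> If; have mf := intg_meas If.
have me : measf (fun x => expR (f x)).
  exact: measurableT_comp (@measurable_expR R) mf.
have [h|] := ltP (\int[P]_x (expR (f x))%:E)%E +oo%E; last first.
  by rewrite leye_eq => /eqP ->; rewrite leey.
have Ie : intg P (fun x => expR (f x)) by apply: intg_fin => // x; exact: expR_ge0.
by rewrite ExE// lee_fin; exact: jensen_expR.
Qed.

Lemma Ex_sqr_le (f : T -> R) : measf f -> intg P (fun x => f x ^+ 2) ->
  Ex P f ^+ 2 <= Ex P (fun x => f x ^+ 2).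
Proof.
move=> mf f2; have := cauchy_schwarz mf (@measurable_cst _ _ _ _ setT (1 : R)) f2.
have -> : (fun=> (1:R) ^+ 2) = (fun=> 1 : R) :> (T -> R) by rewrite expr1n.
rewrite Ex_cst mulr1 => /(_ (intg_cst _)); congr (_ ^+ 2 <= _).
by congr Ex; apply/funext => x; rewrite mulr1.
Qed.

End probability_expectation.

Lemma measurable_comp2 d d1 d2 d3 (T : measurableType d) (S1 : measurableType d1)
    (S2 : measurableType d2) (S3 : measurableType d3) (c : S1 -> S2 -> S3) f g :
  measf (fun z : S1 * S2 => c z.1 z.2) ->
  measurable_fun [set: T] f -> measf g ->
  measf (fun t => c (f t) (g t)).
Proof.
move=> mc mf mg; apply: (measurableT_comp mc (g := fun t => (f t, g t))).
exact: measurable_fun_pair.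
Qed.

(** * Image laws, Fubini for real integrands, densities *)

Section law.
Context d1 d2 (T1 : measurableType d1) (T2 : measurableType d2) (R : realType).

Definition is_law (P : {measure set T1 -> \bar R}) (X : T1 -> T2)
    (Q : {measure set T2 -> \bar R}) : Prop :=
  measf X /\ forall A, measurable A -> Q A = P (X @^-1` A).

Context (P : {measure set T1 -> \bar R}) (X : T1 -> T2)
  (Q : {measure set T2 -> \bar R}).
Hypothesis PXQ : is_law P X Q.

Lemma law_ge0_integral (f : T2 -> \bar R) : measf f ->
  (forall x, 0 <= f x)%E ->
  (\int[Q]_y f y = \int[P]_x f (X x))%E.
Proof.
have [mX E] := PXQ; move=> mf f0.
have -> : (\int[Q]_y f y = \int[pushforward P X]_y f y)%E.
  by apply: eq_measure_integral => A mA _; rewrite E.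
by rewrite (ge0_integral_pushforward mX)// preimage_setT.
Qed.

Lemma law_intg f : measf f -> intg Q f <-> intg P (f \o X).
Proof.
have [mX E] := PXQ; move=> mf.
have h : (\int[Q]_y `|(f y)%:E| = \int[P]_x `|(f (X x))%:E|)%E.
  rewrite (@law_ge0_integral (fun y => `|(f y)%:E|%E))//.
  by apply: measurableT_comp => //; exact/measurable_EFinP.
split => /integrableP[_ foo]; apply/integrableP; split.
- by apply/measurable_EFinP; exact: measurableT_comp.
- by rewrite -h.
- exact/measurable_EFinP.
- by rewrite h.
Qed.

Lemma law_Ex f : measf f -> Ex Q f = Ex P (f \o X).
Proof.
move=> mf; rewrite /Ex /Rintegral integralE [in RHS]integralE; congr fine.
congr (_ - _)%E; rewrite law_ge0_integral.
- by apply: eq_integral => x _; rewrite !funeposE.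
- by apply: measurable_funepos; exact/measurable_EFinP.
- by move=> x; exact: funepos_ge0.
- by apply: eq_integral => x _; rewrite !funenegE.
- by apply: measurable_funeneg; exact/measurable_EFinP.
- by move=> x; exact: funeneg_ge0.
Qed.

End law.

Lemma law_of_integral d1 d2 (T1 : measurableType d1) (T2 : measurableType d2)
    (R : realType) (P : {measure set T1 -> \bar R}) (X : T1 -> T2)
    (Q : {measure set T2 -> \bar R}) : measf X ->
  (forall f : T2 -> \bar R, measf f -> (forall x, 0 <= f x)%E ->
    (\int[Q]_y f y = \int[P]_x f (X x))%E) -> is_law P X Q.
Proof.
move=> mX H; split => // A mA.
have mXA : measurable (X @^-1` A) by rewrite -[X in measurable X]setTI; exact: mX.
have := H (fun y => (\1_A y)%:E); rewrite integral_indic// setIT => ->.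
- by rewrite -[in RHS](setIT (X @^-1` A)) -integral_indic.
- by apply/measurable_EFinP; exact: measurable_indic.
- by move=> x; rewrite lee_fin.
Qed.

Lemma law_trans d1 d2 d3 (T1 : measurableType d1) (T2 : measurableType d2)
    (T3 : measurableType d3) (R : realType) (P : {measure set T1 -> \bar R})
    (Q : {measure set T2 -> \bar R}) (S : {measure set T3 -> \bar R}) X Y :
  is_law P X Q -> is_law Q Y S -> is_law P (Y \o X) S.
Proof.
move=> [mX EX] [mY EY]; split; first exact: measurableT_comp.
move=> A mA; rewrite EY// EX//; rewrite -[X in measurable X]setTI; exact: mY.
Qed.

Section fubini_real.
Context d1 d2 (T1 : measurableType d1) (T2 : measurableType d2) (R : realType).
Context (m1 : {sigma_finite_measure set T1 -> \bar R})
        (m2 : {sigma_finite_measure set T2 -> \bar R}).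

Lemma tonelli1 (f : T1 * T2 -> \bar R) : measf f ->
  (forall x, 0 <= f x)%E ->
  (\int[m1 \x m2]_z f z = \int[m1]_x \int[m2]_y f (x, y))%E.
Proof. by move=> mf f0; exact: fubini_tonelli1. Qed.

Lemma tonelli2 (f : T1 * T2 -> \bar R) : measf f ->
  (forall x, 0 <= f x)%E ->
  (\int[m1 \x m2]_z f z = \int[m2]_y \int[m1]_x f (x, y))%E.
Proof. by move=> mf f0; exact: fubini_tonelli2. Qed.

Lemma meas_inner (f : T1 * T2 -> \bar R) : measf f ->
  (forall x, 0 <= f x)%E -> measf (fun x => \int[m2]_y f (x, y))%E.
Proof. by move=> mf f0; exact: measurable_fun_fubini_tonelli_F. Qed.

(** The integrals of the positive and negative parts depend measurably on the parameter, even where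
    they are infinite, and [Ex] is [fine] of their difference on every section. *)
Lemma meas_Ex (f : T1 * T2 -> R) : measf f ->
  measf (fun x => Ex m2 (fun y => f (x, y))).
Proof.
move=> mf.
have mpos : measf (fun x => \int[m2]_y (Num.max (f (x, y)) 0)%:E)%E.
  apply: (@measurable_fun_fubini_tonelli_F _ _ _ _ _ _
    (fun z => (Num.max (f z) 0)%:E)).
    by apply/measurable_EFinP; apply: measurable_maxr => //; exact: measurable_cst.
  by move=> z; rewrite lee_fin le_max lexx orbT.
have mneg : measf (fun x => \int[m2]_y (Num.max (- f (x, y)) 0)%:E)%E.
  apply: (@measurable_fun_fubini_tonelli_F _ _ _ _ _ _
    (fun z => (Num.max (- f z) 0)%:E)).
    apply/measurable_EFinP; apply: measurable_maxr; last exact: measurable_cst.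
    exact: measurableT_comp.
  by move=> z; rewrite lee_fin le_max lexx orbT.
have mm := emeasurable_funB mpos mneg.
have : measf (fine \o (fun x => \int[m2]_y (Num.max (f (x, y)) 0)%:E
    - \int[m2]_y (Num.max (- f (x, y)) 0)%:E)%E).
  by apply: measurableT_comp => //; exact: measurable_fine.
congr (measurable_fun _ _); apply/funext => x /=.
rewrite /Ex /Rintegral [in RHS]integralE; congr fine; congr (_ - _)%E.
  by apply: eq_integral => y _; rewrite funeposE EFin_max.
by apply: eq_integral => y _; rewrite funenegE EFin_max EFinN.
Qed.

Lemma fub_intg (f : T1 * T2 -> R) : measf f ->
  (forall x, 0 <= f x) -> (forall x, intg m2 (fun y => f (x, y))) ->
  intg m1 (fun x => Ex m2 (fun y => f (x, y))) ->
  intg (m1 \x m2)%E f.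
Proof.
move=> mf f0 if2 if1; apply: intg_fin => //.
rewrite tonelli1//; last exact/measurable_EFinP.
under eq_integral do rewrite ExE//.
rewrite ExE//; exact: ltry.
Qed.

(** Integrability of every section, and not just of almost every one, makes the inner [Ex] agree
    everywhere with the extended-real inner integral. *)
Lemma Ex_fub (f : T1 * T2 -> R) : intg (m1 \x m2)%E f ->
  (forall x, intg m2 (fun y => f (x, y))) ->
  intg m1 (fun x => Ex m2 (fun y => f (x, y))) /\
  Ex (m1 \x m2)%E f = Ex m1 (fun x => Ex m2 (fun y => f (x, y))).
Proof.
move=> mf mf2; have E := integral12_prod_meas1 mf.
have E' : fubini_F m2 (EFin \o f) = EFin \o (fun x => Ex m2 (fun y => f (x, y))).
  by apply/funext => x; rewrite /fubini_F /= ExE.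
split; last by rewrite /Ex /Rintegral -[in LHS]E E'.
by have := integrable_fubini_F mf; rewrite E'.
Qed.

End fubini_real.

Section fubini_real2.
Context d1 d2 (T1 : measurableType d1) (T2 : measurableType d2) (R : realType).
Context (m1 : {sigma_finite_measure set T1 -> \bar R})
        (m2 : {sigma_finite_measure set T2 -> \bar R}).

Lemma Ex_fub2 (f : T1 * T2 -> R) : intg (m1 \x m2)%E f ->
  (forall y, intg m1 (fun x => f (x, y))) ->
  intg m2 (fun y => Ex m1 (fun x => f (x, y))) /\
  Ex (m1 \x m2)%E f = Ex m2 (fun y => Ex m1 (fun x => f (x, y))).
Proof.
move=> mf mf2; have E := integral21_prod_meas1 mf.
have E' : fubini_G m1 (EFin \o f) = EFin \o (fun y => Ex m1 (fun x => f (x, y))).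
  by apply/funext => x; rewrite /fubini_G /= ExE.
split; last by rewrite /Ex /Rintegral -[in LHS]E E'.
have m12 := intg_meas mf.
have ms : measf (fun z : T2 * T1 => f (z.2, z.1)).
  by apply: (measurableT_comp (f := f)) => //; apply: measurable_fun_pair.
have : (m2 \x m1)%E.-integrable setT (EFin \o (fun z : T2 * T1 => f (z.2, z.1))).
  apply/integrable12ltyP; first exact/measurable_EFinP.
  by have /integrable21ltyP := mf; apply; exact/measurable_EFinP.
by move=> h; have [] := Ex_fub h mf2.
Qed.

End fubini_real2.

Definition pp d1 d2 (T1 : measurableType d1) (T2 : measurableType d2)
    (R : realType) (P : probability T1 R) (Q : probability T2 R) :
    probability (T1 * T2)%type R := [the probability _ _ of (P \x Q)%E].

Section density.
Context d (T : measurableType d) (R : realType) (m : {measure set T -> \bar R}).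
Variable f : T -> R.
Hypotheses (f0 : forall x, 0 <= f x) (mf : measf f).

Import HBNNSimple.

Let dens_nnsfun (Q : {measure set T -> \bar R}) (h : {nnsfun T >-> R}) :
  (forall A, measurable A -> Q A = (\int[m]_(x in A) (f x)%:E)%E) ->
  (\int[Q]_x (h x)%:E = \int[m]_x ((h x)%:E * (f x)%:E))%E.
Proof.
move=> QE.
transitivity (\int[Q]_x (\sum_(y \in range h) (y * \1_(h @^-1` [set y]) x)%:E))%E.
  by apply: eq_integral => t tE; rewrite [in LHS]fimfunE -fsumEFin.
rewrite ge0_integral_fsum//; last 2 first.
- by move=> r; apply/measurable_EFinP; apply: measurable_funM => //; exact: measurable_cst.
- by move=> r x _; exact: nnfun_muleindic_ge0.
transitivity (\int[m]_x (\sum_(y \in range h)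
    ((y * \1_(h @^-1` [set y]) x)%:E * (f x)%:E)))%E; last first.
  apply: eq_integral => x _; rewrite -ge0_mule_fsuml.
    by rewrite fsumEFin // -(fimfunE _ x).
  by move=> y; exact: nnfun_muleindic_ge0.
rewrite ge0_integral_fsum//; last 2 first.
- move=> r; apply/measurable_EFinP; apply: measurable_funM => //.
  by apply: measurable_funM => //; exact: measurable_cst.
- by move=> r x _; rewrite mule_ge0 ?lee_fin ?f0//; exact: nnfun_muleindic_ge0.
apply: eq_fsbigr => r rhn.
have mr : measurable (h @^-1` [set r]) by exact: measurable_sfunP.
under eq_integral do rewrite EFinM.
rewrite integralZl_indic_nnsfun// integral_indic// setIT QE//.
under [RHS]eq_integral do rewrite EFinM -muleA.
have r0 : 0 <= r by move: rhn; rewrite inE => -[x _ <-].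
rewrite ge0_integralZl//; last 2 first.
- apply/measurable_EFinP; apply: measurable_funM => //.
- by move=> x _; rewrite mule_ge0// lee_fin ?f0.
congr (_ * _)%E; rewrite [LHS]integral_mkcond; apply: eq_integral => x _.
rewrite epatch_indic muleC //.
Qed.

Lemma dens_integral (Q : {measure set T -> \bar R}) (g : T -> \bar R) :
  (forall A, measurable A -> Q A = (\int[m]_(x in A) (f x)%:E)%E) ->
  measf g -> (forall x, 0 <= g x)%E ->
  (\int[Q]_x g x = \int[m]_x (g x * (f x)%:E))%E.
Proof.
move=> QE mg g0; pose h := nnsfun_approx measurableT mg.
have hg x : (EFin \o h n) x @[n --> \oo] --> g x.
  by apply: cvg_nnsfun_approx => // y _; exact: g0.
have hm x a b : (a <= b)%N -> h a x <= h b x.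
  by move=> ab; exact/lefP/nd_nnsfun_approx.
transitivity (lim ((\int[Q]_x (h n x)%:E)%E @[n --> \oo])).
  rewrite -monotone_convergence//.
  - by apply: eq_integral => x _; apply/esym/cvg_lim => //; exact: hg.
  - by move=> n; apply/measurable_EFinP.
  - by move=> n x _; rewrite lee_fin.
  - by move=> x _ a b ab; rewrite lee_fin hm.
under eq_fun do rewrite dens_nnsfun//.
rewrite -monotone_convergence//.
- apply: eq_integral => x _; apply/cvg_lim => //.
  by apply: cvgeZr => //; exact: hg.
- by move=> n; apply/measurable_EFinP; apply: measurable_funM.
- by move=> n x _; rewrite mule_ge0 ?lee_fin.
- by move=> x _ a b ab; rewrite lee_wpmul2r ?lee_fin ?f0// hm.
Qed.

(** The proofs of positivity and measurability are arguments, so that the measure structure can be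
    attached to this set function. *)
Definition mdens of (forall x, 0 <= f x) & measf f :=
  fun A => (\int[m]_(x in A) (f x)%:E)%E.

Let mdens_set0 : mdens f0 mf set0 = 0%E.
Proof. by rewrite /mdens integral_set0. Qed.

Let mdens_ge0 A : (0 <= mdens f0 mf A)%E.
Proof. by apply: integral_ge0 => x _; rewrite lee_fin. Qed.

Let mdens_sigma_additive : semi_sigma_additive (mdens f0 mf).
Proof.
move=> A mA tA mUA; rewrite /mdens ge0_integral_bigcup//.
- apply: is_cvg_ereal_nneg_natsum_cond => n _ _.
  by apply: integral_ge0 => x _; rewrite lee_fin.
- by apply/measurable_EFinP; exact: measurable_funS mf.
- by move=> x _; rewrite lee_fin.
Qed.

HB.instance Definition _ := isMeasure.Build _ _ _ (mdens f0 mf)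
  mdens_set0 mdens_ge0 mdens_sigma_additive.

Definition dens of (\int[m]_x (f x)%:E = 1)%E := mdens f0 mf.

Hypothesis f1 : (\int[m]_x (f x)%:E = 1)%E.

HB.instance Definition _ := Measure.on (dens f1).

Let dens_setT : dens f1 setT = 1%E.
Proof. exact: f1. Qed.

HB.instance Definition _ := Measure_isProbability.Build _ _ _ (dens f1)
  dens_setT.

Definition pdens : probability T R := [the probability _ _ of dens f1].

End density.

Section density_expectation.
Context d (T : measurableType d) (R : realType) (m Q : {measure set T -> \bar R}).
Variable f : T -> R.
Hypotheses (f0 : forall x, 0 <= f x) (mf : measf f).
Hypothesis QE : forall A, measurable A -> Q A = (\int[m]_(x in A) (f x)%:E)%E.

Lemma dens_intg g : measf g ->
  intg Q g <-> intg m (fun x => g x * f x).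
Proof.
move=> mg; have E : (\int[Q]_x `|(g x)%:E| = \int[m]_x `|(g x * f x)%:E|)%E.
  rewrite (dens_integral f0 mf QE); last by move=> x; rewrite abse_ge0.
    apply: eq_integral => x _; rewrite /= -EFinM normrM.
    by rewrite (ger0_norm (f0 x)).
  by apply: measurableT_comp => //; exact/measurable_EFinP.
split => /integrableP[_ h]; apply/integrableP; split.
- by apply/measurable_EFinP; exact: measurable_funM.
- by rewrite -E.
- exact/measurable_EFinP.
- by rewrite E.
Qed.

Lemma dens_Ex g : measf g ->
  Ex Q g = Ex m (fun x => g x * f x).
Proof.
move=> mg; rewrite /Ex /Rintegral integralE [in RHS]integralE; congr fine.
rewrite !(dens_integral f0 mf QE); last 4 first.
- by apply: measurable_funeneg; exact/measurable_EFinP.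
- by move=> x; exact: funeneg_ge0.
- by apply: measurable_funepos; exact/measurable_EFinP.
- by move=> x; exact: funepos_ge0.
have mx (a b : R) : 0 <= b -> Num.max a 0 * b = Num.max (a * b) 0.
  by move=> b0; rewrite maxr_pMl// mul0r.
congr (_ - _)%E; apply: eq_integral => x _.
  by rewrite !funeposE -!EFin_max -EFinM mx.
by rewrite !funenegE -!EFinN -!EFin_max -EFinM mx// mulNr.
Qed.

End density_expectation.

(** Serves to let a small parameter tend to zero in an estimate whose error is linear in it. *)
Lemma le_of_add_small (R : realType) (a b c e0 : R) : 0 < e0 ->
  (forall e, 0 < e -> e < e0 -> a <= b + c * e) -> a <= b.
Proof.
move=> e00 H; apply/ler_addgt0Pr => e e_gt0.
pose t := Num.min (e0 / 2) (e / (`|c| + 1)).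
have c1 : 0 < `|c| + 1 by rewrite ltr_wpDl.
have t0 : 0 < t by rewrite lt_min !divr_gt0.
have te0 : t < e0 by rewrite gt_min; apply/orP; left; lra.
apply: (le_trans (H _ t0 te0)); rewrite lerD2l.
have : t <= e / (`|c| + 1) by rewrite ge_min lexx orbT.
rewrite ler_pdivlMr// => h; apply: le_trans h; rewrite mulrC ler_wpM2l ?ltW//.
by rewrite (le_lt_trans (ler_norm c))// ltrDl.
Qed.

(** * Row vectors, their Borel sets and Lebesgue measure *)

Section row_vectors.
Context {R : realType}.
Implicit Types n : nat.

Lemma rV_unconsK n : cancel (@rV_uncons R n) (@rV_cons R n).
Proof.
move=> x; apply/rowP => i; rewrite /rV_cons /rV_uncons mxE.
by case: (unliftP ord0 i) => [j ->|->] /=; rewrite ?mxE.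
Qed.

Lemma rV_cons0 n a (y : 'rV[R]_n) : rV_cons (a, y) 0 ord0 = a.
Proof. by rewrite mxE unlift_none. Qed.

Lemma rV_consS n a (y : 'rV[R]_n) j : rV_cons (a, y) 0 (lift ord0 j) = y 0 j.
Proof. by rewrite mxE liftK. Qed.

Definition hd n (x : 'rV[R]_n.+1) : R := x 0 ord0.
Definition tl n (x : 'rV[R]_n.+1) : 'rV[R]_n := \row_(j < n) x 0 (lift ord0 j).

Lemma rV_consE n (x : 'rV[R]_n.+1) : rV_cons (hd x, tl x) = x.
Proof. exact: rV_unconsK. Qed.

Lemma tl_cons n a (y : 'rV[R]_n) : tl (rV_cons (a, y)) = y.
Proof. by apply/rowP => j; rewrite mxE rV_consS. Qed.

Lemma hd_cons n a (y : 'rV[R]_n) : hd (rV_cons (a, y)) = a.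
Proof. exact: rV_cons0. Qed.

Lemma rV_consP n (x y : 'rV[R]_n.+1) : hd x = hd y -> tl x = tl y -> x = y.
Proof. by move=> h t; rewrite -(rV_consE x) -(rV_consE y) h t. Qed.

Lemma rV_consD n a b (x y : 'rV[R]_n) :
  rV_cons (a + b, x + y) = rV_cons (a, x) + rV_cons (b, y).
Proof.
apply/rowP => i; rewrite [RHS]mxE.
by case: (unliftP ord0 i) => [j ->|->]; rewrite ?rV_consS ?rV_cons0// mxE.
Qed.

Lemma rV_consZ n c a (x : 'rV[R]_n) :
  rV_cons (c * a, c *: x) = c *: rV_cons (a, x).
Proof.
apply/rowP => i; rewrite [RHS]mxE.
by case: (unliftP ord0 i) => [j ->|->]; rewrite ?rV_consS ?rV_cons0// mxE.
Qed.

Lemma dotC n (x y : 'rV[R]_n) : dot x y = dot y x.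
Proof. by apply: eq_bigr => i _; rewrite mulrC. Qed.

Lemma dotDl n (x y z : 'rV[R]_n) : dot (x + y) z = dot x z + dot y z.
Proof. by rewrite -big_split; apply: eq_bigr => i _; rewrite mxE mulrDl. Qed.

Lemma dotZl n c (x y : 'rV[R]_n) : dot (c *: x) y = c * dot x y.
Proof. by rewrite /dot mulr_sumr; apply: eq_bigr => i _; rewrite mxE mulrA. Qed.

Lemma dotDr n (x y z : 'rV[R]_n) : dot z (x + y) = dot z x + dot z y.
Proof. by rewrite dotC dotDl !(dotC z). Qed.

Lemma dotZr n c (x y : 'rV[R]_n) : dot x (c *: y) = c * dot x y.
Proof. by rewrite dotC dotZl dotC. Qed.

Lemma dotNl n (x y : 'rV[R]_n) : dot (- x) y = - dot x y.
Proof. by rewrite -scaleN1r dotZl mulN1r. Qed.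

Lemma dotNr n (x y : 'rV[R]_n) : dot x (- y) = - dot x y.
Proof. by rewrite dotC dotNl dotC. Qed.

Lemma dot0l n (x : 'rV[R]_n) : dot 0 x = 0.
Proof. by rewrite -(scale0r x) dotZl mul0r. Qed.

Lemma dot0r n (x : 'rV[R]_n) : dot x 0 = 0.
Proof. by rewrite dotC dot0l. Qed.

Lemma dot_suml n I (s : seq I) (f : I -> 'rV[R]_n) y :
  dot (\sum_(i <- s) f i) y = \sum_(i <- s) dot (f i) y.
Proof.
by elim: s => [|i s IH]; rewrite ?big_nil ?dot0l// !big_cons dotDl IH.
Qed.

Lemma dot_ge0 n (x : 'rV[R]_n) : 0 <= dot x x.
Proof. by apply: sumr_ge0 => i _; rewrite -expr2 sqr_ge0. Qed.

Lemma dot_sqrD n (x y : 'rV[R]_n) :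
  dot (x + y) (x + y) = dot x x + 2 * dot x y + dot y y.
Proof. by rewrite !dotDl !dotDr (dotC y x); ring. Qed.

Lemma dot_sqrB n (x y : 'rV[R]_n) :
  dot (x - y) (x - y) = dot x x - 2 * dot x y + dot y y.
Proof. by rewrite dot_sqrD dotNl !dotNr opprK; ring. Qed.

Lemma dot_cauchy n (x y : 'rV[R]_n) : dot x y ^+ 2 <= dot x x * dot y y.
Proof.
apply: quad_discr; first exact: dot_ge0.
move=> t; have := dot_ge0 (x + t *: y).
by rewrite dot_sqrD !dotZr !dotZl => h; lra.
Qed.

Lemma dot_cons n a b (x y : 'rV[R]_n) :
  dot (rV_cons (a, x)) (rV_cons (b, y)) = a * b + dot x y.
Proof.
by rewrite /dot big_ord_recl !rV_cons0; congr (_ + _); apply: eq_bigr => j _; rewrite !rV_consS.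
Qed.

Lemma coord_sqr_le n (x : 'rV[R]_n) i : x 0 i ^+ 2 <= dot x x.
Proof.
rewrite /dot (bigD1 i)//= -expr2 lerDl; apply: sumr_ge0 => j _.
by rewrite -expr2 sqr_ge0.
Qed.

Lemma dot_delta n (x : 'rV[R]_n) i : dot x (delta_mx 0 i) = x 0 i.
Proof.
rewrite /dot (bigD1 i)//= mxE !eqxx mulr1 big1 ?addr0// => j ji.
by rewrite mxE eqxx (negbTE ji) mulr0.
Qed.

Lemma dot_eq0 n (x : 'rV[R]_n) : dot x x = 0 -> x = 0.
Proof.
move=> xx; apply/rowP => i; rewrite mxE; apply/eqP.
by rewrite -sqrf_eq0 eq_le sqr_ge0 -xx coord_sqr_le.
Qed.

Lemma enorm_ge0 n (x : 'rV[R]_n) : 0 <= enorm x.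
Proof. exact: sqrtr_ge0. Qed.

Lemma enorm_sqr n (x : 'rV[R]_n) : enorm x ^+ 2 = dot x x.
Proof. by rewrite sqr_sqrtr// dot_ge0. Qed.

Lemma dot_le_enorm n (x y : 'rV[R]_n) : `|dot x y| <= enorm x * enorm y.
Proof.
rewrite -(@ler_pXn2r _ 2)// ?nnegrE ?mulr_ge0 ?enorm_ge0//.
by rewrite exprMn !enorm_sqr real_normK ?num_real// dot_cauchy.
Qed.

Lemma enormD n (x y : 'rV[R]_n) : enorm (x + y) <= enorm x + enorm y.
Proof.
rewrite -(@ler_pXn2r _ 2)// ?nnegrE ?addr_ge0 ?enorm_ge0//.
have := dot_le_enorm x y; rewrite ler_norml => /andP[_ h].
by rewrite sqrrD !enorm_sqr dot_sqrD mulr2n; lra.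
Qed.

Lemma enormZ n c (x : 'rV[R]_n) : enorm (c *: x) = `|c| * enorm x.
Proof. by rewrite /enorm dotZl dotZr mulrA -expr2 sqrtrM ?sqr_ge0// sqrtr_sqr. Qed.

Lemma coord_le_enorm n (x : 'rV[R]_n) i : `|x 0 i| <= enorm x.
Proof. by rewrite -sqrtr_sqr ler_sqrt ?dot_ge0// coord_sqr_le. Qed.

Lemma enorm_le_sum n (x : 'rV[R]_n) : enorm x <= \sum_i `|x 0 i|.
Proof.
rewrite -(@ler_pXn2r _ 2)// ?nnegrE ?enorm_ge0 ?sumr_ge0//.
rewrite enorm_sqr expr2 mulr_suml; apply: ler_sum => i _.
rewrite -expr2 -real_normK ?num_real// expr2 ler_wpM2l//.
by rewrite (bigD1 i)//= lerDl sumr_ge0.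
Qed.

Lemma enorm_le_mul n (x : 'rV[R]_n) e : (forall i, `|x 0 i| <= e) ->
  enorm x <= n%:R * e.
Proof.
move=> xe; apply: (le_trans (enorm_le_sum x)).
rewrite mulr_natl -[in leRHS](card_ord n) -sumr_const.
by apply: ler_sum.
Qed.

Section measurability.
Context d (T : measurableType d).

Lemma measurable_rVD n (f g : T -> 'rV[R]_n) : measf f ->
  measf g -> measf (fun t => f t + g t).
Proof.
move=> /measurable_rVP mf /measurable_rVP mg; apply/measurable_rVP => i.
rewrite (_ : (fun _ => _) = (fun t => f t 0 i + g t 0 i)).
  by apply: measurable_funD; [exact: mf|exact: mg].
by apply/funext => t; rewrite mxE.
Qed.

Lemma measurable_rVZ n (c : T -> R) (f : T -> 'rV[R]_n) : measf c ->
  measf f -> measf (fun t => c t *: f t).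
Proof.
move=> mc /measurable_rVP mf; apply/measurable_rVP => i.
rewrite (_ : (fun _ => _) = (fun t => c t * f t 0 i)).
  by apply: measurable_funM; [exact: mc|exact: mf].
by apply/funext => t; rewrite mxE.
Qed.

Lemma measurable_rVN n (f : T -> 'rV[R]_n) : measf f ->
  measf (fun t => - f t).
Proof.
move=> mf; under eq_fun do rewrite -scaleN1r.
by apply: measurable_rVZ => //; exact: measurable_cst.
Qed.

Lemma measurable_rVB n (f g : T -> 'rV[R]_n) : measf f ->
  measf g -> measf (fun t => f t - g t).
Proof. by move=> mf mg; apply: measurable_rVD => //; exact: measurable_rVN. Qed.

Lemma measurable_dot n (f g : T -> 'rV[R]_n) : measf f ->
  measf g -> measf (fun t => dot (f t) (g t)).
Proof.
move=> /measurable_rVP mf /measurable_rVP mg.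
by apply: measurable_sum => i; apply: measurable_funM; [exact: mf|exact: mg].
Qed.

Lemma measurable_enorm n (f : T -> 'rV[R]_n) : measf f ->
  measf (fun t => enorm (f t)).
Proof.
move=> mf; apply: (measurableT_comp (f := @Num.sqrt R)); last exact: measurable_dot.
by apply: continuous_measurable_fun; exact: sqrt_continuous.
Qed.

Lemma measurable_cons n (f : T -> R) (g : T -> 'rV[R]_n) : measf f ->
  measf g -> measf (fun t => rV_cons (f t, g t)).
Proof.
move=> mf mg; apply: (measurableT_comp (f := @rV_cons R n)).
  exact: measurable_rV_cons.
exact: measurable_fun_pair.
Qed.

Lemma measurable_hd n (f : T -> 'rV[R]_n.+1) : measf f ->
  measf (fun t => hd (f t)).
Proof. by move=> /measurable_rVP; apply. Qed.

Lemma measurable_tl n (f : T -> 'rV[R]_n.+1) : measf f ->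
  measf (fun t => tl (f t)).
Proof.
move=> /measurable_rVP mf; apply/measurable_rVP => i.
by under eq_fun do rewrite mxE; exact: mf.
Qed.

End measurability.

Lemma cvg_rV (T : topologicalType) (F : set_system T) (FF : Filter F) n
    (f : T -> 'rV[R]_n) (l : 'rV[R]_n) :
  (forall i, f x 0 i @[x --> F] --> l 0 i) -> f x @[x --> F] --> l.
Proof.
move=> fl; apply/cvg_ballP => e e0.
have H : forall j, \forall x \near F, ball (l 0 j) e (f x 0 j).
  by move=> k; have /cvg_ballP := fl k; apply.
have := @filter_forall _ _ _ _ FF H.
by apply: filterS => x h; split => // i j; rewrite (ord1 i).
Qed.

Lemma continuous_rV (T : topologicalType) n (f : T -> 'rV[R]_n) :
  (forall i, continuous (fun x => f x 0 i)) -> continuous f.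
Proof. by move=> cf x; apply: cvg_rV => i; exact: cf. Qed.

Lemma continuous_rVP n (f : 'rV[R]_n -> R) (x : 'rV[R]_n) :
  {for x, continuous f} <-> forall e : R, 0 < e -> exists2 dl : R, 0 < dl &
    forall y : 'rV[R]_n, (forall i, `|y 0 i - x 0 i| < dl) -> `|f y - f x| < e.
Proof.
split => [cf e e0|H].
  have /cvgrPdist_lt/(_ e e0) := cf; rewrite near_nbhs => /nbhs_ballP[dl/= dl0 H].
  exists dl => // y Hy; rewrite distrC; apply: H; split => // i j.
  by rewrite (ord1 i) /ball/= distrC; exact: Hy.
rewrite /prop_for /continuous_at; apply/(@cvgrPdist_lt _ _ _ _ (nbhs_filter x)) => e e0.
have [dl dl0 Hd] := H e e0.
near=> y; rewrite distrC; apply: Hd => i.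
suff : ball x dl y by move=> [_ /(_ 0 i)]; rewrite /ball/= distrC.
by near: y; exact: nbhsx_ballx.
Unshelve. all: by end_near. Qed.

(** The sigma-algebra is generated by the coordinates, so open sets are reached through countably
    many boxes: [box (N, z)] is a half-open cell of the lattice of mesh 1 / (N + 1), and an open set
    is the union of the cells that it contains. *)
Lemma open_measurable_rV n (U : set 'rV[R]_n) : open U -> measurable U.
Proof.
move=> oU.
pose box (p : nat * 'rV[int]_n) : set 'rV[R]_n :=
  [set x | forall i, ((p.2 0 i)%:~R <= p.1.+1%:R * x 0 i) &&
                     (p.1.+1%:R * x 0 i < (p.2 0 i + 1)%:~R)].
have mbox p : measurable (box p).
  have -> : box p = \bigcap_(i in [set: 'I_n]) ((fun x : 'rV[R]_n => p.1.+1%:R * x 0 i : R)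
      @^-1` [set` `[(p.2 0 i)%:~R, (p.2 0 i + 1)%:~R[ ]).
    by apply/seteqP; split => x /= H i => [_|]; have := H i; rewrite /= in_itv/=; [|apply].
  apply: fin_bigcap_measurable => // i _; rewrite -[X in measurable X]setTI.
  suff : measf (fun x : 'rV[R]_n => p.1.+1%:R * x 0 i) by apply.
  by apply: measurable_funM; [exact: measurable_cst|exact: measurable_coord].
have -> : U = \bigcup_(k : nat)
    (if unpickle k is Some p then if `[< box p `<=` U >] then box p else set0 else set0).
  apply/seteqP; split => [x Ux|x [k _]]; last first.
    by case: (unpickle k) => [p|//]; case: asboolP => // h; exact: h.
  have := oU; rewrite openE => /(_ _ Ux)/nbhs_ballP[e /= e0 eU].
  (* The mesh is finer than the sup-norm radius of a ball around [x] inside [U], so the cell of [x]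
     fits into that ball. *)
  pose N := Num.trunc e^-1.
  have Ne : N.+1%:R^-1 < e.
    by rewrite invf_plt ?posrE// truncnS_gt.
  pose z : 'rV[int]_n := \row_i Num.floor (N.+1%:R * x 0 i).
  have zU : box (N, z) `<=` U.
    move=> y Hy; apply: eU; split => // i j; rewrite (ord1 i) /ball/=.
    apply: le_lt_trans Ne; have /andP[] := Hy j; rewrite mxE/= => h1 h2.
    have h3 := floor_le (N.+1%:R * x 0 j); have h4 := floorD1_gt (N.+1%:R * x 0 j).
    have N0 : 0 < N.+1%:R :> R by [].
    rewrite -(@ler_pM2l _ N.+1%:R)// divff ?gt_eqF// -[X in X * `|_|]gtr0_norm// -normrM.
    rewrite mulrBr; move: h1 h2 h3 h4; rewrite !intrD => *.
    by rewrite ler_norml; lra.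
  exists (pickle (N, z)) => //; rewrite pickleK; case: asboolP => // _ i.
  by rewrite /= mxE floor_le floorD1_gt.
apply: bigcupT_measurable => k; case: (unpickle k) => [p|//].
by case: asboolP.
Qed.

Lemma closed_measurable_rV n (U : set 'rV[R]_n) : closed U -> measurable U.
Proof.
by move=> cU; rewrite -(setCK U); apply: measurableC; apply: open_measurable_rV; exact: closed_openC.
Qed.

Lemma continuous_measurable_rV n (f : 'rV[R]_n -> R) : continuous f ->
  measf f.
Proof.
move=> cf; apply: (measurability _ (RGenOInfty.measurableE R)).
move=> _ [_ [a ->] <-]; rewrite setTI; apply: open_measurable_rV.
by apply: open_comp => [x _|]; [exact: cf|exact: rray_open].
Qed.

Lemma cvg_bigsum (T : topologicalType) (F : set_system T) (FF : Filter F) I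
    (s : seq I) (f : I -> T -> R) (l : I -> R) :
  (forall i, f i x @[x --> F] --> l i) ->
  \sum_(i <- s) f i x @[x --> F] --> \sum_(i <- s) l i.
Proof.
move=> fl; elim: s => [|i s IH].
  by rewrite big_nil; under eq_fun do rewrite big_nil; exact: cvg_cst.
by rewrite big_cons; under eq_fun do rewrite big_cons; exact: cvgD.
Qed.

Lemma dot_continuous n : continuous (fun x : 'rV[R]_n => dot x x).
Proof.
move=> x; apply: (@cvg_bigsum _ _ (nbhs_filter x)) => i.
by apply: cvgM; exact: coord_continuous.
Qed.

Lemma lebesgue_cons_law n :
  is_law (lebesgue_measure \x lebesgue_rV R n)%E rV_cons (lebesgue_rV R n.+1).
Proof. by split => //; exact: measurable_rV_cons. Qed.

Lemma lebesgue_cons n (f : 'rV[R]_n.+1 -> \bar R) : measf f ->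
  (forall x, 0 <= f x)%E ->
  (\int[lebesgue_rV R n.+1]_x f x =
   \int[lebesgue_measure]_a \int[lebesgue_rV R n]_y f (rV_cons (a, y)))%E.
Proof.
move=> mf f0; rewrite (law_ge0_integral (lebesgue_cons_law n))//.
rewrite tonelli1//.
by apply: measurableT_comp => //; exact: measurable_rV_cons.
Qed.

Lemma lebesgue0 (f : 'rV[R]_0 -> \bar R) : measf f ->
  (\int[lebesgue_rV R 0]_x f x)%E = f 0.
Proof. by move=> mf; rewrite /= integral_dirac// diracT mul1e. Qed.

Lemma lebesgue_translation1 (c : R) :
  is_law (@lebesgue_measure R) (fun x : measurableTypeR R => x + c : measurableTypeR R)
    (@lebesgue_measure R).
Proof.
have mX : measf (fun x : measurableTypeR R => x + c : measurableTypeR R).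
  by apply: measurable_funD => //; exact: measurable_cst.
split => // A mA.
apply: (@lebesgue_measure_unique _ (pushforward lebesgue_measure
  (fun x : measurableTypeR R => x + c : measurableTypeR R))) => //.
move=> _ [[a b] _ <-] /=; rewrite /pushforward.
have -> : (fun x => x + c) @^-1` `]a, b] = `]a - c, b - c]%classic.
  by apply/seteqP; split => x /=; rewrite !in_itv/= => /andP[h1 h2]; apply/andP; split; lra.
rewrite !lebesgue_measure_itv/= !lte_fin ltrD2r; case: ifP => // _.
by rewrite -!EFinD; congr EFin; ring.
Qed.

Lemma lebesgue_translation n (v : 'rV[R]_n) :
  is_law (lebesgue_rV R n) (fun x => x + v) (lebesgue_rV R n).
Proof.
apply: law_of_integral => [|f].
  by apply: measurable_rVD => //; exact: measurable_cst.
elim: n v f => [|n IH] v f mf f0.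
  rewrite !lebesgue0//.
    by congr f; apply/rowP => -[].
  by apply: measurableT_comp => //; apply: measurable_rVD => //; exact: measurable_cst.
have mv : measf (fun x : 'rV[R]_n.+1 => x + v).
  by apply: measurable_rVD => //; exact: measurable_cst.
have E2 := lebesgue_cons (measurableT_comp mf mv) (fun x => f0 _).
rewrite (lebesgue_cons mf f0) [RHS]E2.
have mfc : measf (f \o rV_cons).
  by apply: measurableT_comp => //; exact: measurable_rV_cons.
have mG : measf (fun a => \int[lebesgue_rV R n]_y f (rV_cons (a, y)))%E.
  exact: (meas_inner (lebesgue_rV R n) mfc (fun z => f0 _)).
have G0 a : (0 <= \int[lebesgue_rV R n]_y f (rV_cons (a, y)))%E.
  by apply: integral_ge0 => y _.
rewrite [LHS](law_ge0_integral (lebesgue_translation1 (hd v)) mG G0).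
apply: eq_integral => a _; rewrite (IH (tl v)); last 2 first.
- apply: measurableT_comp => //; apply: measurable_cons => //; exact: measurable_cst.
- by move=> y.
by apply: eq_integral => y _; rewrite /= rV_consD rV_consE.
Qed.

End row_vectors.

(** * The standard Gaussian measure: products, rotations, translations *)

Section gaussian.
Context {R : realType}.
Implicit Types n : nat.

Definition gd1 (a : measurableTypeR R) : R := (Num.sqrt (2 * pi))^-1 * expR (- (a ^+ 2 / 2)).

Definition gd n (x : 'rV[R]_n) : R :=
  (Num.sqrt (2 * pi))^-1 ^+ n * expR (- (dot x x / 2)).

Lemma gpeak_gt0 : 0 < (Num.sqrt (2 * pi))^-1 :> R.
Proof. by rewrite invr_gt0 sqrtr_gt0 mulr_gt0// pi_gt0. Qed.

Lemma gd1_gt0 a : 0 < gd1 a.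
Proof. by rewrite mulr_gt0 ?gpeak_gt0 ?expR_gt0. Qed.

Lemma gd_gt0 n (x : 'rV[R]_n) : 0 < gd x.
Proof. by rewrite mulr_gt0 ?exprn_gt0 ?gpeak_gt0 ?expR_gt0. Qed.

Lemma gd1_ge0 a : 0 <= gd1 a. Proof. exact/ltW/gd1_gt0. Qed.

Lemma gd_ge0 n (x : 'rV[R]_n) : 0 <= gd x. Proof. exact/ltW/gd_gt0. Qed.

Lemma gd_cons n a (y : 'rV[R]_n) : gd (rV_cons (a, y)) = gd1 a * gd y.
Proof.
rewrite /gd /gd1 dot_cons exprS mulrACA -expRD; congr (_ * expR _).
by rewrite expr2; lra.
Qed.

Lemma gd1_cont : continuous gd1.
Proof.
move=> x; apply: cvgM; first exact: cvg_cst.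
apply: continuous_comp; last exact: continuous_expR.
by apply: cvgN; apply: cvgM; [exact: exprn_continuous|exact: cvg_cst].
Qed.

Lemma measurable_gd1 : measf gd1.
Proof. exact: continuous_measurable_fun gd1_cont. Qed.

Lemma gd_cont n : continuous (@gd n).
Proof.
move=> x.
apply: (@continuous_comp _ _ _ (fun x : 'rV[R]_n => dot x x)
  (fun t => (Num.sqrt (2 * pi))^-1 ^+ n * expR (- (t / 2)))).
  exact: dot_continuous.
apply: cvgM; first exact: cvg_cst.
apply: (@continuous_comp _ _ _ (fun t : R => - (t / 2)) expR); last exact: continuous_expR.
by apply: cvgN; apply: cvgM; [exact: cvg_id|exact: cvg_cst].
Qed.

Lemma measurable_gd n : measf (@gd n).
Proof. exact: continuous_measurable_rV (@gd_cont n). Qed.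

Lemma integral_gd1 : (\int[lebesgue_measure]_a (gd1 a)%:E = 1)%E.
Proof.
rewrite -(integral_normal_pdf (0:R) 1); apply: eq_integral => a _.
rewrite normal_pdfE ?oner_eq0// /gd1 /normal_peak /normal_fun.
congr (_ * _)%:E; first by rewrite expr1n mul1r mulr_natl.
by congr expR; rewrite subr0 expr1n; lra.
Qed.

Lemma integral_gd n : (\int[lebesgue_rV R n]_x (gd x)%:E = 1)%E.
Proof.
elim: n => [|n IH].
  rewrite lebesgue0; last by apply/measurable_EFinP; exact: measurable_gd.
  by rewrite /gd expr0 mul1r dot0l mul0r oppr0 expR0.
rewrite lebesgue_cons; last by move=> x; rewrite lee_fin gd_ge0.
  under eq_integral => a _.
    under eq_integral do rewrite gd_cons EFinM.
    rewrite ge0_integralZl//; last 3 first.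
    - by apply/measurable_EFinP; exact: measurable_gd.
    - by move=> y _; rewrite lee_fin gd_ge0.
    - by rewrite lee_fin gd1_ge0.
    rewrite IH mule1; over.
  exact: integral_gd1.
by apply/measurable_EFinP; exact: measurable_gd.
Qed.

Definition gam1 : probability (measurableTypeR R) R :=
  @pdens _ (measurableTypeR R) R lebesgue_measure gd1 gd1_ge0 measurable_gd1 integral_gd1.

Definition gam n : probability 'rV[R]_n R :=
  pdens (@gd_ge0 n) (@measurable_gd n) (integral_gd n).

Lemma gam_integral n (f : 'rV[R]_n -> \bar R) : measf f ->
  (forall x, 0 <= f x)%E ->
  (\int[gam n]_x f x = \int[lebesgue_rV R n]_x (f x * (gd x)%:E))%E.
Proof. by apply: dens_integral => //; [exact: gd_ge0|exact: measurable_gd]. Qed.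

Lemma gam1_integral (f : measurableTypeR R -> \bar R) : measf f ->
  (forall x, 0 <= f x)%E ->
  (\int[gam1]_x f x = \int[lebesgue_measure]_x (f x * (gd1 x)%:E))%E.
Proof. by apply: dens_integral => //; [exact: gd1_ge0|exact: measurable_gd1]. Qed.

Lemma gam_intg n (f : 'rV[R]_n -> R) : measf f ->
  intg (gam n) f <-> intg (lebesgue_rV R n) (fun x => f x * gd x).
Proof. by apply: dens_intg => //; [exact: gd_ge0|exact: measurable_gd]. Qed.

Lemma gam_Ex n (f : 'rV[R]_n -> R) : measf f ->
  Ex (gam n) f = Ex (lebesgue_rV R n) (fun x => f x * gd x).
Proof. by apply: dens_Ex => //; [exact: gd_ge0|exact: measurable_gd]. Qed.

Lemma gam_cons_law n : is_law (pp gam1 (gam n)) rV_cons (gam n.+1).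
Proof.
apply: law_of_integral => [|f mf f0]; first exact: measurable_rV_cons.
have mfc : measf (f \o rV_cons).
  by apply: measurableT_comp => //; exact: measurable_rV_cons.
have mfgd : measf (fun x => f x * (gd x)%:E)%E.
  by apply: emeasurable_funM => //; apply/measurable_EFinP; exact: measurable_gd.
rewrite gam_integral// lebesgue_cons//; last first.
  by move=> x; rewrite mule_ge0// lee_fin gd_ge0.
rewrite /= tonelli1// gam1_integral//; last 2 first.
- exact: (meas_inner (gam n) mfc (fun z => f0 _)).
- by move=> a; apply: integral_ge0 => y _.
apply: eq_integral => a _ /=.
have mfa : measf (fun y : 'rV[R]_n => f (rV_cons (a, y))).
  by apply: measurableT_comp => //; apply: measurable_cons => //; exact: measurable_cst.
rewrite gam_integral// muleC -ge0_integralZl//; last 3 first.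
- by apply: emeasurable_funM => //; apply/measurable_EFinP; exact: measurable_gd.
- by move=> y _; rewrite mule_ge0// lee_fin gd_ge0.
- by rewrite lee_fin gd1_ge0.
by apply: eq_integral => y _; rewrite gd_cons EFinM muleCA.
Qed.

Definition orthm n (A : 'M[R]_n) := A *m A^T = 1%:M.

Lemma orthm_trK n (A : 'M[R]_n) x : orthm A -> x *m A^T *m A = x :> 'rV[R]_n.
Proof.
by move=> AA; rewrite -mulmxA (mulmx1C AA) mulmx1.
Qed.

Lemma dot_orth n (A : 'M[R]_n) x y : orthm A -> dot (x *m A) (y *m A) = dot x y.
Proof.
by move=> AA; rewrite !dotE trmx_mul mulmxA -(mulmxA x) AA mulmx1.
Qed.

Lemma gd_orth n (A : 'M[R]_n) x : orthm A -> gd (x *m A) = gd x.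
Proof. by move=> AA; rewrite /gd dot_orth. Qed.

Lemma gdN n (x : 'rV[R]_n) : gd (- x) = gd x.
Proof. by rewrite /gd dotNl dotNr opprK. Qed.

(* Translation invariance and the rotation invariance of the Gaussian density
   [gd] suffice: integrate [g (x A + y) gd y] in both orders. *)
Lemma lebesgue_orth n (A : 'M[R]_n) : orthm A ->
  is_law (lebesgue_rV R n) (fun x => x *m A) (lebesgue_rV R n).
Proof.
move=> AA; have mA := @measurable_mulmxr R n n A.
apply: law_of_integral => // g mg g0.
pose L := lebesgue_rV R n.
pose G (z : 'rV[R]_n * 'rV[R]_n) : \bar R := (g (z.1 *m A + z.2)%R * (gd z.2)%:E)%E.
have mxA : measf (fun z : 'rV[R]_n * 'rV[R]_n => z.1 *m A).
  by apply: (measurableT_comp mA) => //; exact: measurable_fst.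
have mG : measf G.
  apply: emeasurable_funM.
    by apply: measurableT_comp => //; apply: measurable_rVD => //; exact: measurable_snd.
  apply/measurable_EFinP; apply: (measurableT_comp (@measurable_gd n)).
  exact: measurable_snd.
have G0 z : (0 <= G z)%E by rewrite mule_ge0// lee_fin gd_ge0.
have E1 : (\int[L \x L]_z G z = \int[L]_x g (x *m A))%E.
  rewrite tonelli2//=.
  transitivity (\int[L]_y ((\int[L]_x g (x *m A)) * (gd y)%:E))%E.
    apply: eq_integral => y _; rewrite /G/=.
    have mgA : measf (fun x : 'rV[R]_n => g (x *m A)).
      exact: measurableT_comp.
    rewrite ge0_integralZr//; last 2 first.
    - by apply: measurableT_comp => //; apply: measurable_rVD => //; exact: measurable_cst.
    - by rewrite lee_fin gd_ge0.
    congr (_ * _)%E.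
    rewrite (law_ge0_integral (lebesgue_translation (y *m A^T)) mgA (fun=> g0 _)).
    by apply: eq_integral => x _; rewrite mulmxDl orthm_trK.
  rewrite ge0_integralZl//; last 3 first.
  - by apply/measurable_EFinP; exact: measurable_gd.
  - by move=> x _; rewrite lee_fin gd_ge0.
  - by apply: integral_ge0.
  by rewrite integral_gd mule1.
have E2 : (\int[L \x L]_z G z = \int[L]_y g y)%E.
  pose H (z : 'rV[R]_n * 'rV[R]_n) : \bar R := (g z.2 * (gd (z.2 - z.1 *m A)%R)%:E)%E.
  have mH : measf H.
    apply: emeasurable_funM; first by apply: measurableT_comp => //; exact: measurable_snd.
    apply/measurable_EFinP; apply: (measurableT_comp (@measurable_gd n)).
    by apply: measurable_rVB => //; exact: measurable_snd.
  have H0 z : (0 <= H z)%E by rewrite mule_ge0// lee_fin gd_ge0.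
  rewrite tonelli1//=.
  transitivity (\int[L]_x \int[L]_y H (x, y))%E.
    apply: eq_integral => x _; rewrite /G/=.
    rewrite (@law_ge0_integral _ _ _ _ _ _ _ _ (lebesgue_translation (x *m A))
      (fun y => H (x, y))).
    - by apply: eq_integral => y _; rewrite /H/= addrK addrC.
    - apply: measurableT_comp => //; apply: measurable_fun_pair => //.
    - by [].
  rewrite -tonelli1// tonelli2//=; apply: eq_integral => y _; rewrite /H/=.
  have mgy : measf (fun x : 'rV[R]_n => gd (y - x *m A)).
    apply: (measurableT_comp (@measurable_gd n)).
    by apply: measurable_rVB => //; exact: measurable_cst.
  rewrite ge0_integralZl//; last 2 first.
  - by apply/measurable_EFinP.
  - by move=> x _; rewrite lee_fin gd_ge0.
  rewrite -[RHS]mule1 -(integral_gd n); congr (_ * _)%E.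
  have mgd : measf (fun x : 'rV[R]_n => (gd x)%:E).
    by apply/measurable_EFinP; exact: measurable_gd.
  have gd0 (x : 'rV[R]_n) : (0 <= (gd x)%:E)%E by rewrite lee_fin gd_ge0.
  rewrite (law_ge0_integral (lebesgue_translation (- (y *m A^T))) mgd gd0).
  apply: eq_integral => x _; congr EFin.
    by rewrite -[RHS](gd_orth _ AA) mulmxBl orthm_trK// -gdN opprB.
by rewrite -E2 E1.
Qed.

Lemma row_mx_cons p q a (x : 'rV[R]_p) (y : 'rV[R]_q) :
  row_mx (rV_cons (a, x)) y = rV_cons (a, row_mx x y).
Proof.
apply: rV_consP; rewrite ?hd_cons ?tl_cons.
  rewrite /hd (_ : ord0 = lshift q (ord0 : 'I_p.+1)); last exact: val_inj.
  exact: etrans (row_mxEl _ _ _ _) (rV_cons0 _ _).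
apply/rowP => i; rewrite mxE; case: (split_ordP i) => j ->.
  have -> : lift ord0 (lshift q j) = (lshift q (lift ord0 j) : 'I_(p + q).+1).
    exact: val_inj.
  by rewrite row_mxEl; exact: etrans (row_mxEl _ _ _ _) (rV_consS _ _ _).
have -> : lift ord0 (rshift p j) = (rshift p.+1 j : 'I_(p + q).+1).
  exact: val_inj.
by rewrite row_mxEr; exact: row_mxEr.
Qed.

Lemma measurable_row_mx d (T : measurableType d) p q (f : T -> 'rV[R]_p)
    (g : T -> 'rV[R]_q) : measf f -> measf g ->
  measf (fun t => row_mx (f t) (g t)).
Proof.
move=> /measurable_rVP mf /measurable_rVP mg; apply/measurable_rVP => i.
case: (split_ordP i) => j ->.
  by under eq_fun do rewrite row_mxEl; exact: mf.
by under eq_fun do rewrite row_mxEr; exact: mg.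
Qed.

Lemma measurable_lsubmx p q : measf (@lsubmx R 1 p q).
Proof.
apply/measurable_rVP => i; under eq_fun do rewrite mxE.
exact: measurable_coord.
Qed.

Lemma measurable_rsubmx p q : measf (@rsubmx R 1 p q).
Proof.
apply/measurable_rVP => i; under eq_fun do rewrite mxE.
exact: measurable_coord.
Qed.

Lemma lebesgue_split p q :
  is_law (lebesgue_rV R p \x lebesgue_rV R q)%E (fun z => row_mx z.1 z.2)
    (lebesgue_rV R (p + q)).
Proof.
have mr k l : measf (fun z : 'rV[R]_k * 'rV[R]_l => row_mx z.1 z.2).
  by apply: measurable_row_mx; [exact: measurable_fst|exact: measurable_snd].
apply: law_of_integral => [|f mf f0]; first exact: mr.
rewrite [RHS]tonelli1//=; last exact: measurableT_comp mf (mr p q).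
elim: p f mf f0 => [|p IH] f mf f0.
  rewrite lebesgue0; last first.
    exact: (meas_inner (lebesgue_rV R q) (measurableT_comp mf (mr 0%N q)) (fun z => f0 _)).
  apply: eq_integral => y _; congr f; apply/rowP => i.
  rewrite -[LHS](row_mxEr (0 : 'rV[R]_0)); congr (row_mx _ _ _ _).
  exact: val_inj.
rewrite (@lebesgue_cons R (p + q)%N f mf f0) [RHS]lebesgue_cons; last 2 first.
- exact: (meas_inner (lebesgue_rV R q) (measurableT_comp mf (mr p.+1 q)) (fun z => f0 _)).
- by move=> x; apply: integral_ge0.
apply: eq_integral => a _; rewrite IH//; last first.
  apply: (measurableT_comp mf); apply: measurable_cons => //; exact: measurable_cst.
by apply: eq_integral => x _; apply: eq_integral => y _; rewrite row_mx_cons.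
Qed.

Lemma dot_row_mx p q (x x' : 'rV[R]_p) (y y' : 'rV[R]_q) :
  dot (row_mx x y) (row_mx x' y') = dot x x' + dot y y'.
Proof.
by rewrite /dot big_split_ord; congr (_ + _); apply: eq_bigr => i _;
  rewrite ?row_mxEl ?row_mxEr.
Qed.

Lemma gd_row_mx p q (x : 'rV[R]_p) (y : 'rV[R]_q) :
  gd (row_mx x y) = gd x * gd y.
Proof.
rewrite /gd dot_row_mx exprD mulrACA -expRD; congr (_ * expR _).
by lra.
Qed.

Lemma gam2_integral n p (f : 'rV[R]_n * 'rV[R]_p -> \bar R) : measf f ->
  (forall x, 0 <= f x)%E ->
  (\int[pp (gam n) (gam p)]_x f x =
   \int[lebesgue_rV R n \x lebesgue_rV R p]_x (f x * (gd x.1 * gd x.2)%:E))%E.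
Proof.
move=> mf f0.
have mg1 : measf (fun z : 'rV[R]_n * 'rV[R]_p => gd z.1).
  by apply: (measurableT_comp (@measurable_gd n)); exact: measurable_fst.
have mg2 : measf (fun z : 'rV[R]_n * 'rV[R]_p => gd z.2).
  by apply: (measurableT_comp (@measurable_gd p)); exact: measurable_snd.
rewrite /= tonelli1// tonelli1//; last 2 first.
- by apply: emeasurable_funM => //; apply/measurable_EFinP; exact: measurable_funM.
- by move=> x; rewrite mule_ge0// lee_fin mulr_ge0// gd_ge0.
rewrite gam_integral//; last 2 first.
- exact: (meas_inner (gam p) mf f0).
- by move=> x; exact: integral_ge0.
apply: eq_integral => x _ /=.
have mfx : measf (fun y => f (x, y)).
  by apply: measurableT_comp => //; exact: measurable_fun_pair.
rewrite gam_integral// muleC -ge0_integralZl//; last 3 first.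
- by apply: emeasurable_funM => //; apply/measurable_EFinP; exact: measurable_gd.
- by move=> y _; rewrite mule_ge0// lee_fin gd_ge0.
- by rewrite lee_fin gd_ge0.
by apply: eq_integral => y _; rewrite EFinM muleCA.
Qed.

Lemma gam_split_law p q : is_law (pp (gam p) (gam q))
  (fun z => row_mx z.1 z.2) (gam (p + q)).
Proof.
have mr : measf (fun z : 'rV[R]_p * 'rV[R]_q => row_mx z.1 z.2).
  by apply: measurable_row_mx; [exact: measurable_fst|exact: measurable_snd].
apply: law_of_integral => // f mf f0.
rewrite gam_integral// (law_ge0_integral (lebesgue_split p q)); last 2 first.
- by apply: emeasurable_funM => //; apply/measurable_EFinP; exact: measurable_gd.
- by move=> x; rewrite mule_ge0// lee_fin gd_ge0.
rewrite gam2_integral//; last exact: measurableT_comp.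
by apply: eq_integral => z _; rewrite gd_row_mx.
Qed.

Lemma gam_orth_law n (A : 'M[R]_n) : orthm A ->
  is_law (gam n) (fun x => x *m A) (gam n).
Proof.
move=> AA; apply: law_of_integral => [|f mf f0]; first exact: measurable_mulmxr.
rewrite gam_integral// (law_ge0_integral (lebesgue_orth AA)); last 2 first.
- by apply: emeasurable_funM => //; apply/measurable_EFinP; exact: measurable_gd.
- by move=> x; rewrite mule_ge0// lee_fin gd_ge0.
rewrite (gam_integral (measurableT_comp mf (measurable_mulmxr A)) (fun x => f0 _)).
by apply: eq_integral => x _; rewrite gd_orth.
Qed.

Definition rot n (c s : R) (z : 'rV[R]_n * 'rV[R]_n) : 'rV[R]_n * 'rV[R]_n :=
  (c *: z.1 + s *: z.2, - s *: z.1 + c *: z.2).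

Lemma measurable_rot n c s : measf (@rot n c s).
Proof.
by apply: measurable_fun_pair; apply: measurable_rVD; apply: measurable_rVZ;
  rewrite //; exact: measurable_cst.
Qed.

(** The rotation mixes two vectors; as a block matrix on ['rV_(n + n)] it is orthogonal, and
    [gam_split_law] moves between the two pictures. *)
Lemma gam_rot_law n c s : c ^+ 2 + s ^+ 2 = 1 ->
  is_law (pp (gam n) (gam n)) (rot c s) (pp (gam n) (gam n)).
Proof.
move=> cs1; apply: law_of_integral => [|f mf f0]; first exact: measurable_rot.
pose A : 'M[R]_(n + n) := block_mx c%:M (- s)%:M s%:M c%:M.
have AA : orthm A.
  rewrite /orthm tr_block_mx !tr_scalar_mx mulmx_block.
  rewrite -!scalar_mxM -!raddfD/= [RHS]scalar_mx_block.
  by congr block_mx; rewrite -?cs1 -?(raddf0 (@scalar_mx R n)); congr scalar_mx; ring.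
have E (g : 'rV[R]_n * 'rV[R]_n -> \bar R) : measf g ->
    (forall z, 0 <= g z)%E ->
    (\int[pp (gam n) (gam n)]_z g z =
     \int[gam (n + n)]_w g (lsubmx w, rsubmx w))%E.
  move=> mg g0; rewrite (law_ge0_integral (gam_split_law n n)).
  - by apply: eq_integral => -[x y] _; rewrite /= row_mxKl row_mxKr.
  - apply: measurableT_comp => //.
    by apply: measurable_fun_pair; [exact: measurable_lsubmx|exact: measurable_rsubmx].
  - by [].
rewrite E//.
have mfs : measf (fun w : 'rV[R]_(n + n) => f (lsubmx w, rsubmx w)).
  apply: measurableT_comp => //.
  by apply: measurable_fun_pair; [exact: measurable_lsubmx|exact: measurable_rsubmx].
rewrite (law_ge0_integral (gam_orth_law AA))//.
rewrite (law_ge0_integral (gam_split_law n n))//; last first.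
  exact: measurableT_comp mfs (measurable_mulmxr A).
apply: eq_integral => -[x y] _ /=.
rewrite mul_row_block !mul_mx_scalar row_mxKl row_mxKr /rot/=.
by rewrite scaleNr.
Qed.

(** The Cameron-Martin density: the law of [z + e] under [gam n] has density [cm e] with respect to
    [gam n]. *)
Definition cm n (e z : 'rV[R]_n) : R := expR (dot z e - dot e e / 2).

Lemma measurable_cm n (e : 'rV[R]_n) : measf (cm e).
Proof.
apply: (measurableT_comp (@measurable_expR R)); apply: measurable_funB.
  by apply: measurable_dot => //; exact: measurable_cst.
exact: measurable_cst.
Qed.

Lemma gam_shift n (e : 'rV[R]_n) (f : 'rV[R]_n -> R) : measf f ->
  (intg (gam n) (fun z => f (z + e)) <-> intg (gam n) (fun z => f z * cm e z)) /\
  Ex (gam n) (fun z => f (z + e)) = Ex (gam n) (fun z => f z * cm e z).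
Proof.
move=> mf.
have ms : measf (fun z : 'rV[R]_n => z + e).
  by apply: measurable_rVD => //; exact: measurable_cst.
have mfs : measf (fun z : 'rV[R]_n => f (z + e)).
  exact: measurableT_comp.
have mfc : measf (fun z => f z * cm e z).
  by apply: measurable_funM => //; exact: measurable_cm.
pose h z := f z * cm e z * gd z.
have mh : measf h by apply: measurable_funM => //; exact: measurable_gd.
have he : (fun z => f (z + e) * gd z) = h \o (fun z => z + e).
  apply/funext => z; rewrite /h /= -mulrA; congr (_ * _).
  rewrite /cm /gd mulrCA -expRD; congr (_ * expR _).
  by rewrite dot_sqrD dotDl; lra.
split.
  apply: (iff_trans (gam_intg mfs)); rewrite he.
  apply: iff_trans (iff_sym (gam_intg mfc)).
  exact: iff_sym (law_intg (lebesgue_translation e) mh).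
by rewrite (gam_Ex mfs) he (gam_Ex mfc) (law_Ex (lebesgue_translation e) mh).
Qed.

End gaussian.

(** * Change of variable and monotone transport on the line *)

Section change_of_variable.
Context {R : realType}.
Implicit Types (M dM f g : R -> R).

Lemma is_derive_continuous M dM :
  (forall x : R, is_derive x 1 M (dM x)) -> continuous M.
Proof.
move=> HM x; apply: differentiable_continuous; apply/derivable1_diffP.
by have [] := HM x.
Qed.

Lemma is_derive_gt0_incr M dM : (forall x : R, is_derive x 1 M (dM x)) ->
  (forall x, 0 < dM x) -> {homo M : x y / x < y}.
Proof.
move=> HM M0 x y xy; have [z _ E] := MVT xy (fun z _ => HM z)
  (continuous_subspaceT (is_derive_continuous HM)).
by rewrite -subr_gt0 E mulr_gt0// subr_gt0.
Qed.

(** By the fundamental theorem of calculus, the image under [M] of the measure with density [dM]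
    agrees with Lebesgue measure on half-open intervals, hence on all Borel sets. *)
Lemma change_of_variable M dM (g : measurableTypeR R -> \bar R) :
  (forall x : R, is_derive x 1 M (dM x)) -> continuous dM -> (forall x, 0 < dM x) ->
  (forall y, exists x, M x = y) -> measf g -> (forall x, 0 <= g x)%E ->
  (\int[lebesgue_measure]_y g y = \int[lebesgue_measure]_x (g (M x) * (dM x)%:E))%E.
Proof.
move=> HM cdM dM0 sM mg g0.
have inc := is_derive_gt0_incr HM dM0.
have cM := is_derive_continuous HM.
have mM : measf (M : measurableTypeR R -> measurableTypeR R).
  exact: continuous_measurable_fun.
have mdM : measf (dM : measurableTypeR R -> R).
  exact: continuous_measurable_fun.
have dMge0 x : 0 <= dM x by exact/ltW.
pose nu : {measure set (measurableTypeR R) -> \bar R} :=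
  mdens (@lebesgue_measure R) dMge0 mdM.
have H : is_law nu (M : measurableTypeR R -> measurableTypeR R) (@lebesgue_measure R).
  split => // A mA.
  apply: (@lebesgue_measure_unique _ (pushforward nu
    (M : measurableTypeR R -> measurableTypeR R))) => //.
  move=> _ [[a b] _ <-] /=; rewrite /pushforward /= /mdens.
  have [al Ea] := sM a; have [be Eb] := sM b.
  have leM x y : (M x <= M y) = (x <= y).
    have [xy|yx|->] := ltgtP x y; last by rewrite lexx.
      by rewrite ltW// inc.
    by apply/negbTE; rewrite -ltNge inc.
  have -> : M @^-1` `]a, b] = `]al, be]%classic.
    by apply/seteqP; split => x /=; rewrite !in_itv/= -Ea -Eb !ltNge !leM.
  rewrite lebesgue_measure_itv/= lte_fin -Ea -Eb.
  have -> : (M al < M be) = (al < be) by rewrite !ltNge leM.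
  case: ifP => [ab|/negbT]; last first.
    by rewrite -leNgt => ba; rewrite set_itv_ge ?integral_set0// bnd_simp -leNgt.
  rewrite integral_itv_obnd_cbnd; last first.
    by apply/measurable_EFinP; apply: measurable_funTS.
  rewrite (@continuous_FTC2 _ dM M)//.
  - exact: continuous_subspaceT.
  - split => [x _||]; first by have [] := HM x.
      by apply: cvg_at_right_filter; exact: cM.
    by apply: cvg_at_left_filter; exact: cM.
  - by move=> x _; rewrite derive1E; have [_ ->] := HM x.
rewrite (law_ge0_integral H)// (@dens_integral _ _ _ (@lebesgue_measure R) dM)//.
exact: measurableT_comp mg mM.
Qed.

Definition pos1 f := [/\ continuous f, (forall x, 0 < f x) &
  intg (@lebesgue_measure R) f].

(** Divided by the total mass, so that [f] may be an unnormalized density, as marginals of sections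
    are. *)
Definition cdf f (y : R) : R :=
  Ex (@lebesgue_measure R) (fun t => f t * \1_(`]-oo, y]%classic) t) /
  Ex (@lebesgue_measure R) f.

Let lower f (y : R) : R :=
  Ex (@lebesgue_measure R) (fun t => f t * \1_(`]-oo, y]%classic) t).

Let intg_lower f y : pos1 f ->
  intg (@lebesgue_measure R) (fun t => f t * \1_(`]-oo, y]%classic) t).
Proof.
move=> [cf f0 If]; apply: intg_le If.
  apply: measurable_funM; first exact: continuous_measurable_fun.
  exact: measurable_indic.
move=> x; rewrite normrM ger0_norm ?(ltW (f0 x))// -[leRHS]mulr1.
by rewrite ler_wpM2l ?(ltW (f0 x))// ger0_norm// indicE; case: (_ \in _).
Qed.

Let lower_derive f (y : R) : pos1 f -> is_derive y 1 (lower f) (f y).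
Proof.
move=> [cf f0 If].
have E : lower f = fun x => \int[lebesgue_measure]_(t in `]-oo, x]) f t.
  apply/funext => x; rewrite Rintegral_mkcond /lower /Ex; congr Rintegral.
  by apply/funext => t; rewrite patch_indic.
have i1 : (@lebesgue_measure R).-integrable [set` `]-oo, (y + 1)]] (EFin \o f).
  exact: (integrableS measurableT _ (@subsetT _ _) If).
have y1 : y < y + 1 by rewrite ltrDl.
have FT := @continuous_FTC1 R f -oo%O y (y + 1) y1 i1.
move: FT; rewrite -E /= => FT.
have FT1 := FT (ltNyr _).
have [d1 d2] := FT1 (cf y).
by apply: DeriveDef; [exact: d1|rewrite -derive1E; exact: d2].
Qed.

Let lower_mono f : pos1 f -> {homo lower f : x y / x < y}.
Proof.
by move=> pf; apply: is_derive_gt0_incr (fun x => lower_derive x pf) _; case: pf.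
Qed.

Let lower_ge0 f y : pos1 f -> 0 <= lower f y.
Proof.
move=> [cf f0 If]; apply: Ex_ge0 => t.
by rewrite mulr_ge0 ?(ltW (f0 t))// indicE; case: (_ \in _).
Qed.

Let lower_le f y : pos1 f -> lower f y <= Ex (@lebesgue_measure R) f.
Proof.
move=> pf; have [cf f0 If] := pf; apply: Ex_le => //; first exact: intg_lower.
by move=> t; rewrite -[leRHS]mulr1 ler_wpM2l ?(ltW (f0 t))// indicE.
Qed.

Let lower_gt0 f y : pos1 f -> 0 < lower f y.
Proof.
move=> pf; apply: (le_lt_trans (lower_ge0 (y - 1) pf)).
by apply: lower_mono => //; rewrite ltrBlDr ltrDl.
Qed.

Let lower_lt f y : pos1 f -> lower f y < Ex (@lebesgue_measure R) f.
Proof.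
move=> pf; apply: lt_le_trans (lower_le (y + 1) pf).
by apply: lower_mono => //; rewrite ltrDl.
Qed.

Lemma pos1_Ex_gt0 f : pos1 f -> 0 < Ex (@lebesgue_measure R) f.
Proof. by move=> pf; exact: lt_trans (lower_gt0 0 pf) (lower_lt 0 pf). Qed.

Lemma cdf_derive f (y : R) : pos1 f ->
  is_derive y 1 (cdf f) (f y / Ex (@lebesgue_measure R) f).
Proof.
move=> pf; have d := lower_derive y pf.
have -> : cdf f = (Ex (@lebesgue_measure R) f)^-1 \*: lower f.
  by apply/funext => x; rewrite /cdf /= mulrC.
by rewrite mulrC; exact: is_deriveZ.
Qed.

Lemma cdf_mono f : pos1 f -> {homo cdf f : x y / x < y}.
Proof.
move=> pf x y xy; rewrite /cdf ltr_pM2r ?invr_gt0 ?pos1_Ex_gt0//.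
exact: lower_mono.
Qed.

Lemma cdf_gt0 f y : pos1 f -> 0 < cdf f y.
Proof. by move=> pf; apply: divr_gt0; [exact: (lower_gt0 y pf)|exact: pos1_Ex_gt0]. Qed.

Lemma cdf_lt1 f y : pos1 f -> cdf f y < 1.
Proof. by move=> pf; rewrite ltr_pdivrMr ?pos1_Ex_gt0// mul1r; exact: lower_lt. Qed.

Let lower_limy f : pos1 f -> lower f k%:R @[k --> \oo] --> Ex (@lebesgue_measure R) f.
Proof.
move=> pf; have [cf f0 If] := pf.
have [] // := Ex_dct (m := @lebesgue_measure R)
  (f := fun k t => f t * \1_(`]-oo, k%:R]%classic) t) (h := f) (g := f).
- by move=> k; exact: intg_meas (intg_lower k%:R pf).
- move=> x; apply: cvg_near_cst; near=> k.
  rewrite indicE mem_set ?mulr1//= in_itv/=.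
  by near: k; exact: nbhs_infty_ger.
- move=> k x; rewrite normrM ger0_norm ?(ltW (f0 x))// -[leRHS]mulr1.
  by rewrite ler_wpM2l ?(ltW (f0 x))// ger0_norm// indicE; case: (_ \in _).
Unshelve. all: by end_near. Qed.

Let lower_limNy f : pos1 f -> lower f (- k%:R) @[k --> \oo] --> (0 : R).
Proof.
move=> pf; have [cf f0 If] := pf.
have [] // := Ex_dct (m := @lebesgue_measure R)
  (f := fun k t => f t * \1_(`]-oo, - k%:R]%classic) t) (h := fun=> 0) (g := f).
- by move=> k; exact: intg_meas (intg_lower (- k%:R) pf).
- move=> x; apply: cvg_near_cst; near=> k.
  rewrite indicE memNset ?mulr0//= in_itv/=; apply/negP; rewrite -ltNge ltrNl.
  by near: k; exact: nbhs_infty_gtr.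
- move=> k x; rewrite normrM ger0_norm ?(ltW (f0 x))// -[leRHS]mulr1.
  by rewrite ler_wpM2l ?(ltW (f0 x))// ger0_norm// indicE; case: (_ \in _).
- by rewrite Ex0.
Unshelve. all: by end_near. Qed.

Lemma cdf_surj f t : pos1 f -> 0 < t -> t < 1 -> exists y, cdf f y = t.
Proof.
move=> pf t0 t1; have I0 := pos1_Ex_gt0 pf.
pose s := t * Ex (@lebesgue_measure R) f.
have s0 : 0 < s by rewrite mulr_gt0.
have sI : s < Ex (@lebesgue_measure R) f by rewrite /s gtr_pMl.
have [k ks] : exists k : nat, s < lower f k%:R.
  have d0 : 0 < Ex (@lebesgue_measure R) f - s by rewrite subr_gt0.
  have /cvgrPdist_lt/(_ _ d0)[k _ Hk] := lower_limy pf.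
  exists k; have := Hk k (leqnn k); rewrite ltr_norml => /andP[_]; lra.
have [l ls] : exists l : nat, lower f (- l%:R) < s.
  have /cvgrPdist_lt/(_ _ s0)[k' _ Hk] := lower_limNy pf.
  exists k'; have := Hk k' (leqnn k'); rewrite ltr_norml => /andP[]; lra.
have lk : - l%:R <= k%:R :> R by rewrite (@le_trans _ _ 0)// oppr_le0.
have cl : {within `[- l%:R, k%:R], continuous (lower f)}.
  apply: continuous_subspaceT.
  exact: is_derive_continuous (fun x => lower_derive x pf).
have [y _ yE] : exists2 c, c \in `[- l%:R, k%:R] & lower f c = s.
  by apply: (IVT lk cl); rewrite ge_min le_max (ltW ls) (ltW ks) orbT.
by exists y; rewrite /cdf -/(lower f y) yE mulfK// gt_eqF.
Qed.

End change_of_variable.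

Section monotone_map.
Context {R : realType}.
Implicit Types f g : R -> R.

(** The increasing map that carries the standard Gaussian to the normalization of [f]. For [pos1 f]
    the equation between distribution functions has exactly one solution, so the chosen value is
    determined. *)
Definition Tm f (x : R) : R := xget 0 [set y | cdf f y = cdf gd1 x].

Lemma pos1_gd1 : pos1 (@gd1 R).
Proof.
split; [exact: gd1_cont|exact: gd1_gt0|].
by apply: intg_fin; [exact: measurable_gd1|exact: gd1_ge0|rewrite integral_gd1 ltry].
Qed.

Lemma Ex_gd1 : Ex (@lebesgue_measure R) gd1 = 1.
Proof. by rewrite /Ex /Rintegral integral_gd1. Qed.

Lemma cdf_Tm f x : pos1 f -> cdf f (Tm f x) = cdf gd1 x.
Proof.
move=> pf; have [y yE] := cdf_surj pf (cdf_gt0 x pos1_gd1) (cdf_lt1 x pos1_gd1).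
exact: (xgetPex 0 (ex_intro _ y yE : exists y, [set y | cdf f y = cdf gd1 x] y)).
Qed.

Lemma cdf_inj f : pos1 f -> injective (cdf f).
Proof.
move=> pf x y; have [xy|yx|//] := ltgtP x y.
  by have := cdf_mono pf xy => + E; rewrite E ltxx.
by have := cdf_mono pf yx => + E; rewrite E ltxx.
Qed.

Lemma cdf_le f x y : pos1 f -> (cdf f x <= cdf f y) = (x <= y).
Proof.
move=> pf; have [xy|yx|->] := ltgtP x y; last by rewrite lexx.
  by rewrite ltW// cdf_mono.
by apply/negbTE; rewrite -ltNge cdf_mono.
Qed.

Lemma Tm_le f x y : pos1 f -> (Tm f x <= y) = (cdf gd1 x <= cdf f y).
Proof. by move=> pf; rewrite -(cdf_le _ _ pf) cdf_Tm. Qed.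

Lemma Tm_mono f : pos1 f -> {homo Tm f : x y / x < y}.
Proof.
move=> pf x y xy; rewrite ltNge Tm_le// cdf_Tm// cdf_le -?ltNge//.
exact: pos1_gd1.
Qed.

Lemma Tm_surj f y : pos1 f -> exists x, Tm f x = y.
Proof.
move=> pf; have [x xE] := cdf_surj pos1_gd1 (cdf_gt0 y pf) (cdf_lt1 y pf).
by exists x; apply: (cdf_inj pf); rewrite cdf_Tm.
Qed.

(** The Monge-Ampere equation in dimension one: density at the image times slope equals mass times
    [gd1]. *)
Lemma Tm_derive f (x : R) : pos1 f ->
  is_derive x 1 (Tm f) (Ex (@lebesgue_measure R) f * gd1 x / f (Tm f x)).
Proof.
move=> pf; have I0 := pos1_Ex_gt0 pf; have [cf f0 _] := pf.
(* A chosen inverse of [cdf f]. By definition [Tm f] is [q] composed with [cdf gd1], so the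
   derivative of an inverse function and the chain rule apply. *)
pose q t := xget 0 [set y | cdf f y = t].
have qK : cancel (cdf f) q.
  move=> y; apply: (cdf_inj pf).
  exact: (xgetPex 0 (ex_intro _ y erefl : exists z, [set z | cdf f z = cdf f y] z)).
have dq : is_derive (cdf f (Tm f x)) 1 q (f (Tm f x) / Ex (@lebesgue_measure R) f)^-1.
  apply: (@is_derive_inverse _ (cdf f) q).
  - by near=> y; exact: qK.
  - near=> y; exact: (is_derive_continuous (fun z => cdf_derive z pf)).
  - exact: cdf_derive.
  - by rewrite mulf_neq0 ?invr_neq0// gt_eqF.
rewrite cdf_Tm// in dq.
have := is_derive1_comp dq (cdf_derive x pos1_gd1).
rewrite Ex_gd1 divr1 invfM invrK => d.
have -> : Ex (@lebesgue_measure R) f * gd1 x / f (Tm f x) =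
  (f (Tm f x))^-1 * Ex lebesgue_measure f * gd1 x by ring.
exact: d.
Unshelve. all: by end_near. Qed.

Lemma Tm_cont f : pos1 f -> continuous (Tm f).
Proof. by move=> pf; exact: is_derive_continuous (fun x => Tm_derive x pf). Qed.

Lemma Tm_derivative_cont f : pos1 f ->
  continuous (fun x => Ex (@lebesgue_measure R) f * gd1 x / f (Tm f x)).
Proof.
move=> pf x; have [cf f0 _] := pf; apply: cvgM.
  by apply: cvgM; [exact: cvg_cst|exact: gd1_cont].
apply: cvgV; first by rewrite gt_eqF.
by apply: (@continuous_comp _ _ _ (Tm f) f); [exact: Tm_cont|exact: cf].
Qed.

Lemma Tm_derivative_gt0 f x : pos1 f ->
  0 < Ex (@lebesgue_measure R) f * gd1 x / f (Tm f x).
Proof.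
by move=> pf; have [_ f0 _] := pf; rewrite divr_gt0// mulr_gt0 ?gd1_gt0// pos1_Ex_gt0.
Qed.

Lemma Tm_push f (h : measurableTypeR R -> \bar R) : pos1 f -> measf h ->
  (forall x, 0 <= h x)%E ->
  (\int[lebesgue_measure]_y (h y * (f y)%:E) =
   (Ex (@lebesgue_measure R) f)%:E * \int[gam1]_x h (Tm f x))%E.
Proof.
move=> pf mh h0; have [cf f0 _] := pf; have I0 := pos1_Ex_gt0 pf.
have mT : measf (Tm f : measurableTypeR R -> measurableTypeR R).
  exact: continuous_measurable_fun (Tm_cont pf).
have mf : measf (f : measurableTypeR R -> R).
  exact: continuous_measurable_fun.
rewrite (change_of_variable (fun x => Tm_derive x pf) (Tm_derivative_cont pf)
  (fun x => Tm_derivative_gt0 x pf) (fun y => Tm_surj y pf)); last 2 first.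
- by apply: emeasurable_funM => //; exact/measurable_EFinP.
- by move=> y; rewrite mule_ge0// lee_fin ltW.
have mhT : measf (fun x => h (Tm f x)) by exact: measurableT_comp.
rewrite gam1_integral// -ge0_integralZl//; last 3 first.
- by apply: emeasurable_funM => //; apply/measurable_EFinP; exact: measurable_gd1.
- by move=> x _; rewrite mule_ge0// lee_fin gd1_ge0.
- by rewrite lee_fin ltW.
apply: eq_integral => x _; rewrite -muleA [RHS]muleCA; congr (_ * _)%E.
rewrite -!EFinM; congr EFin; field.
by rewrite gt_eqF.
Qed.

Lemma gam1_sqr_intg : intg (@gam1 R) (fun x => x ^+ 2).
Proof.
have mx2 : measf (fun x : measurableTypeR R => x ^+ 2).
  by apply: measurable_funX; exact: measurable_id.
apply/(dens_intg (m := @lebesgue_measure R) (@gd1_ge0 R) (@measurable_gd1 R)) => //.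
have I2 := integrable_normal_pdf (0 : R) (Num.sqrt 2).
have s2 : Num.sqrt 2 != 0 :> R by rewrite gt_eqF// sqrtr_gt0.
(* Since [x ^+ 2 * expR (- (x ^+ 2 / 4)) <= 4], what remains is a multiple of the normal density of
   variance 2. *)
pose C : R := 4 * (Num.sqrt (2 * pi))^-1 / normal_peak (Num.sqrt 2).
have pk : 0 < normal_peak (Num.sqrt 2) :> R by exact: normal_peak_gt0.
apply: (@intg_le _ _ _ (@lebesgue_measure R) _ (fun x => C * normal_pdf 0 (Num.sqrt 2) x)).
- by apply: measurable_funM => //; exact: measurable_gd1.
- move=> x; rewrite ger0_norm; last exact: mulr_ge0 (sqr_ge0 x) (gd1_ge0 x).
  pose e := expR (- (x ^+ 2 / 4)).
  have e0 : 0 < e by exact: expR_gt0.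
  have -> : C * normal_pdf 0 (Num.sqrt 2) x = 4 * (Num.sqrt (2 * pi))^-1 * e.
    rewrite normal_pdfE// /normal_fun subr0 sqr_sqrtr// mulrA /C divfK ?gt_eqF//.
    by congr (_ * expR _); rewrite -mulr_natr; field.
  have -> : gd1 x = (Num.sqrt (2 * pi))^-1 * (e * e).
    by rewrite /e -expRD /gd1; congr (_ * expR _); lra.
  have h : x ^+ 2 * e <= 4.
    rewrite /e expRN ler_pdivrMr ?expR_gt0//.
    by have := expR_ge1Dx (x ^+ 2 / 4); lra.
  have -> : x ^+ 2 * ((Num.sqrt (2 * pi))^-1 * (e * e)) =
    x ^+ 2 * e * ((Num.sqrt (2 * pi))^-1 * e) by ring.
  by rewrite -[leRHS]mulrA ler_wpM2r// mulr_ge0 ?(ltW e0)// ltW// gpeak_gt0.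
- exact: intgZ.
Qed.

End monotone_map.

(** * The one-dimensional transport step at rotated Gaussian points *)

Lemma rotation_exponent (R : realType) (co si a x : R) : co ^+ 2 + si ^+ 2 = 1 ->
  - ((co * x + si * a) ^+ 2 / 2) + - ((co * x - si * a) ^+ 2 / 2) =
  - (x ^+ 2 / 2) + si ^+ 2 * (x ^+ 2 - a ^+ 2) / 2 +
  (- (x ^+ 2 / 2) + si ^+ 2 * (x ^+ 2 - a ^+ 2) / 2).
Proof.
move=> cs; have -> : - ((co * x + si * a) ^+ 2 / 2) + - ((co * x - si * a) ^+ 2 / 2) =
  - (co ^+ 2 * x ^+ 2) - si ^+ 2 * a ^+ 2 by field.
by have -> : co ^+ 2 = 1 - si ^+ 2; [lra|field].
Qed.

Lemma norm_shift_bounds (R : realType) (a b r : R) :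
  [/\ a <= `|a| + `|b| + `|r| + r, a <= `|a| + `|b| + `|r| - r,
      - (`|a| + `|b| + `|r|) + r <= a & - (`|a| + `|b| + `|r|) - r <= a].
Proof.
have := ler_norm a; have := lerNnormlW (lexx `|a|).
have := ler_norm r; have := lerNnormlW (lexx `|r|); have := normr_ge0 b.
by move=> *; split; lra.
Qed.

Lemma sqrt_amgm (R : realType) (p q : R) : 0 < p -> 0 < q ->
  Num.sqrt (p * q) <= 2^-1 * (p + q).
Proof.
move=> p0 q0; have := sqr_ge0 (Num.sqrt p - Num.sqrt q).
by rewrite sqrrB !sqr_sqrtr ?(ltW p0) ?(ltW q0)// sqrtrM ?(ltW p0)// mulr2n; lra.
Qed.

Lemma half_sum_bounds (R : realType) (y p q : R) :
  (y <= p -> y <= q -> y <= 2^-1 * (p + q)) /\ (p <= y -> q <= y -> 2^-1 * (p + q) <= y).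
Proof. by split; lra. Qed.

Section one_dimensional_step.
Context {R : realType}.
Variables (f g : R -> R) (h : measurableTypeR R -> \bar R) (c : R -> R -> R) (co si a C : R).
Hypotheses (pf : pos1 f) (pg : pos1 g) (mh : measf h)
  (h0 : forall x, (0 <= h x)%E) (mc : measf (fun z : R * R => c z.1 z.2))
  (cC : forall x y, `|c x y| <= C) (co0 : 0 < co) (cs1 : co ^+ 2 + si ^+ 2 = 1).
Hypothesis H : forall x y : R,
  ((Num.sqrt (f x * g y) * expR (c x y))%:E <= h (2^-1 * (x + y))%R)%E.

Let If := Ex (@lebesgue_measure R) f.
Let Ig := Ex (@lebesgue_measure R) g.
Let uu (x : R) := co * x + si * a.
Let vv (x : R) := co * x + - (si * a).
Let M (x : R) := 2^-1 * (Tm f (uu x) + Tm g (vv x)).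
Let dTf (x : R) := If * gd1 x / f (Tm f x).
Let dTg (x : R) := Ig * gd1 x / g (Tm g x).
Let dM (x : R) := 2^-1 * (dTf (uu x) * co + dTg (vv x) * co).

Let duu (x : R) : is_derive x 1 uu co.
Proof.
apply: (is_derive_eq (is_deriveD (is_deriveZ co (is_derive_id x 1)) (is_derive_cst (si * a) x 1))).
by rewrite addr0 /GRing.scale/= mulr1.
Qed.

Let dvv (x : R) : is_derive x 1 vv co.
Proof.
apply: (is_derive_eq (is_deriveD (is_deriveZ co (is_derive_id x 1)) (is_derive_cst (- (si * a)) x 1))).
by rewrite addr0 /GRing.scale/= mulr1.
Qed.

Let dMP (x : R) : is_derive x 1 M (dM x).
Proof.
have d1 := is_derive1_comp (Tm_derive (uu x) pf) (duu x).
have d2 := is_derive1_comp (Tm_derive (vv x) pg) (dvv x).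
have d := @is_deriveZ _ _ _ _ 2^-1 _ _ _ (is_deriveD d1 d2).
exact: d.
Qed.

Let cuu : continuous uu. Proof. exact: is_derive_continuous duu. Qed.
Let cvv : continuous vv. Proof. exact: is_derive_continuous dvv. Qed.

Let cdM : continuous dM.
Proof.
move=> x; apply: cvgM; first exact: cvg_cst.
apply: cvgD; (apply: cvgM; last exact: cvg_cst).
  apply: (@continuous_comp _ _ _ uu dTf); first exact: cuu.
  exact: Tm_derivative_cont.
apply: (@continuous_comp _ _ _ vv dTg); first exact: cvv.
exact: Tm_derivative_cont.
Qed.

Let dM0 x : 0 < dM x.
Proof.
by rewrite mulr_gt0 ?invr_gt0// addr_gt0// mulr_gt0//; exact: Tm_derivative_gt0.
Qed.

Let le_Tm (k : R -> R) x y : pos1 k -> x <= y -> Tm k x <= Tm k y.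
Proof. by move=> pk; rewrite le_eqVlt => /orP[/eqP ->//|/(Tm_mono pk)/ltW]. Qed.

Let M_surj y : exists x, M x = y.
Proof.
have [x1 E1] := Tm_surj y pf; have [x2 E2] := Tm_surj y pg.
have cM : continuous M := is_derive_continuous dMP.
have K z : uu (z / co) = z + si * a by rewrite /uu mulrC divfK ?gt_eqF.
have K' z : vv (z / co) = z - si * a by rewrite /vv mulrC divfK ?gt_eqF.
have [b1 b2 b3 b4] := norm_shift_bounds x1 x2 (si * a).
have [] := norm_shift_bounds x2 x1 (si * a); rewrite (addrC `|x2|) => b1' b2' b3' b4'.
set B := `|x1| + _ + _ in b1 b2 b3 b4 b1' b2' b3' b4'.
(* [B] exceeds both preimages in absolute value by a margin [|si * a|]; at [hi] both shifted
   arguments lie above the preimages, at [lo] both lie below. *)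
pose hi := B / co; pose lo := - B / co.
have hM : y <= M hi.
  apply: (half_sum_bounds _ _ _).1.
    by rewrite -[y in y <= _]E1; apply: le_Tm; rewrite // K.
  by rewrite -[y in y <= _]E2; apply: le_Tm; rewrite // K'.
have lM : M lo <= y.
  apply: (half_sum_bounds _ _ _).2.
    by rewrite -[y in _ <= y]E1; apply: le_Tm; rewrite // K.
  by rewrite -[y in _ <= y]E2; apply: le_Tm; rewrite // K'.
have lohi : lo <= hi.
  rewrite /lo /hi ler_pM2r ?invr_gt0// ge0_cp ?addr_ge0//.
have [x _ xE] : exists2 x, x \in `[lo, hi] & M x = y.
  apply: (IVT lohi (continuous_subspaceT cM)).
  by rewrite ge_min le_max lM hM orbT.
by exists x.
Qed.

(** For [co = 1] and [si = 0] this is the transport proof of Prekopa-Leindler along the midpoint [M]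
    of the two monotone maps, with the cost [c] kept. Evaluating the maps at the rotated points
    [co * x + si * a] and [co * x - si * a] costs the factor [co] and the quadratic term, which
    compares [gd1 x] with the geometric mean of the Gaussian densities at those points. *)
Lemma transport_step :
  ((co * Num.sqrt (If * Ig) * expR (Ex gam1 (fun x =>
     c (Tm f (co * x + si * a)) (Tm g (co * x - si * a)) +
     si ^+ 2 * (x ^+ 2 - a ^+ 2) / 2)))%:E <= \int[lebesgue_measure]_x h x)%E.
Proof.
have [cf f0 _] := pf; have [cg g0 _] := pg.
have If0 : 0 < If by exact: pos1_Ex_gt0.
have Ig0 : 0 < Ig by exact: pos1_Ex_gt0.
pose phi x := c (Tm f (uu x)) (Tm g (vv x)) + si ^+ 2 * (x ^+ 2 - a ^+ 2) / 2.
have mTu : measf (fun x : measurableTypeR R => Tm f (uu x)).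
  apply: continuous_measurable_fun => x.
  by apply: (@continuous_comp _ _ _ uu (Tm f)); [exact: cuu|exact: Tm_cont].
have mTv : measf (fun x : measurableTypeR R => Tm g (vv x)).
  apply: continuous_measurable_fun => x.
  by apply: (@continuous_comp _ _ _ vv (Tm g)); [exact: cvv|exact: Tm_cont].
have mcT : measf (fun x : measurableTypeR R => c (Tm f (uu x)) (Tm g (vv x))).
  exact: (measurableT_comp mc (measurable_fun_pair mTu mTv)).
have Iphi : intg gam1 phi.
  apply: intgD; first by apply: intg_bdd mcT _ => x; exact: cC.
  have -> : (fun x => si ^+ 2 * (x ^+ 2 - a ^+ 2) / 2) =
      (fun x : measurableTypeR R => si ^+ 2 / 2 * (x ^+ 2 - a ^+ 2)).
    by apply/funext => x; rewrite mulrAC.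
  apply: intgZ; apply: intgB; [exact: gam1_sqr_intg|exact: intg_cst].
have mphi := intg_meas Iphi.
have mM : measf (M : measurableTypeR R -> measurableTypeR R).
  exact: continuous_measurable_fun (is_derive_continuous dMP).
have mdM : measf (dM : measurableTypeR R -> R).
  exact: continuous_measurable_fun cdM.
rewrite (change_of_variable dMP cdM dM0 M_surj mh h0).
apply: (@le_trans _ _ (\int[lebesgue_measure]_x
    ((co * Num.sqrt (If * Ig) * expR (phi x))%:E * (gd1 x)%:E))%E).
  rewrite -gam1_integral//; last 2 first.
  - apply/measurable_EFinP; apply: measurable_funM; first exact: measurable_cst.
    exact: measurableT_comp (@measurable_expR R) mphi.
  - by move=> x; rewrite lee_fin !mulr_ge0 ?expR_ge0 ?sqrtr_ge0 ?(ltW co0).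
  under eq_integral do rewrite EFinM.
  rewrite ge0_integralZl; last 4 first.
  - by [].
  - apply/measurable_EFinP; exact: measurableT_comp (@measurable_expR R) mphi.
  - by move=> x _; rewrite lee_fin expR_ge0.
  - by rewrite lee_fin mulr_ge0 ?sqrtr_ge0 ?(ltW co0).
  rewrite EFinM; apply: lee_wpmul2l; last exact: jensen_expR_ereal.
  by rewrite lee_fin mulr_ge0 ?sqrtr_ge0 ?(ltW co0).
apply: ge0_le_integral => //.
- by move=> x _; rewrite -EFinM lee_fin !mulr_ge0 ?expR_ge0 ?sqrtr_ge0 ?gd1_ge0 ?(ltW co0).
- apply: emeasurable_funM; last by apply/measurable_EFinP; exact: measurable_gd1.
  apply/measurable_EFinP; apply: measurable_funM; first exact: measurable_cst.
  exact: measurableT_comp (@measurable_expR R) mphi.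
- apply: emeasurable_funM; first exact: measurableT_comp mh mM.
  exact/measurable_EFinP.
move=> x _.
apply: (@le_trans _ _ ((Num.sqrt (f (Tm f (uu x)) * g (Tm g (vv x))) *
    expR (c (Tm f (uu x)) (Tm g (vv x))))%:E * (dM x)%:E)%E); last first.
  by rewrite lee_wpmul2r ?lee_fin ?(ltW (dM0 x))//; exact: H.
rewrite -!EFinM lee_fin.
have fu0 := f0 (Tm f (uu x)); have gv0 := g0 (Tm g (vv x)).
set fu := f _ in fu0 *; set gv := g _ in gv0 *.
set cc := c _ _.
have p0 : 0 < dTf (uu x) by exact: Tm_derivative_gt0.
have q0 : 0 < dTg (vv x) by exact: Tm_derivative_gt0.
(* The arithmetic-geometric mean inequality between the two slopes; the chain rule through [uu] and
   [vv] produces the factor [co]. *)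
have amgm : co * Num.sqrt (dTf (uu x) * dTg (vv x)) <= dM x.
  have -> : dM x = co * (2^-1 * (dTf (uu x) + dTg (vv x))) by rewrite /dM; ring.
  rewrite ler_pM2l//; move: (dTf _) (dTg _) p0 q0 => p q p0 q0.
  exact: sqrt_amgm.

apply: (@le_trans _ _ (Num.sqrt (fu * gv) * expR cc *
    (co * Num.sqrt (dTf (uu x) * dTg (vv x))))); last first.
  by rewrite ler_wpM2l// mulr_ge0 ?sqrtr_ge0 ?expR_ge0.
have -> : Num.sqrt (fu * gv) * expR cc * (co * Num.sqrt (dTf (uu x) * dTg (vv x))) =
    co * expR cc * Num.sqrt (If * Ig * (gd1 (uu x) * gd1 (vv x))).
  rewrite [LHS](_ : _ = co * expR cc * (Num.sqrt (fu * gv) * Num.sqrt (dTf (uu x) * dTg (vv x)))); last by ring.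
  rewrite -sqrtrM ?mulr_ge0 ?(ltW fu0) ?(ltW gv0)//; congr (_ * Num.sqrt _).
  rewrite /dTf /dTg -/fu -/gv; field.
  by rewrite !gt_eqF.
have -> : gd1 (uu x) * gd1 (vv x) = (gd1 x * expR (si ^+ 2 * (x ^+ 2 - a ^+ 2) / 2)) ^+ 2.
  rewrite /gd1; set p := (Num.sqrt _)^-1.
  have sq (A B : R) : (p * expR A * expR B) ^+ 2 = p * p * expR ((A + B) + (A + B)).
    by rewrite !expRD; ring.
  have mu (A B : R) : p * expR A * (p * expR B) = p * p * expR (A + B).
    by rewrite expRD; ring.
  rewrite sq mu; congr (_ * expR _); exact: rotation_exponent.
rewrite [in leRHS]sqrtrM; last by rewrite mulr_ge0 ?(ltW If0) ?(ltW Ig0).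
rewrite sqrtr_sqr ger0_norm; last first.
  by rewrite mulr_ge0 ?gd1_ge0 ?expR_ge0.
rewrite /phi -/cc expRD le_eqVlt; apply/orP; left; apply/eqP; ring.
Qed.

End one_dimensional_step.

(** * Marginals of product laws, Gaussian domination, the Knothe map *)

Section product_laws.
Context d1 d2 (T1 : measurableType d1) (T2 : measurableType d2) (R : realType)
  (P : probability T1 R) (Q : probability T2 R).

Lemma law_fst : is_law (pp P Q) fst P.
Proof.
split=> [|A mA]; first exact: measurable_fst.
have -> : fst @^-1` A = A `*` [set: T2] by apply/seteqP; split => -[x y] //= [].
by rewrite /= product_measure1E// -[X in (_ * X)%E]/(Q setT) probability_setT mule1.
Qed.

Lemma law_snd : is_law (pp P Q) snd Q.
Proof.
split=> [|A mA]; first exact: measurable_snd.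
have -> : snd @^-1` A = [set: T1] `*` A by apply/seteqP; split => -[x y] //= [].
by rewrite /= product_measure1E// -[X in (X * _)%E]/(P setT) probability_setT mul1e.
Qed.

Lemma intg_fst f : intg P f -> intg (pp P Q) (fun z => f z.1).
Proof. by move=> If; apply/(law_intg law_fst (intg_meas If)). Qed.

Lemma intg_snd f : intg Q f -> intg (pp P Q) (fun z => f z.2).
Proof. by move=> If; apply/(law_intg law_snd (intg_meas If)). Qed.

Lemma Ex_fst f : measf f -> Ex (pp P Q) (fun z => f z.1) = Ex P f.
Proof. by move=> mf; rewrite (law_Ex law_fst mf). Qed.

Lemma Ex_snd f : measf f -> Ex (pp P Q) (fun z => f z.2) = Ex Q f.
Proof. by move=> mf; rewrite (law_Ex law_snd mf). Qed.

End product_laws.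

Section gaussian_domination.
Context {R : realType}.
Implicit Types n : nat.

Lemma gexp1_intg (c : R) : 0 < c ->
  intg (@lebesgue_measure R) (fun a => expR (- (c * a ^+ 2))).
Proof.
move=> c0; pose s := Num.sqrt ((2 * c)^-1).
have c20 : 0 < (2 * c)^-1 by rewrite invr_gt0 mulr_gt0.
have s0 : s != 0 by rewrite gt_eqF// sqrtr_gt0.
have pk : 0 < normal_peak s by exact: normal_peak_gt0.
have := @intgZ _ _ _ _ (normal_peak s)^-1 _ (integrable_normal_pdf 0 s).
congr intg; apply/funext => a.
rewrite normal_pdfE// mulrA mulVf ?gt_eqF// mul1r /normal_fun subr0 sqr_sqrtr ?ltW//.
by congr expR; rewrite -mulr_natr; field; rewrite gt_eqF.
Qed.

Lemma gexp_intg n (c : R) : 0 < c ->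
  intg (lebesgue_rV R n) (fun x => expR (- (c * dot x x))).
Proof.
move=> c0; have mg k : measf (fun x : 'rV[R]_k => expR (- (c * dot x x))).
  apply: (measurableT_comp (@measurable_expR R)).
  apply: (measurableT_comp (f := fun t : R => - (c * t))).
    by apply: continuous_measurable_fun => x; apply: cvgN; apply: cvgM; [exact: cvg_cst|exact: cvg_id].
  by apply: measurable_dot.
elim: n => [|n IH].
  apply: intg_fin => [|x|]; [exact: mg|exact: expR_ge0|].
  by rewrite lebesgue0 ?ltry//; apply/measurable_EFinP; exact: mg.
apply/(law_intg (lebesgue_cons_law n) (mg _)).
have E a (y : 'rV[R]_n) : expR (- (c * dot (rV_cons (a, y)) (rV_cons (a, y)))) =
    expR (- (c * a ^+ 2)) * expR (- (c * dot y y)).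
  by rewrite -expRD dot_cons; congr expR; ring.
apply: fub_intg.
- exact: measurableT_comp (mg _) measurable_rV_cons.
- by move=> z; exact: expR_ge0.
- move=> a; have := @intgZ _ _ _ _ (expR (- (c * a ^+ 2))) _ IH.
  by congr intg; apply/funext => y; rewrite /= E.
- have := @intgZ _ _ _ _ (Ex (lebesgue_rV R n) (fun y => expR (- (c * dot y y)))) _ (gexp1_intg c0).
  congr intg; apply/funext => a; rewrite mulrC -ExZ//.
  by congr Ex; apply/funext => y; rewrite /= E.
Qed.

Definition gdom n (F : 'rV[R]_n -> R) : Prop :=
  [/\ continuous F, (forall x, 0 < F x) &
    exists C c : R, 0 < c /\ forall x, F x <= C * expR (- (c * dot x x))].

Definition sec n (F : 'rV[R]_n.+1 -> R) (a : R) : 'rV[R]_n -> R :=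
  fun y => F (rV_cons (a, y)).

Definition mg n (F : 'rV[R]_n.+1 -> R) (a : measurableTypeR R) : R :=
  Ex (lebesgue_rV R n) (sec F a).

Lemma gdom_meas n (F : 'rV[R]_n -> R) : gdom F -> measf F.
Proof. by move=> [cF _ _]; exact: continuous_measurable_rV. Qed.

Lemma gdom_intg n (F : 'rV[R]_n -> R) : gdom F -> intg (lebesgue_rV R n) F.
Proof.
move=> gF; have [_ F0 [C [c [c0 FC]]]] := gF.
apply: intg_le (intgZ C (gexp_intg n c0)); first exact: gdom_meas.
by move=> x; rewrite gtr0_norm//; exact: FC.
Qed.

Lemma cons_continuous n (a : R) : continuous (fun y : 'rV[R]_n => rV_cons (a, y)).
Proof.
apply: continuous_rV => i; case: (unliftP ord0 i) => [j ->|->] y.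
  have -> : (fun x => rV_cons (a, x) 0 (lift ord0 j)) = (fun x : 'rV[R]_n => x 0 j).
    by apply/funext => x; rewrite rV_consS.
  exact: coord_continuous.
have -> : (fun x : 'rV[R]_n => rV_cons (a, x) 0 ord0) = (fun=> a).
  by apply/funext => x; rewrite rV_cons0.
exact: cst_continuous.
Qed.

Lemma cons_continuousl n (y : 'rV[R]_n) : continuous (fun a : R => rV_cons (a, y)).
Proof.
apply: continuous_rV => i; case: (unliftP ord0 i) => [j ->|->] a.
  have -> : (fun x : R => rV_cons (x, y) 0 (lift ord0 j)) = (fun=> y 0 j).
    by apply/funext => x; rewrite rV_consS.
  exact: cst_continuous.
have -> : (fun x : R => rV_cons (x, y) 0 ord0) = id.
  by apply/funext => x; rewrite rV_cons0.
exact: cvg_id.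
Qed.

Lemma gdom_sec n (F : 'rV[R]_n.+1 -> R) a : gdom F -> gdom (sec F a).
Proof.
move=> [cF F0 [C [c [c0 FC]]]]; split.
- move=> y; apply: (@continuous_comp _ _ _ (fun y => rV_cons (a, y)) F).
    exact: cons_continuous.
  exact: cF.
- by move=> y; exact: F0.
- exists (C * expR (- (c * a ^+ 2))), c; split => // y.
  apply: (le_trans (FC _)); rewrite -mulrA -expRD dot_cons.
  by rewrite -opprD -mulrDr expr2.
Qed.

(** Positivity of the marginal is assumed here because [gdom_Ex_gt0] derives it from this very
    lemma, one dimension at a time. *)
Lemma mg_pos1 n (F : 'rV[R]_n.+1 -> R) : gdom F ->
  (forall a, 0 < mg F a) -> pos1 (mg F).
Proof.
move=> gF mg0; have [cF F0 [C [c [c0 FC]]]] := gF.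
have C0 : 0 <= C.
  have := le_trans (ltW (F0 0)) (FC 0); rewrite pmulr_lge0 ?expR_gt0//.
have bd a y : `|sec F a y| <= C * expR (- (c * dot y y)).
  rewrite gtr0_norm ?F0//; apply: (le_trans (FC _)); rewrite ler_wpM2l// ler_expR.
  by rewrite dot_cons lerN2 ler_pM2l// lerDr -expr2 sqr_ge0.
split=> //; last first.
  have mF := gdom_meas gF.
  have IF := (law_intg (lebesgue_cons_law n) mF).1 (gdom_intg gF).
  by have [] := Ex_fub IF (fun a => gdom_intg (gdom_sec a gF)).
move=> a.
have : {in `](a - 1), (a + 1)[%classic, continuous (mg F)}.
  apply: (@continuity_under_integral R _ _ (lebesgue_rV R n) (fun a y => sec F a y) setT
    measurableT (a - 1) (a + 1) _ _ (fun y => C * expR (- (c * dot y y)))).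
  - by move=> b _; exact: gdom_intg (gdom_sec b gF).
  - apply/aeW => y _ b _.
    apply: (@continuous_comp _ _ _ (fun b => rV_cons (b, y)) F).
      exact: cons_continuousl.
    exact: cF.
  - exact: intgZ (gexp_intg n c0).
  - by move=> b _; apply/aeW => y _; exact: bd.
by apply; rewrite inE/= in_itv/= ltrDl ltrBlDr ltrDl ltr01.
Qed.

Lemma Ex_cons n (F : 'rV[R]_n.+1 -> R) : gdom F ->
  Ex (lebesgue_rV R n.+1) F = Ex (@lebesgue_measure R) (mg F).
Proof.
move=> gF; have mF := gdom_meas gF.
have IF := (law_intg (lebesgue_cons_law n) mF).1 (gdom_intg gF).
rewrite (law_Ex (lebesgue_cons_law n) mF).
by have [_ ->] := Ex_fub IF (fun a => gdom_intg (gdom_sec a gF)).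
Qed.

Lemma gdom_Ex_gt0 n (F : 'rV[R]_n -> R) : gdom F -> 0 < Ex (lebesgue_rV R n) F.
Proof.
elim: n F => [|n IH] F gF.
  have [cF F0 _] := gF; rewrite /Ex /Rintegral lebesgue0 ?F0//.
  by apply/measurable_EFinP; exact: gdom_meas.
rewrite Ex_cons//; apply/pos1_Ex_gt0/mg_pos1 => // a.
exact: IH (gdom_sec a gF).
Qed.

Lemma gdom_mg n (F : 'rV[R]_n.+1 -> R) : gdom F -> pos1 (mg F).
Proof. by move=> gF; apply: mg_pos1 => // a; exact: gdom_Ex_gt0 (gdom_sec a gF). Qed.

(* The Knothe map, which transports the standard Gaussian measure to the
   normalization of [F]. *)
Fixpoint KN n : ('rV[R]_n -> R) -> 'rV[R]_n -> 'rV[R]_n :=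
  match n with
  | 0 => fun _ x => x
  | m.+1 => fun F x =>
      let a := Tm (mg F) (hd x) in rV_cons (a, KN (sec F a) (tl x))
  end.

(** The recursion replaces the density by its section at the coordinate just computed, so the
    induction has to carry measurability jointly in a parameter of the density and in the point. *)
Lemma measurable_KN_param n d (S : measurableType d) (F : S -> 'rV[R]_n -> R) :
  measf (fun z : S * 'rV[R]_n => F z.1 z.2) -> (forall s, gdom (F s)) ->
  measf (fun z : S * 'rV[R]_n => KN (F z.1) z.2).
Proof.
elim: n d S F => [|n IH] d S F mF gF /=; first exact: measurable_snd.
have mmg : measf (fun z : S * measurableTypeR R => mg (F z.1) z.2).
  pose k (w : (S * measurableTypeR R) * 'rV[R]_n) := F w.1.1 (rV_cons (w.1.2, w.2)).
  have mk : measf k.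
    apply: (measurableT_comp mF (g := fun w : (S * measurableTypeR R) * 'rV[R]_n =>
      (w.1.1, rV_cons (w.1.2, w.2)))).
    apply: measurable_fun_pair; first exact: (measurableT_comp measurable_fst measurable_fst).
    apply: measurable_cons; last exact: measurable_snd.
    exact: (measurableT_comp measurable_snd measurable_fst).
  exact: (meas_Ex (lebesgue_rV R n) mk).
have mlow y : measf (fun s => Ex (@lebesgue_measure R)
    (fun t => mg (F s) t * \1_(`]-oo, y]%classic) t)).
  pose k (w : S * measurableTypeR R) := mg (F w.1) w.2 * \1_(`]-oo, y]%classic) w.2.
  have mk : measf k.
    apply: measurable_funM => //.
    by apply: measurableT_comp; [exact: measurable_indic|exact: measurable_snd].
  exact: (meas_Ex (@lebesgue_measure R) mk).
have mtot : measf (fun s => Ex (@lebesgue_measure R) (mg (F s))).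
  exact: (meas_Ex (@lebesgue_measure R) mmg).
have mcg : measf (cdf (@gd1 R)).
  apply: continuous_measurable_fun.
  exact: is_derive_continuous (fun y => cdf_derive y pos1_gd1).
have mT : measf (fun z : S * 'rV[R]_n.+1 =>
    Tm (mg (F z.1)) (hd z.2) : measurableTypeR R).
  apply: (measurability _ (RGenOInfty.measurableE R)).
  move=> _ [_ [a ->] <-]; rewrite setTI.
  (* [Tm] is a chosen value; its superlevel sets are described by comparing the two distribution
     functions, here multiplied out by the total mass. *)
  have -> : (fun z : S * 'rV[R]_n.+1 => Tm (mg (F z.1)) (hd z.2)) @^-1` `]a, +oo[ =
     (fun z : S * 'rV[R]_n.+1 => cdf gd1 (hd z.2) * Ex (@lebesgue_measure R) (mg (F z.1)) -
        Ex (@lebesgue_measure R) (fun t => mg (F z.1) t * \1_(`]-oo, a]%classic) t))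
        @^-1` `]0, +oo[.
    apply/seteqP; split => z /=; have pz := gdom_mg (gF z.1);
      by rewrite !in_itv/= !andbT subr_gt0 -ltr_pdivrMr ?pos1_Ex_gt0// !ltNge Tm_le.
  rewrite -[X in measurable X]setTI; apply: measurable_funB => //.
    apply: measurable_funM; last exact: (measurableT_comp mtot measurable_fst).
    apply: (measurableT_comp mcg); apply: measurable_hd; exact: measurable_snd.
  exact: (measurableT_comp (mlow a) measurable_fst).
apply: measurable_cons => //.
pose F' (w : S * measurableTypeR R) (y : 'rV[R]_n) := F w.1 (rV_cons (w.2, y)).
have mF' : measf (fun w : (S * measurableTypeR R) * 'rV[R]_n => F' w.1 w.2).
  apply: (measurableT_comp mF (g := fun w : (S * measurableTypeR R) * 'rV[R]_n =>
    (w.1.1, rV_cons (w.1.2, w.2)))).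
  apply: measurable_fun_pair; first exact: (measurableT_comp measurable_fst measurable_fst).
  apply: measurable_cons; last exact: measurable_snd.
  exact: (measurableT_comp measurable_snd measurable_fst).
have mK := IH _ _ F' mF' (fun w => gdom_sec w.2 (gF w.1)).
apply: (measurableT_comp mK (g := fun z : S * 'rV[R]_n.+1 =>
  ((z.1, Tm (mg (F z.1)) (hd z.2)), tl z.2))).
apply: measurable_fun_pair; first exact: measurable_fun_pair.
by apply: measurable_tl; exact: measurable_snd.
Qed.

Lemma measurable_KN n (F : 'rV[R]_n -> R) : gdom F -> measf (KN F).
Proof.
move=> gF.
have := @measurable_KN_param n _ unit (fun=> F) (measurableT_comp (gdom_meas gF) measurable_snd) (fun=> gF).
move=> mK; apply: (measurableT_comp mK (g := fun x => (tt, x))).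
by apply: measurable_fun_pair => //; exact: measurable_cst.
Qed.

Lemma measurable_KN_sec n (F : 'rV[R]_n.+1 -> R) : gdom F ->
  measf (fun z : measurableTypeR R * 'rV[R]_n => KN (sec F z.1) z.2).
Proof.
move=> gF; apply: (measurable_KN_param (F := fun a : measurableTypeR R => sec F a)) => [|a].
  exact: measurableT_comp (gdom_meas gF) measurable_rV_cons.
exact: gdom_sec.
Qed.

(** Fubini peels off the first coordinate: [Tm_push] handles the marginal and the induction
    hypothesis each section. The mass appears because [F] is not normalized. *)
Lemma KN_push n (F : 'rV[R]_n -> R) (h : 'rV[R]_n -> \bar R) : gdom F ->
  measf h -> (forall x, 0 <= h x)%E ->
  (\int[lebesgue_rV R n]_x (h x * (F x)%:E) =
   (Ex (lebesgue_rV R n) F)%:E * \int[gam n]_x h (KN F x))%E.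
Proof.
elim: n F h => [|n IH] F h gF mh h0.
  have mF := gdom_meas gF; have [_ F0 _] := gF.
  have mF' : measf (fun x => (F x)%:E) by exact/measurable_EFinP.
  rewrite gam_integral// !lebesgue0; last 2 first.
  - by apply: emeasurable_funM => //; apply/measurable_EFinP; exact: measurable_gd.
  - exact: emeasurable_funM.
  rewrite /Ex /Rintegral lebesgue0//= /gd expr0 mul1r dot0l mul0r oppr0 expR0 mule1.
  by rewrite muleC.
have mF := gdom_meas gF; have [_ F0 _] := gF.
have mhF : measf (fun x => h x * (F x)%:E)%E.
  by apply: emeasurable_funM => //; exact/measurable_EFinP.
have hF0 x : (0 <= h x * (F x)%:E)%E by rewrite mule_ge0// lee_fin ltW.
rewrite (lebesgue_cons mhF hF0) Ex_cons//.
pose k (z : measurableTypeR R * 'rV[R]_n) := h (rV_cons (z.1, KN (sec F z.1) z.2)).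
have mk : measf k.
  apply: (measurableT_comp mh); apply: measurable_cons; first exact: measurable_fst.
  exact: measurable_KN_sec.
have mkI := meas_inner (gam n) mk (fun z => h0 _).
have := @Tm_push R (mg F) _ (gdom_mg gF) mkI (fun a => integral_ge0 _ (fun z _ => h0 _)).
have -> : (\int[gam n.+1]_x h (KN F x) =
    \int[gam1]_x \int[gam n]_y k (Tm (mg F) x, y))%E.
  have mhK : measf (fun x => h (KN F x)).
    exact: measurableT_comp mh (measurable_KN gF).
  rewrite (law_ge0_integral (gam_cons_law n) mhK (fun x => h0 _)).
  apply: etrans; first exact: (tonelli1 gam1 (gam n) (measurableT_comp mhK measurable_rV_cons) (fun z => h0 _)).
  by apply: eq_integral => x _; apply: eq_integral => y _; rewrite /= hd_cons tl_cons.
move=> <-; apply: eq_integral => a _.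
have mha : measf (fun y : 'rV[R]_n => h (rV_cons (a, y))).
  by apply: measurableT_comp => //; apply: measurable_cons => //; exact: measurable_cst.
by rewrite muleC -(IH (sec F a) _ (gdom_sec a gF) mha (fun y => h0 _)).
Qed.

End gaussian_domination.

(** * Prekopa-Leindler with a transport remainder; Lipschitz and rotation bounds for the Knothe
    map *)

Section knothe.
Context {R : realType}.
Implicit Types n : nat.

Definition had n (c x : 'rV[R]_n) : 'rV[R]_n := \row_i (c 0 i * x 0 i).

(** The quadratic corrections of [transport_step], summed over the coordinates. Being antisymmetric
    in [g] and [h], it averages to zero over two independent Gaussian vectors. *)
Definition qd n (s g h : 'rV[R]_n) : R :=
  \sum_i s 0 i ^+ 2 * (g 0 i ^+ 2 - h 0 i ^+ 2) / 2.

Lemma hd_had n (c x : 'rV[R]_n.+1) : hd (had c x) = hd c * hd x.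
Proof. by rewrite /hd mxE. Qed.

Lemma tl_had n (c x : 'rV[R]_n.+1) : tl (had c x) = had (tl c) (tl x).
Proof. by apply/rowP => j; rewrite !mxE. Qed.

Lemma hdD n (x y : 'rV[R]_n.+1) : hd (x + y) = hd x + hd y.
Proof. by rewrite /hd mxE. Qed.

Lemma tlD n (x y : 'rV[R]_n.+1) : tl (x + y) = tl x + tl y.
Proof. by apply/rowP => j; rewrite !mxE. Qed.

Lemma hdN n (x : 'rV[R]_n.+1) : hd (- x) = - hd x.
Proof. by rewrite /hd mxE. Qed.

Lemma tlN n (x : 'rV[R]_n.+1) : tl (- x) = - tl x.
Proof. by apply/rowP => j; rewrite !mxE. Qed.

Lemma qd_cons n (s g h : 'rV[R]_n.+1) :
  qd s g h = hd s ^+ 2 * (hd g ^+ 2 - hd h ^+ 2) / 2 + qd (tl s) (tl g) (tl h).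
Proof. by rewrite /qd big_ord_recl; congr (_ + _); apply: eq_bigr => i _; rewrite !mxE. Qed.

Lemma measurable_had n d (T : measurableType d) (c : 'rV[R]_n) (f : T -> 'rV[R]_n) :
  measf f -> measf (fun t => had c (f t)).
Proof.
move=> /measurable_rVP mf; apply/measurable_rVP => i.
rewrite (_ : (fun _ => _) = fun t => c 0 i * f t 0 i); last by apply/funext => t; rewrite mxE.
by apply: measurable_funM; [exact: measurable_cst|exact: mf].
Qed.

Lemma gam_dot_intg n : intg (@gam R n) (fun x => dot x x).
Proof.
have md k : measf (fun x : 'rV[R]_k => dot x x) by exact: measurable_dot.
elim: n => [|n IH].
  apply: (@intg_bdd _ _ _ _ _ 0); first exact: md.
  by move=> x; rewrite /dot big_ord0 normr0.
apply/(law_intg (gam_cons_law n) (md _)).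
have := intgD (intg_fst (gam n) gam1_sqr_intg) (intg_snd gam1 IH).
by congr intg; apply/funext => -[a y]; rewrite /= dot_cons expr2.
Qed.

Lemma measurable_coord_gam n i : measf (fun x : 'rV[R]_n => x 0 i : R).
Proof. exact: measurable_coord. Qed.

Lemma gam_coord_sqr_intg n i : intg (@gam R n) (fun x => x 0 i ^+ 2).
Proof.
apply: intg_le (gam_dot_intg n).
  by apply: measurable_funX; exact: measurable_coord_gam.
by move=> x; rewrite ger0_norm ?sqr_ge0// coord_sqr_le.
Qed.

Lemma qd_intg n (s h : 'rV[R]_n) : intg (gam n) (fun g => qd s g h).
Proof.
apply: intg_sum => i _.
have := @intgZ _ _ _ (gam n) (s 0 i ^+ 2 / 2) _
  (intgB (gam_coord_sqr_intg i) (intg_cst (gam n) (h 0 i ^+ 2))).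
by congr intg; apply/funext => g; rewrite mulrAC.
Qed.

(** Induction on the dimension. For fixed first coordinates the induction hypothesis, applied to
    sections, bounds the integral of a section of [H] from below, and this bound is the hypothesis
    of [transport_step] for the marginals. The cost [c] retains how far apart the two transported
    points are, a gain over Prekopa-Leindler; its boundedness makes all averages finite. Each
    coordinate has its own angle, so that later a single block can be rotated. *)
Theorem knothe_ineq n (F G : 'rV[R]_n -> R) (H : 'rV[R]_n -> \bar R)
    (c : 'rV[R]_n -> 'rV[R]_n -> R) (C : R) (cs sn g' : 'rV[R]_n) :
  gdom F -> gdom G -> measf H -> (forall x, 0 <= H x)%E ->
  measf (fun z : 'rV[R]_n * 'rV[R]_n => c z.1 z.2) ->
  (forall x y, `|c x y| <= C) ->
  (forall i, 0 < cs 0 i) -> (forall i, cs 0 i ^+ 2 + sn 0 i ^+ 2 = 1) ->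
  (forall x y, (Num.sqrt (F x * G y) * expR (c x y))%:E <= H (2^-1 *: (x + y))%R)%E ->
  (((\prod_i cs 0 i) * Num.sqrt (Ex (lebesgue_rV R n) F * Ex (lebesgue_rV R n) G) *
    expR (Ex (gam n) (fun g =>
      c (KN F (had cs g + had sn g')) (KN G (had cs g - had sn g')) + qd sn g g')))%:E
   <= \int[lebesgue_rV R n]_x H x)%E.
Proof.
elim: n F G H c cs sn g' => [|n IH] F G H c cs sn g' gF gG mH H0 mc cC cs0 cs1 HH.
  have E0 (f : 'rV[R]_0 -> R) : measf f -> Ex (lebesgue_rV R 0) f = f 0.
    by move=> mf; rewrite /Ex /Rintegral lebesgue0//; exact/measurable_EFinP.
  rewrite lebesgue0// !E0; [|exact: gdom_meas|exact: gdom_meas].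
  have e0 (x : 'rV[R]_0) : x = 0 by apply/rowP => -[].
  rewrite big_ord0 mul1r.
  have -> : Ex (gam 0) (fun g => c (KN F (had cs g + had sn g'))
     (KN G (had cs g - had sn g')) + qd sn g g') = c 0 0.
    rewrite -[RHS](Ex_cst (gam 0)); congr Ex; apply/funext => g.
    by rewrite /qd big_ord0 addr0; congr c; exact: e0.
  by have := HH 0 0; rewrite addr0 scaler0.
have [mF mG] := (gdom_meas gF, gdom_meas gG).
have [cs'0 cs'1] : (forall i, 0 < tl cs 0 i) /\ (forall i, tl cs 0 i ^+ 2 + tl sn 0 i ^+ 2 = 1).
  by split=> i; rewrite !mxE.
pose P := \prod_i tl cs 0 i.
have P0 : 0 < P by apply: prodr_gt0 => i _; exact: cs'0.
pose phi (z : (measurableTypeR R * measurableTypeR R) * 'rV[R]_n) : R :=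
  c (rV_cons (z.1.1, KN (sec F z.1.1) (had (tl cs) z.2 + had (tl sn) (tl g'))))
    (rV_cons (z.1.2, KN (sec G z.1.2) (had (tl cs) z.2 - had (tl sn) (tl g')))).
have mphi : measf phi.
  have m1 : measf (fun z : (measurableTypeR R * measurableTypeR R) * 'rV[R]_n => z.1.1).
    exact: (measurableT_comp measurable_fst measurable_fst).
  have m2 : measf (fun z : (measurableTypeR R * measurableTypeR R) * 'rV[R]_n => z.1.2).
    exact: (measurableT_comp measurable_snd measurable_fst).
  have mh : measurable_fun setT
      (fun z : (measurableTypeR R * measurableTypeR R) * 'rV[R]_n => had (tl cs) z.2).
    by apply: measurable_had; exact: measurable_snd.
  have ma := measurable_rVD mh (@measurable_cst _ _ _ _ setT (had (tl sn) (tl g'))).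
  have mb := measurable_rVB mh (@measurable_cst _ _ _ _ setT (had (tl sn) (tl g'))).
  apply: (measurable_comp2 mc); apply: measurable_cons => //.
    exact: measurableT_comp (measurable_KN_sec gF) (measurable_fun_pair m1 ma).
  exact: measurableT_comp (measurable_KN_sec gG) (measurable_fun_pair m2 mb).
have mphi2 t1 t2 : measf (fun g => phi ((t1, t2), g)).
  by apply: measurableT_comp => //; exact: measurable_fun_pair.
have Iphi t1 t2 : intg (gam n) (fun g => phi ((t1, t2), g)).
  by apply: (@intg_bdd _ _ _ _ _ C) => // g; exact: cC.
have IQ := qd_intg (tl sn) (tl g').
(* The cost seen by the first coordinate is the averaged cost of the others; their product of
   cosines is moved into the exponent by [K]. *)
pose K := ln P + Ex (gam n) (fun g => qd (tl sn) g (tl g')).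
pose c1 t1 t2 : R := Ex (gam n) (fun g => phi ((t1, t2), g)) + K.
have mc1 : measf (fun z : R * R => c1 z.1 z.2).
  apply: measurable_funD; last exact: measurable_cst.
  have := meas_Ex (gam n) mphi.
  by congr measurable_fun; apply/funext => -[].
have c1C t1 t2 : `|c1 t1 t2| <= C + `|K|.
  apply: (le_trans (ler_normD _ _)); rewrite lerD2r.
  apply: (le_trans (Ex_abs (Iphi t1 t2))); rewrite -[leRHS](Ex_cst (gam n)).
  by apply: Ex_le => [||g]; [exact: intg_abs|exact: intg_cst|exact: cC].
have mHc : measf (H \o rV_cons).
  exact: measurableT_comp mH measurable_rV_cons.
pose h (a : measurableTypeR R) := (\int[lebesgue_rV R n]_y H (rV_cons (a, y)))%E.
have mh : measf h := meas_inner (lebesgue_rV R n) mHc (fun z => H0 _).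
have h0 a : (0 <= h a)%E by apply: integral_ge0.
have step t1 t2 : ((Num.sqrt (mg F t1 * mg G t2) * expR (c1 t1 t2))%:E <= h (2^-1 * (t1 + t2))%R)%E.
  have -> : expR (c1 t1 t2) = P * expR (Ex (gam n) (fun g => phi ((t1, t2), g) +
      qd (tl sn) g (tl g'))).
    by rewrite ExD// /c1 /K addrCA [LHS]expRD lnK ?posrE.
  rewrite mulrCA mulrA.
  apply: (IH (sec F t1) (sec G t2) (fun y => H (rV_cons ((2^-1 * (t1 + t2))%R, y)))
     (fun x y => c (rV_cons (t1, x)) (rV_cons (t2, y)))) => //.
  - exact: gdom_sec.
  - exact: gdom_sec.
  - by apply: measurableT_comp => //; apply: measurable_cons => //; exact: measurable_cst.
  - apply: (measurable_comp2 mc); apply: measurable_cons; first exact: measurable_cst.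
    + exact: measurable_fst.
    + exact: measurable_cst.
    + exact: measurable_snd.
  - by move=> x y; have := HH (rV_cons (t1, x)) (rV_cons (t2, y)); rewrite -rV_consD -rV_consZ.
have TS := transport_step (hd g') (gdom_mg gF) (gdom_mg gG) mh h0 mc1 c1C (cs0 ord0) (cs1 ord0) step.
rewrite (lebesgue_cons mH H0) !Ex_cons//.
apply: le_trans TS; rewrite lee_fin.
rewrite big_ord_recl (_ : \prod_(i < n) _ = P); last by apply: eq_bigr => i _; rewrite mxE.
rewrite -!mulrA ler_pM2l// mulrCA ler_wpM2l ?sqrtr_ge0//.
rewrite -[P]lnK ?posrE// -expRD ler_expR le_eqVlt; apply/orP; left; apply/eqP.
set Psi := (X in _ + Ex _ X = _).
pose t1 (a : R) := Tm (mg F) (cs 0 ord0 * a + sn 0 ord0 * hd g').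
pose t2 (a : R) := Tm (mg G) (cs 0 ord0 * a - sn 0 ord0 * hd g').
pose q (a : R) := sn 0 ord0 ^+ 2 * (a ^+ 2 - hd g' ^+ 2) / 2.
have PsiE a g : Psi (rV_cons (a, g)) = phi ((t1 a, t2 a), g) + (q a + qd (tl sn) g (tl g')).
  rewrite /Psi qd_cons hd_cons tl_cons; congr (_ + _).
  by rewrite /= !hdD !tlD !hdN !tlN !hd_had !tl_had !hd_cons !tl_cons.
have mPsi : measf Psi.
  apply: measurable_funD; last exact: intg_meas (qd_intg sn g').
  apply: (measurable_comp2 mc).
    apply: (measurableT_comp (measurable_KN gF)); apply: measurable_rVD; last exact: measurable_cst.
    exact: measurable_had.
  apply: (measurableT_comp (measurable_KN gG)); apply: measurable_rVB; last exact: measurable_cst.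
  exact: measurable_had.
have Iq : intg gam1 q.
  have := @intgZ _ _ _ gam1 (sn 0 ord0 ^+ 2 / 2) _
    (intgB (@gam1_sqr_intg R) (intg_cst gam1 (hd g' ^+ 2))).
  by congr intg; apply/funext => g; rewrite /q mulrAC.
have IPsi : intg (pp gam1 (gam n)) (Psi \o rV_cons).
  have mPc : measf (Psi \o rV_cons) by exact: measurableT_comp mPsi measurable_rV_cons.
  have I2 := intgD (intg_fst (gam n) Iq) (intg_snd gam1 IQ).
  have := intgD (intgB (@intg_bdd _ _ _ (pp gam1 (gam n)) (fun z =>
    Psi (rV_cons z) - (q z.1 + qd (tl sn) z.2 (tl g'))) C _ _) (intg0 _)) I2.
  have E : (fun x : measurableTypeR R * 'rV[R]_n => Psi (rV_cons x) - (q x.1 + qd (tl sn) x.2 (tl g')) - 0 +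
      (q x.1 + qd (tl sn) x.2 (tl g'))) = Psi \o rV_cons.
    by apply/funext => z /=; rewrite subr0 subrK.
  rewrite E; apply; first exact: measurable_funB mPc (intg_meas I2).
  by move=> [a g]; rewrite PsiE addrK; exact: cC.
have Isec a : intg (gam n) (fun g => Psi (rV_cons (a, g))).
  have := intgD (Iphi (t1 a) (t2 a)) (intgD (intg_cst (gam n) (q a)) IQ).
  by congr intg; apply/funext => g; rewrite PsiE.
have [I1 E1] := Ex_fub IPsi Isec.
rewrite (law_Ex (gam_cons_law n) mPsi) [X in _ + X]E1.
rewrite -[ln P](Ex_cst gam1) -ExD//; last exact: intg_cst.
congr Ex; apply/funext => a.
rewrite -/(t1 a) -/(t2 a) -/(q a) /c1 /K.
rewrite (_ : Ex (gam n) (fun g => Psi _) = Ex (gam n) (fun g => phi ((t1 a, t2 a), g) +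
  (q a + qd (tl sn) g (tl g')))); last by congr Ex; apply/funext => g; rewrite PsiE.
rewrite ExD//; last by apply: intgD => //; exact: intg_cst.
rewrite ExD//; last exact: intg_cst.
by rewrite Ex_cst; ring.
Qed.

(** The case of zero angles and constant cost. *)
Lemma prekopa_leindler n (F G : 'rV[R]_n -> R) (H : 'rV[R]_n -> \bar R) (c : R) :
  gdom F -> gdom G -> measf H -> (forall x, 0 <= H x)%E ->
  (forall x y, (Num.sqrt (F x * G y) * expR c)%:E <= H (2^-1 *: (x + y))%R)%E ->
  ((Num.sqrt (Ex (lebesgue_rV R n) F * Ex (lebesgue_rV R n) G) * expR c)%:E
   <= \int[lebesgue_rV R n]_x H x)%E.
Proof.
move=> gF gG mH H0 HH.
have := @knothe_ineq n F G H (fun _ _ => c) `|c| (const_mx 1) 0 0 gF gG mH H0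
  (measurable_cst _) (fun _ _ => lexx _).
have -> : \prod_i (const_mx 1 : 'rV[R]_n) 0 i = 1 by apply: big1 => i _; rewrite mxE.
have -> : (fun g : 'rV[R]_n => c + qd 0 g 0) = fun=> c.
  by apply/funext => g; rewrite /qd big1 ?addr0// => i _; rewrite mxE expr0n !mul0r.
rewrite Ex_cst mul1r; apply => // i; rewrite !mxE//.
by rewrite expr1n expr0n addr0.
Qed.

(** Midpoint form of the Hessian of [- ln F] being at least [k], free of derivatives; 1/8 is the
    midpoint deficit of the model [k * dot x x / 2]. *)
Definition slc n (k : R) (F : 'rV[R]_n -> R) : Prop := forall x y,
  Num.sqrt (F x * F y) * expR (k * dot (x - y) (x - y) / 8) <= F (2^-1 *: (x + y)).

Lemma slc_sec n k (F : 'rV[R]_n.+1 -> R) a : slc k F -> slc k (sec F a).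
Proof.
move=> sF x y; have := sF (rV_cons (a, x)) (rV_cons (a, y)).
have -> : rV_cons (a, x) - rV_cons (a, y) = rV_cons (0, x - y).
  by rewrite -[- _]scaleN1r -rV_consZ -rV_consD mulN1r subrr scaleN1r.
rewrite dot_cons mulr0 add0r -rV_consD -rV_consZ /sec.
by have -> : 2^-1 * (a + a) = a by lra.
Qed.

(** Prekopa-Leindler for the two sections: the separation of the first coordinates contributes a
    constant gain, which is kept, and the separation of the others is dropped. *)
Lemma slc_mg n k (F : 'rV[R]_n.+1 -> R) a b : 0 <= k -> gdom F -> slc k F ->
  Num.sqrt (mg F a * mg F b) * expR (k * (a - b) ^+ 2 / 8) <= mg F (2^-1 * (a + b)).
Proof.
move=> kge gF sF.
rewrite -lee_fin /mg -ExE; last exact: gdom_intg (gdom_sec _ gF).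
apply: prekopa_leindler; [exact: gdom_sec|exact: gdom_sec| | |].
- apply/measurable_EFinP; exact: gdom_meas (gdom_sec _ gF).
- by move=> y; rewrite lee_fin ltW//; have [_ F0 _] := gF; exact: F0.
move=> x y; rewrite lee_fin.
have := sF (rV_cons (a, x)) (rV_cons (b, y)).
have -> : rV_cons (a, x) - rV_cons (b, y) = rV_cons (a - b, x - y).
  by rewrite -[- rV_cons _]scaleN1r -rV_consZ -rV_consD mulN1r scaleN1r.
rewrite dot_cons -rV_consD -rV_consZ; apply: le_trans.
rewrite ler_wpM2l ?sqrtr_ge0// ler_expR ler_pM2r ?invr_gt0// ler_wpM2l//.
by rewrite -expr2 lerDl dot_ge0.
Qed.

(* Log-concavity of [f / gd1], suitably shifted: its superlevel set above the
   mass [I] cannot lie on one side of [x], since the cumulative masses agree. *)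
Lemma Tm_contraction (f : R -> R) (x : R) : pos1 f ->
  (forall a b, Num.sqrt (f a * f b) * expR ((a - b) ^+ 2 / 8) <= f (2^-1 * (a + b))) ->
  Ex (@lebesgue_measure R) f * gd1 x <= f (Tm f x).
Proof.
move=> pf sf; have [cf f0 _] := pf; have I0 := pos1_Ex_gt0 pf.
set I := Ex (@lebesgue_measure R) f in I0 *; rewrite leNgt; apply/negP => lt.
pose s := Tm f x - x; pose r t := f (t + s) / gd1 t.
have r0 t : 0 < r t by rewrite divr_gt0 ?gd1_gt0.
have rx : r x < I by rewrite /r /s addrC subrK ltr_pdivrMr ?gd1_gt0.
have mid a b : r a * r b <= r (2^-1 * (a + b)) ^+ 2.
  have := sf (a + s) (b + s).
  have -> : a + s - (b + s) = a - b by ring.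
  have -> : 2^-1 * (a + s + (b + s)) = 2^-1 * (a + b) + s by field.
  set m := 2^-1 * (a + b); set e := expR _ => h.
  have h2 : f (a + s) * f (b + s) * e ^+ 2 <= f (m + s) ^+ 2.
    rewrite -[X in X * _](@sqr_sqrtr _ (f (a + s) * f (b + s))) ?mulr_ge0 ?(ltW (f0 _))//.
    by rewrite -exprMn ler_pXn2r// nnegrE ?mulr_ge0 ?sqrtr_ge0 ?expR_ge0 ?(ltW (f0 _)).
  have g2 : gd1 m ^+ 2 = gd1 a * gd1 b * e ^+ 2.
    have E (p u v w t : R) : u * 2 = v + w + t * 2 ->
        (p * expR u) ^+ 2 = p * expR v * (p * expR w) * expR t ^+ 2.
      move=> h'; rewrite exprMn -!expRM_natl !mulrA [p * _ * p]mulrAC -!mulrA -!expRD.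
      by congr (_ * (_ * expR _)); lra.
    by apply: E; rewrite /m; field.
  rewrite /r exprMn exprVn g2 mulrACA -invfM invfM mulrA ler_pdivlMr; last first.
    by apply: mulr_gt0; [rewrite mulr_gt0 ?gd1_gt0|rewrite exprn_gt0 ?expR_gt0].
  apply: le_trans h2; rewrite le_eqVlt; apply/orP; left; apply/eqP; field.
  by rewrite !gt_eqF ?gd1_gt0.
have cr : continuous r.
  move=> t; apply: cvgM.
    apply: (@continuous_comp _ _ _ (fun t => t + s) f); last exact: cf.
    by apply: cvgD; [exact: cvg_id|exact: cvg_cst].
  by apply: cvgV; [rewrite gt_eqF ?gd1_gt0|exact: gd1_cont].
(* If [I <= r] at points on both sides of [x], a minimizer [z] of [r] between them is interior with
   [r z < I]. A step [dl], the distance from [z] to the nearer end, reaches an end, where [r]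
   exceeds [r z], and this contradicts [mid]. *)
have side : (forall t, t < x -> r t < I) \/ (forall t, x < t -> r t < I).
  apply: contrapT => /not_orP[/existsNP[p /not_implyP[px /negP]]].
  rewrite -leNgt => Ip /existsNP[q /not_implyP[xq /negP]]; rewrite -leNgt => Iq.
  have pq := ltW (lt_trans px xq).
  have [z + zmin] := EVT_min pq (continuous_subspaceT cr).
  rewrite in_itv/= => /andP[pz zq].
  have rzI : r z < I.
    by apply: le_lt_trans rx; apply: zmin; rewrite in_itv/= !ltW.
  have {}pz : p < z.
    by rewrite lt_neqAle pz andbT; apply/eqP => E; move: rzI; rewrite -E ltNge Ip.
  have {}zq : z < q.
    by rewrite lt_neqAle zq andbT; apply/eqP => E; move: rzI; rewrite E ltNge Iq.
  pose dl := Num.min (z - p) (q - z).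
  have [d1 d2] : dl <= z - p /\ dl <= q - z by rewrite !ge_min !lexx orbT.
  have d0 : 0 < dl by rewrite lt_min !subr_gt0 pz zq.
  have m1 : r z <= r (z - dl) by apply: zmin; rewrite in_itv/=; apply/andP; split; lra.
  have m2 : r z <= r (z + dl) by apply: zmin; rewrite in_itv/=; apply/andP; split; lra.
  have := mid (z - dl) (z + dl).
  have -> : 2^-1 * (z - dl + (z + dl)) = z by field.
  have z0 := r0 z; suff : r z < r (z - dl) \/ r z < r (z + dl).
    by rewrite expr2 leNgt => -[h|h]; apply/negP; rewrite negbK; nra.
  have [E|E] : dl = z - p \/ dl = q - z by rewrite /dl /Num.min; case: ifP; [left|right].
    by left; rewrite (_ : z - dl = p) ?(lt_le_trans rzI)//; lra.
  by right; rewrite (_ : z + dl = q) ?(lt_le_trans rzI)//; lra.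
(* [phi] vanishes at [x] and is strictly increasing on the side where [r < I]; hence on that side
   [cdf f] stays away from 0, or from 1, which contradicts [cdf_surj]. *)
pose phi w := cdf gd1 w - cdf f (w + s).
have dphi (w : R) : is_derive w 1 phi (gd1 w - f (w + s) / I).
  have d1 := cdf_derive w (@pos1_gd1 R); rewrite Ex_gd1 divr1 in d1.
  have d2 : is_derive w 1 (fun w => w + s) 1.
    by apply: (is_derive_eq (is_deriveD (is_derive_id w 1) (is_derive_cst s w 1))); rewrite addr0.
  have d3 := @is_derive1_comp _ (cdf f) (fun w => w + s) w _ 1 (cdf_derive (w + s) pf) d2; rewrite mulr1 in d3.
  exact: is_deriveB d1 d3.
have dpos w : r w < I -> 0 < gd1 w - f (w + s) / I.
  by rewrite subr_gt0 /r !ltr_pdivrMr ?gd1_gt0// mulrC.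
have phix : phi x = 0.
  by rewrite /phi (_ : x + s = Tm f x) ?cdf_Tm ?subrr// /s; ring.
have cphi := is_derive_continuous dphi.
have mono u v : u < v -> (forall w, u < w < v -> r w < I) -> phi u < phi v.
  move=> uv H; have [w] := MVT uv (fun w _ => dphi w) (continuous_subspaceT cphi).
  rewrite in_itv/= => wI E; rewrite -subr_gt0 E.
  by apply: mulr_gt0; [exact/dpos/H|rewrite subr_gt0].
case: side => side.
  have x1 : x - 1 < x by rewrite ltrBlDr ltrDl.
  have c0 : phi (x - 1) < 0 by rewrite -phix; apply: mono => // w /andP[_]; exact: side.
  have bd w : w <= x - 1 -> - phi (x - 1) <= cdf f (w + s).
    move=> wx; have : phi w <= phi (x - 1).
      move: wx; rewrite le_eqVlt => /orP[/eqP->//|wx]; apply/ltW/mono => // v /andP[_ vx].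
      by apply: side; lra.
    by have := cdf_gt0 w (@pos1_gd1 R); rewrite {1}/phi; lra.
  have b1 := bd _ (lexx _); have l1 := cdf_lt1 (x - 1 + s) pf.
  have [y' yE] : exists y', cdf f y' = - phi (x - 1) / 2 by apply: cdf_surj => //; lra.
  pose w := Num.min (y' - s) (x - 1).
  have [w1 w2] : w <= y' - s /\ w <= x - 1 by rewrite !ge_min !lexx orbT.
  have : cdf f (w + s) <= cdf f y' by rewrite cdf_le//; lra.
  by have := bd _ w2; rewrite yE; lra.
have x1 : x < x + 1 by rewrite ltrDl.
have c0 : 0 < phi (x + 1) by rewrite -phix; apply: mono => // w /andP[+ _]; exact: side.
have bd w : x + 1 <= w -> cdf f (w + s) <= 1 - phi (x + 1).
  move=> wx; have : phi (x + 1) <= phi w.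
    move: wx; rewrite le_eqVlt => /orP[/eqP->//|wx]; apply/ltW/mono => // v /andP[xv _].
    by apply: side; lra.
  by have := cdf_lt1 w (@pos1_gd1 R); rewrite {2}/phi; lra.
have b1 := bd _ (lexx _); have l1 := cdf_gt0 (x + 1 + s) pf.
have [y' yE] : exists y', cdf f y' = 1 - phi (x + 1) / 2 by apply: cdf_surj => //; lra.
pose w := Num.max (y' - s) (x + 1).
have [w1 w2] : y' - s <= w /\ x + 1 <= w by rewrite !le_max !lexx orbT.
have : cdf f y' <= cdf f (w + s) by rewrite cdf_le//; lra.
by have := bd _ w2; rewrite yE; lra.
Qed.

(** By [Tm_contraction] the slope found in [Tm_derive] is at most one. *)
Lemma Tm_lipschitz (f : R -> R) (x y : R) : pos1 f ->
  (forall a b, Num.sqrt (f a * f b) * expR ((a - b) ^+ 2 / 8) <= f (2^-1 * (a + b))) ->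
  y <= x -> 0 <= Tm f x - Tm f y <= x - y.
Proof.
move=> pf sf; rewrite le_eqVlt => /orP[/eqP ->|yx]; first by rewrite !subrr lexx.
rewrite subr_ge0 ltW ?Tm_mono//=.
have [z _ ->] := MVT yx (fun z _ => Tm_derive z pf) (continuous_subspaceT (Tm_cont pf)).
rewrite ger_pMl ?subr_gt0// ler_pdivrMr ?mul1r; last by case: pf.
exact: Tm_contraction.
Qed.

Lemma KN_dep n (F : 'rV[R]_n -> R) (x y : 'rV[R]_n) (i : 'I_n) :
  (forall j : 'I_n, (j <= i)%N -> x 0 j = y 0 j) -> KN F x 0 i = KN F y 0 i.
Proof.
elim: n F x y i => [|n IH] F x y i; first by case: i.
move=> xy.
have h : hd x = hd y by exact: xy.
rewrite /= h; case: (unliftP ord0 i) => [j ij|->]; last by rewrite !rV_cons0.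
rewrite ij !rV_consS; apply: IH => l lj; rewrite !mxE; apply: xy.
by rewrite ij.
Qed.

(** With the earlier coordinates frozen, output [i] is the monotone transport to a marginal of a
    section; sections and marginals inherit [slc 1], so [Tm_lipschitz] applies. *)
Lemma KN_lip n (F : 'rV[R]_n -> R) (x y : 'rV[R]_n) (i : 'I_n) : gdom F -> slc 1 F ->
  (forall j : 'I_n, (j < i)%N -> x 0 j = y 0 j) -> y 0 i <= x 0 i ->
  0 <= KN F x 0 i - KN F y 0 i <= x 0 i - y 0 i.
Proof.
elim: n F x y i => [|n IH] F x y i; first by case: i.
move=> gF sF xy yx.
case: (unliftP ord0 i) => [j ij|i0]; last first.
  rewrite i0 /= !rV_cons0; apply: Tm_lipschitz; [exact: gdom_mg| |by move: yx; rewrite i0].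
  by move=> a b; have := slc_mg a b ler01 gF sF; rewrite mul1r.
have h : hd x = hd y by apply: xy; rewrite ij.
rewrite ij /= !rV_consS h.
have := IH (sec F (Tm (mg F) (hd y))) (tl x) (tl y) j (gdom_sec _ gF) (slc_sec _ sF).
rewrite !mxE -ij; apply => // l lj; rewrite !mxE; apply: xy.
by rewrite ij.
Qed.

(** Monotone convergence along truncations; it turns estimates for bounded costs into one for the
    quadratic cost. *)
Lemma intg_of_min d (T : measurableType d) (P : probability T R) (f : T -> R) B :
  measf f -> (forall x, 0 <= f x) ->
  (forall k : nat, Ex P (fun x => Num.min (f x) k%:R) <= B) ->
  intg P f /\ Ex P f <= B.
Proof.
move=> mf f0 H.
have mm k : measf (fun x => Num.min (f x) k%:R).
  by apply: measurable_minr => //; exact: measurable_cst.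
have im (k : nat) : intg P (fun x => Num.min (f x) k%:R).
  apply: (@intg_bdd _ _ _ _ _ k%:R); first exact: mm.
  by move=> x; rewrite ger0_norm ?ge_min ?lexx ?orbT// le_min f0 ler0n.
have E : (\int[P]_x (f x)%:E <= B%:E)%E.
  have -> : (\int[P]_x (f x)%:E = \int[P]_x lim ((Num.min (f x) k%:R)%:E @[k --> \oo]))%E.
    apply: eq_integral => x _; apply/esym/cvg_lim => //.
    apply: cvg_near_cst; near=> k; congr EFin; apply/min_idPl.
    by near: k; exact: nbhs_infty_ger.
  rewrite monotone_convergence//.
  - apply: lime_le; first by apply: ereal_nondecreasing_is_cvgn => a b ab;
      apply: ge0_le_integral => //; [by move=> x _; rewrite lee_fin le_min f0 ler0n
      |exact/measurable_EFinP|exact/measurable_EFinP|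
      move=> x _; rewrite lee_fin le_min ge_min lexx/= ge_min ler_nat ab orbT//].
    by near=> k; rewrite ExE// lee_fin.
  - by move=> k; exact/measurable_EFinP.
  - by move=> k x _; rewrite lee_fin le_min f0 ler0n.
  - move=> x _ a b ab; rewrite lee_fin le_min ge_min lexx/= ge_min ler_nat ab orbT//.
have If : intg P f by apply: intg_fin => //; exact: le_lt_trans E (ltry _).
by split => //; rewrite -lee_fin -ExE.
Unshelve. all: by end_near. Qed.

(** [knothe_ineq] with all three functions equal to [F]: strong log-concavity admits the cost
    [dot (x - y) (x - y) / 8], and as both sides contain the same mass, the averaged cost is at most
    [- ln] of the product of cosines, up to [qd]. Averaging over [g'] removes [qd]. *)
Lemma KN_rotation n (F : 'rV[R]_n -> R) (cs sn : 'rV[R]_n) : gdom F -> slc 1 F ->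
  (forall i, 0 < cs 0 i) -> (forall i, cs 0 i ^+ 2 + sn 0 i ^+ 2 = 1) ->
  let D z := KN F (had cs z.1 + had sn z.2) - KN F (had cs z.1 - had sn z.2) in
  intg (pp (gam n) (gam n)) (fun z => dot (D z) (D z)) /\
  Ex (pp (gam n) (gam n)) (fun z => dot (D z) (D z)) <= - 8 * ln (\prod_i cs 0 i).
Proof.
move=> gF sF cs0 cs1 D.
have mF := gdom_meas gF; have IF := gdom_Ex_gt0 gF; have [_ F0 _] := gF.
have P0 : 0 < \prod_i cs 0 i by apply: prodr_gt0 => i _; exact: cs0.
set P := \prod_i _ in P0 *.
have mK := measurable_KN gF.
have mD : measf D.
  apply: measurable_rVB; apply: (measurableT_comp mK).
    by apply: measurable_rVD; apply: measurable_had.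
  by apply: measurable_rVB; apply: measurable_had.
apply: intg_of_min; [exact: measurable_dot|by move=> z; exact: dot_ge0|].
move=> k.
(* Truncated to be admissible for [knothe_ineq]; [intg_of_min] has reduced the claim to
   truncations. *)
pose c (x y : 'rV[R]_n) : R := Num.min (dot (x - y) (x - y)) k%:R / 8.
have c0 x y : 0 <= c x y by rewrite divr_ge0// le_min dot_ge0 ler0n.
have cC x y : `|c x y| <= k%:R.
  rewrite ger0_norm// /c ler_pdivrMr// (@le_trans _ _ k%:R)//.
    by rewrite ge_min lexx orbT.
  by rewrite ler_peMr// ler1n.
have mc : measf (fun z : 'rV[R]_n * 'rV[R]_n => c z.1 z.2).
  apply: measurable_funM; last exact: measurable_cst.
  apply: measurable_minr; last exact: measurable_cst.
  by apply: measurable_dot; apply: measurable_rVB.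
have main g' : Ex (gam n) (fun g => c (KN F (had cs g + had sn g')) (KN F (had cs g - had sn g'))
    + qd sn g g') <= - ln P.
  have := @knothe_ineq n F F (fun x => (F x)%:E) c k%:R cs sn g' gF gF.
  rewrite ExE; last exact: gdom_intg.
  move=> /(_ _ _ mc cC cs0 cs1 _).
  have -> : Num.sqrt (Ex (lebesgue_rV R n) F * Ex (lebesgue_rV R n) F) = Ex (lebesgue_rV R n) F.
    by rewrite -expr2 sqrtr_sqr gtr0_norm.
  move=> H; have {H} : P * Ex (lebesgue_rV R n) F * expR (Ex (gam n) (fun g =>
      c (KN F (had cs g + had sn g')) (KN F (had cs g - had sn g')) + qd sn g g'))
      <= Ex (lebesgue_rV R n) F.
    rewrite -lee_fin; apply: H.
    - exact/measurable_EFinP.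
    - by move=> x; rewrite lee_fin ltW.
    - move=> x y; rewrite lee_fin; apply: le_trans (sF x y).
      rewrite ler_wpM2l ?sqrtr_ge0// ler_expR mul1r /c ler_pM2r ?invr_gt0//.
      by rewrite ge_min lexx.
  rewrite mulrAC ger_pMl// -[X in X * _]lnK ?posrE// -expRD.
  by rewrite -expR0 ler_expR => h; rewrite -subr_le0 opprK addrC.
pose Phi (z : 'rV[R]_n * 'rV[R]_n) := c (KN F (had cs z.1 + had sn z.2)) (KN F (had cs z.1 - had sn z.2)).
have mPhi : measf Phi.
  apply: (measurable_comp2 mc); apply: (measurableT_comp mK).
    by apply: measurable_rVD; apply: measurable_had.
  by apply: measurable_rVB; apply: measurable_had.
have IPhi : intg (pp (gam n) (gam n)) Phi by apply: intg_bdd mPhi _ => z; exact: cC.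
have IPhi2 y : intg (gam n) (fun x => Phi (x, y)).
  apply: (@intg_bdd _ _ _ _ _ k%:R) => [|x]; last exact: cC.
  by apply: measurableT_comp => //; exact: measurable_fun_pair.
have [I2 E2] := Ex_fub2 IPhi IPhi2.
have Eq : Ex (gam n) (fun g' => Ex (gam n) (fun g => qd sn g g')) = 0.
  pose s i := sn 0 i ^+ 2 / 2.
  pose q (g : 'rV[R]_n) := \sum_i s i * g 0 i ^+ 2.
  have Iq : intg (gam n) q.
    by apply: intg_sum => i _; apply: intgZ; exact: gam_coord_sqr_intg.
  have qE g g' : qd sn g g' = q g - q g'.
    by rewrite /qd /q -sumrB; apply: eq_bigr => i _; rewrite /s; ring.
  have -> : (fun g' => Ex (gam n) (fun g => qd sn g g')) = (fun g' => Ex (gam n) q - q g').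
    apply/funext => g'; rewrite -[X in _ - X](Ex_cst (gam n)) -ExB//; last exact: intg_cst.
    by congr Ex; apply/funext => g; rewrite qE.
  by rewrite ExB//; [rewrite Ex_cst subrr|exact: intg_cst].
have Iqq : intg (gam n) (fun g' => Ex (gam n) (fun g => qd sn g g')).
  have -> : (fun g' => Ex (gam n) (fun g => qd sn g g')) = (fun g' => Ex (gam n)
     (fun g => qd sn g 0) - qd sn g' 0).
    apply/funext => g'; rewrite -[X in _ - X](Ex_cst (gam n)) -ExB//; last exact: intg_cst.
      congr Ex; apply/funext => g; rewrite /qd -sumrB; apply: eq_bigr => i _.
      by rewrite mxE; ring.
    exact: qd_intg.
  by apply: intgB; [exact: intg_cst|exact: qd_intg].
have E3 : Ex (gam n) (fun y => Ex (gam n) (fun x => Phi (x, y))) <= - ln P.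
  rewrite -[X in X <= _]addr0 -Eq -ExD// -[leRHS](Ex_cst (gam n)).
  apply: Ex_le; [exact: intgD|exact: intg_cst|] => g'.
  rewrite -ExD//; [exact: main|exact: qd_intg].
have -> : (fun z => Num.min (dot (D z) (D z)) k%:R) = fun z => 8 * Phi z.
  by apply/funext => z; rewrite /Phi /c mulrCA divff ?mulr1.
by rewrite ExZ// [Ex _ _]E2 mulNr -mulrN ler_pM2l.
Qed.

End knothe.

(** * Elementary exponential bounds and Gaussian moments *)

Section exponential_inequalities.
Context {R : realType}.
Implicit Types x t : R.

Let d2 (x : R) : is_derive x 1 (fun y : R => expR y - (1 + y + 2^-1 * (y * y))) (expR x - (1 + x)).
Proof.
by apply: is_derive_eq; rewrite /GRing.scale/=; field.
Qed.

Let d3 (x : R) : is_derive x 1 (fun y : R => expR y -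
  (1 + y + 2^-1 * (y * y) + 6^-1 * (y * (y * y)))) (expR x - (1 + x + 2^-1 * (x * x))).
Proof.
by apply: is_derive_eq; rewrite /GRing.scale/=; field.
Qed.

Let h x := expR x - (1 + x + 2^-1 * (x * x)).

Let h_mono : {homo h : x y / x <= y}.
Proof.
move=> x y; rewrite le_eqVlt => /orP[/eqP->//|xy].
have [z _ E] := MVT xy (fun z _ => d2 z) (continuous_subspaceT (is_derive_continuous d2)).
rewrite -subr_ge0 /h E mulr_ge0 ?subr_ge0 ?(ltW xy)//; exact: expR_ge1Dx.
Qed.

(** [h] is the derivative of the difference; it is nondecreasing and vanishes at 0, so the
    difference has its minimum there. *)
Lemma expR_ge_deg3 x : 1 + x + x ^+ 2 / 2 + x ^+ 3 / 6 <= expR x.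
Proof.
have h00 : h 0 = 0 by rewrite /h expR0; lra.
have c3 := is_derive_continuous d3.
have [x0|x0|->] := ltgtP x 0; last by rewrite expR0 !expr0n /=; lra.
  have [z + E] := MVT x0 (fun z _ => d3 z) (continuous_subspaceT c3).
  rewrite in_itv/= => /andP[_ z0].
  have : h z <= 0 by rewrite -h00; apply: h_mono; exact: ltW.
  move: E; rewrite -/(h z) expR0 => E hz.
  have : h z * (0 - x) <= 0 by rewrite mulr_le0_ge0// sub0r oppr_ge0 ltW.
  by rewrite -E; lra.
have [z + E] := MVT x0 (fun z _ => d3 z) (continuous_subspaceT c3).
rewrite in_itv/= => /andP[z0 _].
have : 0 <= h z by rewrite -h00; apply: h_mono; exact: ltW.
move: E; rewrite -/(h z) expR0 => E hz.
have : 0 <= h z * (x - 0) by rewrite mulr_ge0// subr0 ltW.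
by rewrite -E; lra.
Qed.

(** Inverts the cubic lower bound at [- x]; the product of the two polynomials is at least one on
    [0, 1]. *)
Lemma expR_le_deg2 x : 0 <= x -> x <= 1 -> expR x <= 1 + x + x ^+ 2.
Proof.
move=> x0 x1; have := expR_ge_deg3 (- x); have := expRN x => ->.
have e0 := expR_gt0 x; set e := expR x in e0 *.
have p0 : 0 < 1 + - x + (- x) ^+ 2 / 2 + (- x) ^+ 3 / 6 by nra.
rewrite -[e^-1]mul1r ler_pdivlMr// => H; rewrite -(ler_pM2l p0).
apply: le_trans H _.
have -> : (1 + - x + (- x) ^+ 2 / 2 + (- x) ^+ 3 / 6) * (1 + x + x ^+ 2) =
  1 + x ^+ 2 * (1 / 2 - x * (2 / 3) + x ^+ 2 * (1 / 3) - x ^+ 3 / 6) by field.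
rewrite lerDl mulr_ge0 ?sqr_ge0//.
have : x ^+ 3 <= x ^+ 2 by rewrite exprS ler_piMl ?sqr_ge0.
by nra.
Qed.

Lemma expR_norm_le x : expR `|x| <= expR x + expR (- x).
Proof.
have := expR_ge0 x; have := expR_ge0 (- x).
by case: (ger0P x) => _ *; lra.
Qed.

Lemma cube_le_expR x : `|x| ^+ 3 <= 27 * expR `|x|.
Proof.
have := normr_ge0 x; set a := `|x| => a0.
have -> : expR a = expR (a / 3) ^+ 3 by rewrite -expRM_natl; congr expR; field.
have -> : a ^+ 3 = 27 * (a / 3) ^+ 3 by field.
rewrite ler_pM2l// lerXn2r ?nnegrE ?divr_ge0 ?expR_ge0//.
by have := expR_ge1Dx (a / 3); lra.
Qed.

Lemma expR_quadratic x : `|expR x - 1 - x| <= x ^+ 2 * expR `|x|.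
Proof.
have h1 := expR_ge1Dx x; have h2 := expR_ge1Dx (- x).
rewrite ger0_norm; last by lra.
have e0 := expR_gt0 x.
have h3 : expR x - 1 <= x * expR x.
  move: h2; rewrite expRN -(ler_pM2r e0) mulVf ?gt_eqF//; lra.
have [x0|x0] := leP 0 x.
  by rewrite ger0_norm//; nra.
rewrite ltr0_norm//.
have : 1 <= expR (- x) by rewrite -expR0 ler_expR; lra.
have : expR x <= 1 by rewrite -expR0 ler_expR ltW.
by nra.
Qed.

End exponential_inequalities.

Section gaussian_moments.
Context {R : realType} (n : nat).
Implicit Types e : 'rV[R]_n.

Lemma measurable_dotl e : measf (fun z : 'rV[R]_n => dot z e).
Proof. by apply: measurable_dot => //; exact: measurable_cst. Qed.

Lemma measurable_exp_dot e : measf (fun z : 'rV[R]_n => expR (dot z e)).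
Proof. by apply: (measurableT_comp (@measurable_expR R)); exact: measurable_dotl. Qed.

Lemma gam_cm e : intg (gam n) (cm e) /\ Ex (gam n) (cm e) = 1.
Proof.
have [h1 h2] := gam_shift e (@measurable_cst _ _ _ _ setT (1 : R)).
have E : (fun z => 1 * cm e z) = cm e by apply/funext => z; rewrite mul1r.
rewrite E in h1 h2; split; first by apply/h1; exact: intg_cst.
by rewrite -h2 Ex_cst.
Qed.

Lemma gam_exp e : intg (gam n) (fun z => expR (dot z e)) /\
  Ex (gam n) (fun z => expR (dot z e)) = expR (dot e e / 2).
Proof.
have [h1 h2] := gam_cm e.
have -> : (fun z => expR (dot z e)) = (fun z => expR (dot e e / 2) * cm e z).
  by apply/funext => z; rewrite /cm -expRD; congr expR; ring.
by split; [exact: intgZ|rewrite ExZ// h2 mulr1].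
Qed.

Lemma gam_exp_norm e : intg (gam n) (fun z => expR `|dot z e|).
Proof.
apply: intg_le (intgD (gam_exp e).1 (gam_exp (- e)).1).
  apply: (measurableT_comp (@measurable_expR R)); apply: measurableT_comp => //.
  exact: measurable_dotl.
by move=> z; rewrite ger0_norm ?expR_ge0// dotNr expR_norm_le.
Qed.

Lemma gam_dot_sqr_intg e : intg (gam n) (fun z => dot z e ^+ 2).
Proof.
apply: intg_le (intgZ (dot e e) (gam_dot_intg n)).
  by apply: measurable_funX; exact: measurable_dotl.
by move=> z; rewrite ger0_norm ?sqr_ge0// mulrC dot_cauchy.
Qed.

Lemma gam_dotl_intg e : intg (gam n) (fun z => dot z e).
Proof. by apply: intg_sqr; [exact: measurable_dotl|exact: gam_dot_sqr_intg]. Qed.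

Lemma gamN_law : is_law (@gam R n) (fun z => - z) (gam n).
Proof.
have -> : (fun z => - z) = (fun z : 'rV[R]_n => z *m (- 1%:M)).
  by apply/funext => z; rewrite mulmxN mulmx1.
by apply: gam_orth_law; rewrite /orthm linearN /= trmx1 mulmxN mulNmx opprK mulmx1.
Qed.

Lemma gam_mean e : Ex (gam n) (fun z => dot z e) = 0.
Proof.
have := law_Ex gamN_law (measurable_dotl e).
have -> : (fun z => dot z e) \o -%R = (fun z => - dot z e).
  by apply/funext => z /=; rewrite dotNl.
by rewrite ExN; [lra|exact: gam_dotl_intg].
Qed.

Lemma gam_dot_exp e e' : Ex (gam n) (fun z => dot z e' * expR (dot z e)) =
   dot e e' * expR (dot e e / 2).
Proof.
have [_] := gam_shift e (measurable_dotl e').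
have -> : (fun z => dot (z + e) e') = (fun z => dot z e' + dot e e').
  by apply/funext => z; rewrite dotDl.
rewrite ExD; [|exact: gam_dotl_intg|exact: intg_cst].
rewrite gam_mean Ex_cst add0r => ->.
have e0 := expR_gt0 (dot e e / 2).
have -> : (fun z => dot z e' * cm e z) =
    (fun z => (expR (dot e e / 2))^-1 * (dot z e' * expR (dot z e))).
  by apply/funext => z; rewrite /cm expRD expRN; ring.
rewrite ExZ; first by rewrite mulrAC mulVf ?mul1r// gt_eqF.
apply: intg_sqr_mul; [exact: measurable_dotl|exact: measurable_exp_dot|
  exact: gam_dot_sqr_intg|].
have := (gam_exp (2 *: e)).1; congr intg; apply/funext => z.
by rewrite dotZr -expRM_natl.
Qed.

(** Differentiates [gam_dot_exp] along [t *: e] at [t = 0] by difference quotients: the quotient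
    equals [r * expR (t ^+ 2 * r / 2)] and lies within [K * t] of the second moment. *)
Lemma gam_dot_sqr e : Ex (gam n) (fun z => dot z e ^+ 2) = dot e e.
Proof.
set r := dot e e; have r0 : 0 <= r by exact: dot_ge0.
pose K := Ex (gam n) (fun z => `|dot z e| ^+ 3 * expR `|dot z e|).
have ms := measurable_dotl e.
have IK : intg (gam n) (fun z => `|dot z e| ^+ 3 * expR `|dot z e|).
  apply: intg_le (intgZ 27 (gam_exp_norm (2 *: e))).
    apply: measurable_funM; first by apply: measurable_funX; exact: measurableT_comp.
    by apply: (measurableT_comp (@measurable_expR R)); exact: measurableT_comp.
  move=> z; rewrite ger0_norm ?mulr_ge0 ?exprn_ge0 ?expR_ge0//.
  apply: (le_trans (ler_wpM2r (expR_ge0 _) (cube_le_expR _))).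
  have E : `|dot z (2 *: e)| = `|dot z e| + `|dot z e|.
    by rewrite dotZr normrM ger0_norm//; ring.
  by rewrite E expRD mulrA.
have Ise t : intg (gam n) (fun z => dot z e * expR (dot z (t *: e))).
  apply: intg_sqr_mul; [exact: ms|exact: measurable_exp_dot|exact: gam_dot_sqr_intg|].
  have := (gam_exp (2 *: (t *: e))).1; congr intg; apply/funext => z.
  by rewrite dotZr -expRM_natl.
have key t : 0 < t -> t < 1 ->
    `|r * expR (t ^+ 2 * r / 2) - Ex (gam n) (fun z => dot z e ^+ 2)| <= K * t.
  move=> t0 t1.
  have -> : r * expR (t ^+ 2 * r / 2) = t^-1 * Ex (gam n) (fun z => dot z e * expR (dot z (t *: e))).
    rewrite gam_dot_exp !dotZl !dotZr -/r (_ : t * (t * r) / 2 = t ^+ 2 * r / 2); last by ring.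
    by field; rewrite gt_eqF.
  have -> : t^-1 * Ex (gam n) (fun z => dot z e * expR (dot z (t *: e))) =
      Ex (gam n) (fun z => t^-1 * (dot z e * expR (dot z (t *: e)) - dot z e)).
    by rewrite ExZ; [rewrite ExB ?gam_mean ?subr0//; exact: gam_dotl_intg|
      apply: intgB => //; exact: gam_dotl_intg].
  have I1 : intg (gam n) (fun z => t^-1 * (dot z e * expR (dot z (t *: e)) - dot z e)).
    by apply: intgZ; apply: intgB => //; exact: gam_dotl_intg.
  have I2 := gam_dot_sqr_intg e.
  rewrite -ExB// mulrC -ExZ//; apply: le_trans (Ex_abs (intgB I1 I2)) _.
  apply: Ex_le; [exact/intg_abs/intgB|exact: intgZ|] => z.
  rewrite dotZr; set s := dot z e.
  have -> : t^-1 * (s * expR (t * s) - s) - s ^+ 2 = t^-1 * s * (expR (t * s) - 1 - t * s).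
    by field; rewrite gt_eqF.
  rewrite normrM normrM ger0_norm ?invr_ge0 ?(ltW t0)//.
  apply: (le_trans (ler_wpM2l _ (expR_quadratic _))).
    by rewrite mulr_ge0 ?invr_ge0 ?(ltW t0).
  have -> : t^-1 * `|s| * ((t * s) ^+ 2 * expR `|t * s|) = t * (`|s| ^+ 3 * expR `|t * s|).
    by rewrite exprMn -(real_normK (num_real s)); field; rewrite gt_eqF.
  rewrite !ler_wpM2l ?exprn_ge0 ?(ltW t0)// ler_expR normrM ger0_norm ?(ltW t0)//.
  by rewrite ler_piMl// ltW.
apply/eqP; rewrite eq_le; apply/andP; split.
  apply: (@le_of_add_small _ _ _ (K + r ^+ 2 / 2 * expR (r / 2)) 1) => // t t0 t1.
  have := key t t0 t1; rewrite ler_norml => /andP[h _].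
  suff : r * expR (t ^+ 2 * r / 2) <= r + r ^+ 2 / 2 * expR (r / 2) * t by lra.
  have tt : t ^+ 2 <= t by rewrite expr2 ler_piMl ?(ltW t0)// ltW.
  set x := t ^+ 2 * r / 2.
  have x0 : 0 <= x by rewrite /x divr_ge0// mulr_ge0// sqr_ge0.
  have h1 : expR x <= 1 + x * expR (r / 2).
    have := expR_ge1Dx (- x); rewrite expRN => h2.
    have ex := expR_gt0 x.
    have : expR x - 1 <= x * expR x by move: h2; rewrite -(ler_pM2r ex) mulVf ?gt_eqF//; lra.
    have : x * expR x <= x * expR (r / 2).
      by rewrite ler_wpM2l// ler_expR /x ler_pM2r ?invr_gt0// ler_piMl// (le_trans tt)// ltW.
    by lra.
  apply: (le_trans (ler_wpM2l r0 h1)); rewrite mulrDr mulr1 lerD2l /x.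
  have -> : r * (t ^+ 2 * r / 2 * expR (r / 2)) = r ^+ 2 / 2 * expR (r / 2) * t ^+ 2 by ring.
  by rewrite ler_wpM2l// mulr_ge0 ?expR_ge0// divr_ge0// sqr_ge0.
apply: (@le_of_add_small _ _ _ K 1) => // t t0 t1.
have := key t t0 t1; rewrite ler_norml => /andP[_ h].
suff : r <= r * expR (t ^+ 2 * r / 2) by lra.
by rewrite ler_peMr// -expR0 ler_expR divr_ge0// mulr_ge0// sqr_ge0.
Qed.

Lemma gam_dot_mul e e' : Ex (gam n) (fun z => dot z e * dot z e') = dot e e'.
Proof.
have := gam_dot_sqr (e + e'); rewrite dot_sqrD.
have -> : (fun z => dot z (e + e') ^+ 2) = (fun z => (dot z e + dot z e') ^+ 2).
  by apply/funext => z; rewrite dotDr.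
rewrite Ex_sqrD ?gam_dot_sqr; [by lra|exact: measurable_dotl|exact: measurable_dotl|
  exact: gam_dot_sqr_intg|exact: gam_dot_sqr_intg].
Qed.

End gaussian_moments.

(** * The Poincare inequality from Prekopa-Leindler *)

Section poincare.
Context {R : realType} (n : nat).
Implicit Types F u L : 'rV[R]_n -> R.

Definition lingrow u := exists A B : R, forall x, `|u x| <= A + B * enorm x.

Lemma gdom_exp F u s : gdom F -> continuous u -> lingrow u ->
  gdom (fun x => F x * expR (s * u x)).
Proof.
move=> [cF F0 [C [c [c0 FC]]]] cu [A [B uAB]]; split.
- move=> x; apply: (cvgM (cF x)).
  apply: (@continuous_comp _ _ _ u (fun t => expR (s * t))); first exact: cu.
  apply: (@continuous_comp _ _ _ (fun t : R => s * t) expR); last exact: continuous_expR.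
  by apply: cvgM; [exact: cvg_cst|exact: cvg_id].
- by move=> x; rewrite mulr_gt0 ?expR_gt0.
have C0 : 0 <= C by have := le_trans (ltW (F0 0)) (FC 0); rewrite pmulr_lge0 ?expR_gt0.
exists (C * expR (`|s| * A + (s * B) ^+ 2 / (2 * c))), (c / 2); split; first by rewrite divr_gt0.
move=> x; apply: le_trans (ler_wpM2r (expR_ge0 _) (FC x)) _.
rewrite -[leLHS]mulrA -[leRHS]mulrA ler_wpM2l// -!expRD ler_expR -enorm_sqr.
have : s * u x <= `|s| * A + `|s| * B * enorm x.
  apply: (le_trans (ler_norm _)); rewrite normrM -mulrA -mulrDr ler_wpM2l//.
have e0 := enorm_ge0 x; move: (enorm x) e0 => p p0.
have -> : (s * B) ^+ 2 = (`|s| * B) ^+ 2 by rewrite !exprMn real_normK// num_real.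
move: (`|s| * B) (`|s| * A) => b a h.
have : 0 <= (c * p - b) ^+ 2 / (2 * c) by rewrite divr_ge0 ?sqr_ge0// mulr_ge0// ltW.
have -> : (c * p - b) ^+ 2 / (2 * c) = c * p ^+ 2 / 2 - b * p + b ^+ 2 / (2 * c).
  by field; rewrite gt_eqF.
by lra.
Qed.

Lemma gdom_intg_exp F u : gdom F -> continuous u -> lingrow u ->
  intg (lebesgue_rV R n) (fun x => expR `|u x| * F x).
Proof.
move=> gF cu lu; have [_ F0 _] := gF.
have h s := gdom_intg (gdom_exp s gF cu lu).
apply: intg_le (intgD (h 1) (h (-1))).
  apply: measurable_funM; last exact: gdom_meas.
  apply: (measurableT_comp (@measurable_expR R)); apply: measurableT_comp => //.
  exact: continuous_measurable_rV.
move=> x; rewrite ger0_norm ?mulr_ge0 ?expR_ge0 ?(ltW (F0 x))// mul1r mulN1r -mulrDr mulrC.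
by rewrite ler_wpM2l ?(ltW (F0 x))// expR_norm_le.
Qed.

Lemma gdom_intg_cube F u (g : 'rV[R]_n -> R) : gdom F -> continuous u -> lingrow u ->
  measf g -> (forall x, `|g x| <= 1 + `|u x| ^+ 3) ->
  intg (lebesgue_rV R n) (fun x => g x * F x).
Proof.
move=> gF cu lu mg gu; have [_ F0 _] := gF.
apply: intg_le (intgZ 28 (gdom_intg_exp gF cu lu)).
  by apply: measurable_funM => //; exact: gdom_meas.
move=> x; rewrite normrM (gtr0_norm (F0 x)) mulrA ler_wpM2r ?(ltW (F0 x))//.
apply: (le_trans (gu x)); have := cube_le_expR (u x).
have : 1 <= expR `|u x| by rewrite -expR0 ler_expR.
by lra.
Qed.

(** Bookkeeping of the expansion in [poincare]: the two estimates of [J] are compared and divided by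
    [s ^+ 2]. *)
Let small_bound (I s S2 S3 Q t k C M J q : R) : 0 < s -> s < 1 -> 0 < k -> 0 <= C ->
  0 <= S2 -> 0 <= Q -> 0 <= M -> k / 2 <= q -> q = k - 2 * s * C -> t = s ^+ 2 / (2 * q) ->
  I + s ^+ 2 * S2 / 2 - s ^+ 3 * `|S3| / 6 <= J -> J <= I + t * Q * (1 + t * M) ->
  k * S2 <= Q + (2 * C * S2 + k * `|S3| / 3 + Q * M / k) * s.
Proof.
move=> s0 s1 k0 C0 S20 Q0 M0 kq qE tE h1 h2.
have q0 : 0 < q by apply: lt_le_trans kq; rewrite divr_gt0.
have qk : q <= k by rewrite qE lerBlDr lerDl !mulr_ge0// ltW.
have tk : t <= s / k.
  rewrite tE ler_pdivrMr ?mulr_gt0// mulrAC ler_pdivlMr//.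
  have : s ^+ 2 * k <= s * k by rewrite ler_pM2r// expr2 ger_pMl// ltW.
  have : s * (k / 2) <= s * q by rewrite ler_pM2l.
  by lra.
have s20 : 0 < s ^+ 2 by rewrite exprn_gt0.
have S30 := normr_ge0 S3.
have E1 : 2 * q * (t * Q * (1 + t * M)) = s ^+ 2 * (Q * (1 + t * M)).
  by rewrite tE; field; rewrite gt_eqF.
have h3 : s ^+ 2 * (q * S2 - q * s * `|S3| / 3) <= s ^+ 2 * (Q * (1 + t * M)).
  rewrite -E1; have : s ^+ 2 * S2 / 2 - s ^+ 3 * `|S3| / 6 <= t * Q * (1 + t * M) by lra.
  rewrite -(@ler_pM2l _ (2 * q)) ?mulr_gt0//; apply: le_trans.
  by rewrite le_eqVlt; apply/orP; left; apply/eqP; field.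
rewrite ler_pM2l// in h3.
have h4 : Q * (t * M) <= Q * M / k * s.
  have -> : Q * M / k * s = Q * (s / k * M) by ring.
  by rewrite ler_wpM2l// ler_wpM2r.
have h5 : q * s * `|S3| <= k * s * `|S3| by rewrite !ler_wpM2r// ltW.
have h6 : q * S2 = k * S2 - 2 * s * C * S2 by rewrite qE; ring.
lra.
Qed.

(** Lower bound for a product whose two factors carry the same odd term [b] with opposite signs. *)
Let sandwich (a b b' p1 p2 : R) : 0 <= a - b' -> - b' <= b -> b <= b' -> a + b <= p1 ->
  a - b <= p2 -> (a - b') ^+ 2 <= p1 * p2.
Proof.
move=> h0 h1 h2 h3 h4; apply: (@le_trans _ _ ((a + b) * (a - b))); last first.
  by rewrite ler_pM//; lra.
have : b ^+ 2 <= b' ^+ 2 by nra.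
have b'0 : 0 <= b' by lra.
nra.
Qed.

Let scale_abs (c x : R) : 0 <= c -> - (c * `|x| / 6) <= c * x / 6 /\ c * x / 6 <= c * `|x| / 6.
Proof.
have := ler_norm x; have := lerNnormlW (lexx `|x|); move: `|x| => y h1 h2 c0.
by split; nra.
Qed.

Let small_bound2 (I s X Y N : R) : s * (N + 1) < 6 * I -> 0 <= X -> Y <= s * N -> 0 <= s ->
  0 <= I + X / 2 - Y / 6.
Proof. by move=> *; lra. Qed.

(** Prekopa-Leindler for [F * expR (s * u)], [F * expR (- s * u)] and [F * expR (t * L ^+ 2)],
    expanded to second order in [s]. The two-point hypothesis makes [L] a gradient bound without
    derivatives; its error [C] only enters at the next order and vanishes with [s]. *)
Lemma poincare F u L (k Lm C : R) : gdom F -> 0 < k -> slc k F -> continuous u ->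
  lingrow u -> measf L -> (forall x, 0 <= L x <= Lm) -> 0 <= C ->
  (forall x d, `|u (x + d) - u (x - d)| <= 2 * enorm d * (L x + C * enorm d)) ->
  Ex (lebesgue_rV R n) (fun x => u x * F x) = 0 ->
  k * Ex (lebesgue_rV R n) (fun x => u x ^+ 2 * F x) <=
  Ex (lebesgue_rV R n) (fun x => L x ^+ 2 * F x).
Proof.
move=> gF k0 sF cu lu mL L01 C0 Hu u0; have [cF F0 _] := gF.
have mF := gdom_meas gF; have mu := continuous_measurable_rV cu.
have IF := gdom_intg gF.
have L2 x : L x ^+ 2 <= Lm ^+ 2.
  by have /andP[l0 l1] := L01 x; rewrite lerXn2r ?nnegrE// (le_trans l0).
have mL2 : measf (fun x => L x ^+ 2) by exact: measurable_funX.
have IL : intg (lebesgue_rV R n) (fun x => L x ^+ 2 * F x).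
  by apply: (@intg_mul_bdd _ _ _ _ _ _ (Lm ^+ 2)) => // x; rewrite ger0_norm ?sqr_ge0.
have I1 : intg (lebesgue_rV R n) (fun x => u x * F x).
  apply: (gdom_intg_cube gF cu lu) => // x; have := normr_ge0 (u x); set a := `|u x| => a0.
  by have [a1|a1] := leP a 1; [have := exprn_ge0 3 a0; lra|have : 1 <= a by exact: ltW]; nra.
have I2 : intg (lebesgue_rV R n) (fun x => u x ^+ 2 * F x).
  apply: (gdom_intg_cube gF cu lu) => [|x]; first exact: measurable_funX.
  rewrite normrX; have := normr_ge0 (u x); set a := `|u x| => a0.
  by have [a1|a1] := leP a 1; [have := exprn_ge0 3 a0|]; nra.
have I3 : intg (lebesgue_rV R n) (fun x => u x ^+ 3 * F x).
  apply: (gdom_intg_cube gF cu lu) => [|x]; first exact: measurable_funX.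
  by rewrite normrX lerDr.
set S2 := Ex _ (fun x => u x ^+ 2 * F x); set Q := Ex _ _.
pose S3 := Ex (lebesgue_rV R n) (fun x => u x ^+ 3 * F x).
pose I := Ex (lebesgue_rV R n) F.
have I0 : 0 < I by exact: gdom_Ex_gt0.
have S20 : 0 <= S2 by apply: Ex_ge0 => x; rewrite mulr_ge0 ?sqr_ge0 ?ltW.
have Q0 : 0 <= Q by apply: Ex_ge0 => x; rewrite mulr_ge0 ?sqr_ge0 ?ltW.
(* The bounds ensure, in this order, [s < 1], [k / 2 <= q], [t * L x ^+ 2 <= 1], and nonnegativity
   of the lower bound for the geometric mean of the two exponential integrals. *)
pose s0 := Num.min 1 (Num.min (k / (4 * (C + 1))) (Num.min (k / (Lm ^+ 2 + 1)) (6 * I / (`|S3| + 1)))).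
have Lm1 : 0 < Lm ^+ 2 + 1 by rewrite ltr_wpDl ?sqr_ge0.
have S31 : 0 < `|S3| + 1 by rewrite ltr_wpDl.
have C1 : 0 < 4 * (C + 1) by rewrite mulr_gt0// ltr_wpDl.
have s00 : 0 < s0 by rewrite !lt_min ltr01 !divr_gt0// mulr_gt0.
apply: (@le_of_add_small _ _ _ (2 * C * S2 + k * `|S3| / 3 + Q * Lm ^+ 2 / k) s0) => // s sp.
rewrite !lt_min => /and4P[s1 sC sL sS].
rewrite ltr_pdivlMr// in sC; rewrite ltr_pdivlMr// in sL; rewrite ltr_pdivlMr// in sS.
(* With these values, completing the square in [enorm d] absorbs [s * enorm d * (L + C * enorm d)]
   into [k * enorm d ^+ 2 / 2 + t * L ^+ 2]. *)
pose q := k - 2 * s * C; pose t := s ^+ 2 / (2 * q).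
have kq : k / 2 <= q by rewrite /q; nra.
have q0 : 0 < q by apply: lt_le_trans kq; rewrite divr_gt0.
have t0 : 0 <= t by rewrite /t divr_ge0 ?sqr_ge0 ?mulr_ge0// ltW.
pose H x := F x * expR (t * L x ^+ 2).
have tL1 x : t * L x ^+ 2 <= 1.
  apply: (le_trans (ler_wpM2l t0 (L2 x))).
  rewrite /t mulrAC ler_pdivrMr ?mulr_gt0// mul1r; have := sqr_ge0 Lm; nra.
have mH : measf H.
  apply: measurable_funM => //; apply: (measurableT_comp (@measurable_expR R)).
  by apply: measurable_funM => //; exact: measurable_cst.
have HF x : H x <= F x + t * (L x ^+ 2 * F x) + t ^+ 2 * Lm ^+ 2 * (L x ^+ 2 * F x).
  have := expR_le_deg2 (mulr_ge0 t0 (sqr_ge0 (L x))) (tL1 x).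
  rewrite -(ler_pM2l (F0 x)) => h; apply: le_trans h _.
  rewrite exprMn !mulrDr mulr1 -!addrA lerD2l lerD//.
    by rewrite le_eqVlt; apply/orP; left; apply/eqP; ring.
  have -> : F x * (t ^+ 2 * (L x ^+ 2) ^+ 2) = t ^+ 2 * (L x ^+ 2 * F x) * L x ^+ 2 by ring.
  have -> : t ^+ 2 * Lm ^+ 2 * (L x ^+ 2 * F x) = t ^+ 2 * (L x ^+ 2 * F x) * Lm ^+ 2 by ring.
  apply: ler_wpM2l; last exact: L2.
  by rewrite mulr_ge0 ?sqr_ge0// mulr_ge0 ?sqr_ge0 ?(ltW (F0 x)).
have IH' : intg (lebesgue_rV R n) (fun x =>
    F x + t * (L x ^+ 2 * F x) + t ^+ 2 * Lm ^+ 2 * (L x ^+ 2 * F x)).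
  by apply: intgD; [apply: intgD|]; try exact: intgZ.
have IH : intg (lebesgue_rV R n) H.
  by apply: intg_le IH' => // x; rewrite ger0_norm ?HF// mulr_ge0 ?expR_ge0 ?ltW.
have JU : Ex (lebesgue_rV R n) H <= I + t * Q * (1 + t * Lm ^+ 2).
  apply: (le_trans (Ex_le IH IH' HF)); rewrite ExD; [|by apply: intgD => //; exact: intgZ|exact: intgZ].
  rewrite ExD//; last exact: intgZ.
  by rewrite !ExZ// -/I -/Q le_eqVlt; apply/orP; left; apply/eqP; ring.
have g1 := gdom_exp s gF cu lu; have g2 := gdom_exp (- s) gF cu lu.
have Hlow (e : R) : e ^+ 2 = s ^+ 2 -> I + s ^+ 2 * S2 / 2 + e ^+ 3 * S3 / 6 <=
    Ex (lebesgue_rV R n) (fun x => F x * expR (e * u x)).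
  move=> es; have ge := gdom_exp e gF cu lu.
  have <- : Ex (lebesgue_rV R n) (fun x => F x + e * (u x * F x) + (s ^+ 2 / 2) * (u x ^+ 2 * F x)
      + (e ^+ 3 / 6) * (u x ^+ 3 * F x)) = I + s ^+ 2 * S2 / 2 + e ^+ 3 * S3 / 6.
    rewrite ExD; [|by do 2?[apply: intgD]; try exact: intgZ|exact: intgZ].
    rewrite ExD; [|by apply: intgD => //; exact: intgZ|exact: intgZ].
    rewrite ExD//; last exact: intgZ.
    by rewrite !ExZ// u0 -/S2 -/S3 -/I; ring.
  apply: Ex_le; [by do 3?[apply: intgD]; try exact: intgZ|exact: gdom_intg|].
  move=> x; have := expR_ge_deg3 (e * u x); rewrite -(ler_pM2l (F0 x)); apply: le_trans.
  by rewrite -es le_eqVlt; apply/orP; left; apply/eqP; ring.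
have PL : Num.sqrt (Ex (lebesgue_rV R n) (fun x => F x * expR (s * u x)) *
     Ex (lebesgue_rV R n) (fun x => F x * expR (- s * u x))) <= Ex (lebesgue_rV R n) H.
  have := @prekopa_leindler R n _ _ (fun x => (H x)%:E) 0 g1 g2.
  rewrite ExE// expR0 mulr1 lee_fin; apply.
  - exact/measurable_EFinP.
  - by move=> x; rewrite lee_fin mulr_ge0 ?expR_ge0 ?ltW.
  move=> x y; rewrite lee_fin mulr1.
  pose m := 2^-1 *: (x + y); pose d := 2^-1 *: (x - y).
  have [xE yE] : x = m + d /\ y = m - d.
    by split; apply/rowP => i; rewrite !mxE; field.
  have -> : F x * expR (s * u x) * (F y * expR (- s * u y)) =
      F x * F y * expR (s * (u x - u y) / 2) ^+ 2.
    by rewrite -expRM_natl mulrACA -expRD; congr (_ * expR _); field.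
  rewrite sqrtrM; last by rewrite mulr_ge0 ?ltW.
  rewrite sqrtr_sqr (gtr0_norm (expR_gt0 _)).
  have := sF x y; rewrite -/m /H => sxy.
  have dE : dot (x - y) (x - y) = 4 * enorm d ^+ 2.
    by rewrite enorm_sqr /d dotZl dotZr; field.
  have hu : s * (u x - u y) / 2 <= s * enorm d * (L m + C * enorm d).
    have := Hu m d; rewrite -xE -yE => hu.
    have := ler_wpM2l (ltW sp) (le_trans (ler_norm _) hu).
    have -> : s * (2 * enorm d * (L m + C * enorm d)) = s * enorm d * (L m + C * enorm d) * 2 by ring.
    by rewrite -ler_pdivrMr.
  have hex : s * (u x - u y) / 2 <= k * dot (x - y) (x - y) / 8 + t * L m ^+ 2.
    apply: (le_trans hu); rewrite dE /t; set p := enorm d; set l := L m.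
    have : 0 <= (q * p - s * l) ^+ 2 / (2 * q) by rewrite divr_ge0 ?sqr_ge0// mulr_ge0// ltW.
    have -> : (q * p - s * l) ^+ 2 / (2 * q) = q * p ^+ 2 / 2 - s * p * l + s ^+ 2 / (2 * q) * l ^+ 2.
      by field; rewrite gt_eqF.
    by rewrite {1}/q; lra.
  apply: (@le_trans _ _ (Num.sqrt (F x * F y) * (expR (k * dot (x - y) (x - y) / 8) *
      expR (t * L m ^+ 2)))).
    by rewrite ler_wpM2l ?sqrtr_ge0// -expRD ler_expR.
  by rewrite mulrA ler_wpM2r ?expR_ge0.
have J1 : I + s ^+ 2 * S2 / 2 - s ^+ 3 * `|S3| / 6 <= Ex (lebesgue_rV R n) H.
  apply: le_trans PL.
  have l1 := Hlow s erefl; have l2 := Hlow (- s) (sqrrN s).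
  have s30 : 0 < s ^+ 3 by rewrite exprn_gt0.
  have s3s : s ^+ 3 <= s by rewrite exprS ger_pMr// expr2 mulr_ile1// ltW.
  have b0 : 0 <= I + s ^+ 2 * S2 / 2 - s ^+ 3 * `|S3| / 6.
    by apply: (small_bound2 sS); rewrite ?mulr_ge0 ?sqr_ge0 ?ler_wpM2r// ltW.
  rewrite -[leLHS]ger0_norm// -sqrtr_sqr ler_sqrt; last first.
    exact: mulr_ge0 (ltW (gdom_Ex_gt0 g1)) (ltW (gdom_Ex_gt0 g2)).
  apply: (@sandwich _ (s ^+ 3 * S3 / 6)); [exact: b0| | |exact: l1|].
  - by have [] := scale_abs S3 (ltW s30).
  - by have [] := scale_abs S3 (ltW s30).
  - by move: l2; rewrite exprNn -signr_odd /= expr1 mulN1r mulNr mulNr.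
apply: (@small_bound I s S2 S3 Q t k C (Lm ^+ 2) (Ex (lebesgue_rV R n) H) q) => //.
exact: sqr_ge0.
Qed.

End poincare.

(** * Square-integrable functions, covariances and variances *)

Section square_integrable.
Context d (T : measurableType d) (R : realType) (P : probability T R).
Implicit Types f g h : T -> R.

Definition L2 f := measf f /\ intg P (fun x => f x ^+ 2).

Definition cov f g : R := Ex P (fun x => f x * g x) - Ex P f * Ex P g.

Definition var f : R := cov f f.

Lemma L2_intg f : L2 f -> intg P f.
Proof. by move=> [mf f2]; exact: intg_sqr. Qed.

Lemma L2_mul f g : L2 f -> L2 g -> intg P (fun x => f x * g x).
Proof. by move=> [mf f2] [mg g2]; exact: intg_sqr_mul. Qed.

Lemma L2D f g : L2 f -> L2 g -> L2 (fun x => f x + g x).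
Proof. by move=> [mf f2] [mg g2]; split; [exact: measurable_funD|exact: intg_sqrD]. Qed.

Lemma L2Z c f : L2 f -> L2 (fun x => c * f x).
Proof.
move=> [mf f2]; split; last exact: intg_sqrZ.
by apply: measurable_funM => //; exact: measurable_cst.
Qed.

Lemma L2B f g : L2 f -> L2 g -> L2 (fun x => f x - g x).
Proof.
move=> Lf /(L2Z (-1)) Lg; have := L2D Lf Lg; congr L2.
by apply/funext => x; rewrite mulN1r.
Qed.

Lemma L2_bdd f (C : R) : measf f -> (forall x, `|f x| <= C) -> L2 f.
Proof.
move=> mf fC; split => //; apply: (@intg_bdd _ _ _ _ _ (C ^+ 2)).
  exact: measurable_funX.
by move=> x; rewrite normrX lerXn2r ?nnegrE// (le_trans _ (fC x)).
Qed.

Lemma L2_cst c : L2 (fun=> c).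
Proof. by apply: (@L2_bdd _ `|c|) => //; exact: measurable_cst. Qed.

Lemma L2_sum I (s : seq I) (f : I -> T -> R) : (forall i, L2 (f i)) ->
  L2 (fun x => \sum_(i <- s) f i x).
Proof.
move=> Lf; elim: s => [|i s IH].
  by under [X in L2 X]funext do rewrite big_nil; exact: L2_cst.
by under [X in L2 X]funext do rewrite big_cons; exact: L2D.
Qed.

Lemma covC f g : cov f g = cov g f.
Proof.
rewrite /cov mulrC; congr (_ - _); congr Ex; apply/funext => x; exact: mulrC.
Qed.

Lemma covDl f g h : L2 f -> L2 g -> L2 h ->
  cov (fun x => f x + g x) h = cov f h + cov g h.
Proof.
move=> Lf Lg Lh; rewrite /cov ExD; [|exact: L2_intg|exact: L2_intg].
have -> : (fun x => (f x + g x) * h x) = (fun x => f x * h x + g x * h x).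
  by apply/funext => x; rewrite mulrDl.
by rewrite ExD; [ring|exact: L2_mul|exact: L2_mul].
Qed.

Lemma covZl c f h : L2 f -> L2 h -> cov (fun x => c * f x) h = c * cov f h.
Proof.
move=> Lf Lh; rewrite /cov ExZ; last exact: L2_intg.
have -> : (fun x => c * f x * h x) = (fun x => c * (f x * h x)).
  by apply/funext => x; rewrite mulrA.
by rewrite ExZ; [ring|exact: L2_mul].
Qed.

Lemma covDr f g h : L2 f -> L2 g -> L2 h ->
  cov h (fun x => f x + g x) = cov h f + cov h g.
Proof. by move=> Lf Lg Lh; rewrite covC covDl// !(covC h). Qed.

Lemma covZr c f h : L2 f -> L2 h -> cov h (fun x => c * f x) = c * cov h f.
Proof. by move=> Lf Lh; rewrite covC covZl// covC. Qed.

Lemma covBl f g h : L2 f -> L2 g -> L2 h ->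
  cov (fun x => f x - g x) h = cov f h - cov g h.
Proof.
move=> Lf Lg Lh; have -> : (fun x => f x - g x) = (fun x => f x + -1 * g x).
  by apply/funext => x; rewrite mulN1r.
by rewrite covDl ?covZl ?mulN1r//; exact: L2Z.
Qed.

Lemma cov_cst c f : L2 f -> cov (fun=> c) f = 0.
Proof. by move=> Lf; rewrite /cov ExZ ?Ex_cst ?subrr//; exact: L2_intg. Qed.

Lemma varE f : var f = Ex P (fun x => f x ^+ 2) - Ex P f ^+ 2.
Proof. by []. Qed.

Lemma var_ge0 f : L2 f -> 0 <= var f.
Proof. by move=> [mf f2]; rewrite varE subr_ge0; exact: Ex_sqr_le. Qed.

Lemma var_le f : var f <= Ex P (fun x => f x ^+ 2).
Proof. by rewrite varE lerBlDr lerDl sqr_ge0. Qed.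

Lemma varD f g : L2 f -> L2 g -> var (fun x => f x + g x) = var f + 2 * cov f g + var g.
Proof.
move=> Lf Lg; have Lfg := L2D Lf Lg.
by rewrite /var covDl// !covDr// (covC g f); ring.
Qed.

Lemma varZ c f : L2 f -> var (fun x => c * f x) = c ^+ 2 * var f.
Proof. by move=> Lf; rewrite /var covZl ?covZr//; [ring|exact: L2Z]. Qed.

Lemma varB f g : L2 f -> L2 g -> var (fun x => f x - g x) = var f - 2 * cov f g + var g.
Proof.
move=> Lf Lg; have -> : (fun x => f x - g x) = (fun x => f x + -1 * g x).
  by apply/funext => x; rewrite mulN1r.
by rewrite varD ?covZr ?varZ//; [ring|exact: L2Z].
Qed.

Lemma varD_le f g : L2 f -> L2 g -> var (fun x => f x + g x) <= 2 * var f + 2 * var g.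
Proof.
by move=> Lf Lg; have := var_ge0 (L2B Lf Lg); rewrite varB// varD//; lra.
Qed.

Lemma cov_sqr_le f g : L2 f -> L2 g -> cov f g ^+ 2 <= var f * var g.
Proof.
move=> Lf Lg; apply: quad_discr; first exact: var_ge0.
move=> t; have := var_ge0 (L2D Lf (L2Z t Lg)).
by rewrite varD ?covZr ?varZ//; [lra|exact: L2Z].
Qed.

Lemma var_shift c f : L2 f -> var (fun x => f x - c) = var f.
Proof.
move=> Lf; rewrite varB//; last exact: L2_cst.
by rewrite covC cov_cst// /var cov_cst ?mulr0 ?subr0 ?addr0//; exact: L2_cst.
Qed.

End square_integrable.
Arguments cov {d T R} P f g.
Arguments var {d T R} P f.

(** * Linear coefficients of functions under the Gaussian *)

Section gaussian_kernel.
Context {R : realType} (n : nat).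
Implicit Types (e x : 'rV[R]_n) (g h : 'rV[R]_n -> R).

Lemma L2_dot e : L2 (gam n) (fun z => dot z e).
Proof. by split; [exact: measurable_dotl|exact: gam_dot_sqr_intg]. Qed.

Lemma L2_cm e : L2 (gam n) (cm e).
Proof.
split; first exact: measurable_cm.
have := intgZ (expR (dot e e)) (gam_cm (2 *: e)).1; congr intg; apply/funext => z.
by rewrite /cm -expRM_natl -expRD; congr expR; rewrite !dotZr dotZl; field.
Qed.

(** The coefficients of [g] on the coordinate functions, which are orthonormal for [gam n]; for a
    smooth [g] this is the mean gradient, by Gaussian integration by parts. *)
Definition grad g : 'rV[R]_n := \row_i Ex (gam n) (fun z => g z * z 0 i).

Lemma coordE (z : 'rV[R]_n) i : z 0 i = dot z (delta_mx 0 i).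
Proof. by rewrite dot_delta. Qed.

Lemma L2_coord i : L2 (gam n) (fun z : 'rV[R]_n => z 0 i).
Proof. by have := L2_dot (delta_mx 0 i); congr L2; apply/funext => z; rewrite -coordE. Qed.

Lemma dot_grad g e : L2 (gam n) g -> Ex (gam n) (fun z => g z * dot z e) = dot e (grad g).
Proof.
move=> Lg; have -> : (fun z => g z * dot z e) = (fun z => \sum_i e 0 i * (g z * z 0 i)).
  by apply/funext => z; rewrite mulr_sumr; apply: eq_bigr => i _; ring.
rewrite Ex_sum => [|i _]; last by apply: intgZ; apply: L2_mul => //; exact: L2_coord.
by apply: eq_bigr => i _; rewrite mxE ExZ//; apply: L2_mul => //; exact: L2_coord.
Qed.

(** The squared distance from [g] to its projection onto affine functions. *)
Lemma bessel g : L2 (gam n) g ->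
  L2 (gam n) (fun z => g z - Ex (gam n) g - dot z (grad g)) /\
  Ex (gam n) (fun z => (g z - Ex (gam n) g - dot z (grad g)) ^+ 2) =
  Ex (gam n) (fun z => g z ^+ 2) - Ex (gam n) g ^+ 2 - dot (grad g) (grad g).
Proof.
move=> Lg; have Lc := L2B Lg (L2_cst (gam n) (Ex (gam n) g)).
have Ld := L2_dot (grad g); have Lr := L2B Lc Ld; split => //.
have E0 : Ex (gam n) (fun z => g z - Ex (gam n) g - dot z (grad g)) = 0.
  rewrite ExB; [|exact: L2_intg|exact: L2_intg].
  by rewrite ExB ?Ex_cst ?gam_mean; [ring|exact: L2_intg|exact: intg_cst].
have := varB Lc Ld; rewrite var_shift//.
rewrite [var _ _ in LHS]varE E0 expr0n subr0 => ->.
rewrite covBl ?cov_cst//; last exact: L2_cst.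
rewrite /cov gam_mean mulr0 dot_grad// !varE gam_mean gam_dot_sqr.
by ring.
Qed.

(** First-order expansion of a Gaussian average under translation, with an error that sees only the
    bound on [g]: by [gam_shift] the expression is the integral of [g] against [w], a difference of
    Cameron-Martin densities minus its linear part, and Cauchy-Schwarz applies. *)
Lemma kernel_bound g e (B : R) : measf g -> (forall z, `|g z| <= B) ->
  `|Ex (gam n) (fun z => g (z + e)) - Ex (gam n) (fun z => g (z - e)) - 2 * dot e (grad g)|
  <= 4 * B * dot e e.
Proof.
move=> mg gB; have Lg := L2_bdd (gam n) mg gB.
have B0 : 0 <= B := le_trans (normr_ge0 _) (gB 0).
set r := dot e e; have r0 : 0 <= r by exact: dot_ge0.
have gen (e' : 'rV[R]_n) : `|Ex (gam n) (fun z => g (z + e'))| <= B.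
  have mge : measf (fun z : 'rV[R]_n => g (z + e')).
    by apply: measurableT_comp => //; apply: measurable_rVD => //; exact: measurable_cst.
  have Ige : intg (gam n) (fun z => g (z + e')) by apply: intg_bdd mge _ => z; exact: gB.
  rewrite -[leRHS](Ex_cst (gam n)); apply: (le_trans (Ex_abs Ige)).
  by apply: Ex_le => [||z]; [exact: intg_abs|exact: intg_cst|exact: gB].
have gB2 : Ex (gam n) (fun z => g z ^+ 2) <= B ^+ 2.
  rewrite -[leRHS](Ex_cst (gam n)); apply: Ex_le; [by case: Lg|exact: intg_cst|].
  by move=> z; rewrite -real_normK ?num_real// lerXn2r ?nnegrE.
(* For [1 < r] the crude bounds by [B] are enough; the expansion is used for short translations
   only. *)
have [r1|r1] := leP r 1; last first.
  have dg : dot e (grad g) ^+ 2 <= B ^+ 2 * r.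
    rewrite -dot_grad// (_ : r = Ex (gam n) (fun z => dot z e ^+ 2)); last by rewrite gam_dot_sqr.
    apply: (le_trans (cauchy_schwarz Lg.1 (L2_dot e).1 Lg.2 (L2_dot e).2)).
    by rewrite ler_wpM2r//; apply: Ex_ge0 => z; exact: sqr_ge0.
  have dg' : `|dot e (grad g)| <= B * r.
    rewrite -(@ler_pXn2r _ 2) ?nnegrE ?mulr_ge0// real_normK ?num_real//.
    apply: (le_trans dg); by rewrite exprMn ler_wpM2l ?sqr_ge0// expr2 ler_peMl// (ltW r1).
  have h1 := gen e; have h2 := gen (- e).
  have rB : B <= B * r by rewrite ler_peMr// (ltW r1).
  apply: (le_trans (ler_normB _ _)); rewrite normrM ger0_norm//.
  have := ler_normB (Ex (gam n) (fun z => g (z + e))) (Ex (gam n) (fun z => g (z - e))).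
  by rewrite -/r; lra.
have [Lp Lm Ld] := And3 (L2_cm e) (L2_cm (- e)) (L2Z 2 (L2_dot e)).
pose w z := cm e z - cm (- e) z - 2 * dot z e.
have Lw : L2 (gam n) w by apply: L2B => //; exact: L2B.
have -> : Ex (gam n) (fun z => g (z + e)) - Ex (gam n) (fun z => g (z - e)) -
    2 * dot e (grad g) = Ex (gam n) (fun z => g z * w z).
  have [_ ->] := gam_shift e mg; have [_ ->] := gam_shift (- e) mg.
  rewrite -dot_grad// -ExZ; last by apply: L2_mul => //; exact: L2_dot.
  rewrite -ExB; [|exact: L2_mul|exact: L2_mul].
  rewrite -ExB; [|by apply: intgB; exact: L2_mul|by apply: intgZ; apply: L2_mul => //; exact: L2_dot].
  by congr Ex; apply/funext => z; rewrite /w; ring.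
have cmdot (e' : 'rV[R]_n) : Ex (gam n) (fun z => dot z e * cm e' z) = dot e' e.
  have [_ <-] := gam_shift e' (measurable_dotl e).
  have -> : (fun z => dot (z + e') e) = (fun z => dot z e + dot e' e).
    by apply/funext => z; rewrite dotDl.
  by rewrite ExD ?gam_mean ?Ex_cst ?add0r//; [exact: gam_dotl_intg|exact: intg_cst].
have cm2 (e' : 'rV[R]_n) : Ex (gam n) (fun z => cm e' z ^+ 2) = expR (dot e' e').
  have -> : (fun z => cm e' z ^+ 2) = (fun z => expR (dot e' e') * cm (2 *: e') z).
    by apply/funext => z; rewrite /cm -expRM_natl -expRD; congr expR; rewrite !dotZr dotZl; field.
  by have [i1 i2] := gam_cm (2 *: e'); rewrite ExZ// i2 mulr1.
have w2 : Ex (gam n) (fun z => w z ^+ 2) = 2 * expR r - 2 * expR (- r) - 4 * r.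
  have Ew : Ex (gam n) w = 0.
    rewrite ExB; [|by apply: intgB; exact: L2_intg|exact: L2_intg].
    rewrite ExB; [|exact: L2_intg|exact: L2_intg].
    by rewrite !(gam_cm _).2 ExZ ?gam_mean; [ring|exact: gam_dotl_intg].
  have := varB (L2B Lp Lm) Ld; rewrite [var _ _ in LHS]varE Ew expr0n subr0 => ->.
  rewrite varB// covBl// varZ; last exact: L2_dot.
  rewrite !covZr//; [|exact: L2_dot|exact: L2_dot].
  rewrite !varE /cov !(gam_cm _).2 !gam_mean !cm2 gam_dot_sqr dotNl dotNr opprK.
  have cme (e' : 'rV[R]_n) : Ex (gam n) (fun x => cm e' x * dot x e) = dot e' e.
    by rewrite -cmdot; congr Ex; apply/funext => z; rewrite mulrC.
  rewrite !cme dotNl -/r.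
  have -> : (fun x => cm e x * cm (- e) x) = fun=> expR (- r).
    by apply/funext => z; rewrite /cm -expRD; congr expR; rewrite !dotNr dotNl opprK -/r; field.
  by rewrite Ex_cst; ring.
have w2r : Ex (gam n) (fun z => w z ^+ 2) <= (2 * r) ^+ 2.
  rewrite w2; have := expR_le_deg2 r0 r1; have := expR_ge_deg3 (- r).
  have : r ^+ 3 <= r ^+ 2 by rewrite exprS ler_piMl ?sqr_ge0.
  by rewrite sqrrN (exprNn r 3) -signr_odd /= expr1 mulN1r; nra.
have : `|Ex (gam n) (fun z => g z * w z)| <= B * (2 * r).
  rewrite -(@ler_pXn2r _ 2) ?nnegrE ?mulr_ge0// real_normK ?num_real//.
  apply: (le_trans (cauchy_schwarz _ _ _ _)); try by [case: Lg|case: Lw].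
  rewrite exprMn ler_pM//; apply: Ex_ge0 => z; exact: sqr_ge0.
have := mulr_ge0 B0 r0; rewrite -/r; lra.
Qed.

End gaussian_kernel.

(** * Measures with a strongly log-concave, Gaussian-dominated density *)

Section strongly_log_concave_measure.
Context {R : realType} (n : nat).

Definition sdens (P : probability 'rV[R]_n R) (F : 'rV[R]_n -> R) : Prop :=
  [/\ gdom F, slc 1 F &
    forall A, measurable A -> P A = (\int[lebesgue_rV R n]_(x in A) (F x)%:E)%E].

Lemma sdens_gam : sdens (gam n) (@gd R n).
Proof.
split=> //.
- split; [exact: gd_cont|exact: gd_gt0|].
  by exists ((Num.sqrt (2 * pi))^-1 ^+ n), 2^-1; split => // x; rewrite /gd mulrC [_ / 2]mulrC mulrC.
- move=> x y; rewrite /gd; set p := _ ^+ n.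
  have p0 : 0 < p by rewrite exprn_gt0// gpeak_gt0.
  have -> : p * expR (- (dot x x / 2)) * (p * expR (- (dot y y / 2))) =
      (p * expR (- ((dot x x + dot y y) / 4))) ^+ 2.
    by rewrite exprMn -expRM_natl mulrACA -expRD -expr2; congr (_ * expR _); field.
  rewrite sqrtr_sqr ger0_norm; last by rewrite mulr_ge0 ?expR_ge0 ?(ltW p0).
  rewrite -[leLHS]mulrA -expRD ler_pM2l// ler_expR dotZl dotZr mul1r.
  by have := dot_sqrD x y; have := dot_sqrB x y; lra.
Qed.

Section with_density.
Variables (P : probability 'rV[R]_n R) (F : 'rV[R]_n -> R).
Hypothesis PF : sdens P F.

Let gF : gdom F. Proof. by case: PF. Qed.
Let F0 x : 0 <= F x. Proof. by case: gF => _ /(_ x)/ltW. Qed.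
Let mF : measf F. Proof. exact: gdom_meas. Qed.

Lemma sdens_intg g : measf g ->
  intg P g <-> intg (lebesgue_rV R n) (fun x => g x * F x).
Proof. by apply: dens_intg => //; case: PF. Qed.

Lemma sdens_Ex g : measf g ->
  Ex P g = Ex (lebesgue_rV R n) (fun x => g x * F x).
Proof. by apply: dens_Ex => //; case: PF. Qed.

Lemma sdens_Ex1 : Ex (lebesgue_rV R n) F = 1.
Proof.
have := sdens_Ex (@measurable_cst _ _ _ _ setT (1 : R)); rewrite Ex_cst => ->.
by congr Ex; apply/funext => x; rewrite mul1r.
Qed.

Lemma enorm_continuous : continuous (@enorm R n).
Proof.
move=> x; apply: (@continuous_comp _ _ _ (fun x : 'rV[R]_n => dot x x) Num.sqrt).
  exact: dot_continuous.
exact: sqrt_continuous.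
Qed.

Lemma sdens_dot_intg : intg P (fun x => dot x x).
Proof.
have md : measf (fun x : 'rV[R]_n => dot x x) by exact: measurable_dot.
apply/(sdens_intg md); apply: (gdom_intg_cube gF enorm_continuous) => // [|x].
  by exists 0, 1 => x; rewrite add0r mul1r ger0_norm ?enorm_ge0.
rewrite (ger0_norm (enorm_ge0 x)) ger0_norm ?dot_ge0// -enorm_sqr.
have := enorm_ge0 x; move: (enorm x) => a a0.
by have [a1|a1] := leP a 1; [have := exprn_ge0 3 a0|]; nra.
Qed.

Lemma sdens_L2_dot a : L2 P (fun x => dot x a).
Proof.
split; first by apply: measurable_dot => //; exact: measurable_cst.
apply: intg_le (intgZ (dot a a) sdens_dot_intg).
  by apply: measurable_funX; apply: measurable_dot => //; exact: measurable_cst.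
by move=> x; rewrite ger0_norm ?sqr_ge0// mulrC dot_cauchy.
Qed.

Lemma two_point_continuous (u L : 'rV[R]_n -> R) (Lm C : R) :
  (forall x, 0 <= L x <= Lm) -> 0 <= C ->
  (forall x d, `|u (x + d) - u (x - d)| <= 2 * enorm d * (L x + C * enorm d)) ->
  continuous u.
Proof.
move=> L01 C0 H x; apply/continuous_rVP => e e0.
have Lm0 : 0 <= Lm by have /andP[l0 l1] := L01 0; exact: le_trans l1.
pose K := (n%:R + 1) * (Lm + C * (n%:R + 1) + 1).
have n1 : 0 < n%:R + 1 :> R by rewrite ltr_wpDl.
have K1 : 0 < Lm + C * (n%:R + 1) + 1 by rewrite ltr_wpDl// addr_ge0// mulr_ge0// ltW.
have K0 : 0 < K by rewrite mulr_gt0.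
exists (Num.min 1 (e / K)); first by rewrite lt_min ltr01 divr_gt0.
move=> y yx; pose d := 2^-1 *: (y - x); pose m := 2^-1 *: (x + y).
have [-> ->] : y = m + d /\ x = m - d by split; apply/rowP => i; rewrite !mxE; field.
apply: (le_lt_trans (H m d)); set q := enorm d.
have [q1 qe] : 2 * q <= n%:R * Num.min 1 (e / K) /\ 0 <= q.
  split; last exact: enorm_ge0.
  rewrite /q enormZ ger0_norm ?invr_ge0// mulrA divff ?mul1r//.
  by apply: enorm_le_mul => i; rewrite !mxE; exact/ltW/yx.
have h1 : Num.min 1 (e / K) <= 1 by rewrite ge_min lexx.
have h2 : Num.min 1 (e / K) <= e / K by rewrite ge_min lexx orbT.
set t := Num.min _ _ in q1 h1 h2.
have t0 : 0 < t by rewrite lt_min ltr01 divr_gt0.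
have q2 : q <= n%:R + 1.
  by have : n%:R * t <= n%:R :> R by [rewrite ler_piMr]; lra.
have /andP[l0 l1] := L01 m.
apply: (@le_lt_trans _ _ (n%:R * t * (Lm + C * (n%:R + 1)))).
  apply: ler_pM => //; rewrite ?mulr_ge0 ?addr_ge0 ?mulr_ge0//.
  by apply: lerD => //; rewrite ler_wpM2l.
apply: (@lt_le_trans _ _ (K * t)); last by rewrite mulrC -ler_pdivlMr.
rewrite /K mulrAC ltr_pM2r//; apply: (@le_lt_trans _ _ ((n%:R + 1) * (Lm + C * (n%:R + 1)))).
  by rewrite ler_wpM2r ?lerDl// addr_ge0// mulr_ge0// ltW.
by rewrite ltr_pM2l// ltrDl.
Qed.

Lemma sdens_poincare (u L : 'rV[R]_n -> R) (Lm C : R) : lingrow u ->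
  measf L -> (forall x, 0 <= L x <= Lm) -> 0 <= C ->
  (forall x d, `|u (x + d) - u (x - d)| <= 2 * enorm d * (L x + C * enorm d)) ->
  L2 P u /\ var P u <= Ex P (fun x => L x ^+ 2).
Proof.
move=> [A [B uAB]] mL L01 C0 H; have cu := two_point_continuous L01 C0 H.
have mu := continuous_measurable_rV cu.
have B0 : intg P (fun x => (`|A| + `|B| * enorm x) ^+ 2).
  apply: (@intg_le _ _ _ _ _ (fun x => 2 * A ^+ 2 + 2 * B ^+ 2 * dot x x)).
  - apply: measurable_funX; apply: measurable_funD; first exact: measurable_cst.
    by apply: measurable_funM; [exact: measurable_cst|exact: measurable_enorm].
  - move=> x; rewrite ger0_norm ?sqr_ge0// -enorm_sqr.
    rewrite -(real_normK (num_real A)) -(real_normK (num_real B)).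
    by have := sqr_ge0 (`|A| - `|B| * enorm x); lra.
  - by apply: intgD; [exact: intg_cst|apply: intgZ; exact: sdens_dot_intg].
have Lu : L2 P u.
  split => //; apply: intg_le B0 => [|x]; first exact: measurable_funX.
  rewrite normrX lerXn2r ?nnegrE ?addr_ge0 ?mulr_ge0 ?enorm_ge0//.
  apply: (le_trans (uAB x)); apply: lerD; first exact: ler_norm.
  by rewrite ler_wpM2r ?enorm_ge0// ler_norm.
split => //; pose c := Ex P u; rewrite -(var_shift c Lu) varE.
have Luc := L2B Lu (L2_cst P c).
have Ec : Ex P (fun x => u x - c) = 0.
  by rewrite ExB ?Ex_cst ?subrr//; [exact: L2_intg|exact: intg_cst].
rewrite Ec expr0n subr0 !sdens_Ex; [|exact: measurable_funX|by apply: measurable_funX; case: Luc].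
have [_ sF _] := PF.
have := @poincare R n F (fun x => u x - c) L 1 Lm C gF ltr01 sF.
rewrite mul1r; apply => //.
- by move=> x; apply: cvgB (cu x) (cvg_cst _).
- exists (A + `|c|), B => x; apply: (le_trans (ler_normB _ _)).
  by rewrite addrAC lerD2r.
- move=> x dd; rewrite (_ : _ - _ = u (x + dd) - u (x - dd)); last by ring.
  exact: H.
- by rewrite -sdens_Ex//; case: Luc.
Qed.

End with_density.
End strongly_log_concave_measure.

(** * Gaussian smoothing, its slope and variance contraction *)

Section smoothing.
Context {R : realType}.

Lemma pp_Ex d1 d2 (T1 : measurableType d1) (T2 : measurableType d2)
    (P : probability T1 R) (Q : probability T2 R) (f : T1 * T2 -> R) (C : R) :
  measf f -> (forall x, `|f x| <= C) ->
  Ex (pp P Q) f = Ex P (fun x => Ex Q (fun y => f (x, y))).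
Proof.
move=> mf fC; have [|x|//] := @Ex_fub _ _ _ _ _ P Q f.
  exact: (@intg_bdd _ _ _ _ _ C).
by apply: (@intg_bdd _ _ _ _ _ C) => [|y]; [exact: measurableT_comp|exact: fC].
Qed.

Context (n : nat).
Implicit Types (h g : 'rV[R]_n -> R) (x z : 'rV[R]_n).

Lemma grad_sqr_le g : L2 (gam n) g ->
  Ex (gam n) g ^+ 2 + dot (grad g) (grad g) <= Ex (gam n) (fun z => g z ^+ 2).
Proof.
move=> /bessel[_ e]; have : 0 <= Ex (gam n) (fun z => (g z - Ex (gam n) g - dot z (grad g)) ^+ 2).
  by apply: Ex_ge0 => z; exact: sqr_ge0.
by rewrite e; lra.
Qed.

(** For [rho ^+ 2 + sigma ^+ 2 = 1] an Ornstein-Uhlenbeck step; for [rho = sigma = 1] the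
    expectation of [h (X + Z)] given [X = x], with [Z] a standard Gaussian. *)
Definition sm (rho sigma : R) h x := Ex (gam n) (fun z => h (rho *: x + sigma *: z)).

(** The gradient of [sm] at [x] up to the factor [rho / sigma], in the sense of [sm_two_point]. *)
Definition gsm (rho sigma : R) h x := grad (fun z => h (rho *: x + sigma *: z)).

Lemma measurable_mix (rho sigma : R) :
  measf (fun p : 'rV[R]_n * 'rV[R]_n => rho *: p.1 + sigma *: p.2).
Proof.
by apply: measurable_rVD; apply: measurable_rVZ => //; exact: measurable_cst.
Qed.

Section bounded.
Variables (rho sigma : R) (h : 'rV[R]_n -> R) (B : R).
Hypotheses (mh : measf h) (hB : forall x, `|h x| <= B).

Let mhx x : measf (fun z : 'rV[R]_n => h (rho *: x + sigma *: z)).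
Proof.
have := measurableT_comp mh (measurable_mix rho sigma).
by move=> /measurableT_comp /(_ (pair1_measurable x)).
Qed.

Lemma mix_L2 x : L2 (gam n) (fun z => h (rho *: x + sigma *: z)).
Proof. by apply: (@L2_bdd _ _ _ _ _ B). Qed.

Lemma measurable_sm : measf (sm rho sigma h).
Proof. exact: (@meas_Ex _ _ _ _ _ (gam n)) (measurableT_comp mh (measurable_mix rho sigma)). Qed.

Lemma measurable_gsm i : measf (fun x => gsm rho sigma h x 0 i).
Proof.
rewrite (_ : (fun _ => _) = (fun x => Ex (gam n) (fun z => h (rho *: x + sigma *: z) * z 0 i)));
  last by apply/funext => x; rewrite mxE.
have := @meas_Ex _ _ 'rV[R]_n 'rV[R]_n R (gam n)
  (fun p => h (rho *: p.1 + sigma *: p.2) * p.2 0 i); apply.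
apply: measurable_funM; first exact: (measurableT_comp mh (measurable_mix rho sigma)).
exact: (measurableT_comp (measurable_coord i) measurable_snd).
Qed.

Lemma measurable_gsm_rV : measf (gsm rho sigma h).
Proof. by apply/measurable_rVP => i; exact: measurable_gsm. Qed.

Let B0 : 0 <= B. Proof. exact: le_trans (normr_ge0 _) (hB 0). Qed.

Lemma gsm_sm_le x : sm rho sigma h x ^+ 2 + dot (gsm rho sigma h x) (gsm rho sigma h x) <= B ^+ 2.
Proof.
apply: (le_trans (grad_sqr_le (mix_L2 x))); rewrite -[leRHS](Ex_cst (gam n)).
apply: Ex_le; [exact: (mix_L2 x).2|exact: intg_cst|move=> z].
by rewrite -real_normK ?num_real// lerXn2r ?nnegrE.
Qed.

Lemma sm_bdd x : `|sm rho sigma h x| <= B.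
Proof.
rewrite -(@ler_pXn2r _ 2) ?nnegrE// real_normK ?num_real//.
by have := gsm_sm_le x; have := dot_ge0 (gsm rho sigma h x); lra.
Qed.

Lemma gsm_enorm x : enorm (gsm rho sigma h x) <= B.
Proof.
rewrite -(@ler_pXn2r _ 2) ?nnegrE ?enorm_ge0// enorm_sqr.
by have := gsm_sm_le x; have := sqr_ge0 (sm rho sigma h x); lra.
Qed.

Lemma gsm_bdd x i : `|gsm rho sigma h x 0 i| <= B.
Proof.
rewrite -(@ler_pXn2r _ 2) ?nnegrE// real_normK ?num_real//.
apply: (le_trans (coord_sqr_le _ _)).
by have := gsm_sm_le x; have := sqr_ge0 (sm rho sigma h x); lra.
Qed.

Lemma sm_two_point x d : 0 < sigma ->
  `|sm rho sigma h (x + d) - sm rho sigma h (x - d) -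
    2 * dot d ((rho / sigma) *: gsm rho sigma h x)| <=
  4 * B * (rho / sigma) ^+ 2 * dot d d.
Proof.
move=> s0; have s1 := lt0r_neq0 s0.
have := kernel_bound ((rho / sigma) *: d) (mhx x) (fun z => hB _).
rewrite /sm /gsm; set G := grad _.
have e (t : R) : t = 1 \/ t = -1 -> (fun z => h (rho *: (x + t *: d) + sigma *: z)) =
    (fun z => h (rho *: x + sigma *: (z + t *: ((rho / sigma) *: d)))).
  move=> _; apply/funext => z; congr h; apply/rowP => i; rewrite !mxE; field.
  by [].
have := e 1 (or_introl erefl); rewrite !scale1r => ->.
have := e (-1) (or_intror erefl); rewrite !scaleN1r => ->.
rewrite !dotZl !dotZr; congr (`|_ - _| <= _); ring.
Qed.

Section poincare_smoothing.
Variables (P : probability 'rV[R]_n R) (F : 'rV[R]_n -> R).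
Hypotheses (PF : sdens P F) (s0 : 0 < sigma).

(** The gradient bound comes from [sm_two_point]. A linear function is added so that its slope can
    later be varied in the stability argument. *)
Lemma sm_poincare (a : 'rV[R]_n) :
  var P (fun x => sm rho sigma h x + dot x a) <=
  Ex P (fun x => dot ((rho / sigma) *: gsm rho sigma h x + a)
                     ((rho / sigma) *: gsm rho sigma h x + a)).
Proof.
set k := rho / sigma; pose L x := enorm (k *: gsm rho sigma h x + a).
have mL : measf L.
  apply: measurable_enorm; apply: measurable_rVD; last exact: measurable_cst.
  by apply: measurable_rVZ; [exact: measurable_cst|exact: measurable_gsm_rV].
have [] := @sdens_poincare R n P F PF (fun x => sm rho sigma h x + dot x a) L
    (`|k| * B + enorm a) (2 * B * k ^+ 2) _ mL.
- exists B, (enorm a) => x; apply: (le_trans (ler_normD _ _)).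
  by rewrite lerD ?sm_bdd// mulrC dot_le_enorm.
- move=> x; rewrite enorm_ge0/= (le_trans (enormD _ _))// lerD2r enormZ.
  by rewrite ler_wpM2l// gsm_enorm.
- by rewrite mulr_ge0 ?sqr_ge0// mulr_ge0.
- move=> x d; rewrite dotDl (dotDl x (- d)) dotNl.
  have h1 := sm_two_point x d s0; rewrite -/k in h1.
  have h2 : `|2 * dot d (k *: gsm rho sigma h x + a)| <= 2 * (enorm d * L x).
    by rewrite normrM ger0_norm// ler_wpM2l// dot_le_enorm.
  have -> : sm rho sigma h (x + d) + (dot x a + dot d a) -
     (sm rho sigma h (x - d) + (dot x a - dot d a)) =
    (sm rho sigma h (x + d) - sm rho sigma h (x - d) - 2 * dot d (k *: gsm rho sigma h x)) +
    2 * dot d (k *: gsm rho sigma h x + a) by rewrite dotDr; ring.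
  apply: (le_trans (ler_normD _ _)); apply: (le_trans (lerD h1 h2)).
  by rewrite -enorm_sqr le_eqVlt; apply/orP; left; apply/eqP; ring.
by move=> _; congr (_ <= Ex P _); apply/funext => x; exact: enorm_sqr.
Qed.

Lemma Ex_mix (g : 'rV[R]_n -> R) (C : R) : measf g -> (forall x, `|g x| <= C) ->
  Ex (pp P (gam n)) (fun p => g (rho *: p.1 + sigma *: p.2)) = Ex P (sm rho sigma g).
Proof.
move=> mg gC; rewrite (@pp_Ex _ _ _ _ _ _ _ C)//.
exact: (measurableT_comp mg (measurable_mix rho sigma)).
Qed.

(* Smoothing contracts variances: the Bessel inequality loses [E |gsm h|^2], which
   by the Poincare inequality is at least a multiple of the variance left. *)
Lemma sm_var_contract :
  (1 + sigma ^+ 2 / rho ^+ 2) * var P (sm rho sigma h) <=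
  Ex P (sm rho sigma (fun y => h y ^+ 2)) - Ex P (sm rho sigma h) ^+ 2.
Proof.
have I1 : intg P (fun x => sm rho sigma h x ^+ 2).
  apply: (@intg_bdd _ _ _ _ _ (B ^+ 2)); first by apply: measurable_funX; exact: measurable_sm.
  by move=> x; rewrite normrX lerXn2r ?nnegrE// sm_bdd.
have mgg : measf (fun x => dot (gsm rho sigma h x) (gsm rho sigma h x)).
  by apply: measurable_dot; exact: measurable_gsm_rV.
have I2 : intg P (fun x => dot (gsm rho sigma h x) (gsm rho sigma h x)).
  apply: (@intg_bdd _ _ _ _ _ (B ^+ 2)) => // x; rewrite ger0_norm ?dot_ge0//.
  by have := gsm_sm_le x; have := sqr_ge0 (sm rho sigma h x); lra.
have h2 x : `|h x ^+ 2| <= B ^+ 2 by rewrite normrX lerXn2r ?nnegrE.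
have mh2 : measf (fun x => h x ^+ 2) by exact: measurable_funX.
have I3 : intg P (sm rho sigma (fun y => h y ^+ 2)).
  apply: (@intg_bdd _ _ _ _ _ (B ^+ 2)) => [|x].
    exact: (@meas_Ex _ _ _ _ _ (gam n)) (measurableT_comp mh2 (measurable_mix rho sigma)).
  rewrite ger0_norm ?Ex_ge0// => [|z]; last exact: sqr_ge0.
  rewrite -[leRHS](Ex_cst (gam n)); apply: Ex_le; [exact: (mix_L2 x).2|exact: intg_cst|move=> z].
  exact: (le_trans (ler_norm _) (h2 _)).
have := Ex_le (intgD I1 I2) I3 (fun x => grad_sqr_le (mix_L2 x)); rewrite ExD//.
have := sm_poincare 0; under [X in var P X]funext do rewrite dot0r addr0.
have -> : (fun x => dot (rho / sigma *: gsm rho sigma h x + 0) (rho / sigma *: gsm rho sigma h x + 0)) =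
   (fun x => (rho / sigma) ^+ 2 * dot (gsm rho sigma h x) (gsm rho sigma h x)).
  by apply/funext => x; rewrite addr0 dotZl dotZr mulrA -expr2.
rewrite ExZ// varE; set v := Ex _ (fun x => sm _ _ _ x ^+ 2); set e := Ex _ (sm _ _ h).
set w := Ex _ (fun x => dot _ _); set z := Ex _ _ => p1 p2.
suff : sigma ^+ 2 / rho ^+ 2 * (v - e ^+ 2) <= w by lra.
have [->|r0] := eqVneq rho 0.
  rewrite expr0n invr0 mulr0 mul0r; apply: Ex_ge0 => x; exact: dot_ge0.
have q0 : 0 < rho ^+ 2 by rewrite exprn_even_gt0.
rewrite mulrAC ler_pdivrMr// -ler_pdivlMl ?exprn_gt0//; apply: (le_trans p1).
by rewrite le_eqVlt; apply/orP; left; apply/eqP; field; exact: lt0r_neq0.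
Qed.

End poincare_smoothing.

End bounded.

(** For the Gaussian itself [sm_var_contract] says that the variance of [sm rho sigma f] is at most
    [rho ^+ 2] times that of [f], because [1 + sigma ^+ 2 / rho ^+ 2 = (rho ^+ 2)^-1];
    Cauchy-Schwarz concludes. *)
Lemma gebelein (f : 'rV[R]_n -> R) (rho sigma B : R) : measf f ->
  (forall x, `|f x| <= B) -> rho != 0 -> 0 < sigma -> rho ^+ 2 + sigma ^+ 2 = 1 ->
  cov (gam n) f (sm rho sigma f) <= `|rho| * var (gam n) f.
Proof.
move=> mf fB r0 s0 rs; have Lf := L2_bdd (gam n) mf fB.
have Ls := L2_bdd (gam n) (measurable_sm rho sigma mf) (sm_bdd rho sigma mf fB).
have E (g : 'rV[R]_n -> R) C : measf g -> (forall x, `|g x| <= C) ->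
    Ex (gam n) (sm rho sigma g) = Ex (gam n) g.
  move=> mg gC; rewrite -(Ex_mix _ _ _ mg gC) -(Ex_fst (gam n) (gam n) mg).
  by rewrite (law_Ex (gam_rot_law n rs) (measurableT_comp mg measurable_fst)).
have := sm_var_contract rho mf fB (sdens_gam n) s0; rewrite (E _ _ mf fB).
rewrite (E (fun x => f x ^+ 2) (B ^+ 2)); last first.
- by move=> x; rewrite normrX lerXn2r ?nnegrE// (le_trans _ (fB x)).
- exact: measurable_funX.
rewrite -varE (_ : 1 + _ = (rho ^+ 2)^-1); last first.
  have -> : sigma ^+ 2 = 1 - rho ^+ 2 by rewrite -rs; ring.
  by field.
rewrite mulrC ler_pdivrMr ?exprn_even_gt0// => vs.
have v0 := var_ge0 Lf; have [c0|c0] := leP (cov (gam n) f (sm rho sigma f)) 0.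
  by rewrite (le_trans c0)// mulr_ge0.
rewrite -(@ler_pXn2r _ 2) ?nnegrE ?mulr_ge0// ?(ltW c0)//.
apply: (le_trans (cov_sqr_le Lf Ls)); rewrite exprMn real_normK ?num_real//.
by rewrite mulrC [in leRHS]expr2 mulrA ler_wpM2r// mulrC.
Qed.

(** [gsm c s g] is the slope of [g] in the remaining noise once a part of the noise is revealed. Its
    deviation from the mean [s *: grad g] is the slope of the Bessel remainder [r] of [g], so the
    Bessel inequality for [r] given the revealed part bounds it by the mean square of [r]. *)
Lemma half_noise (g : 'rV[R]_n -> R) (c s B : R) : measf g ->
  (forall x, `|g x| <= B) -> c ^+ 2 + s ^+ 2 = 1 ->
  (forall i, Ex (gam n) (fun z => gsm c s g z 0 i) = s * grad g 0 i) /\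
  Ex (gam n) (fun z => dot (gsm c s g z - s *: grad g) (gsm c s g z - s *: grad g)) <=
  Ex (gam n) (fun z => g z ^+ 2) - Ex (gam n) g ^+ 2 - dot (grad g) (grad g).
Proof.
move=> mg gB cs1; have Lg := L2_bdd (gam n) mg gB.
have rl := gam_rot_law n cs1; have Lgx x := mix_L2 c s mg gB x.
set G := grad g; split=> [i|].
  pose phi (p : 'rV[R]_n * 'rV[R]_n) := g p.1 * (s * p.1 0 i + c * p.2 0 i).
  have Lc := @L2_coord R n i.
  have L1 (f : 'rV[R]_n -> R) : L2 (gam n) f -> L2 (pp (gam n) (gam n)) (fun p => f p.1).
    by move=> [mf f2]; split; [exact: (measurableT_comp mf measurable_fst)|exact: (intg_fst (gam n) f2)].
  have L1' (f : 'rV[R]_n -> R) : L2 (gam n) f -> L2 (pp (gam n) (gam n)) (fun p => f p.2).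
    by move=> [mf f2]; split; [exact: (measurableT_comp mf measurable_snd)|exact: (intg_snd (gam n) f2)].
  have Ip : intg (pp (gam n) (gam n)) phi.
    by apply: L2_mul; [exact: L1|exact: L2D (L2Z s (L1 _ Lc)) (L2Z c (L1' _ Lc))].
  have mp := intg_meas Ip.
  have [|_ e1] := Ex_fub Ip.
    move=> x; apply: (@L2_mul _ _ _ _ (fun=> g x)); first exact: L2_cst.
    exact: L2D (L2_cst _ (s * x 0 i)) (L2Z c Lc).
  have [|_ e2] := Ex_fub ((law_intg rl mp).1 Ip).
    move=> x; have := L2_mul (Lgx x) Lc; congr intg; apply/funext => z.
    by rewrite /phi /rot /= !mxE; have := cs1; rewrite !expr2 => E; 
      congr (_ * _); transitivity ((c * c + s * s) * z 0 i); [rewrite E mul1r|ring].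
  have := law_Ex rl mp; rewrite e1 e2 => E.
  transitivity (Ex (gam n) (fun x => Ex (gam n) (fun y => (phi \o rot c s) (x, y)))).
    congr Ex; apply/funext => x; rewrite mxE; congr Ex; apply/funext => z.
    rewrite /phi /rot /= !mxE; have := cs1; rewrite !expr2 => E'.
    by congr (_ * _); transitivity ((c * c + s * s) * z 0 i); [rewrite E' mul1r|ring].
  rewrite -E mxE -ExZ; last exact: L2_mul.
  congr Ex; apply/funext => x; rewrite /phi/= ExZ; last first.
    exact: L2_intg (L2D (L2_cst _ (s * x 0 i)) (L2Z c Lc)).
  rewrite ExD; [|exact: intg_cst|by apply: L2_intg; exact: L2Z].
  rewrite Ex_cst ExZ; last exact: L2_intg.
  rewrite (_ : (fun y : 'rV[R]_n => y 0 i) = (fun y => dot y (delta_mx 0 i))).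
    by rewrite gam_mean; ring.
  by apply/funext => y; exact: coordE.
have [Lr <-] := bessel Lg; rewrite -/G; set r := fun z => _ in Lr; pose r2 z := r z ^+ 2.
have Ir : intg (gam n) r2 := Lr.2.
have Ip := intg_fst (gam n) Ir; have mp := intg_meas Ip.
have Lk x : L2 (gam n) (fun z => r (c *: x + s *: z)).
  have -> : (fun z => r (c *: x + s *: z)) =
     (fun z => g (c *: x + s *: z) - (Ex (gam n) g + c * dot x G) - s * dot z G).
    by apply/funext => z; rewrite /r dotDl !dotZl; ring.
  by apply: L2B; [apply: L2B => //; exact: L2_cst|apply: L2Z; exact: L2_dot].
have [|I1 e1] := Ex_fub ((law_intg rl mp).1 Ip); first by move=> x; exact: (Lk x).2.
have := law_Ex rl mp; rewrite e1 (Ex_fst _ _ (intg_meas Ir)) => E.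
rewrite [leRHS](_ : _ = Ex (gam n) r2)// E.
have mG : measf (fun z => gsm c s g z - s *: G).
  apply: measurable_rVD; first by have H := measurable_gsm_rV c s mg; exact: H.
  exact: measurable_cst.
have mGG := measurable_dot mG mG.
have key x : dot (gsm c s g x - s *: G) (gsm c s g x - s *: G) <=
    Ex (gam n) (fun z => r (c *: x + s *: z) ^+ 2).
  have -> : gsm c s g x - s *: G = grad (fun z => r (c *: x + s *: z)).
    apply/rowP => i; rewrite !mxE.
    have Lc := @L2_coord R n i.
    have -> : (fun z => r (c *: x + s *: z) * z 0 i) =
     (fun z => g (c *: x + s *: z) * z 0 i - (Ex (gam n) g + c * dot x G) * dot z (delta_mx 0 i)
         - s * (dot z G * dot z (delta_mx 0 i))).
      by apply/funext => z; rewrite /r dotDl !dotZl -coordE; ring.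
    have I3 := L2_mul (Lgx x) Lc; have I4 := L2_mul (L2_dot G) (L2_dot (delta_mx 0 i)).
    have I5 := gam_dotl_intg (delta_mx 0 i : 'rV[R]_n).
    rewrite ExB; [|by apply: intgB I3 _; exact: intgZ|exact: intgZ].
    rewrite ExB; [|exact: I3|exact: intgZ].
    by rewrite !ExZ// gam_mean gam_dot_mul dot_delta !mxE; ring.
  by have := grad_sqr_le (Lk x); have := sqr_ge0 (Ex (gam n) (fun z => r (c *: x + s *: z))); lra.
apply: Ex_le => //; apply: intg_le I1 => // x.
by rewrite ger0_norm ?dot_ge0//; exact: key.
Qed.

End smoothing.

(** * Posterior densities and posterior means under Gaussian noise *)

Lemma measurable_pos_inv d (T : measurableType d) (R : realType) (f : T -> R) :
  (forall x, 0 < f x) -> measf f -> measf (fun x => (f x)^-1).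
Proof.
move=> f0 mf; rewrite (_ : (fun _ => _) = (fun x => expR (- ln (f x)))); last first.
  by apply/funext => x; rewrite expRN lnK ?posrE.
apply: (measurableT_comp (@measurable_expR R)); apply: measurable_funN.
exact: measurableT_comp.
Qed.

Section posterior.
Context {R : realType} (n : nat).
Variables (P : probability 'rV[R]_n R) (F : 'rV[R]_n -> R).
Hypothesis PF : sdens P F.
Local Notation leb := (lebesgue_rV R n).
Implicit Types (x y z : 'rV[R]_n).

Let gF : gdom F. Proof. by case: PF. Qed.
Let F0 x : 0 <= F x. Proof. by case: gF => _ /(_ x)/ltW. Qed.
Let mF : measf F. Proof. exact: gdom_meas. Qed.

(** Unnormalized density of [X] given [X + Z = y], where [X] has law [P] and [Z] is an independent
    standard Gaussian. *)
Definition post y x : R := F x * gd (y - x).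

Lemma post_ge0 y x : 0 <= post y x. Proof. by rewrite mulr_ge0// gd_ge0. Qed.

Lemma post_gdom y : gdom (post y).
Proof.
have [cF p0 [C [c [c0 FC]]]] := gF; have [[_ _ [D [d [d0 gD]]]] _ _] := @sdens_gam R n.
split.
- move=> x; apply: (cvgM (cF x)).
  apply: (@continuous_comp _ _ _ (fun x => y - x) (@gd R n)); last exact: gd_cont.
  exact: cvgB (cvg_cst _) cvg_id.
- by move=> x; rewrite mulr_gt0// gd_gt0.
- have D0 : 0 <= D.
    by have := le_trans (gd_ge0 0) (gD 0); rewrite pmulr_lge0// expR_gt0.
  exists (C * D), c; split => // x; rewrite mulrAC; apply: ler_pM => //; first exact: gd_ge0.
  apply: (le_trans (gD _)); rewrite ler_piMr// -expR0 ler_expR oppr_le0.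
  by rewrite mulr_ge0 ?dot_ge0// ltW.
Qed.

(** The Gaussian factor contributes a second unit of log-concavity, which makes the posterior
    Poincare constant 1/2. *)
Lemma post_slc y : slc 2 (post y).
Proof.
move=> x x'; have [_ sF _] := PF; have [_ sg _] := @sdens_gam R n.
have := ler_pM _ _ (sF x x') (sg (y - x) (y - x')).
rewrite !mulr_ge0 ?sqrtr_ge0 ?expR_ge0// => /(_ isT isT); rewrite /post.
have -> : y - x - (y - x') = - (x - x') by apply/rowP => i; rewrite !mxE; ring.
have -> : 2^-1 *: (y - x + (y - x')) = y - 2^-1 *: (x + x').
  by apply/rowP => i; rewrite !mxE; field.
apply: le_trans; rewrite dotNl dotNr opprK mul1r.
rewrite [leRHS]mulrACA -sqrtrM ?mulr_ge0// -expRD mulrACA [gd _ * _]mulrC [gd _ * _]mulrC.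
by rewrite le_eqVlt; apply/orP; left; apply/eqP; congr (_ * expR _); field.
Qed.

Lemma measurable_post : measf (fun p : 'rV[R]_n * 'rV[R]_n => post p.1 p.2).
Proof.
apply: measurable_funM; first exact: (measurableT_comp mF measurable_snd).
apply: (measurableT_comp (@measurable_gd R n)); apply: measurable_rVD => //.
exact: measurable_rVN.
Qed.

Lemma post_integral (f : 'rV[R]_n * 'rV[R]_n -> \bar R) : measf f ->
  (forall p, 0 <= f p)%E ->
  (integral (pp P (gam n)) setT (fun p => f (p.1, (p.1 + p.2)%R)) =
   \int[leb]_y \int[leb]_x (f (x, y) * (post y x)%:E))%E.
Proof.
move=> mf f0.
have madd : measf (fun p : 'rV[R]_n * 'rV[R]_n => (p.1, p.1 + p.2)).
  by apply: measurable_fun_pair => //; exact: measurable_rVD.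
have mgd : measf (fun p : 'rV[R]_n * 'rV[R]_n => gd (p.2 - p.1)).
  apply: (measurableT_comp (@measurable_gd R n)); apply: measurable_rVD => //.
  exact: measurable_rVN.
rewrite tonelli1//; last exact: measurableT_comp.
pose k (p : 'rV[R]_n * 'rV[R]_n) := (f p * (gd (p.2 - p.1))%:E)%E.
have mk : measf k by apply: emeasurable_funM => //; exact/measurable_EFinP.
have k0 p : (0 <= k p)%E by rewrite mule_ge0// lee_fin gd_ge0.
have e1 x : (\int[gam n]_z f (x, (x + z)%R) = \int[leb]_y k (x, y))%E.
  have mfx := measurableT_comp (measurableT_comp mf madd) (pair1_measurable x).
  rewrite (gam_integral mfx (fun=> f0 _)).
  have mkx := measurableT_comp mk (pair1_measurable x).
  rewrite [RHS](law_ge0_integral (lebesgue_translation x) mkx (fun=> k0 _)).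
  by apply: eq_integral => z _; rewrite /k/= addrK addrC.
under eq_integral do rewrite /= e1.
have [_ _ Pd] := PF.
rewrite (dens_integral F0 mF Pd); [|exact: meas_inner|by move=> x; exact: integral_ge0].
transitivity (\int[leb]_x \int[leb]_y (k (x, y) * (F x)%:E))%E.
  apply: eq_integral => x _; rewrite ge0_integralZr//.
  - exact: (measurableT_comp mk (pair1_measurable x)).
  - by rewrite lee_fin.
have mkF : measf (fun p : 'rV[R]_n * 'rV[R]_n => k p * (F p.1)%:E)%E.
  apply: emeasurable_funM => //; apply/measurable_EFinP.
  exact: (measurableT_comp mF measurable_fst).
have kF0 (p : 'rV[R]_n * 'rV[R]_n) : (0 <= k p * (F p.1)%:E)%E by rewrite mule_ge0// lee_fin.
rewrite -(tonelli1 leb leb mkF kF0) (tonelli2 leb leb mkF kF0).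
apply: eq_integral => y _; apply: eq_integral => x _.
by rewrite /k /post /= -muleA -EFinM [F x * _]mulrC.
Qed.

(** Expectations of functions of [(X, X + Z)] are compared by comparing posterior integrals for
    every [y]; nonnegativity allows Tonelli in both orders. *)
Lemma post_le (g1 g2 : 'rV[R]_n * 'rV[R]_n -> R) C :
  measf g1 -> measf g2 ->
  (forall p, 0 <= g1 p <= C) -> (forall p, 0 <= g2 p <= C) ->
  (forall y, Ex leb (fun x => g1 (x, y) * post y x) <= Ex leb (fun x => g2 (x, y) * post y x)) ->
  Ex (pp P (gam n)) (fun p => g1 (p.1, p.1 + p.2)) <=
  Ex (pp P (gam n)) (fun p => g2 (p.1, p.1 + p.2)).
Proof.
move=> m1 m2 g1C g2C H.
have madd : measf (fun p : 'rV[R]_n * 'rV[R]_n => (p.1, p.1 + p.2)).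
  by apply: measurable_fun_pair => //; exact: measurable_rVD.
have Ig (g : 'rV[R]_n * 'rV[R]_n -> R) : measf g -> (forall p, 0 <= g p <= C) ->
    intg (pp P (gam n)) (fun p => g (p.1, p.1 + p.2)) /\
    forall y, intg leb (fun x => g (x, y) * post y x).
  move=> mg gC; split=> [|y].
    apply: (@intg_bdd _ _ _ _ _ C); first exact: measurableT_comp.
    by move=> p; have /andP[a b] := gC (p.1, p.1 + p.2); rewrite ger0_norm.
  have mgy : measf (fun x => g (x, y)).
    exact: (measurableT_comp mg (pair2_measurable y)).
  apply: intg_le (intgZ C (gdom_intg (post_gdom y))).
    by apply: measurable_funM => //; exact: gdom_meas (post_gdom y).
  move=> x; have /andP[a b] := gC (x, y).
  by rewrite normrM !ger0_norm ?post_ge0// ler_wpM2r// post_ge0.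
have [I1 J1] := Ig _ m1 g1C; have [I2 J2] := Ig _ m2 g2C.
rewrite -lee_fin -!ExE//.
have eq (g : 'rV[R]_n * 'rV[R]_n -> R) : measf g -> (forall p, 0 <= g p <= C) ->
    (integral (pp P (gam n)) setT (fun p => (g (p.1, (p.1 + p.2)%R))%:E) =
     \int[leb]_y \int[leb]_x ((g (x, y) * post y x)%:E))%E.
  move=> mg gC; rewrite (post_integral (f := fun p => (g p)%:E)).
  - by apply: eq_integral => y _; apply: eq_integral => x _; rewrite EFinM.
  - exact/measurable_EFinP.
  - by move=> p; rewrite lee_fin; case/andP: (gC p).
rewrite !eq//; have mi (g : 'rV[R]_n * 'rV[R]_n -> R) : measf g -> (forall p, 0 <= g p <= C) ->
    measf (fun y => \int[leb]_x (g (x, y) * post y x)%:E)%E.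
  move=> mg gC; apply: (meas_inner leb (f := fun p => (g (p.2, p.1) * post p.1 p.2)%:E)).
    apply/measurable_EFinP; apply: measurable_funM; last exact: measurable_post.
    apply: (measurableT_comp mg); exact: measurable_fun_pair.
  by move=> p; rewrite lee_fin mulr_ge0 ?post_ge0//; case/andP: (gC (p.2, p.1)).
apply: ge0_le_integral => //.
- by move=> y _; apply: integral_ge0 => x _; rewrite lee_fin mulr_ge0 ?post_ge0//; case/andP: (g1C (x, y)).
- exact: mi.
- exact: mi.
- by move=> y _; rewrite !ExE// lee_fin.
Qed.

(** The conditional expectation of [u (X)] given [X + Z = y]. *)
Definition pmean (u : 'rV[R]_n -> R) y : R :=
  Ex leb (fun x => u x * post y x) / Ex leb (post y).

Section pmean.
Variables (u : 'rV[R]_n -> R) (B : R).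
Hypotheses (mu : measf u) (uB : forall x, `|u x| <= B).

Let B0 : 0 <= B. Proof. exact: le_trans (normr_ge0 _) (uB 0). Qed.

Let p0 y : 0 < Ex leb (post y). Proof. exact/gdom_Ex_gt0/post_gdom. Qed.

Let Iu y : intg leb (fun x => u x * post y x).
Proof.
apply: intg_le (intgZ B (gdom_intg (post_gdom y))).
  by apply: measurable_funM => //; exact: gdom_meas (post_gdom y).
by move=> x; rewrite normrM (ger0_norm (post_ge0 _ _)) ler_wpM2r// post_ge0.
Qed.

Lemma pmeanE y c : Ex leb (fun x => (u x + c) * post y x) = (pmean u y + c) * Ex leb (post y).
Proof.
rewrite (_ : (fun _ => _) = (fun x => u x * post y x + c * post y x)); last first.
  by apply/funext => x; rewrite mulrDl.
have Ip := gdom_intg (post_gdom y).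
by rewrite ExD//; [rewrite ExZ// mulrDl mulfVK// gt_eqF|exact: intgZ].
Qed.

Lemma pmean_bdd y : `|pmean u y| <= B.
Proof.
have Ip := gdom_intg (post_gdom y).
rewrite normrM normfV (gtr0_norm (p0 y)) ler_pdivrMr// -ExZ//.
apply: (le_trans (Ex_abs (Iu y))); apply: Ex_le => [||x]; [exact: intg_abs|exact: intgZ|].
by rewrite normrM (ger0_norm (post_ge0 _ _)) ler_wpM2r// post_ge0.
Qed.

Lemma measurable_pmean : measf (pmean u).
Proof.
apply: measurable_funM.
  apply: (meas_Ex leb (f := fun p => u p.2 * post p.1 p.2)).
  by apply: measurable_funM; [exact: (measurableT_comp mu measurable_snd)|exact: measurable_post].
apply: measurable_pos_inv => //; exact: (meas_Ex leb (f := fun p => post p.1 p.2) measurable_post).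
Qed.

(** What later arguments use about the conditional expectation: it preserves the mean, it is an
    orthogonal projection, and the posterior Poincare inequality with constant 1/2, integrated over
    [y], bounds the lost variance. *)
Lemma pmean_law : [/\ Ex P (sm 1 1 (pmean u)) = Ex P u,
  Ex P (fun x => u x * sm 1 1 (pmean u) x) = Ex P (sm 1 1 (fun y => pmean u y ^+ 2)) &
  forall (L : 'rV[R]_n -> R) Lm C, measf L -> (forall x, 0 <= L x <= Lm) -> 0 <= C ->
    (forall x d, `|u (x + d) - u (x - d)| <= 2 * enorm d * (L x + C * enorm d)) ->
    2 * (Ex P (fun x => u x ^+ 2) - Ex P (sm 1 1 (fun y => pmean u y ^+ 2))) <=
    Ex P (fun x => L x ^+ 2)].
Proof.
set m := pmean u; have mm : measf m := measurable_pmean.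
have mE y c : Ex leb (fun x => (u x + c) * post y x) = (m y + c) * Ex leb (post y) := pmeanE y c.
have mB y : `|m y| <= B := pmean_bdd y.
clearbody m.
have m1 : measf (fun p : 'rV[R]_n * 'rV[R]_n => u p.1).
  exact: (measurableT_comp mu measurable_fst).
have m2 : measf (fun p : 'rV[R]_n * 'rV[R]_n => m p.2).
  exact: (measurableT_comp mm measurable_snd).
have mc (c : R) : measf (fun p : 'rV[R]_n * 'rV[R]_n => c) by exact: measurable_cst.
(* Adding [B] makes the functions nonnegative, as [post_le] requires; the shift cancels
   afterwards. *)
have uB' x : 0 <= u x + B <= 2 * B by have := uB x; rewrite ler_norml => /andP[? ?]; lra.
have mB' x : 0 <= m x + B <= 2 * B by have := mB x; rewrite ler_norml => /andP[? ?]; lra.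
have post_eq (g1 g2 : 'rV[R]_n * 'rV[R]_n -> R) C :
  measf g1 -> measf g2 ->
  (forall p, 0 <= g1 p <= C) -> (forall p, 0 <= g2 p <= C) ->
  (forall y, Ex leb (fun x => g1 (x, y) * post y x) = Ex leb (fun x => g2 (x, y) * post y x)) ->
  Ex (pp P (gam n)) (fun p => g1 (p.1, p.1 + p.2)) =
  Ex (pp P (gam n)) (fun p => g2 (p.1, p.1 + p.2)).
  move=> a b c d e; apply/eqP; rewrite eq_le; apply/andP.
  by split; apply: (@post_le _ _ C) => // y; rewrite e.
have toY (g : 'rV[R]_n -> R) (C : R) : measf g -> (forall x, `|g x| <= C) ->
    Ex (pp P (gam n)) (fun p => g (p.1 + p.2)) = Ex P (sm 1 1 g).
  move=> mg gC; rewrite -(Ex_mix 1 1 P mg gC); congr Ex; apply/funext => p.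
  by rewrite !scale1r.
have toX (g : 'rV[R]_n -> R) : measf g ->
    Ex (pp P (gam n)) (fun p => g p.1) = Ex P g by move=> mg; exact: Ex_fst.
have sqB (g : 'rV[R]_n -> R) : (forall x, `|g x| <= B) -> forall x, `|g x ^+ 2| <= B ^+ 2.
  by move=> gB x; rewrite normrX lerXn2r ?nnegrE.
have mm2 : measf (fun y => m y ^+ 2) by exact: measurable_funX.
have mY : measf (fun p : 'rV[R]_n * 'rV[R]_n => m (p.1 + p.2)).
  by apply: (measurableT_comp mm); exact: measurable_rVD.
have Im : intg (pp P (gam n)) (fun p => m (p.1 + p.2)) by exact: (@intg_bdd _ _ _ _ _ B).
have Iu1 : intg (pp P (gam n)) (fun p => u p.1) by exact: (@intg_bdd _ _ _ _ _ B).
have Ium : intg (pp P (gam n)) (fun p => u p.1 * m (p.1 + p.2)).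
  apply: (@intg_bdd _ _ _ _ _ (B * B)) => [|p]; first exact: measurable_funM.
  by rewrite normrM ler_pM.
have Imm : intg (pp P (gam n)) (fun p => m (p.1 + p.2) ^+ 2).
  by apply: (@intg_bdd _ _ _ _ _ (B ^+ 2)) => [|p]; [exact: measurable_funX|exact: sqB].
have Iuu : intg (pp P (gam n)) (fun p => u p.1 ^+ 2).
  by apply: (@intg_bdd _ _ _ _ _ (B ^+ 2)) => [|p]; [exact: measurable_funX|exact: sqB].
have e1 : Ex (pp P (gam n)) (fun p => m (p.1 + p.2)) = Ex (pp P (gam n)) (fun p => u p.1).
  have := post_eq (fun p => m p.2 + B) (fun p => u p.1 + B) (2 * B).
  rewrite !ExD ?Ex_cst//; try exact: intg_cst; move=> H; apply: (addIr B); apply: H => //.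
  - exact: measurable_funD.
  - exact: measurable_funD.
  - by move=> y /=; rewrite mE ExZ//; exact: gdom_intg (post_gdom y).
have e2 : Ex (pp P (gam n)) (fun p => u p.1 * m (p.1 + p.2)) =
    Ex (pp P (gam n)) (fun p => m (p.1 + p.2) ^+ 2).
  have := post_eq (fun p => (u p.1 + B) * (m p.2 + B)) (fun p => (m p.2 + B) ^+ 2) ((2 * B) ^+ 2).
  have -> : (fun p : 'rV[R]_n * 'rV[R]_n => (u (p.1, p.1 + p.2).1 + B) * (m (p.1, p.1 + p.2).2 + B)) =
     (fun p => u p.1 * m (p.1 + p.2) + B * (u p.1 + m (p.1 + p.2)) + B ^+ 2).
    by apply/funext => p /=; ring.
  have -> : (fun p : 'rV[R]_n * 'rV[R]_n => (m (p.1, p.1 + p.2).2 + B) ^+ 2) =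
     (fun p => m (p.1 + p.2) ^+ 2 + B * (m (p.1 + p.2) + m (p.1 + p.2)) + B ^+ 2).
    by apply/funext => p /=; ring.
  have I2 := intgZ B (intgD Iu1 Im); have I3 := intgZ B (intgD Im Im).
  rewrite !ExD//; try exact: intg_cst; try exact: intgD.
  rewrite !ExZ//; try exact: intgD; try exact: intg_cst.
  rewrite !ExD// e1 => H; apply: addIr; apply: addIr; apply: H.
  - by apply: measurable_funM; exact: measurable_funD.
  - by apply: measurable_funX; exact: measurable_funD.
  - move=> p; have /andP[a b] := uB' p.1; have /andP[c d] := mB' p.2.
    by rewrite mulr_ge0// expr2 ler_pM.
  - move=> p; have /andP[c d] := mB' p.2.
    by rewrite sqr_ge0 lerXn2r ?nnegrE// (le_trans c).
  - move=> y /=; have Ip := gdom_intg (post_gdom y).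
    rewrite ExZ// (_ : (fun x => _) = (fun x => (m y + B) * ((u x + B) * post y x))); last first.
      by apply/funext => x; ring.
    rewrite ExZ ?mE; first by rewrite mulrA expr2.
    rewrite (_ : (fun x => _) = (fun x => u x * post y x + B * post y x)); last first.
      by apply/funext => x; rewrite mulrDl.
    by apply: intgD => //; exact: intgZ.
split.
- by rewrite -(toY _ _ mm mB) e1 toX.
- rewrite -(toY _ _ mm2 (sqB _ mB)) -e2 (@pp_Ex R _ _ _ _ _ _ _ (B * B)) => [||p].
  + congr Ex; apply/funext => x /=; rewrite -ExZ; last first.
      have := L2_intg (mix_L2 1 1 mm mB x); exact.
    by congr Ex; apply/funext => z; rewrite !scale1r.
  + exact: measurable_funM.
  + by rewrite normrM ler_pM.
move=> L Lm C mL L01 C0 H; have cu := two_point_continuous L01 C0 H.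
rewrite -(toY _ _ mm2 (sqB _ mB)) -(toX (fun x => u x ^+ 2)); last exact: measurable_funX.
rewrite -(toX (fun x => L x ^+ 2)); last exact: measurable_funX.
have := @post_le (fun p => 2 * (u p.1 - m p.2) ^+ 2) (fun p => L p.1 ^+ 2)
   (Num.max (2 * (2 * B) ^+ 2) (Lm ^+ 2)).
rewrite /=; have -> : (fun p : 'rV[R]_n * 'rV[R]_n => 2 * (u p.1 - m (p.1 + p.2)) ^+ 2) =
   (fun p => 2 * (u p.1 ^+ 2 - 2 * (u p.1 * m (p.1 + p.2)) + m (p.1 + p.2) ^+ 2)).
  by apply/funext => p; congr (_ * _); ring.
have I2 := intgB Iuu (intgZ 2 Ium).
rewrite ExZ; last exact: intgD.
rewrite ExD// ExB//; last exact: intgZ.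
rewrite ExZ// e2 => G; suff: 2 * (Ex (pp P (gam n)) (fun p => u p.1 ^+ 2) -
   2 * Ex (pp P (gam n)) (fun p => m (p.1 + p.2) ^+ 2) +
   Ex (pp P (gam n)) (fun p => m (p.1 + p.2) ^+ 2)) <= Ex (pp P (gam n)) (fun p => L p.1 ^+ 2) by lra.
apply: G.
- apply: measurable_funM => //; apply: measurable_funX; exact: measurable_funB.
- by apply: measurable_funX; exact: (measurableT_comp mL measurable_fst).
- move=> p; rewrite mulr_ge0 ?sqr_ge0//= le_max; apply/orP; left.
  rewrite ler_pM2l// -real_normK ?num_real// lerXn2r ?nnegrE ?mulr_ge0//.
  by apply: (le_trans (ler_normB _ _)); rewrite mulr_natl mulr2n lerD.
- move=> p; rewrite sqr_ge0/= le_max; apply/orP; right.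
  by have /andP[a b] := L01 p.1; rewrite lerXn2r ?nnegrE// (le_trans a).
move=> y /=; rewrite (_ : (fun x => 2 * _ * _) = (fun x => 2 * ((u x - m y) ^+ 2 * post y x)));
  last by apply/funext => x; rewrite mulrA.
have mpy := gdom_meas (post_gdom y).
rewrite ExZ; last first.
  apply: intg_le (intgZ ((2 * B) ^+ 2) (gdom_intg (post_gdom y))).
    apply: measurable_funM => //; apply: measurable_funX; apply: measurable_funB => //; exact: measurable_cst.
  move=> x; rewrite ger0_norm; last by rewrite mulr_ge0 ?sqr_ge0 ?post_ge0.
  rewrite ler_wpM2r ?post_ge0//.
  rewrite -real_normK ?num_real// lerXn2r ?nnegrE ?mulr_ge0//.
  by apply: (le_trans (ler_normB _ _)); rewrite mulr_natl mulr2n lerD.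
apply: (@poincare R n (post y) (fun x => u x - m y) L 2 Lm C) => //.
- exact: post_gdom.
- exact: post_slc.
- by move=> x; apply: cvgB (cu x) (cvg_cst _).
- exists (2 * B), 0 => x; rewrite mul0r addr0 (le_trans (ler_normB _ _))//.
  by rewrite mulr_natl mulr2n lerD.
- move=> x dd; rewrite (_ : _ - _ = u (x + dd) - u (x - dd)); last by ring.
  exact: H.
- by have := mE y (- m y); rewrite subrr mul0r.
Qed.

End pmean.
End posterior.

(** * Stability of the Poincare inequality for regular functions *)

Section stability.
Context {R : realType} (n : nat).
Variables (P : probability 'rV[R]_n R) (F : 'rV[R]_n -> R).
Hypothesis PF : sdens P F.
Implicit Types (u : 'rV[R]_n -> R).

(** For a centred [u] this is the vector of covariances of [u] with the coordinates. *)
Definition mom (Q : probability 'rV[R]_n R) u : 'rV[R]_n := \row_i Ex Q (fun x => u x * x 0 i).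

Lemma dot_mom u a : L2 P u -> Ex P (fun x => u x * dot x a) = dot (mom P u) a.
Proof.
move=> Lu; have -> : (fun x => u x * dot x a) = (fun x => \sum_i a 0 i * (u x * x 0 i)).
  by apply/funext => x; rewrite mulr_sumr; apply: eq_bigr => i _; ring.
have Li i : L2 P (fun x : 'rV[R]_n => x 0 i).
  by have := sdens_L2_dot PF (delta_mx 0 i); congr L2; apply/funext => x; rewrite -coordE.
rewrite Ex_sum => [|i _]; last by apply: intgZ; exact: L2_mul.
by apply: eq_bigr => i _; rewrite mxE [RHS]mulrC -ExZ//; exact: L2_mul.
Qed.

Section smoothed.
Variables (m : 'rV[R]_n -> R) (B : R).
Hypotheses (mm : measf m) (mB : forall x, `|m x| <= B).

(** [m] plays the posterior mean, [b] is the slope of its smoothing [Am], and [eb] the average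
    slope. When [u] is linear with slope [a] and [P] is Gaussian, [Am] is [u / 2], and both [b] and
    [eb] equal [a / 2]. *)
Let Am := sm 1 1 m.
Let b := gsm 1 1 m.
Let eb : 'rV[R]_n := \row_i Ex P (fun x => b x 0 i).

Let B0 : 0 <= B. Proof. exact: le_trans (normr_ge0 _) (mB 0). Qed.

Let sq_le (t : R) : `|t| <= B -> t ^+ 2 <= B ^+ 2.
Proof. by move=> tB; rewrite -real_normK ?num_real// lerXn2r ?nnegrE. Qed.

Let Lb i : L2 P (fun x => b x 0 i).
Proof. by apply: (@L2_bdd _ _ _ _ _ B); [exact: measurable_gsm|move=> x; exact: gsm_bdd]. Qed.

Let bbE c : Ex P (fun x => dot (b x + c) (b x + c)) =
  Ex P (fun x => dot (b x) (b x)) + 2 * dot eb c + dot c c.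
Proof.
have Ib i : intg P (fun x => b x 0 i * b x 0 i) by exact: L2_mul.
have -> : (fun x => dot (b x + c) (b x + c)) =
    (fun x => \sum_i (b x 0 i * b x 0 i + (2 * c 0 i) * b x 0 i + c 0 i * c 0 i)).
  by apply/funext => x; apply: eq_bigr => i _; rewrite !mxE; ring.
have I1 i : intg P (fun x => (2 * c 0 i) * b x 0 i) by apply: intgZ; exact: L2_intg.
rewrite Ex_sum => [|i _]; last by apply: intgD; [exact: intgD|exact: intg_cst].
rewrite /dot Ex_sum// mulr_sumr -!big_split/=; apply: eq_bigr => i _.
rewrite ExD ?Ex_cst; [|exact: intgD|exact: intg_cst].
by rewrite ExD// ExZ ?mxE; [ring|exact: L2_intg].
Qed.

(* [D a <= 0] fails for no [a]: this is the Poincare inequality for [Am + a.X]. *)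
Let defect a : var P (fun x => Am x + dot x a) <=
  Ex P (fun x => dot (b x) (b x)) + 2 * dot eb a + dot a a.
Proof.
rewrite -bbE; have := sm_poincare 1 mm mB PF ltr01 a.
by rewrite divr1; under [X in _ <= Ex P X]funext do rewrite scale1r.
Qed.

Let Isq : intg P (sm 1 1 (fun y => m y ^+ 2)).
Proof.
apply: (@intg_bdd _ _ _ _ _ (B ^+ 2)) => [|x].
  by apply: measurable_sm; exact: measurable_funX.
apply: (@sm_bdd _ _ _ _ _ (B ^+ 2)) => [|y]; first exact: measurable_funX.
by rewrite ger0_norm ?sqr_ge0// sq_le.
Qed.

Let IA : intg P (fun x => Am x ^+ 2).
Proof.
apply: (@intg_bdd _ _ _ _ _ (B ^+ 2)) => [|x].
  by apply: measurable_funX; exact: measurable_sm.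
by rewrite ger0_norm ?sqr_ge0// sq_le// (@sm_bdd _ _ _ _ _ B).
Qed.

Let Ib2 : intg P (fun x => dot (b x) (b x)).
Proof.
by rewrite /dot; apply: intg_sum => i _; exact: L2_mul.
Qed.

Let half : R := Num.sqrt 2^-1.
Let half2 : half ^+ 2 = 2^-1. Proof. by rewrite sqr_sqrtr// invr_ge0. Qed.
Let half0 : 0 < half. Proof. by rewrite sqrtr_gt0 invr_gt0. Qed.

(* Splitting the noise into two independent halves and conditioning on the first
   turns the Bessel remainder into a bound on the fluctuations of the slope. *)
Let slope_var : 4^-1 * (Ex P (fun x => dot (b x) (b x)) - dot eb eb) <=
  Ex P (sm 1 1 (fun y => m y ^+ 2)) - Ex P (fun x => Am x ^+ 2) - Ex P (fun x => dot (b x) (b x)).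
Proof.
pose beta i y := gsm 1 half m y 0 i.
have mbeta i : measf (beta i) by exact: measurable_gsm.
have betaB i y : `|beta i y| <= B by exact: gsm_bdd.
have mg x : measf (fun z : 'rV[R]_n => m (1 *: x + 1 *: z)).
  by case: (mix_L2 1 1 mm mB x).
have gsmE x z : gsm half half (fun z => m (1 *: x + 1 *: z)) z = gsm 1 half m (1 *: x + half *: z).
  by apply/rowP => i; rewrite !mxE; congr Ex; apply/funext => y; rewrite !scale1r addrA.
have hh : half ^+ 2 + half ^+ 2 = 1 by rewrite half2; field.
have Lbeta i x := mix_L2 1 half (mbeta i) (betaB i) x.
have smb i x : sm 1 half (beta i) x = half * b x 0 i.
  have [+ _] := half_noise (mg x) (fun z => mB _) hh; move=> /(_ i) <-.
  by rewrite /sm; congr Ex; apply/funext => z; rewrite gsmE.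
have sms x : \sum_i sm 1 half (fun y => beta i y ^+ 2) x <=
    sm 1 1 (fun y => m y ^+ 2) x - Am x ^+ 2 - 2^-1 * dot (b x) (b x).
  have [_] := half_noise (mg x) (fun z => mB _) hh.
  have -> : (fun z => dot (gsm half half (fun z0 => m (1 *: x + 1 *: z0)) z -
        half *: grad (fun z0 => m (1 *: x + 1 *: z0)))
      (gsm half half (fun z0 => m (1 *: x + 1 *: z0)) z -
        half *: grad (fun z0 => m (1 *: x + 1 *: z0)))) =
    (fun z => \sum_i (beta i (1 *: x + half *: z) ^+ 2 -
       2 * half * b x 0 i * beta i (1 *: x + half *: z) + 2^-1 * (b x 0 i * b x 0 i))).
    apply/funext => z; rewrite gsmE; apply: eq_bigr => i _; rewrite -half2 /beta.
    by move: (gsm 1 half m _) => G; rewrite -/(gsm 1 1 m x) -/b !mxE; ring.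
  have I1 i : intg (gam n) (fun z => 2 * half * b x 0 i * beta i (1 *: x + half *: z)).
    by apply: intgZ; exact: L2_intg.
  have I2 i : intg (gam n) (fun z => beta i (1 *: x + half *: z) ^+ 2) := (Lbeta i x).2.
  rewrite Ex_sum => [|i _]; last by apply: intgD; [exact: intgB|exact: intg_cst].
  suff -> : \sum_i Ex (gam n) (fun z => beta i (1 *: x + half *: z) ^+ 2 -
       2 * half * b x 0 i * beta i (1 *: x + half *: z) + 2^-1 * (b x 0 i * b x 0 i)) =
     \sum_i sm 1 half (fun y => beta i y ^+ 2) x - 2^-1 * dot (b x) (b x).
    by rewrite -/(sm 1 1 m x) -/(gsm 1 1 m x) -/b -/Am /(sm _ _ (fun y => m y ^+ 2)); lra.
  rewrite /dot mulr_sumr -sumrB; apply: eq_bigr => i _.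
  rewrite ExD ?Ex_cst; [|exact: intgB|exact: intg_cst].
  rewrite ExB// ExZ; last exact: L2_intg.
  rewrite -/(sm 1 half (beta i) x) smb -/(sm 1 half (fun y => beta i y ^+ 2) x).
  have := half2; rewrite expr2 => h2.
  have -> : 2 * half * b x 0 i * (half * b x 0 i) = 2 * (half * half) * (b x 0 i * b x 0 i) by ring.
  by rewrite h2; field.
have I3 i : intg P (sm 1 half (fun y => beta i y ^+ 2)).
  have mb2 : measf (fun y => beta i y ^+ 2) by exact: measurable_funX.
  apply: (@intg_bdd _ _ _ _ _ (B ^+ 2)) => [|x]; first exact: measurable_sm.
  apply: (@sm_bdd _ _ _ _ _ (B ^+ 2)) => // y.
  by rewrite ger0_norm ?sqr_ge0// sq_le.
have key i : 3 / 4 * (Ex P (fun x => b x 0 i * b x 0 i) - eb 0 i * eb 0 i) <=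
    Ex P (sm 1 half (fun y => beta i y ^+ 2)) - 2^-1 * (eb 0 i * eb 0 i).
  have := sm_var_contract 1 (mbeta i) (betaB i) PF half0.
  have -> : sm 1 half (beta i) = (fun x => half * b x 0 i) by apply/funext => x; exact: smb.
  rewrite varZ// ExZ; last exact: L2_intg.
  rewrite exprMn half2 expr1n divr1 /var /cov [eb 0 i]mxE expr2.
  lra.
have I4 := intgB (intgB Isq IA) (intgZ 2^-1 Ib2).
have I5 : intg P (fun x => \sum_i sm 1 half (fun y => beta i y ^+ 2) x) by apply: intg_sum.
have := Ex_le I5 I4 sms.
rewrite Ex_sum// ExB; [|exact: intgB|exact: intgZ].
rewrite ExB// ExZ//.
have : 3 / 4 * (Ex P (fun x => dot (b x) (b x)) - dot eb eb) <=
    \sum_i Ex P (sm 1 half (fun y => beta i y ^+ 2)) - 2^-1 * dot eb eb.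
  rewrite [X in X - dot eb eb]Ex_sum => [|i _]; last exact: L2_mul.
  rewrite /dot -sumrB !mulr_sumr -sumrB; exact: ler_sum.
lra.
Qed.

Let bessel_le : Ex P (fun x => Am x ^+ 2) + Ex P (fun x => dot (b x) (b x)) <=
  Ex P (sm 1 1 (fun y => m y ^+ 2)).
Proof.
have := Ex_le (intgD IA Ib2) Isq (fun x => grad_sqr_le (mix_L2 1 1 mm mB x)).
by rewrite (ExD IA Ib2).
Qed.

(** Dictionary: [v] is the mean square of [u], [E] its energy, [ka], [tau] and [bb] are the mean
    squares of [m], [Am] and [b], [be] is the squared norm of [eb]; [c] and [cu] are the covariances
    of [Am] and [u] with the linear function of slope [eb], [w] is the variance of that function,
    and [mu2] is the squared norm of [mom P u]. In the linear Gaussian model [ka = v / 2] and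
    [tau = v / 4]; [k2] and [kq] measure the departure from it. *)
Let arith (v E ka tau bb c w be mu2 cu : R) : 0 <= E - v ->
  2 * (v - ka) <= E -> tau + bb <= ka -> 0 <= tau -> ka ^+ 2 <= tau * v -> 0 <= v ->
  tau <= bb -> tau - 2 * c + w <= bb - be -> tau - c + 4^-1 * w <= bb - 3 / 4 * be ->
  4^-1 * (bb - be) <= ka - tau - bb ->
  2 * (2 * cu) - 4 * be <= mu2 ->
  v - 4 * cu + 4 * w <= 2 * (v - 4 * ka + 4 * tau) + 8 * (tau - 2 * c + w) ->
  v - mu2 <= 38 * (E - v).
Proof.
move=> Q0 h1 h2 t0 cs v0 d0 d1 d2 sv hm hv.
have k2 : 2 * ka <= v.
  have [k0|k0] := leP ka 0; first lra.
  have : ka * ka <= v / 2 * ka by rewrite -expr2; nra.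
  by rewrite ler_pM2r//; lra.
(* Multiplied by [v]: [cs] gives [v * (ka - 2 * tau) <= ka * (v - 2 * ka)], where [ka <= v / 2] and
   [v - 2 * ka <= E - v]. *)
have kq : ka - 2 * tau <= (E - v) / 2.
  move: v0; rewrite le_eqVlt => /predU1P[v0|v0]; first by rewrite -v0 in h1 k2 cs Q0 *; lra.
  by rewrite -(ler_pM2l v0); nra.
lra.
Qed.

(** Passes from [u] to [2 * Am] by the posterior inequality and from [Am] to the linear function of
    slope [eb] by [defect] with slopes 0, [- eb] and [- eb / 2]. The vector [2 *: eb] then competes
    with [mom P u]. *)
Lemma stability_of_smoothing u (E : R) : measf u -> (forall x, `|u x| <= B) ->
  Ex P u = 0 -> Ex P (fun x => u x ^+ 2) <= E -> Ex P Am = 0 ->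
  Ex P (fun x => u x * Am x) = Ex P (sm 1 1 (fun y => m y ^+ 2)) ->
  2 * (Ex P (fun x => u x ^+ 2) - Ex P (sm 1 1 (fun y => m y ^+ 2))) <= E ->
  Ex P (fun x => u x ^+ 2) - dot (mom P u) (mom P u) <= 38 * (E - Ex P (fun x => u x ^+ 2)).
Proof.
move=> mu uB u0 uE A0 uA h1.
have Lu : L2 P u by exact: (@L2_bdd _ _ _ _ _ B).
have LA : L2 P Am by split => //; exact: measurable_sm.
pose X a := fun x : 'rV[R]_n => dot x a.
have LX a : L2 P (X a) := sdens_L2_dot PF a.
have vA : var P Am = Ex P (fun x => Am x ^+ 2) by rewrite varE A0 expr0n subr0.
have vu : var P u = Ex P (fun x => u x ^+ 2) by rewrite varE u0 expr0n subr0.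
have cuA : cov P u Am = Ex P (sm 1 1 (fun y => m y ^+ 2)) by rewrite /cov u0 mul0r subr0.
have cuX : cov P u (X eb) = dot (mom P u) eb by rewrite /cov u0 mul0r subr0 dot_mom.
have vAX (t : R) : var P (fun x => Am x + dot x (t *: eb)) =
    var P Am + 2 * t * cov P Am (X eb) + t ^+ 2 * var P (X eb).
  have -> : (fun x => Am x + dot x (t *: eb)) = (fun x => Am x + t * X eb x).
    by apply/funext => x; rewrite dotZr.
  by rewrite varD ?covZr ?varZ//; [ring|exact: L2Z].
have D t := defect (t *: eb).
apply: (@arith _ _ (Ex P (sm 1 1 (fun y => m y ^+ 2))) (Ex P (fun x => Am x ^+ 2))
  (Ex P (fun x => dot (b x) (b x))) (cov P Am (X eb)) (var P (X eb)) (dot eb eb) _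
  (dot (mom P u) eb)) => //.
- by rewrite subr_ge0.
- by apply: Ex_ge0 => x; exact: sqr_ge0.
- by rewrite -cuA -vA -vu mulrC cov_sqr_le.
- by apply: Ex_ge0 => x; exact: sqr_ge0.
- by have := D 0; rewrite vAX vA scale0r dot0r dot0l; lra.
- have := D (-1); rewrite vAX vA !dotZl !dotZr; lra.
- have := D (- 2^-1); rewrite vAX vA !dotZl !dotZr; lra.
- have := dot_ge0 (mom P u - 2 *: eb); rewrite dot_sqrB !dotZr dotZl; lra.
have L1 := L2B Lu (L2Z 2 LA); have L3 := L2B LA (LX eb).
have := varD_le L1 (L2Z 2 L3); rewrite varZ//.
have -> : (fun x => u x - 2 * Am x + 2 * (Am x - X eb x)) = (fun x => u x - 2 * X eb x).
  by apply/funext => x; ring.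
rewrite (varB Lu (L2Z 2 (LX eb))) (varB Lu (L2Z 2 LA)) varB// !covZr// !varZ//.
by rewrite vu vA cuA cuX; lra.
Qed.

End smoothed.

Lemma stability_nice u (L : 'rV[R]_n -> R) (B Lm C : R) :
  (forall x, `|u x| <= B) -> measf L -> (forall x, 0 <= L x <= Lm) -> 0 <= C ->
  (forall x d, `|u (x + d) - u (x - d)| <= 2 * enorm d * (L x + C * enorm d)) ->
  Ex P u = 0 ->
  Ex P (fun x => u x ^+ 2) - dot (mom P u) (mom P u) <=
  38 * (Ex P (fun x => L x ^+ 2) - Ex P (fun x => u x ^+ 2)).
Proof.
move=> uB mL L01 C0 H u0.
have cu := two_point_continuous L01 C0 H; have mu := continuous_measurable_rV cu.
have lu : lingrow u by exists B, 0 => x; rewrite mul0r addr0.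
have [_ pu] := sdens_poincare PF lu mL L01 C0 H.
have [e1 e2 e3] := pmean_law PF mu uB.
have st := stability_of_smoothing (measurable_pmean PF mu) (pmean_bdd PF mu uB) mu uB u0.
apply: st => //.
- by move: pu; rewrite varE u0 expr0n subr0.
- by rewrite e1.
- exact: (e3 L Lm C).
Qed.

End stability.

(** * Smooth functions, bumps and test functions *)

Section smooth_calculus.
Context {R : realType} (n : nat).
Implicit Types (f g : 'rV[R]_n -> R) (v x : 'rV[R]_n).

(** Recursive form of differentiability to order [k], so that closure under sums and products
    follows by induction on [k]. *)
Fixpoint smk k f : Prop :=
  if k is k'.+1 then (forall x, differentiable f x) /\ forall v, smk k' ('D_v f)
  else forall x, differentiable f x.

Lemma smk_diff k f x : smk k f -> differentiable f x.
Proof. by case: k => [|k] /=; [apply|case=> + _; apply]. Qed.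

Lemma smkW k f : smk k.+1 f -> smk k f.
Proof.
elim: k f => [|k IH] f [] // df Df; split => // v.
by apply: IH; exact: Df.
Qed.

Lemma smooth_D f v : smooth f -> smooth ('D_v f).
Proof. by move=> sf s x; have := sf (rcons s v) x; rewrite foldr_rcons. Qed.

Lemma smoothP f : smooth f <-> forall k, smk k f.
Proof.
split=> [sf k|sf s x].
  elim: k f sf => [|k IH] f sf; first by move=> x; exact: (sf [::]).
  by split=> [x|v]; [exact: (sf [::])|apply: IH; exact: smooth_D].
have : smk (size s) f by [].
elim/last_ind: s f {sf} => [|s v IH] f sf; first exact: sf.
by rewrite foldr_rcons; apply: IH; move: sf; rewrite size_rcons => -[_]; apply.
Qed.

Lemma smk_cst k (c : R) : smk k (fun=> c).
Proof.
elim: k c => [|k IH] c; first by move=> x; exact: differentiable_cst.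
split=> [x|v]; first exact: differentiable_cst.
rewrite (_ : 'D_v _ = fun=> 0)//; apply/funext => x; exact: (derive_cst c).
Qed.

Lemma smkD k f g : smk k f -> smk k g -> smk k (fun x => f x + g x).
Proof.
elim: k f g => [|k IH] f g sf sg; first by move=> x; exact: differentiableD.
have df x := smk_diff x sf; have dg x := smk_diff x sg.
split=> [x|v]; first exact: differentiableD.
rewrite (_ : 'D_v _ = fun x => 'D_v f x + 'D_v g x); last first.
  by apply/funext => x; apply: deriveD; exact: diff_derivable.
exact: IH (sf.2 v) (sg.2 v).
Qed.

Lemma derive_mul f g v x : differentiable f x -> differentiable g x ->
  'D_v (fun x => f x * g x) x = f x * 'D_v g x + g x * 'D_v f x.
Proof. by move=> df dg; apply: deriveM; exact: diff_derivable. Qed.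

Lemma smkM k f g : smk k f -> smk k g -> smk k (fun x => f x * g x).
Proof.
elim: k f g => [|k IH] f g sf sg; first by move=> x; exact: differentiableM.
have df x := smk_diff x sf; have dg x := smk_diff x sg.
split=> [x|v]; first exact: differentiableM.
rewrite (_ : 'D_v _ = fun x => f x * 'D_v g x + g x * 'D_v f x); last first.
  by apply/funext => x; exact: derive_mul.
exact: smkD (IH _ _ (smkW sf) (sg.2 v)) (IH _ _ (smkW sg) (sf.2 v)).
Qed.

Lemma smk_prod I (s : seq I) k (F : I -> 'rV[R]_n -> R) : (forall i, smk k (F i)) ->
  smk k (fun x => \prod_(i <- s) F i x).
Proof.
move=> sF; elim: s => [|i s IH].
  by under [X in smk k X]funext do rewrite big_nil; exact: smk_cst.
by under [X in smk k X]funext do rewrite big_cons; exact: smkM.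
Qed.

Lemma smooth_continuous f : smooth f -> continuous f.
Proof. by move=> sf x; apply: differentiable_continuous; exact: (sf [::]). Qed.

Lemma derive_coords f v x : differentiable f x ->
  'D_v f x = \sum_i v 0 i * 'D_(delta_mx 0 i) f x.
Proof.
move=> df; rewrite deriveE// [in LHS](row_sum_delta v) linear_sum.
by apply: eq_bigr => i _; rewrite linearZ /= -deriveE.
Qed.

Lemma line_derive f v x (t : R) : differentiable f (x + t *: v) ->
  is_derive t 1 (fun s => f (x + s *: v)) ('D_v f (x + t *: v)).
Proof.
move=> df; have e : (fun h : R => h^-1 *: (f (x + (h *: 1 + t) *: v) - f (x + t *: v))) =
    (fun h : R => h^-1 *: (f (h *: v + (x + t *: v)) - f (x + t *: v))).
  apply/funext => h; congr (_ *: (f _ - _)).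
  by rewrite scalerDl addrCA [h%:A]mulr1.
have /= dv : derivable f (x + t *: v) v by exact: diff_derivable.
by split; [rewrite /derivable/= e|rewrite /derive/= e].
Qed.

End smooth_calculus.

Section flat_function.
Context {R : realType}.
Implicit Types (p : {poly R}) (t : R).

(** The functions [p (1 / t) * exp (- 1 / t)] on the positive half-line. With a polynomial parameter
    the family is closed under differentiation, which proves smoothness of the flat function
    [hp 1]. *)
Definition hp p t : R := if 0 < t then p.[t^-1] * expR (- t^-1) else 0.

Lemma hp_gt0 t : (0 < hp 1 t) = (0 < t).
Proof. by rewrite /hp; case: ifP => //; rewrite ?ltxx// hornerC mul1r expR_gt0. Qed.

Lemma hp_ge0 t : 0 <= hp 1 t.
Proof. by rewrite /hp; case: ifP => // _; rewrite hornerC mul1r expR_ge0. Qed.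

Let exp_dom k : exists2 C : R, 0 <= C & forall s, 0 <= s -> s ^+ k <= C * expR s.
Proof.
case: k => [|k].
  by exists 1 => // s s0; rewrite expr0 mul1r -expR0 ler_expR.
exists (k.+1%:R ^+ k.+1) => [|s s0]; first exact: exprn_ge0.
have -> : s = k.+1%:R * (s / k.+1%:R) by field; rewrite addrC natr1.
rewrite exprMn ler_pM2l ?exprn_gt0// expRM_natl lerXn2r ?nnegrE ?expR_ge0 ?divr_ge0//.
by apply: le_trans (expR_ge1Dx _); rewrite lerDr.
Qed.

Let poly_dom p : exists2 C : R, 0 <= C & forall s, 0 <= s -> `|p.[s]| <= C * expR s.
Proof.
have [K KP] := choice (fun i : 'I_(size p) => let: ex_intro2 C C0 H := exp_dom i in
  ex_intro (fun C : R => 0 <= C /\ forall s, 0 <= s -> s ^+ i <= C * expR s) C (conj C0 H)).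
exists (\sum_(i < size p) `|p`_i| * K i) => [|s s0].
  by apply: sumr_ge0 => i _; rewrite mulr_ge0//; case: (KP i).
rewrite horner_coef mulr_suml; apply: (le_trans (ler_norm_sum _ _ _)).
apply: ler_sum => i _; rewrite normrM -mulrA ler_wpM2l//.
by rewrite ger0_norm ?exprn_ge0//; have [_] := KP i; exact.
Qed.

(** A quadratic bound at the origin gives the derivative zero there. *)
Lemma hp_bound p : exists2 C : R, 0 <= C & forall t, `|hp p t| <= C * t ^+ 2.
Proof.
have [C C0 pC] := poly_dom (p * 'X^2); exists C => // t; rewrite /hp.
case: ifP => [t0|_]; last by rewrite normr0 mulr_ge0// sqr_ge0.
have := pC t^-1; rewrite invr_ge0 (ltW t0) => /(_ isT).
rewrite hornerM hornerXn normrM (ger0_norm (exprn_ge0 _ _)) ?invr_ge0 ?(ltW t0)//.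
rewrite normrM (ger0_norm (expR_ge0 _)) expRN exprVn.
by rewrite ler_pdivrMr ?exprn_gt0// ler_pdivrMr ?expR_gt0// mulrAC.
Qed.

Lemma is_derive_hp p t : is_derive t 1 (hp p) (hp ('X^2 * (p - p^`())) t).
Proof.
have [t0|t0|->] := ltgtP t 0.
- have e : \forall s \near t, (fun=> 0) s = hp p s.
    near=> s; rewrite /hp; case: ifP => // s0; have : s < 0 by near: s; exact: lt_nbhsl.
    by move=> /(lt_trans s0); rewrite ltxx.
  apply: (near_eq_is_derive e); rewrite /hp ifF; last by apply/negbTE; rewrite -leNgt ltW.
  exact: is_derive_cst.
- have e : \forall s \near t, (fun s => p.[s^-1] * expR (- s^-1)) s = hp p s.
    near=> s; rewrite /hp ifT//; near: s; exact: lt_nbhsr.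
  apply: (near_eq_is_derive e); rewrite /hp t0.
  have d1 : is_derive t 1 (fun s : R => s^-1) (- t ^- 2).
    by have := @is_deriveV R id t 1 1 (lt0r_neq0 t0) (is_derive_id t 1); rewrite /GRing.scale /= mulr1.
  have d2 := is_derive1_comp (is_derive_poly p t^-1) d1.
  have d1' : is_derive t 1 (fun s : R => - s^-1) (- - t ^- 2) by exact: is_deriveN.
  have d3 := @is_derive1_comp R expR (fun s => - s^-1) t _ _ (is_derive_expR (- t^-1)) d1'.
  have d4 := is_deriveM d2 d3.
  apply: (is_derive_eq d4); rewrite /GRing.scale /= !hornerE /= exprVn.
  by ring.
- have [C C0 pC] := hp_bound p; rewrite [X in is_derive _ _ _ X]/hp ltxx.
  have l : (fun h : R => h^-1 *: (hp p (h *: 1 + 0) - hp p 0)) @ 0^' --> (0 : R).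
    apply/cvgr0Pnorm_le => e e0; near=> h.
    have h0 : h != 0 by near: h; exact: nbhs_dnbhs_neq.
    have he : `|h| <= e / (C + 1) by near: h; apply: dnbhs0_le; rewrite divr_gt0// ltr_wpDl.
    rewrite {2}/hp ltxx subr0 addr0 /GRing.scale /= mulr1 normrM normfV.
    rewrite ler_pdivrMl ?normr_gt0//; apply: (le_trans (pC _)).
    rewrite -real_normK ?num_real// expr2 mulrCA ler_wpM2l//.
    apply: (le_trans (ler_wpM2l C0 he)); rewrite mulrA ler_pdivrMr ?ltr_wpDl//.
    by rewrite mulrC ler_wpM2l ?(ltW e0)// lerDl.
  by split; [apply/cvg_ex; exists 0|exact: cvg_lim].
Unshelve. all: by end_near. Qed.

End flat_function.

Section bumps.
Context {R : realType} (n : nat).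

Lemma smk_hp k p (a b : R) (i : 'I_n) : smk k (fun x : 'rV[R]_n => hp p (a + b * x 0 i)).
Proof.
have dl (x : 'rV[R]_n) : differentiable (fun x : 'rV[R]_n => a + b * x 0 i) x.
  apply: differentiableD; first exact: differentiable_cst.
  by apply: differentiableM; [exact: differentiable_cst|exact: differentiable_coord].
have dh q (t : R) : differentiable (hp q) t.
  by apply/derivable1_diffP; case: (is_derive_hp q t).
have dhl q (x : 'rV[R]_n) : differentiable (fun x : 'rV[R]_n => hp q (a + b * x 0 i)) x.
  exact: (differentiable_comp (dl x) (dh q _)).
elim: k p => [|k IH] p; first by move=> x; exact: dhl.
split=> [x|v]; first exact: dhl.
rewrite (_ : 'D_v _ = fun x => (b * v 0 i) * hp ('X^2 * (p - p^`())) (a + b * x 0 i)); last first.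
  apply/funext => x.
  have d1 : is_derive (0 : R) 1 (fun t : R => a + b * (x + t *: v) 0 i) (b * v 0 i).
    rewrite (_ : (fun _ => _) = (fun t => (a + b * x 0 i) + (b * v 0 i) * t)); last first.
      by apply/funext => t; rewrite !mxE; ring.
    have := is_deriveD (is_derive_cst (a + b * x 0 i) (0 : R) 1)
      (is_deriveZ (b * v 0 i) (is_derive_id (0 : R) 1)).
    by rewrite add0r /GRing.scale/= mulr1.
  have d2 : is_derive (a + b * (x + 0 *: v) 0 i) 1 (hp p) (hp ('X^2 * (p - p^`())) (a + b * x 0 i)).
    by rewrite scale0r addr0; exact: is_derive_hp.
  have d3 := @is_derive1_comp R (hp p) (fun t => a + b * (x + t *: v) 0 i) 0 _ _ d2 d1.
  have := @line_derive R n (fun x => hp p (a + b * x 0 i)) v x 0.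
  rewrite scale0r addr0 => /(_ (dhl p x)) d4.
  rewrite [RHS]mulrC; have [_ <-] := d3; by have [_ <-] := d4.
by apply: smkM; [exact: smk_cst|exact: IH].
Qed.

(* Supported in the cube of centre [y] and half side [r]. *)
Definition bump (r : R) (y x : 'rV[R]_n) : R :=
  \prod_i (hp 1 ((1 - r^-1 * y 0 i) + r^-1 * x 0 i) *
           hp 1 ((1 + r^-1 * y 0 i) + (- r^-1) * x 0 i)).

Lemma smooth_bump r y : smooth (bump r y).
Proof. by apply/smoothP => k; apply: smk_prod => i; apply: smkM; exact: smk_hp. Qed.

Lemma bump_ge0 r y x : 0 <= bump r y x.
Proof. by apply: prodr_ge0 => i _; rewrite mulr_ge0 ?hp_ge0. Qed.

Lemma bump_gt0 r y x : 0 < r -> (0 < bump r y x) <-> forall i, `|x 0 i - y 0 i| < r.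
Proof.
move=> r0; have e i : (0 < hp 1 ((1 - r^-1 * y 0 i) + r^-1 * x 0 i) *
    hp 1 ((1 + r^-1 * y 0 i) + (- r^-1) * x 0 i)) = (`|x 0 i - y 0 i| < r).
  rewrite lt0r mulf_eq0 negb_or mulr_ge0 ?hp_ge0// andbT.
  have h (t : R) : (hp 1 t != 0) = (0 < t) by rewrite -hp_gt0 lt0r hp_ge0 andbT.
  have rE (t : R) : (0 < t) = (0 < r * t) by rewrite pmulr_rgt0.
  rewrite !h ltr_norml andbC (rE (_ + _ * _)) [in X in _ && X](rE (_ + _ * _)).
  have -> : r * (1 + r^-1 * y 0 i + - r^-1 * x 0 i) = r + y 0 i - x 0 i by field; exact: lt0r_neq0.
  have -> : r * (1 - r^-1 * y 0 i + r^-1 * x 0 i) = r - y 0 i + x 0 i by field; exact: lt0r_neq0.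
  by rewrite andbC; congr (_ && _); apply/idP/idP => ?; lra.
split=> [b0 i|H]; last by apply: prodr_gt0 => i _; rewrite e.
rewrite -e lt0r mulr_ge0 ?hp_ge0// andbT; apply: contraTN b0 => /eqP z.
by rewrite /bump (bigD1 i)//= z mul0r ltxx.
Qed.

Lemma bump_sym r (x y : 'rV[R]_n) : bump r y x = bump r x y.
Proof.
apply: eq_bigr => i _; rewrite mulrC; congr (hp _ _ * hp _ _); ring.
Qed.

Lemma bump_shift r (x y z : 'rV[R]_n) : bump r (y + z) (x + z) = bump r y x.
Proof. by apply: eq_bigr => i _; rewrite !mxE; congr (hp _ _ * hp _ _); ring. Qed.

Lemma test_of_support (f : 'rV[R]_n -> R) (K : R) : smooth f ->
  (forall x, f x != 0 -> forall i, `|x 0 i| <= K) -> test_function f.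
Proof.
move=> sf fK; split=> //.
have cK := @rV_compact _ n (fun=> `[- K, K]%classic) (fun=> @segment_compact R (- K) K).
apply: (subclosed_compact _ cK); first exact: closed_closure.
apply: (subset_trans (B := closure [set v : 'rV[R]_n | forall i, `[- K, K]%classic (v ord0 i)])).
  by apply: closure_subset => x /= /fK H i; rewrite /= in_itv /= -ler_norml.
by rewrite -(closure_id _).1//; exact: compact_closed.
Qed.

Lemma test_bump r y : 0 < r -> test_function (bump r y).
Proof.
move=> r0; apply: (@test_of_support _ (r + \sum_i `|y 0 i|)); first exact: smooth_bump.
move=> x fx i; have : 0 < bump r y x by rewrite lt0r fx bump_ge0.
move=> /(bump_gt0 y x r0)/(_ i) xy.
have : `|y 0 i| <= \sum_i `|y 0 i| by rewrite (bigD1 i)//= lerDl sumr_ge0.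
have := ler_normD (x 0 i - y 0 i) (y 0 i); rewrite subrK; lra.
Qed.

End bumps.

Section test_functions.
Context {R : realType} (n : nat).
Implicit Types (f g : 'rV[R]_n -> R) (v x d : 'rV[R]_n).

Lemma test_D f v : test_function f -> test_function ('D_v f).
Proof.
move=> [sf cf]; split; first exact: smooth_D.
apply: (subclosed_compact _ cf); first exact: closed_closure.
rewrite [X in _ `<=` X](closure_id _).1; last exact: closed_closure.
apply: closure_subset => x /= Df; apply: contrapT => nx; move: Df; apply/negP; rewrite negbK.
have e : \forall y \near x, f y = cst 0 y.
  have : nbhs x (~` closure [set x | f x != 0]).
    by apply: open_nbhs_nbhs; split => //; apply: closed_openC; exact: closed_closure.
  apply: filterS => y /= ny; apply/eqP; apply: contrapT => /negP fy; apply: ny.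
  exact: subset_closure.
by rewrite (near_eq_derive v e) (derive_cst (0 : R)).
Qed.

Lemma test_mul f g : smooth f -> test_function g -> test_function (fun x => f x * g x).
Proof.
move=> sf [sg cg]; split.
  by apply/smoothP => k; apply: smkM; [move/smoothP : sf|move/smoothP : sg].
apply: (subclosed_compact _ cg); first exact: closed_closure.
by apply: closure_subset => x /=; rewrite mulf_eq0 negb_or => /andP[].
Qed.

Lemma test_continuous f : test_function f -> continuous f.
Proof. by case=> sf _; exact: smooth_continuous. Qed.

Lemma test_meas f : test_function f -> measf f.
Proof. by move=> /test_continuous; exact: continuous_measurable_rV. Qed.

Lemma test_bounded f : test_function f -> exists2 M : R, 0 <= M & forall x, `|f x| <= M.
Proof.
move=> tf; have [sf cf] := tf.
have c : compact (f @` closure [set x | f x != 0]).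
  by apply: continuous_compact => //; apply: continuous_subspaceT; exact: test_continuous.
have [M [Mr HM]] := compact_bounded c.
exists (`|M| + 1) => [|x]; first by rewrite addr_ge0.
have [->|fx] := eqVneq (f x) 0; first by rewrite normr0 addr_ge0.
apply: HM; first by have := ler_norm M; lra.
by exists x => //; exact: subset_closure.
Qed.

Lemma test_support f : test_function f -> exists2 K : R, 0 <= K & forall x, K < enorm x -> f x = 0.
Proof.
move=> [_ cf]; have [M [Mr HM]] := compact_bounded cf.
exists (n%:R * (`|M| + 1)) => [|x xK]; first by rewrite mulr_ge0// addr_ge0.
apply/eqP; apply: contraTT xK => fx; rewrite -leNgt; apply: enorm_le_mul => i.
have : `|x| <= `|M| + 1.
  by apply: HM; [have := ler_norm M; lra|exact: subset_closure].
apply: le_trans; rewrite [leRHS]mx_normrE.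
exact: (le_bigmax _ (fun ij => `|x ij.1 ij.2|) (0, i)).
Qed.

Lemma mvt_abs (g g' : R -> R) (h M : R) : (forall t : R, is_derive t 1 g (g' t)) -> 0 <= h ->
  (forall t, 0 <= t <= h -> `|g' t| <= M) -> `|g h - g 0| <= M * h.
Proof.
move=> dg h0 gM; have [|t th ->] := @MVT_segment R g g' 0 h h0 (fun t _ => dg t).
- apply: continuous_subspaceT => x; apply: differentiable_continuous.
  by apply/derivable1_diffP; case: (dg x).
- rewrite subr0 normrM (ger0_norm h0) ler_wpM2r// gM//.
Qed.

Lemma test_line f v x (t : R) : test_function f ->
  is_derive t 1 (fun s => f (x + s *: v)) ('D_v f (x + t *: v)).
Proof. by case=> sf _; apply: line_derive; exact: (sf [::]). Qed.

Lemma test_derive_bound f : test_function f ->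
  exists2 K : R, 0 <= K & forall x d, `|'D_d f x| <= K * enorm d.
Proof.
move=> tf; have [K KP] := choice (fun i : 'I_n => let: ex_intro2 C C0 H :=
    test_bounded (test_D (delta_mx 0 i) tf) in
  ex_intro (fun C : R => 0 <= C /\ forall x, `|'D_(delta_mx 0 i) f x| <= C) C (conj C0 H)).
exists (\sum_(i < n) K i) => [|x d]; first by apply: sumr_ge0 => i _; case: (KP i).
rewrite derive_coords; last by case: tf => sf _; exact: (sf [::]).
apply: (le_trans (ler_norm_sum _ _ _)); rewrite mulr_suml; apply: ler_sum => i _.
by rewrite normrM mulrC ler_pM// ?coord_le_enorm//; case: (KP i).
Qed.

Lemma test_lip f : test_function f ->
  exists2 K : R, 0 <= K & forall x d, `|f (x + d) - f x| <= K * enorm d.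
Proof.
move=> tf; have [K K0 HK] := test_derive_bound tf; exists K => // x d.
have := @mvt_abs (fun s => f (x + s *: d)) (fun t => 'D_d f (x + t *: d)) 1 (K * enorm d)
  (fun t => test_line d x t tf) ler01 (fun t _ => HK _ _).
by rewrite scale1r scale0r addr0 mulr1.
Qed.

Lemma test_derive_lip f : test_function f ->
  exists2 K : R, 0 <= K & forall x v d, `|'D_v f (x + d) - 'D_v f x| <= K * enorm v * enorm d.
Proof.
move=> tf; have df x : differentiable f x by case: tf => sf _; exact: (sf [::]).
have [K KP] := choice (fun i : 'I_n => let: ex_intro2 C C0 H :=
    test_lip (test_D (delta_mx 0 i) tf) in
  ex_intro (fun C : R => 0 <= C /\ forall x d, `|'D_(delta_mx 0 i) f (x + d) -
     'D_(delta_mx 0 i) f x| <= C * enorm d) C (conj C0 H)).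
exists (\sum_(i < n) K i) => [|x v d]; first by apply: sumr_ge0 => i _; case: (KP i).
rewrite !(derive_coords v)// -sumrB !mulr_suml.
apply: (le_trans (ler_norm_sum _ _ _)); apply: ler_sum => i _.
rewrite -[X in `|X|]mulrBr normrM mulrAC mulrC.
by rewrite ler_pM ?coord_le_enorm//; case: (KP i).
Qed.

Let two_sided f x v (t : R) : test_function f ->
  is_derive t 1 (fun s => f (x + s *: v) - f (x - s *: v)) ('D_v f (x + t *: v) + 'D_v f (x - t *: v)).
Proof.
move=> tf; have d1 := test_line v x t tf; have d2 := test_line (- v) x t tf.
have := is_deriveB d1 d2; rewrite !scalerN.
have -> : 'D_(- v) f (x - t *: v) = - 'D_v f (x - t *: v).
  have df : differentiable f (x - t *: v) by case: tf => sf _; exact: (sf [::]).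
  by rewrite !deriveE// linearN.
rewrite opprK; congr is_derive; apply/funext => s.
by rewrite -[in RHS]scalerN.
Qed.

Lemma first_diff f : test_function f -> exists2 M : R, 0 <= M & forall x d,
  `|f (x + d) - f (x - d) - 2 * 'D_d f x| <= M * dot d d.
Proof.
move=> tf; have [K K0 HK] := test_derive_lip tf; exists (2 * K) => [|x d]; first by rewrite mulr_ge0.
have dq (t : R) : is_derive t 1 (fun s : R => f (x + s *: d) - f (x - s *: d) - 2 * 'D_d f x * s)
    ('D_d f (x + t *: d) + 'D_d f (x - t *: d) - 2 * 'D_d f x).
  apply: is_deriveB; first exact: two_sided.
  have := is_deriveZ (2 * 'D_d f x) (is_derive_id t (1 : R)).
  by rewrite [_ *: 1]mulr1.
have := mvt_abs dq ler01 (M := 2 * K * dot d d).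
rewrite !scale1r !scale0r subr0 addr0 subrr mulr0 mulr1 !subr0 mulr1; apply.
move=> t /andP[t0 t1].
have -> : 'D_d f (x + t *: d) + 'D_d f (x - t *: d) - 2 * 'D_d f x =
   ('D_d f (x + t *: d) - 'D_d f x) + ('D_d f (x - t *: d) - 'D_d f x) by ring.
apply: (le_trans (ler_normD _ _)).
have h1 := HK x d (t *: d); have h2 := HK x d (- (t *: d)).
have e : enorm (t *: d) <= enorm d by rewrite enormZ ger0_norm// ler_piMl// enorm_ge0.
have e' : enorm (- (t *: d)) <= enorm d by rewrite -scaleNr enormZ normrN ger0_norm// ler_piMl// enorm_ge0.
have Kd : 0 <= K * enorm d by rewrite mulr_ge0// enorm_ge0.
have := ler_wpM2l Kd e; have := ler_wpM2l Kd e'; rewrite -enorm_sqr expr2; lra.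
Qed.

(** The mean value theorem in the step [h] reduces the symmetric second difference to [first_diff]
    for the derivative ['D_v f]; the error is uniform in [x]. *)
Lemma second_diff f v : test_function f -> exists2 M : R, 0 <= M & forall x (h : R),
  `|f (x + h *: v) + f (x - h *: v) - 2 * f x - h ^+ 2 * 'D_v ('D_v f) x| <= M * `|h| ^+ 3.
Proof.
move=> tf; have [M M0 HM] := first_diff (test_D v tf).
exists (M * dot v v) => [|x h]; first by rewrite mulr_ge0// dot_ge0.
wlog h0 : h / 0 <= h.
  move=> H; have [/H//|h0] := leP 0 h.
  have := H (- h); rewrite oppr_ge0 (ltW h0) => /(_ isT).
  by rewrite !scaleNr opprK sqrrN normrN [f (x - _) + _]addrC.
have dq (t : R) : is_derive t 1 (fun s : R => f (x + s *: v) + f (x - s *: v) - s * s * 'D_v ('D_v f) x)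
    ('D_v f (x + t *: v) - 'D_v f (x - t *: v) - 2 * t * 'D_v ('D_v f) x).
  apply: is_deriveB.
    have d1 := test_line v x t tf; have d2 := test_line (- v) x t tf.
    have := is_deriveD d1 d2; rewrite !scalerN.
    have -> : 'D_(- v) f (x - t *: v) = - 'D_v f (x - t *: v).
      have df : differentiable f (x - t *: v) by case: tf => sf _; exact: (sf [::]).
      by rewrite !deriveE// linearN.
    by congr is_derive; apply/funext => s; rewrite -[in RHS]scalerN.
  have d1 := is_deriveM (is_derive_id t (1 : R)) (is_derive_id t (1 : R)).
  have := is_deriveM d1 (is_derive_cst ('D_v ('D_v f) x) t (1 : R)).
  rewrite (_ : _ *: 0 + _ = 2 * t * 'D_v ('D_v f) x)//.
  by rewrite /GRing.scale /= /cst; ring.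
have := mvt_abs dq h0 (M := M * (h ^+ 2 * dot v v)).
rewrite !scale0r subr0 addr0 mul0r mul0r subr0 => H.
have -> : f (x + h *: v) + f (x - h *: v) - 2 * f x - h ^+ 2 * 'D_v ('D_v f) x =
  f (x + h *: v) + f (x - h *: v) - h * h * 'D_v ('D_v f) x - (f x + f x) by ring.
rewrite (ger0_norm h0) (_ : M * dot v v * h ^+ 3 = M * (h ^+ 2 * dot v v) * h); last by ring.
apply: H => t /andP[t0 th]; have := HM x (t *: v).
have -> : 'D_(t *: v) ('D_v f) x = t * 'D_v ('D_v f) x.
  have df : differentiable ('D_v f) x by case: (test_D v tf) => sf _; exact: (sf [::]).
  by rewrite !deriveE// linearZ.
rewrite [2 * (t * _)]mulrA => H; apply: (le_trans H); rewrite ler_wpM2l// dotZl dotZr mulrA -expr2.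
by rewrite ler_wpM2r ?dot_ge0// lerXn2r ?nnegrE.
Qed.

End test_functions.

(** * Continuity of translations in the mean *)

Lemma le_of_sqr (R : realType) (a b : R) : 0 <= b -> a ^+ 2 <= b ^+ 2 -> a <= b.
Proof.
move=> b0; have [a0 _|a0] := leP a 0; first exact: le_trans b0.
by rewrite ler_pXn2r// nnegrE ltW.
Qed.

Import HBNNSimple.

(** The nonnegative function [f + B] is approximated instead of [f]; finite lists of weighted sets
    allow inductions over simple functions. *)
Lemma simple_approx d (T : measurableType d) (R : realType) (f : T -> R) (B : R) :
  measf f -> (forall x, `|f x| <= B) ->
  exists h : nat -> T -> R, [/\ forall k x, `|h k x| <= B + B,
    forall x, h k x @[k --> \oo] --> f x + B &
    forall k, exists2 s : seq (R * set T), (forall p, List.In p s -> measurable p.2) &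
      h k = fun x => \sum_(p <- s) p.1 * \1_(p.2) x].
Proof.
move=> mf fB; pose g x := (f x + B)%:E.
have g0 x : (0 <= g x)%E by rewrite lee_fin; have := fB x; rewrite ler_norml => /andP[+ _]; lra.
have mg : measf g.
  by apply/measurable_EFinP; apply: measurable_funD => //; exact: measurable_cst.
pose h := nnsfun_approx measurableT mg; exists (fun k x => h k x).
have hg x : h k x @[k --> \oo] --> f x + B.
  have c : (EFin \o h k) x @[k --> \oo] --> g x.
    by apply: cvg_nnsfun_approx => // y _; exact: g0.
  by move/fine_cvgP : c => [_].
have nd x : {homo (fun k => h k x) : a b / (a <= b)%N >-> a <= b}.
  by move=> a b ab; exact/lefP/nd_nnsfun_approx.
split=> // [k x|k].
  rewrite ger0_norm//; have := nondecreasing_cvgn_le (nd x) (cvgP _ (hg x)) k.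
  rewrite (cvg_lim _ (hg x))// => /le_trans; apply.
  by rewrite lerD2r (le_trans (ler_norm _)).
exists [seq (y, h k @^-1` [set y]) | y <- finmap.enum_fset (fset_set (range (h k)))].
  by elim: (finmap.enum_fset _) => //= y s IH p [<- /=|/IH//].
by apply/funext => x; rewrite big_map fimfunE fsbig_finite.
Qed.

Section translation_continuity.
Context {R : realType} (n : nat).
Implicit Types (f g : 'rV[R]_n -> R) (x z : 'rV[R]_n).

(** Stated for the Gaussian, for which bounded functions are integrable and which a translation
    changes only by the density [cm]. *)
Definition tcont f : Prop := forall e : R, 0 < e -> exists2 d : R, 0 < d &
  forall z, enorm z <= d -> Ex (gam n) (fun x => `|f (x + z) - f x|) <= e.

Definition tc f : Prop :=
  [/\ measf f, exists B : R, forall x, `|f x| <= B & tcont f].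

Lemma measurable_shift f z : measf f -> measf (fun x => f (x + z)).
Proof.
by move=> mf; apply: measurableT_comp mf _; apply: measurable_rVD => //; exact: measurable_cst.
Qed.

Let diff_intg f (B : R) z : measf f -> (forall x, `|f x| <= B) ->
  intg (gam n) (fun x => `|f (x + z) - f x|).
Proof.
move=> mf fB; apply: (@intg_bdd _ _ _ _ _ (B + B)).
  by apply: measurableT_comp => //; apply: measurable_funB => //; exact: measurable_shift.
by move=> x; rewrite normr_id (le_trans (ler_normB _ _))// lerD.
Qed.

(* Translation continuity passes to any function controlled pointwise by the
   increments of two functions that have it. *)
Lemma tc_control f g (h : 'rV[R]_n -> R) (A : R) : tc f -> tc g -> measf h -> 0 < A ->
  (exists B : R, forall x, `|h x| <= B) ->
  (forall x y, `|h y - h x| <= A * (`|f y - f x| + `|g y - g x|)) -> tc h.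
Proof.
move=> [mf [Bf fB] tf] [mg [Bg gB] tg] mh A0 [Bh hB] H; split=> //; first by exists Bh.
move=> e e0; have e2 : 0 < e / (2 * A) by rewrite divr_gt0// mulr_gt0.
have [d d0 fd] := tf _ e2; have [d' d'0 gd] := tg _ e2.
exists (Num.min d d') => [|z]; first by rewrite lt_min d0.
rewrite le_min => /andP[zd zd'].
have If := diff_intg z mf fB; have Ig := diff_intg z mg gB.
apply: (le_trans (Ex_le (diff_intg z mh hB) (intgZ A (intgD If Ig)) (fun x => H x (x + z)))).
rewrite ExZ; last exact: intgD.
rewrite ExD// mulrC -ler_pdivlMr//; have := fd z zd; have := gd z zd'.
have -> : e / A = e / (2 * A) + e / (2 * A) by field; exact: lt0r_neq0.
lra.
Qed.

Lemma tc_lip f (K B : R) : measf f -> (forall x, `|f x| <= B) -> 0 <= K ->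
  (forall x z, `|f (x + z) - f x| <= K * enorm z) -> tc f.
Proof.
move=> mf fB K0 H; split=> //; first by exists B.
move=> e e0; exists (e / (K + 1)) => [|z ze]; first by rewrite divr_gt0// ltr_wpDl.
rewrite -[leRHS](Ex_cst (gam n)); apply: Ex_le => [||x]; [exact: diff_intg fB|exact: intg_cst|].
apply: (le_trans (H x z)); apply: (le_trans (ler_wpM2l K0 ze)).
rewrite mulrCA ler_piMr ?(ltW e0)// ler_pdivrMr ?ltr_wpDl// mul1r lerDl//.
Qed.

Lemma tc_cst (c : R) : tc (fun=> c).
Proof.
apply: (@tc_lip _ 0 `|c|) => // x z.
by rewrite subrr normr0 mul0r.
Qed.

Lemma tcD f g : tc f -> tc g -> tc (fun x => f x + g x).
Proof.
move=> tf tg; have [mf [B fB] _] := tf; have [mg [C gC] _] := tg.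
apply: (tc_control (A := 1) tf tg) => //; first exact: measurable_funD.
  by exists (B + C) => x; rewrite (le_trans (ler_normD _ _))// lerD.
move=> x y; rewrite mul1r (_ : _ - _ = (f y - f x) + (g y - g x)); last by ring.
exact: ler_normD.
Qed.

Lemma tcM f g : tc f -> tc g -> tc (fun x => f x * g x).
Proof.
move=> tf tg; have [mf [B fB] _] := tf; have [mg [C gC] _] := tg.
have B0 : 0 <= B := le_trans (normr_ge0 _) (fB 0).
have C0 : 0 <= C := le_trans (normr_ge0 _) (gC 0).
apply: (tc_control (A := B + C + 1) tf tg); [exact: measurable_funM|lra| |].
  by exists (B * C) => x; rewrite normrM ler_pM.
move=> x y; rewrite (_ : _ - _ = (f y - f x) * g y + f x * (g y - g x)); last by ring.
apply: (le_trans (ler_normD _ _)); rewrite !normrM.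
have h1 := ler_wpM2l (normr_ge0 (f y - f x)) (gC y).
have h2 := ler_wpM2r (normr_ge0 (g y - g x)) (fB x).
have := mulr_ge0 B0 (normr_ge0 (f y - f x)); have := mulr_ge0 C0 (normr_ge0 (g y - g x)).
have := normr_ge0 (f y - f x); have := normr_ge0 (g y - g x); lra.
Qed.

(** The convergence also holds in the Gaussian mean square; Cauchy-Schwarz against [cm z] carries
    this error over to all translates with [enorm z <= 1], at the price of a constant factor. *)
Lemma tc_lim (f : nat -> 'rV[R]_n -> R) (h : 'rV[R]_n -> R) (B : R) : (forall k, tc (f k)) ->
  (forall k x, `|f k x| <= B) -> (forall x, f k x @[k --> \oo] --> h x) -> tc h.
Proof.
move=> tf fB fh; have mf k : measf (f k) by case: (tf k).
have mh : measf h by apply: measurable_fun_cvg mf _ => x _; exact: fh.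
have hB x : `|h x| <= B.
  apply/ler_addgt0Pl => e e0.
  have [k _ /(_ k (leqnn k)) kP] := (cvgrPdist_le _ _).1 (fh x) e e0.
  by rewrite -(subrK (f k x) (h x)) (le_trans (ler_normD _ _))// lerD.
split=> //; first by exists B.
move=> e e0; pose s := e / (3 * expR 1).
have s0 : 0 < s by rewrite divr_gt0// mulr_gt0// expR_gt0.
have [_ c] : intg (gam n) (fun=> 0 : R) /\
    Ex (gam n) (fun x => (f k x - h x) ^+ 2) @[k --> \oo] --> Ex (gam n) (fun=> 0 : R).
  apply: (@Ex_dct _ _ _ _ _ _ (fun=> (B + B) ^+ 2)) => [k|x||k x].
  - by apply: measurable_funX; exact: measurable_funB.
  - rewrite -[X in _ --> X](expr0n _ 2) -[X in X ^+ 2](subrr (h x)).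
    rewrite !expr2; under eq_fun do rewrite expr2.
    by apply: cvgM; apply: cvgB => //; exact: cvg_cst.
  - exact: intg_cst.
  - rewrite normrX lerXn2r ?nnegrE ?(le_trans _ (lerD (fB k x) (hB x))) ?addr_ge0//.
    exact: ler_normB.
rewrite Ex_cst in c; have [k _ /(_ k (leqnn k)) kP] := (cvgrPdist_le _ _).1 c (s ^+ 2) (exprn_gt0 2 s0).
have {kP} Es : Ex (gam n) (fun x => (f k x - h x) ^+ 2) <= s ^+ 2.
  by apply: le_trans kP; rewrite sub0r normrN ler_norm.
pose g x := `|f k x - h x|.
have mg : measf g.
  by apply: measurableT_comp => //; exact: measurable_funB.
have Lg : L2 (gam n) g.
  apply: (@L2_bdd _ _ _ _ _ (B + B)) => // x.
  by rewrite normr_id (le_trans (ler_normB _ _))// lerD.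
have Eg z : enorm z <= 1 -> Ex (gam n) (fun x => g (x + z)) <= s * expR 1.
  move=> z1; have [_ ->] := gam_shift z mg; have Lc := L2_cm z.
  apply: le_of_sqr; first by rewrite mulr_ge0 ?expR_ge0// (ltW s0).
  apply: (le_trans (cauchy_schwarz Lg.1 Lc.1 Lg.2 Lc.2)); rewrite exprMn.
  have -> : Ex (gam n) (fun x => cm z x ^+ 2) = expR (dot z z).
    have -> : (fun y => cm z y ^+ 2) = (fun y => expR (dot z z) * cm (2 *: z) y).
      by apply/funext => y; rewrite /cm -expRM_natl -expRD; congr expR; rewrite !dotZr dotZl; field.
    by have [i1 i2] := gam_cm (2 *: z); rewrite ExZ// i2 mulr1.
  apply: ler_pM; [by apply: Ex_ge0 => x; exact: sqr_ge0|exact: expR_ge0| |].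
    by under eq_fun do rewrite real_normK ?num_real//.
  by rewrite -expRM_natl ler_expR -enorm_sqr; have := enorm_ge0 z; nra.
have [_ _ tk] := tf k; have [d d0 Hd] := tk _ (divr_gt0 e0 (ltr0n R 3)).
exists (Num.min d 1) => [|z]; first by rewrite lt_min d0 ltr01.
rewrite le_min => /andP[zd z1].
have If := diff_intg z (mf k) (fB k).
have Igz : intg (gam n) (fun x => g (x + z)).
  apply: (@intg_bdd _ _ _ _ _ (B + B)); first exact: measurable_shift.
  by move=> x; rewrite normr_id (le_trans (ler_normB _ _))// lerD.
have H x : `|h (x + z) - h x| <= `|f k (x + z) - f k x| + (g (x + z) + g x).
  rewrite /g (_ : h _ - h x = (f k (x + z) - f k x) - (f k (x + z) - h (x + z)) + (f k x - h x)).
    by apply: (le_trans (ler_normD _ _)); rewrite addrA lerD2r ler_normB.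
  by ring.
have Ig := L2_intg Lg.
apply: (le_trans (Ex_le (diff_intg z mh hB) (intgD If (intgD Igz Ig)) H)).
rewrite ExD//; last exact: intgD.
rewrite ExD//; have := Hd z zd; have := Eg z z1.
have := Eg 0; rewrite {1}/enorm dot0l sqrtr0 ler01 => /(_ isT).
under [X in Ex _ X <= _]funext do rewrite addr0.
have : s * expR 1 = e / 3 by rewrite /s; field; rewrite lt0r_neq0// expR_gt0.
by lra.
Qed.

(** Reduces indicators of measurable sets to those of generators. The map [p] is used as the
    identity, for sets of vectors, and as a coordinate, for sets of reals. *)
Let tc_sigma (D : Type) (p : 'rV[R]_n -> D) :
  sigma_algebra setT [set A : set D | tc (fun x => (\1_A (p x) : R))].
Proof.
split=> [|A tA|F tF] /=.
- by under [X in tc X]funext do rewrite indic0; exact: tc_cst.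
- rewrite (_ : (fun _ => _) = (fun x => 1 + (- 1) * \1_A (p x))).
    exact: tcD (tc_cst 1) (tcM (tc_cst (-1)) tA).
  by apply/funext => x; rewrite setTD !indicE in_setC; case: (_ \in A); rewrite /=; ring.
- pose G k x : R := \prod_(i < k) (1 + (- 1) * \1_(F i) (p x)).
  have G01 k x : 0 <= G k x <= 1.
    elim: k => [|k IH]; first by rewrite /G big_ord0 ler01 lexx.
    rewrite /G big_ord_recr /= indicE; case: (_ \in F k); rewrite /=.
      by rewrite mulN1r subrr mulr0 lexx ler01.
    by rewrite mulr0 addr0 mulr1.
  have tG k : tc (G k).
    elim: k => [|k IH].
      by rewrite (_ : G 0%N = fun=> 1); [exact: tc_cst|apply/funext => x; rewrite /G big_ord0].
    rewrite (_ : G k.+1 = fun x => G k x * (1 + (- 1) * \1_(F k) (p x))).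
      exact: tcM IH (tcD (tc_cst 1) (tcM (tc_cst (-1)) (tF k))).
    by apply/funext => x; rewrite /G big_ord_recr.
  apply: (@tc_lim (fun k x => 1 + (- 1) * G k x) _ 1) => [k|k x|x].
  + exact: tcD (tc_cst 1) (tcM (tc_cst (-1)) (tG k)).
  + by have /andP[a b] := G01 k x; rewrite ger0_norm; lra.
  rewrite indicE; case: (boolP (_ \in _)) => [|nx].
    rewrite in_setE => -[k _ Fk]; apply: cvg_near_cst.
    exists k.+1 => //= m km; rewrite /G (bigD1 (Ordinal km))//= indicE mem_set//.
    by rewrite (_ : 1 + -1 * true%:R = 0) ?mul0r ?mulr0 ?addr0//= mulr1; ring.
  rewrite (_ : (fun _ => _) = fun=> 0); first exact: cvg_cst.
  apply/funext => k; rewrite /G big1 ?mulN1r ?subrr// => i _.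
  rewrite indicE memNset ?mulr0 ?addr0// => Fi; move/negP : nx; apply.
  by rewrite inE; exists i.
Qed.

Lemma tc_indic (A : set 'rV[R]_n) : measurable A -> tc (fun x => (\1_A x : R)).
Proof.
move=> mA; apply: (smallest_sub (tc_sigma id) _ mA) => {A mA} B.
rewrite -bigcup_seq/= => -[i _ [C mC <-]] /=.
have -> : (fun x : 'rV[R]_n => \1_(setT `&` (fun x0 => x0 0 i) @^-1` C) x : R) =
    (fun x : 'rV[R]_n => \1_C (x 0 i)).
  by apply/funext => x; rewrite !indicE setTI.
have {}mC : (@RGenOInfty.G R).-sigma.-measurable C by rewrite -RGenOInfty.measurableE.
apply: (smallest_sub (tc_sigma (fun x : 'rV[R]_n => x 0 i)) _ mC) => {C mC} C [a ->] /=.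
(* Lipschitz ramps that increase to the indicator of the open half-line above [a]. *)
pose t k (x : 'rV[R]_n) : R := Num.min 1 (k%:R * Num.max 0 (x 0 i - a)).
have t01 k x : 0 <= t k x <= 1.
  by rewrite le_min ler01 mulr_ge0 ?le_max ?lexx//= ge_min lexx.
apply: (@tc_lim t _ 1) => [k|k x|x].
- apply: (@tc_lip _ k%:R 1) => // [|x|x z].
  + apply: measurable_minr; first exact: measurable_cst.
    apply: measurable_funM; first exact: measurable_cst.
    apply: measurable_maxr; first exact: measurable_cst.
    by apply: measurable_funB; [exact: measurable_coord|exact: measurable_cst].
  + by have /andP[a0 a1] := t01 k x; rewrite ger0_norm.
  + apply: (@le_trans _ _ (k%:R * `|z 0 i|)); last by rewrite ler_wpM2l// coord_le_enorm.
    rewrite /t mxE; have k0 : 0 <= k%:R :> R by []; move: (k%:R) k0 (x 0 i) (z 0 i) => K K0 u v.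
    have l1 (b b' : R) : `|Num.min 1 b - Num.min 1 b'| <= `|b - b'|.
      have n1 := ler_norm (b - b'); have n2 := ler_norm (b' - b); rewrite distrC in n2.
      by case: (leP 1 b) => ?; case: (leP 1 b') => ?; rewrite ler_norml; lra.
    apply: (le_trans (l1 _ _)); rewrite -mulrBr normrM ger0_norm// ler_wpM2l//.
    have n1 := ler_norm v; have n2 := ler_norm (- v); rewrite normrN in n2.
    by case: (leP 0 (u + v - a)) => ?; case: (leP 0 (u - a)) => ?; rewrite ler_norml; lra.
- by have /andP[a0 a1] := t01 k x; rewrite ger0_norm.
rewrite indicE mem_setE in_itv/= andbT; have [xa|xa] := ltP a (x 0 i); last first.
  rewrite (_ : (fun _ => _) = fun=> 0); first exact: cvg_cst.
  apply/funext => k; rewrite /t max_l ?subr_le0// mulr0 min_r ?ler01//.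
have u0 : 0 < x 0 i - a by rewrite subr_gt0.
apply: cvg_near_cst; exists (Num.trunc (x 0 i - a)^-1).+1 => // k /= Nk.
rewrite /t (max_r (ltW u0)) min_l// -ler_pdivrMr// div1r.
by apply: (le_trans (ltW (truncnS_gt _))); rewrite ler_nat.
Qed.

Lemma tc_bounded f (B : R) : measf f -> (forall x, `|f x| <= B) -> tc f.
Proof.
move=> mf fB; have [h [hB hf hs]] := simple_approx mf fB.
have th k : tc (h k).
  have [s ms ->] := hs k; elim: s ms => [|[y A] s IH] ms.
    by under [X in tc X]funext do rewrite big_nil; exact: tc_cst.
  under [X in tc X]funext do rewrite big_cons; apply: tcD.
    by apply: tcM; [exact: tc_cst|apply: tc_indic; apply: (ms (y, A)); left].
  by apply: IH => p ps; apply: ms; right.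
have tg : tc (fun x => f x + B) by apply: (tc_lim th hB).
have := tcD tg (tc_cst (- B)); congr tc; apply/funext => x; ring.
Qed.

End translation_continuity.

Section lebesgue_translation_continuity.
Context {R : realType} (n : nat).
Implicit Types (f g : 'rV[R]_n -> R) (x z : 'rV[R]_n).
Local Notation leb := (lebesgue_rV R n).

Variable p : nat.
Hypothesis p12 : (0 < p <= 2)%N.

Let pE : p = 1%N \/ p = 2%N.
Proof. by move: p12; case: p => [|[|[|q]]]//; [left|right]. Qed.

Lemma pow3 (a b c : R) : `|a + b + c| ^+ p <= 3 * (`|a| ^+ p + `|b| ^+ p + `|c| ^+ p).
Proof.
have := ler_normD (a + b) c; have := ler_normD a b.
have := normr_ge0 a; have := normr_ge0 b; have := normr_ge0 c.
case: pE => ->; first by rewrite !expr1; lra.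
rewrite !real_normK ?num_real// => _ _ _ _ _.
by have := sqr_ge0 (a - b); have := sqr_ge0 (a - c); have := sqr_ge0 (b - c); lra.
Qed.

Lemma leb_shift f z : measf f ->
  (intg leb f <-> intg leb (fun x => f (x + z))) /\ Ex leb f = Ex leb (fun x => f (x + z)).
Proof.
by move=> mf; split; [exact: (law_intg (lebesgue_translation z) mf)|exact: law_Ex (lebesgue_translation z) _ mf].
Qed.

Lemma diff_pow f z : measf f -> intg leb (fun x => `|f x| ^+ p) ->
  intg leb (fun x => `|f (x + z) - f x| ^+ p) /\
  Ex leb (fun x => `|f (x + z) - f x| ^+ p) <= 6 * Ex leb (fun x => `|f x| ^+ p).
Proof.
move=> mf If; have mp : measf (fun x => `|f x| ^+ p) := intg_meas If.
have [s1 s2] := leb_shift z mp; have Ifz := s1.1 If.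
have mfz : measf (fun x => `|f (x + z) - f x| ^+ p).
  apply: measurable_funX; apply: measurableT_comp => //.
  by apply: measurable_funB => //; exact: measurable_shift.
have I3 := intgZ 3 (intgD Ifz If).
have H x : `|f (x + z) - f x| ^+ p <= 3 * (`|f (x + z)| ^+ p + `|f x| ^+ p).
  have := pow3 (f (x + z)) (- f x) 0; rewrite addr0 normrN normr0.
  by rewrite (_ : 0 ^+ p = 0) ?addr0//; case: pE => ->; rewrite ?expr1 ?expr0n.
have I4 : intg leb (fun x => `|f (x + z) - f x| ^+ p).
  by apply: intg_le I3 => // x; rewrite ger0_norm ?exprn_ge0.
split => //; apply: (le_trans (Ex_le I4 I3 H)).
by rewrite ExZ ?ExD -?s2//; [lra|exact: intgD].
Qed.

(** On the ball of radius [K + 1], outside of which both translates vanish, the Gaussian density is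
    at least [c], so Gaussian translation continuity transfers to Lebesgue measure. *)
Let bdd_case f (M K : R) : measf f -> (forall x, `|f x| <= M) -> 0 <= K ->
  (forall x, K < enorm x -> f x = 0) -> forall e : R, 0 < e -> exists2 d : R, 0 < d &
  forall z, enorm z <= d -> Ex leb (fun x => `|f (x + z) - f x| ^+ p) <= e.
Proof.
move=> mf fM K0 fK e e0; have M0 : 0 <= M := le_trans (normr_ge0 _) (fM 0).
have [_ _ tf] := tc_bounded mf fM.
pose c := (Num.sqrt (2 * pi))^-1 ^+ n * expR (- ((K + 1) ^+ 2 / 2)) : R.
have c0 : 0 < c by rewrite mulr_gt0 ?exprn_gt0 ?gpeak_gt0 ?expR_gt0.
have M1 : 0 < 2 * M + 1 by lra.
have [d d0 Hd] := tf _ (mulr_gt0 e0 (divr_gt0 c0 M1)).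
exists (Num.min d 1) => [|z]; first by rewrite lt_min d0 ltr01.
rewrite le_min => /andP[zd z1]; pose h x := `|f (x + z) - f x|.
have mh : measf h.
  by apply: measurableT_comp => //; apply: measurable_funB => //; exact: measurable_shift.
have hM x : h x <= 2 * M by rewrite (le_trans (ler_normB _ _))// mulr_natl mulr2n lerD.
have Ih : intg (gam n) h by apply: (@intg_bdd _ _ _ _ _ (2 * M)) => // x; rewrite normr_id hM.
have := Hd z zd; rewrite (gam_Ex mh) => Ec.
have I1 := (gam_intg mh).1 Ih.
have H x : h x ^+ p <= (2 * M + 1) / c * (h x * gd x).
  have [xK|xK] := ltP (K + 1) (enorm x).
    have hx : h x = 0.
      have z2 := enormD (x + z) (- z); rewrite addrK -scaleN1r enormZ normrN1 mul1r in z2.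
      by rewrite /h !fK ?subrr ?normr0//; lra.
    by rewrite hx mul0r mulr0; case: pE => ->; rewrite ?expr1 ?expr0n.
  have hp1 : h x ^+ p <= (2 * M + 1) * h x.
    have := hM x; have := normr_ge0 (f (x + z) - f x); rewrite -/(h x) => h0 h1.
    by case: pE => ->; rewrite ?expr1 ?expr2; nra.
  apply: (le_trans hp1); rewrite -mulrA ler_pM2l// mulrCA ler_peMr ?normr_ge0//.
  rewrite mulrC ler_pdivlMr// mul1r ler_pM2l ?exprn_gt0 ?gpeak_gt0// ler_expR lerN2.
  by rewrite ler_pM2r// -enorm_sqr lerXn2r ?nnegrE ?enorm_ge0 ?addr_ge0.
have I2 := intgZ ((2 * M + 1) / c) I1.
have mhp : measf (fun x => h x ^+ p) by exact: measurable_funX.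
have I3 : intg leb (fun x => h x ^+ p).
  by apply: intg_le I2 => // x; rewrite ger0_norm ?exprn_ge0 ?normr_ge0.
apply: (le_trans (Ex_le I3 I2 H)); rewrite ExZ//.
by rewrite mulrC -ler_pdivlMr ?divr_gt0// invf_div.
Qed.

(** Clipping at a high level reduces to [bdd_case]; by translation invariance the clipping error is
    controlled uniformly in [z] through [diff_pow]. *)
Lemma lebesgue_tcont f K : measf f -> intg leb (fun x => `|f x| ^+ p) -> 0 <= K ->
  (forall x, K < enorm x -> f x = 0) -> forall e : R, 0 < e -> exists2 d : R, 0 < d &
  forall z, enorm z <= d -> Ex leb (fun x => `|f (x + z) - f x| ^+ p) <= e.
Proof.
move=> mf If K0 fK e e0.
pose clip (M : R) x : R := Num.max (- M) (Num.min M (f x)).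
have mclip M : measf (clip M).
  apply: measurable_maxr; first exact: measurable_cst.
  by apply: measurable_minr => //; exact: measurable_cst.
have clipE M x : `|f x| <= M -> clip M x = f x.
  rewrite ler_norml => /andP[a b]; rewrite /clip min_r// max_r//.
have clipM M x : 0 <= M -> `|clip M x| <= M.
  move=> M0; rewrite /clip; case: (leP M (f x)) => a; case: (leP (- M) _) => b;
    rewrite ler_norml; lra.
have clip_le M x : 0 <= M -> `|f x - clip M x| <= `|f x|.
  move=> M0; have a0 := ler_norm (f x); have a1 := ler_norm (- f x); rewrite normrN in a1.
  rewrite /clip; case: (leP M (f x)) => a; case: (leP (- M) _) => b; rewrite ler_norml; lra.
have mpw (g : 'rV[R]_n -> R) : measf g -> measf (fun x => `|g x| ^+ p).
  by move=> mg; apply: measurable_funX; exact: measurableT_comp.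
have mr M : measf (fun x => f x - clip M x) by exact: measurable_funB.
have dct := @Ex_dct _ _ _ leb (fun k x => `|f x - clip k%:R x| ^+ p) (fun=> 0) (fun x => `|f x| ^+ p)
  (fun k => mpw _ (mr _)).
have {}c : Ex leb (fun x => `|f x - clip k%:R x| ^+ p) @[k --> \oo] --> (0 : R).
  rewrite -[X in _ --> X](Ex0 leb); apply: (dct _ If _).2 => [x|k x].
    apply: cvg_near_cst; exists (Num.trunc `|f x|).+1 => // k /= xk.
    rewrite clipE ?subrr ?normr0; first by case: pE => ->; rewrite ?expr1 ?expr0n.
    by apply: (le_trans (ltW (truncnS_gt _))); rewrite ler_nat.
  by rewrite ger0_norm ?exprn_ge0// lerXn2r ?nnegrE// clip_le.
(* The final sum is [3 * (e / 6 + 6 * (e / 36)) = e], with 3 from [pow3] and 6 from [diff_pow]. *)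
have e12 : 0 < e / 36 by rewrite divr_gt0.
have [k _ /(_ k (leqnn k)) kP] := (cvgrPdist_le _ _).1 c _ e12.
have {kP} Er : Ex leb (fun x => `|f x - clip k%:R x| ^+ p) <= e / 36.
  by apply: le_trans kP; rewrite sub0r normrN ler_norm.
set M := k%:R in Er; have M0 : 0 <= M by [].
have e6 : 0 < e / 6 by rewrite divr_gt0.
have cK x : K < enorm x -> clip M x = 0.
  by move=> /fK fx; rewrite clipE fx ?normr0.
have [d d0 Hd] := bdd_case (mclip M) (fun x => clipM M x M0) K0 cK e6.
exists d => // z zd; have := Hd z zd.
pose r x := f x - clip M x.
have Ir : intg leb (fun x => `|r x| ^+ p).
  apply: intg_le If => [|x]; first exact: mpw (mr M).
  by rewrite ger0_norm ?exprn_ge0// lerXn2r ?nnegrE// clip_le.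
have Ic : intg leb (fun x => `|clip M x| ^+ p).
  apply: intg_le (intgZ 3 (intgD Ir If)) => [|x]; first exact: mpw (mclip M).
  rewrite ger0_norm ?exprn_ge0//; have := pow3 (- r x) (f x) 0.
  rewrite addr0 normr0 normrN (_ : 0 ^+ p = 0); last by case: pE => ->; rewrite ?expr1 ?expr0n.
  by rewrite addr0 (_ : - r x + f x = clip M x)// /r; ring.
have [I1 _] := diff_pow z (mclip M) Ic; have [I2 E2] := diff_pow z (mr M) Ir.
have [I3 _] := diff_pow z mf If.
have H x : `|f (x + z) - f x| ^+ p <=
    3 * (`|clip M (x + z) - clip M x| ^+ p + `|r (x + z) - r x| ^+ p).
  have := pow3 (clip M (x + z) - clip M x) (r (x + z) - r x) 0.
  rewrite addr0 normr0 (_ : 0 ^+ p = 0); last by case: pE => ->; rewrite ?expr1 ?expr0n.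
  by rewrite addr0 (_ : _ + _ = f (x + z) - f x)// /r; ring.
have := Ex_le I3 (intgZ 3 (intgD I1 I2)) H.
by rewrite ExZ ?ExD//; [lra|exact: intgD].
Qed.

End lebesgue_translation_continuity.

(** * Mollification as expectation under small random shifts *)

Section mollifier.
Context {R : realType} (n : nat).
Implicit Types (f g : 'rV[R]_n -> R) (x z : 'rV[R]_n).
Local Notation leb := (lebesgue_rV R n).

(** A lower bound obtained coordinate by coordinate. It supplies positivity of mollifier masses,
    non-nullity of the whole space, and local lower bounds for marginal densities. *)
Lemma box_integral m (s d : R) (F : 'rV[R]_m -> R) : 0 < s -> 0 <= d -> measf F ->
  (forall x : 'rV[R]_m, 0 <= F x) -> (forall x : 'rV[R]_m, (forall i, `|x 0 i| < s) -> d <= F x) ->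
  ((d * (2 * s) ^+ m)%:E <= \int[lebesgue_rV R m]_x (F x)%:E)%E.
Proof.
move=> s0 d0; elim: m F => [|m IH] F mF F0 Fd.
  rewrite lebesgue0; last exact/measurable_EFinP.
  by rewrite expr0 mulr1 lee_fin; apply: Fd => -[].
have mE : measf (fun w => (F w)%:E) by exact/measurable_EFinP.
rewrite lebesgue_cons//.
have mc : measf (fun w => (F (rV_cons w))%:E).
  exact: (measurableT_comp mE measurable_rV_cons).
have I0 (a : measurableTypeR R) : (0 <= \int[lebesgue_rV R m]_y (F (rV_cons (a, y)))%:E)%E.
  by apply: integral_ge0 => y _; rewrite lee_fin.
have mg := meas_inner (lebesgue_rV R m) mc (fun w => F0 _ : (0 <= (F (rV_cons w))%:E)%E).
apply: (@le_trans _ _ (\int[@lebesgue_measure R]_(a in `](- s)%R, s[%classic) (d * (2 * s) ^+ m)%:E)%E).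
  rewrite integral_cst//= lebesgue_measure_itv/= lte_fin ifT; last by lra.
  by rewrite -EFinB -EFinM lee_fin exprSr mulrA opprK -[s + s]mulr2n mulr_natl.
apply: (@le_trans _ _ (\int[@lebesgue_measure R]_(a in `](- s)%R, s[%classic)
    \int[lebesgue_rV R m]_y (F (rV_cons (a, y)))%:E)%E).
  apply: ge0_le_integral => //.
  - by move=> a _; rewrite lee_fin mulr_ge0// exprn_ge0// mulr_ge0// ltW.
  - exact: measurable_funTS.
  move=> a; rewrite /= in_itv/= => /andP[a1 a2]; apply: IH => [|y|y ys]; [| |apply: Fd => i].
  - exact: (measurableT_comp mF (measurableT_comp measurable_rV_cons (pair1_measurable _))).
  - exact: F0.
  - rewrite mxE; case: unliftP => [j _|_]/=; last by rewrite ltr_norml a1.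
    exact: ys.
by apply: ge0_subset_integral => //; exact: measurable_itv.
Qed.

Lemma supp_intg f (M K : R) : measf f -> (forall x, `|f x| <= M) -> 0 <= K ->
  (forall x, K < enorm x -> f x = 0) -> intg leb f.
Proof.
move=> mf fM K0 fK; pose c := (Num.sqrt (2 * pi))^-1 ^+ n * expR (- (K ^+ 2 / 2)) : R.
have c0 : 0 < c by rewrite mulr_gt0 ?exprn_gt0 ?gpeak_gt0 ?expR_gt0.
have Ig : intg leb (@gd R n).
  have := (gam_intg (@measurable_cst _ _ _ _ setT (1 : R))).1 (intg_cst (gam n) 1).
  by congr intg; apply/funext => x; rewrite mul1r.
apply: intg_le (intgZ (M / c) Ig) => // x; have M0 : 0 <= M := le_trans (normr_ge0 _) (fM 0).
have [xK|xK] := ltP K (enorm x).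
  by rewrite fK// normr0 mulr_ge0 ?gd_ge0// divr_ge0// ltW.
apply: (le_trans (fM x)); rewrite -mulrA ler_peMr// mulrC ler_pdivlMr// mul1r.
rewrite ler_pM2l ?exprn_gt0 ?gpeak_gt0// ler_expR lerN2.
by rewrite ler_pM2r// -enorm_sqr lerXn2r ?nnegrE ?enorm_ge0.
Qed.

Lemma test_intg f : test_function f -> intg leb f.
Proof.
move=> tf; have [M M0 fM] := test_bounded tf; have [K K0 fK] := test_support tf.
exact: supp_intg (test_meas tf) fM K0 fK.
Qed.

Definition rad (k : nat) : R := k.+1%:R^-1.
Definition bmass (k : nat) : R := Ex leb (bump (rad k) 0).
Definition molk (k : nat) z : R := bump (rad k) 0 z / bmass k.

Lemma rad_gt0 k : 0 < rad k. Proof. by rewrite invr_gt0. Qed.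

Let tb k (y : 'rV[R]_n) : test_function (bump (rad k) y) := test_bump y (rad_gt0 k).

Lemma bmass_gt0 k : 0 < bmass k.
Proof.
have r0 := rad_gt0 k; have r2 : 0 < rad k / 2 by rewrite divr_gt0.
pose d : R := (hp 1 2^-1 * hp 1 2^-1) ^+ n.
have h0 : 0 < hp 1 (2^-1 : R) by rewrite hp_gt0 invr_gt0.
have d0 : 0 < d by rewrite exprn_gt0// mulr_gt0.
have hmono (a b : R) : 0 < a -> a <= b -> hp 1 a <= hp 1 b.
  move=> a0 ab; rewrite /hp a0 (lt_le_trans a0 ab) !hornerC !mul1r ler_expR lerN2.
  by rewrite lef_pV2// posrE (lt_le_trans a0).
have := @box_integral n (rad k / 2) d (bump (rad k) 0) r2 (ltW d0) (test_meas (tb k 0))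
  (bump_ge0 _ _).
rewrite (ExE (test_intg (tb k 0))) lee_fin => H; apply: lt_le_trans (H _).
  by rewrite mulr_gt0// exprn_gt0// mulr_gt0.
move=> x xs; rewrite /d -[n in _ ^+ n]card_ord -prodr_const; apply: ler_prod => i _.
rewrite mulr_ge0 ?hp_ge0//=; have := xs i; rewrite ltr_norml => /andP[a b].
have e : rad k * (rad k)^-1 = 1 by rewrite divff// gt_eqF.
have q1 : - 2^-1 <= (rad k)^-1 * x 0 i by rewrite ler_pdivlMl//; lra.
have q2 : (rad k)^-1 * x 0 i <= 2^-1 by rewrite ler_pdivrMl//; lra.
by rewrite mxE; apply: ler_pM; rewrite ?hp_ge0//; apply: hmono; rewrite ?invr_gt0//; lra.
Qed.

Lemma molk_ge0 k z : 0 <= molk k z.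
Proof. by rewrite divr_ge0 ?bump_ge0// ltW// bmass_gt0. Qed.

Lemma measurable_molk k : measf (molk k).
Proof. by apply: measurable_funM; [exact: test_meas (tb k 0)|exact: measurable_cst]. Qed.

Lemma molk_integral k : (\int[leb]_z (molk k z)%:E = 1)%E.
Proof.
have E : molk k = (fun z => (bmass k)^-1 * bump (rad k) 0 z).
  by apply/funext => z; rewrite mulrC.
have I := test_intg (tb k 0); rewrite ExE E; last exact: intgZ.
by rewrite ExZ// mulVf// gt_eqF// bmass_gt0.
Qed.

(** The mollifier is taken as a probability measure, so that convolution is an expectation and
    Jensen applies. *)
Definition nu k : probability 'rV[R]_n R := pdens (molk_ge0 k) (measurable_molk k) (molk_integral k).

Let nuE k A : measurable A -> nu k A = (\int[leb]_(x in A) (molk k x)%:E)%E.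
Proof. by []. Qed.

Lemma nu_Ex k g : measf g -> Ex (nu k) g = Ex leb (fun z => g z * molk k z).
Proof. by apply: dens_Ex; [exact: molk_ge0|exact: measurable_molk|exact: nuE]. Qed.

Lemma nu_intgE k g : measf g -> intg (nu k) g <-> intg leb (fun z => g z * molk k z).
Proof. by apply: dens_intg; [exact: molk_ge0|exact: measurable_molk|exact: nuE]. Qed.

Lemma molk_bounded k : exists2 M : R, 0 <= M & forall z, molk k z <= M.
Proof.
have [M M0 HM] := test_bounded (tb k 0); have b0 := ltW (bmass_gt0 k).
exists (M / bmass k) => [|z]; first exact: divr_ge0.
by rewrite ler_wpM2r ?invr_ge0// (le_trans (ler_norm _) (HM z)).
Qed.

Lemma nu_intg k g : intg leb g -> intg (nu k) g.
Proof.
move=> Ig; have mg := intg_meas Ig; have [M M0 HM] := molk_bounded k; apply/(nu_intgE k mg).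
apply: intg_le (intgZ M (intg_abs Ig)).
  by apply: measurable_funM => //; exact: measurable_molk.
move=> z; rewrite normrM (ger0_norm (molk_ge0 k z)).
by rewrite mulrC ler_wpM2r.
Qed.

Lemma nu_supp k z : molk k z != 0 -> forall i, `|z 0 i| < rad k.
Proof.
move=> z0; have : 0 < bump (rad k) 0 z.
  by rewrite lt0r bump_ge0 andbT; apply: contra z0 => /eqP z0; rewrite /molk z0 mul0r.
by move=> /(bump_gt0 0 z (rad_gt0 k)) H i; have := H i; rewrite mxE subr0.
Qed.

Lemma nu_le k g (e : R) : intg (nu k) g -> (forall z, enorm z <= n%:R * rad k -> g z <= e) ->
  Ex (nu k) g <= e.
Proof.
move=> Ig ge; have mg := intg_meas Ig; rewrite nu_Ex// -[leRHS](Ex_cst (nu k)) nu_Ex; last exact: measurable_cst.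
apply: Ex_le => [||z]; [exact/nu_intgE| |].
  by apply/nu_intgE; [exact: measurable_cst|exact: intg_cst].
have [->|/nu_supp zs] := eqVneq (molk k z) 0; first by rewrite !mulr0.
by rewrite ler_wpM2r ?molk_ge0// ge// enorm_le_mul// => i; exact/ltW/zs.
Qed.

Definition mol k f x : R := Ex (nu k) (fun z => f (x + z)).

Lemma mol_bump k f x : measf f ->
  mol k f x = Ex leb (fun y => f y * (bump (rad k) x y / bmass k)).
Proof.
move=> mf; have mfx : measf (fun z => f (x + z)).
  have := measurable_shift x mf; congr measurable_fun; apply/funext => z; congr f; exact: addrC.
rewrite /mol (nu_Ex k mfx); have mh : measf (fun y => f y * (bump (rad k) x y / bmass k)).
  apply: measurable_funM => //; apply: measurable_funM; last exact: measurable_cst.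
  exact: test_meas (tb k x).
have [_ ->] := leb_shift x mh; congr Ex; apply/funext => z.
by have := bump_shift (rad k) z 0 x; rewrite (addrC x z) /molk add0r => ->.
Qed.

Lemma measurable_mol k f : measf f -> measf (mol k f).
Proof.
move=> mf; have m2 : measf (fun p : 'rV[R]_n * 'rV[R]_n => f (p.1 + p.2)).
  by apply: measurableT_comp mf _; exact: measurable_rVD.
have H := meas_Ex (nu k) m2; exact: H.
Qed.

Lemma mol_intg k f x : intg leb f -> intg (nu k) (fun z => f (x + z)).
Proof.
move=> If; apply: nu_intg; have mf := intg_meas If.
have [s1 _] := leb_shift x mf; have := s1.1 If.
by congr intg; apply/funext => z; rewrite addrC.
Qed.

(** Jensen in the shift and Fubini bound the error by an average over small shifts of the
    translation errors in [lebesgue_tcont]. *)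
Lemma mol_cvg (p : nat) f (K : R) : (0 < p <= 2)%N -> intg leb f ->
  intg leb (fun x => `|f x| ^+ p) -> 0 <= K -> (forall x, K < enorm x -> f x = 0) ->
  forall e : R, 0 < e -> exists N : nat, forall k, (N <= k)%N ->
    intg leb (fun x => `|mol k f x - f x| ^+ p) /\ Ex leb (fun x => `|mol k f x - f x| ^+ p) <= e.
Proof.
move=> p12 If Ip K0 fK e e0; have mf := intg_meas If.
have [d d0 Hd] := lebesgue_tcont p12 mf Ip K0 fK e0.
exists (Num.trunc (n%:R / d)) => k Nk.
have zd z : enorm z <= n%:R * rad k -> enorm z <= d.
  move=> zk; apply: (le_trans zk); rewrite ler_pdivrMr// mulrC -ler_pdivrMr//.
  by apply: (le_trans (ltW (truncnS_gt _))); rewrite ler_nat.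
pose g (q : 'rV[R]_n * 'rV[R]_n) := `|f (q.2 + q.1) - f q.2| ^+ p.
have mg : measf g.
  apply: measurable_funX; apply: measurableT_comp => //; apply: measurable_funB.
    by apply: measurableT_comp mf _; exact: measurable_rVD.
  exact: measurableT_comp mf measurable_snd.
have g0 q : 0 <= g q by exact: exprn_ge0.
have Ix z : intg leb (fun x => g (z, x)) := (diff_pow p12 z mf Ip).1.
have Iz x : intg (nu k) (fun z => g (z, x)).
  have I1 := intgZ 3 (intgD (mol_intg k x Ip) (intg_cst (nu k) (`|f x| ^+ p))).
  apply: intg_le I1 => [|z]; first exact: (measurableT_comp mg (pair2_measurable x)).
  rewrite ger0_norm ?g0//; have := pow3 p12 (f (x + z)) (- f x) 0.
  rewrite addr0 normrN normr0 (_ : 0 ^+ p = 0) ?addr0//.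
  by move: p12; case: (p) => // q _; rewrite expr0n.
have I1 : intg (nu k) (fun z => Ex leb (fun x => g (z, x))).
  apply: (@intg_bdd _ _ _ _ _ (6 * Ex leb (fun x => `|f x| ^+ p))).
    by have H := meas_Ex leb mg; exact: H.
  by move=> z; rewrite ger0_norm ?Ex_ge0//; exact: (diff_pow p12 z mf Ip).2.
have Ig := fub_intg mg g0 Ix I1.
have [_ e1] := Ex_fub Ig Ix; have [I2 e2] := Ex_fub2 Ig Iz.
have H x : `|mol k f x - f x| ^+ p <= Ex (nu k) (fun z => g (z, x)).
  have If1 : intg (nu k) (fun z => f (x + z) - f x).
    by apply: intgB; [exact: mol_intg|exact: intg_cst].
  have -> : mol k f x - f x = Ex (nu k) (fun z => f (x + z) - f x).
    by rewrite ExB ?Ex_cst//; [exact: mol_intg|exact: intg_cst].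
  move: p12 Iz; rewrite /g; case: (p) => [|[|[|q]]]// _ Iz; first by rewrite expr1; exact: Ex_abs.
  have := Iz x; under eq_fun do rewrite /= real_normK ?num_real//.
  rewrite real_normK ?num_real// => Iz'.
  by apply: Ex_sqr_le => //; exact: intg_meas If1.
have mm : measf (fun x => `|mol k f x - f x| ^+ p).
  apply: measurable_funX; apply: measurableT_comp => //; apply: measurable_funB => //.
  exact: measurable_mol.
have I3 : intg leb (fun x => `|mol k f x - f x| ^+ p).
  by apply: intg_le I2 => // x; rewrite ger0_norm ?exprn_ge0.
split=> //; apply: (le_trans (Ex_le I3 I2 H)); rewrite -e2 e1.
by apply: nu_le I1 _ => z zk; exact/Hd/zd.
Qed.

End mollifier.

(** * Strongly midpoint-convex functions *)

Section midpoint_convexity.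
Context {R : realType} (n : nat).
Variable f : 'rV[R]_n -> R.
Hypothesis fc : forall x d, 2 * f x + dot d d <= f (x + d) + f (x - d).
Hypothesis fb : forall K : R, exists C : R, forall x : 'rV[R]_n, enorm x <= K -> f x <= C.

Let pow2 k : 0 < 2^-1 ^+ k :> R. Proof. by rewrite exprn_gt0// invr_gt0. Qed.

Let step x d k : f (x + 2^-1 ^+ k *: d) - f x <= 2^-1 ^+ k * (f (x + d) - f x).
Proof.
elim: k => [|k IH]; first by rewrite expr0 scale1r mul1r.
have := fc (x + 2^-1 ^+ k.+1 *: d) (2^-1 ^+ k.+1 *: d).
rewrite addrK -addrA -scalerDl exprS (_ : 2^-1 * 2^-1 ^+ k + _ = 2^-1 ^+ k); last by field.
have := dot_ge0 ((2^-1 * 2^-1 ^+ k) *: d).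
by rewrite -mulrA; lra.
Qed.

(** The Bernstein-Doetsch argument: a local upper bound and repeated halving give small upward
    increments, and midpoint convexity through [x] turns the increment at the reflected point into a
    lower bound. *)
Lemma midpoint_continuous : continuous f.
Proof.
move=> x; apply/continuous_rVP => e e0; have [C HC] := fb (enorm x + 1).
have C0 : 0 <= C - f x by rewrite subr_ge0 HC// lerDl.
pose k := (Num.trunc ((C - f x) / e)).+1.
have ke : 2^-1 ^+ k * (C - f x) < e.
  rewrite exprVn ltr_pdivrMl ?exprn_gt0// -ltr_pdivrMr//.
  apply: (lt_trans (truncnS_gt _)); rewrite -natrX ltr_nat; exact: ltn_expl.
exists (2^-1 ^+ k / n.+1%:R) => [|y yx]; first by rewrite divr_gt0.
have close h : enorm h <= 2^-1 ^+ k -> f (x + h) - f x <= 2^-1 ^+ k * (C - f x).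
  move=> hk; have := step x (2 ^+ k *: h) k.
  rewrite scalerA exprVn mulVf ?expf_neq0// scale1r -exprVn => /le_trans; apply.
  rewrite ler_pM2l// lerD2r HC// (le_trans (enormD _ _))// lerD2l enormZ ger0_norm ?exprn_ge0//.
  by rewrite -ler_pdivlMl ?exprn_gt0// mulr1 -exprVn.
have hk : enorm (y - x) <= 2^-1 ^+ k.
  apply: (@le_trans _ _ (n%:R * (2^-1 ^+ k / n.+1%:R))).
    by apply: enorm_le_mul => i; rewrite !mxE; exact/ltW/yx.
  by rewrite mulrCA ler_piMr ?(ltW (pow2 k))// ler_pdivrMr// mul1r ler_nat.
have h1 := close _ hk; have h2 := close (- (y - x)); rewrite -scaleN1r enormZ normrN1 mul1r in h2.
have {h2} h2 := h2 hk; have := fc x (y - x); have := dot_ge0 (y - x).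
have e1 : x + (y - x) = y by rewrite addrC subrK.
rewrite e1 in h1; rewrite scaleN1r in h2; rewrite e1.
by rewrite ltr_norml; lra.
Qed.

(** [H] is midpoint convex and vanishes at 0, so [2 * H x <= H (2 *: x)]; a lower bound on the unit
    ball then deteriorates only linearly, and half of the quadratic part of [f] absorbs it. *)
Lemma midpoint_growth : exists C : R, forall x, 4^-1 * dot x x - C <= f x.
Proof.
have [C0 HC] := fb 1; pose H x := f x - 2^-1 * dot x x - f 0.
pose M := Num.max 0 (C0 - f 0 + 2^-1).
have M0 : 0 <= M by rewrite le_max lexx.
have H2 x : 2 * H x <= H (2 *: x).
  have := fc x x; rewrite (_ : x + x = 2 *: x) ?subrr; last by rewrite scaler_nat mulr2n.
  rewrite /H dotZl dotZr; lra.
have HM k x : enorm x <= 2 ^+ k -> - (2 ^+ k * M) <= H x.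
  elim: k x => [|k IH] x xk; last first.
    have := IH (2^-1 *: x); rewrite enormZ ger0_norm ?invr_ge0// ler_pdivrMl// -exprS => /(_ xk).
    by have := H2 (2^-1 *: x); rewrite scalerA divff// scale1r exprS; lra.
  rewrite expr0 mul1r; have := fc 0 x; have := HC (- x).
  rewrite sub0r add0r -scaleN1r enormZ normrN1 mul1r => /(_ xk) h1 h2.
  have : C0 - f 0 + 2^-1 <= M by rewrite le_max lexx orbT.
  have : dot x x <= 1 by rewrite -enorm_sqr expr_le1 ?enorm_ge0.
  by rewrite /H; have := dot_ge0 x; lra.
have HL x : - (M + 2 * enorm x * M) <= H x.
  have x0 := enorm_ge0 x; have [x1|x1] := leP (enorm x) 1.
    by have := HM 0%N x; rewrite expr0 => /(_ x1); have := mulr_ge0 x0 M0; lra.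
  have ex : exists k, enorm x <= 2 ^+ k.
    exists (Num.trunc (enorm x)).+1; apply: (le_trans (ltW (truncnS_gt _))).
    by rewrite -natrX ler_nat ltnW// ltn_expl.
  case: (ex_minnP ex) => -[|k] xk kmin; first by move: xk; rewrite expr0; lra.
  have kx : 2 ^+ k < enorm x by rewrite ltNge; apply/negP => /kmin; rewrite ltnn.
  have := HM _ _ xk; rewrite exprS; nra.
exists (M + 4 * M ^+ 2 - f 0) => x; have := HL x; rewrite /H -enorm_sqr.
by have := sqr_ge0 (enorm x / 2 - 2 * M); rewrite sqrrB !exprMn; lra.
Qed.

Lemma midpoint_slc : gdom (fun x => expR (- f x)) /\ slc 1 (fun x => expR (- f x)).
Proof.
split.
  split=> [x|x|]; [|exact: expR_gt0|].
    apply: (@continuous_comp _ _ _ f (fun t => expR (- t))); first exact: midpoint_continuous.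
    by apply: (@continuous_comp _ _ _ -%R expR); [exact: opp_continuous|exact: continuous_expR].
  have [C HC] := midpoint_growth; exists (expR C), 4^-1; rewrite invr_gt0; split=> // x.
  by rewrite -expRD ler_expR; have := HC x; lra.
move=> x y; rewrite -expRD.
have -> : expR (- f x + - f y) = expR (- ((f x + f y) / 2)) ^+ 2.
  by rewrite -expRM_natl; congr expR; field.
rewrite sqrtr_sqr ger0_norm ?expR_ge0// -expRD ler_expR mul1r.
have := fc (2^-1 *: (x + y)) (2^-1 *: (x - y)).
have -> : 2^-1 *: (x + y) + 2^-1 *: (x - y) = x by apply/rowP => i; rewrite !mxE; field.
have -> : 2^-1 *: (x + y) - 2^-1 *: (x - y) = y by apply/rowP => i; rewrite !mxE; field.
rewrite dotZl dotZr; lra.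
Qed.

End midpoint_convexity.

(** * Mollified potentials are strongly midpoint-convex *)

Section regularization.
Context {R : realType} (n : nat).
Implicit Types (x y z d : 'rV[R]_n).
Local Notation leb := (lebesgue_rV R n).

Lemma ball_compact (M : R) : compact [set x : 'rV[R]_n | enorm x <= M].
Proof.
have cK := @rV_compact _ n (fun=> `[- M, M]%classic) (fun=> @segment_compact R (- M) M).
apply: (subclosed_compact _ cK) => [|x /= xM i].
  by apply: (@closed_comp _ _ (@enorm R n) [set t | t <= M]) => [? _|]; [exact: enorm_continuous|exact: closed_le].
by rewrite /= in_itv /= -ler_norml; apply: le_trans xM; exact: coord_le_enorm.
Qed.

Lemma derive_shift (f : 'rV[R]_n -> R) v z : 'D_v (fun y => f (y + z)) = fun y => 'D_v f (y + z).
Proof.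
apply/funext => y; rewrite /derive.
rewrite (_ : (fun h : R => h^-1 *: (((fun y0 => f (y0 + z)) \o shift y) (h *: v) - f (y + z))) =
  (fun h : R => h^-1 *: ((f \o shift (y + z)) (h *: v) - f (y + z))))//.
by apply/funext => h /=; rewrite addrA.
Qed.

Lemma derive_shift2 (f : 'rV[R]_n -> R) v w y z :
  'D_v ('D_w (fun y => f (y + z))) y = 'D_v ('D_w f) (y + z).
Proof. by rewrite derive_shift; have /(congr1 (@^~ y)) := derive_shift ('D_w f) v z. Qed.

(** Truncation to a ball makes a locally integrable function integrable. *)
Definition loc (V : 'rV[R]_n -> R) (M : R) x : R := if enorm x <= M then V x else 0.

Section local_integrability.
Variable V : 'rV[R]_n -> R.
Hypothesis LV : loc_integrable leb V.

Let mV : measf V. Proof. by case: LV. Qed.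

Lemma measurable_loc M : measf (loc V M).
Proof.
apply: measurable_fun_ifT; [|exact: mV|exact: measurable_cst].
by apply: measurable_fun_ler; [exact: measurable_enorm|exact: measurable_cst].
Qed.

Lemma loc_intg M : intg leb (loc V M).
Proof.
have mm := measurable_loc M; have mn : measf (fun x => `|loc V M x|) by exact: measurableT_comp.
suff I : intg leb (fun x => `|loc V M x|) by apply: intg_le I.
apply: intg_fin => //; have := LV.2 _ (@ball_compact M); rewrite [X in (X < _)%E -> _]integral_mkcond.
congr (_ < _)%E; apply: eq_integral => x _; rewrite patchE /loc; case: (boolP (enorm x <= M)) => xM.
  by rewrite mem_set.
by rewrite memNset ?normr0//; exact/negP.
Qed.

Lemma loc_mul_intg M (g : 'rV[R]_n -> R) (B : R) : measf g -> (forall x, `|g x| <= B) ->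
  intg leb (fun x => loc V M x * g x).
Proof.
move=> mg gB; apply: intg_le (intgZ B (intg_abs (loc_intg M))).
  by apply: measurable_funM => //; exact: measurable_loc.
by move=> x; rewrite normrM mulrC ler_wpM2r.
Qed.

Lemma molk_enorm k z : molk k z != 0 -> enorm z <= n%:R.
Proof.
move=> /nu_supp zs; rewrite -[leRHS]mulr1; apply: enorm_le_mul => i.
by apply: (le_trans (ltW (zs i))); rewrite /rad invf_le1// ler1n.
Qed.

Lemma mol_loc k x M : enorm x + n%:R <= M -> mol k V x = mol k (loc V M) x.
Proof.
move=> xM; have sh (f : 'rV[R]_n -> R) : measf f -> measf (fun z => f (x + z)).
  by move=> mf; apply: measurableT_comp mf _; apply: measurable_rVD => //; exact: measurable_cst.
rewrite /mol (nu_Ex k (sh _ mV)) (nu_Ex k (sh _ (measurable_loc M))); congr Ex; apply/funext => z.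
have [->|z0] := eqVneq (molk k z) 0; first by rewrite !mulr0.
rewrite /loc ifT// (le_trans (enormD _ _))// (le_trans _ xM)// lerD2l.
exact: molk_enorm z0.
Qed.

Lemma nu_sym k (f : 'rV[R]_n -> R) : measf f ->
  (intg (nu n k) (fun z => f (- z)) <-> intg (nu n k) f) /\
  Ex (nu n k) (fun z => f (- z)) = Ex (nu n k) f.
Proof.
have o : orthm (- 1%:M : 'M[R]_n) by rewrite /orthm linearN /= trmx1 mulNmx mul1mx opprK.
have l : is_law leb (fun z : 'rV[R]_n => - z) leb.
  have := lebesgue_orth o; congr is_law; apply/funext => z; by rewrite mulmxN mulmx1.
move=> mf; have mfN : measf (fun z => f (- z)).
  by apply: measurableT_comp mf _; exact: measurable_rVN.
have mh : measf (fun z => f z * molk k z).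
  by apply: measurable_funM => //; exact: measurable_molk.
have e : (fun z => f z * molk k z) \o -%R = (fun z => f (- z) * molk k z).
  apply/funext => z /=; rewrite /molk -(bump_shift (rad k) (- z) 0 z) add0r addNr.
  by rewrite bump_sym.
rewrite !nu_Ex// (law_Ex l mh) e; split=> //.
by rewrite !nu_intgE// -e; split => h; apply/(law_intg l mh).
Qed.

End local_integrability.

Section mollified_potential.
Variable V : 'rV[R]_n -> R.
Hypothesis HV : Hess_ge_Id leb fullv V.

Let LV : loc_integrable leb V. Proof. by case: HV. Qed.

Let hess_loc (phi : 'rV[R]_n -> R) x d (K M : R) : test_function (fun y => phi (y - x)) ->
  (forall y, 0 <= phi y) -> test_function phi -> (forall w, K < enorm w -> 'D_d ('D_d phi) w = 0) ->
  enorm x + K <= M ->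
  dot d d * Ex leb phi <= Ex leb (fun y => loc V M y * 'D_d ('D_d phi) (y - x)).
Proof.
move=> tx p0 tp HK xM; have tD := test_D d (test_D d tp); have [B B0 HB] := test_bounded tD.
have := HV.2 _ tx (fun y => p0 (y - x)) d (memvf d).
have -> : (fun y => (V y * 'D_d ('D_d (fun y => phi (y - x))) y)%:E) =
    (fun y => (loc V M y * 'D_d ('D_d phi) (y - x))%:E).
  apply/funext => y; rewrite derive_shift2 /loc; case: ifP => // /negbT; rewrite -ltNge => yM.
  rewrite HK ?mulr0//; have := enormD (y - x) x; rewrite subrK; lra.
have mD2 : measf (fun y => 'D_d ('D_d phi) (y - x)) := measurable_shift (- x) (test_meas tD).
rewrite (ExE (test_intg tx)) (ExE (loc_mul_intg LV M mD2 (fun y => HB _))) -EFinM lee_fin enorm_sqr.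
by have [_ <-] := leb_shift (- x) (test_meas tp).
Qed.

Let second_loc (L phi D2 : 'rV[R]_n -> R) d (M2 B B' : R) x h : intg leb L ->
  measf phi -> (forall y, `|phi y| <= B) ->
  measf D2 -> (forall y, `|D2 y| <= B') ->
  (forall w, `|phi (w + h *: d) + phi (w - h *: d) - 2 * phi w - h ^+ 2 * D2 w| <= M2) ->
  h ^+ 2 * Ex leb (fun y => L y * D2 (y - x)) - M2 * Ex leb (fun y => `|L y|) <=
  Ex leb (fun y => L y * phi (y - (x + h *: d))) + Ex leb (fun y => L y * phi (y - (x - h *: d))) -
  2 * Ex leb (fun y => L y * phi (y - x)).
Proof.
move=> IL mp pB mD DB H2.
have I (f : 'rV[R]_n -> R) (C : R) z : measf f -> (forall y, `|f y| <= C) ->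
    intg leb (fun y => L y * f (y - z)).
  move=> mf fC; have := intg_mul_bdd IL (measurable_shift (- z) mf) (fun y => fC _).
  by congr intg; apply/funext => y; rewrite mulrC.
have I1 z := I _ _ z mp pB; have I2 := I _ _ x mD DB.
have key y : h ^+ 2 * (L y * D2 (y - x)) - M2 * `|L y| <=
   L y * phi (y - (x + h *: d)) + L y * phi (y - (x - h *: d)) - 2 * (L y * phi (y - x)).
  have -> : y - (x + h *: d) = y - x - h *: d by rewrite opprD addrA.
  have -> : y - (x - h *: d) = y - x + h *: d by rewrite opprB addrA addrAC.
  have := ler_wpM2l (normr_ge0 (L y)) (H2 (y - x)); rewrite -normrM ler_norml => /andP[+ _]; lra.
have J1 := intgB (intgZ (h ^+ 2) I2) (intgZ M2 (intg_abs IL)).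
have J2 := intgB (intgD (I1 (x + h *: d)) (I1 (x - h *: d))) (intgZ 2 (I1 x)).
have := Ex_le J1 J2 key.
rewrite (ExB (intgZ (h ^+ 2) I2) (intgZ M2 (intg_abs IL))).
rewrite (ExB (intgD (I1 (x + h *: d)) (I1 (x - h *: d))) (intgZ 2 (I1 x))).
by rewrite (ExZ _ I2) (ExZ _ (intg_abs IL)) (ExZ _ (I1 x)) (ExD (I1 _) (I1 _)).
Qed.

(** Tests the distributional Hessian bound against a translated mollifier and replaces the second
    derivative of the bump by a second difference; the error is cubic in [h], with a constant
    uniform on balls. *)
Let second_difference k d (M0 : R) : exists C : R, forall x (h : R), enorm x <= M0 -> `|h| <= 1 ->
  h ^+ 2 * dot d d - C * `|h| ^+ 3 <=
  mol k V (x + h *: d) + mol k V (x - h *: d) - 2 * mol k V x.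
Proof.
have := test_bump (0 : 'rV[R]_n) (rad_gt0 k); have : 0 < Ex leb (bump (rad k) 0) := @bmass_gt0 R n k.
have bE x y : bump (rad k) x y = bump (rad k) 0 (y - x).
  by rewrite -[in RHS](bump_shift (rad k) (y - x) 0 x) add0r subrK.
have cE : bmass n k = Ex leb (bump (rad k) 0) by [].
have := cE; have := bE; have tb x := test_bump x (rad_gt0 k); have b0 := bump_ge0 (rad k) (0 : 'rV[R]_n).
move: (bump (rad k) 0) b0 => phi b0 {}bE {}cE c0 tp; set c := Ex leb phi in c0.
have [M2 M20 H2] := second_diff d tp; have tD := test_D d (test_D d tp).
have [K K0 HK] := test_support tD; have [B B0 HB] := test_bounded tD.
have [B' B'0 HB'] := test_bounded tp.
pose M := M0 + enorm d + K + n%:R; have d0 := enorm_ge0 d.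
have WE z : enorm z <= M0 + enorm d -> mol k V z = Ex leb (fun y => loc V M y * phi (y - z)) / c.
  move=> zM; have I := loc_mul_intg LV M (measurable_shift (- z) (test_meas tp)) (fun y => HB' _).
  rewrite (@mol_loc _ LV k z M); last by rewrite /M; lra.
  rewrite mol_bump; last exact: measurable_loc.
  rewrite mulrC -ExZ//; congr Ex; apply/funext => y.
  by rewrite bE cE mulrA mulrC.
exists (M2 * Ex leb (fun y => `|loc V M y|) / c) => x h xM h1.
have hd (t : R) : `|t| <= 1 -> enorm (x + t *: d) <= M0 + enorm d.
  by move=> th; rewrite (le_trans (enormD _ _))// lerD// enormZ ler_piMl.
have S := second_loc x (loc_intg LV M) (test_meas tp) HB' (test_meas tD) HB (fun w => H2 w h).
have tx : test_function (fun y => phi (y - x)).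
  by have := tb x; congr test_function; apply/funext => y; exact: bE.
have Hs := hess_loc tx b0 tp HK (_ : enorm x + K <= M).
have {}Hs : dot d d * c <= Ex leb (fun y => loc V M y * 'D_d ('D_d phi) (y - x)).
  by apply: Hs; rewrite /M; have := ler0n R n; lra.
rewrite !WE; [|lra| |exact: hd]; last by rewrite -scaleNr hd ?normrN.
have := ler_wpM2l (sqr_ge0 h) Hs; move: S.
move: (Ex leb _) (Ex leb _) (Ex leb _) (Ex leb _) (Ex leb _) => a1 a2 a3 a4 a5 S H.
rewrite -(ler_pM2r c0) (_ : (_ - _) * c = h ^+ 2 * (dot d d * c) - M2 * `|h| ^+ 3 * a4).
  by rewrite [leRHS](_ : _ = a3 + a2 - 2 * a1); [lra|field; exact: lt0r_neq0].
by field; exact: lt0r_neq0.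
Qed.

(** Discrete double integration: the increment from [m] to [m + 1] is at least [(2 * m + 1) * dl],
    and the odd numbers sum to a square. *)
Let lattice (S : nat -> R) (dl : R) N : dl <= S 1%N - S 0%N ->
  (forall m, (0 < m < N)%N -> 2 * dl <= S m.+1 + S m.-1 - 2 * S m) ->
  N%:R ^+ 2 * dl <= S N - S 0%N.
Proof.
move=> S1 H; have D m : (m < N)%N -> (2 * m%:R + 1) * dl <= S m.+1 - S m.
  elim: m => [|m IH] mN; first by rewrite mulr0 add0r mul1r.
  by have := H m.+1 mN; have := IH (ltnW mN); rewrite /= -natr1; lra.
suff G m : (m <= N)%N -> m%:R ^+ 2 * dl <= S m - S 0%N by exact: G.
elim: m => [|m IH] mN; first by rewrite expr0n mul0r subrr.
by have := D m mN; have := IH (ltnW mN); rewrite -natr1; lra.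
Qed.

(** The cubic error disappears by subdivision: with step [h = 1 / N], the second differences of
    [P (t) + P (- t)] add up to [N ^ 2] times the local bound, in which the error is then of order
    [1 / N]. *)
Lemma mol_midpoint k x d : 2 * mol k V x + dot d d <= mol k V (x + d) + mol k V (x - d).
Proof.
have [C HC] := second_difference k d (enorm x + enorm d).
apply: (@le_of_add_small _ _ _ `|C| 1) => // e e0 e1; pose N := (Num.trunc e^-1).+1.
have N0 : 0 < N%:R :> R by [].
have Ne : N%:R^-1 <= e by rewrite -[leRHS]invrK lef_pV2 ?posrE ?invr_gt0// ltW// truncnS_gt.
pose h : R := N%:R^-1; have h0 : 0 < h by rewrite invr_gt0.
have h1 : `|h| <= 1 by rewrite ger0_norm ?(ltW h0)// invf_le1// ler1n.
pose dl := h ^+ 2 * dot d d - C * `|h| ^+ 3.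
pose P (t : R) := mol k V (x + t *: d).
have HP t : `|t| <= 1 -> dl <= P (t + h) + P (t - h) - 2 * P t.
  move=> t1; have := HC (x + t *: d) h _ h1; rewrite /P scalerDl scalerBl !addrA; apply.
  by rewrite (le_trans (enormD _ _))// lerD2l enormZ ler_piMl// enorm_ge0.
have Nh : N%:R * h = 1 by rewrite divff// gt_eqF.
have := @lattice (fun m => P (m%:R * h) + P (- (m%:R * h))) dl N.
rewrite Nh mul0r mul1r oppr0 => H.
have {}H : N%:R ^+ 2 * dl <= P 1 + P (- 1) - (P 0 + P 0).
  apply: H => [|m /andP[m0 mN]].
    by have := HP 0; rewrite normr0 ler01 => /(_ isT); rewrite add0r sub0r; lra.
  have mh : `|m%:R * h| <= 1.
    rewrite ger0_norm; last by rewrite mulr_ge0// ltW.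
    by rewrite -[leRHS]Nh ler_pM2r// ler_nat ltnW.
  have A := HP _ mh; have := HP (- (m%:R * h)); rewrite normrN => /(_ mh).
  have -> : m.+1%:R * h = m%:R * h + h by rewrite -natr1 mulrDl mul1r.
  have -> : m.-1%:R * h = m%:R * h - h by rewrite -{2}(prednK m0) -natr1 mulrDl mul1r addrK.
  have -> : - (m%:R * h + h) = - (m%:R * h) - h by ring.
  have -> : - (m%:R * h - h) = - (m%:R * h) + h by ring.
  by move: A; lra.
have dlE : N%:R ^+ 2 * dl = dot d d - C * h.
  by rewrite /dl (ger0_norm (ltW h0)) /h; field; rewrite gt_eqF.
move: H; rewrite dlE /P scaleN1r scale1r scale0r addr0.
have := ler_wpM2r (ltW h0) (ler_norm C); have := ler_wpM2l (normr_ge0 C) Ne; rewrite -/h; lra.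
Qed.

End mollified_potential.
End regularization.

(** * A regular version of the potential *)

Section potential_limit.
Context {R : realType} (n : nat).
Variable V : 'rV[R]_n -> R.
Local Notation leb := (lebesgue_rV R n).
Hypothesis HV : Hess_ge_Id leb fullv V.

Let LV : loc_integrable leb V. Proof. by case: HV. Qed.
Let mV : measf V. Proof. by case: LV. Qed.

(** An upper limit gives a value at every point, not only where the mollifications converge, and the
    midpoint inequality still passes to it. *)
Definition is_limsup (u : nat -> R) (L : R) : Prop :=
  (forall e : R, 0 < e -> exists J : nat, forall j, (J <= j)%N -> u j <= L + e) /\
  (forall (e : R) (J : nat), 0 < e -> exists2 j, (J <= j)%N & L - e <= u j).

Lemma limsup_exists (u : nat -> R) (C c : R) J : (forall j, (J <= j)%N -> c <= u j <= C) ->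
  exists L, is_limsup u L.
Proof.
move=> uC; pose S := [set t : R | exists K : nat, forall j, (K <= j)%N -> u j <= t].
have SC : S C by exists J => j /uC /andP[].
have lS : lbound S c.
  move=> t [K Kt]; have /andP[a b] := uC _ (leq_maxl J K).
  exact: le_trans a (Kt _ (leq_maxr J K)).
have hS : has_inf S by split; [exists C|exists c].
exists (inf S); split=> [e e0|e K e0].
  have [t [K Kt] tS] := inf_adherent e0 hS.
  by exists K => j /Kt /le_trans; apply; exact: ltW.
apply: contrapT => H; have : S (inf S - e).
  exists K => j Kj; have [//|/ltW uj] := leP (u j) (inf S - e).
  by case: H; exists j.
by move=> /(ge_inf hS.2); rewrite lerBrDr gerDl leNgt e0.
Qed.

Let dyad (j : nat) : R := 1 / (2 ^ j.+1)%:R.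

Let half_trans (a b c d : R) : 2 * a <= b + b -> b <= c -> c <= d -> a <= d.
Proof. lra. Qed.

Let dyad_le1 j : dyad j <= 1.
Proof.
have h : 1 <= (2 ^ j.+1)%:R :> R by rewrite ler1n expn_gt0.
by rewrite /dyad ler_pdivrMr ?mul1r// (lt_le_trans ltr01).
Qed.

(** The scale is chosen so that the errors in the mean on the ball of radius [j] are summable,
    whence convergence almost everywhere along a single sequence. *)
Let choose_k (j : nat) : exists k : nat,
  intg leb (fun x => `|mol k (loc V j%:R) x - loc V j%:R x|) /\
  Ex leb (fun x => `|mol k (loc V j%:R) x - loc V j%:R x|) <= dyad j.
Proof.
have I := loc_intg LV j%:R; have d0 : 0 < dyad j by rewrite divr_gt0// ltr0n expn_gt0.
have I1 : intg leb (fun x => `|loc V j%:R x| ^+ 1) := intg_abs I.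
have fK x : j%:R < enorm x -> loc V j%:R x = 0 by move=> xj; rewrite /loc leNgt xj.
by have [N HN] := mol_cvg (isT : (0 < 1 <= 2)%N) I I1 (ler0n R j) fK d0; exists N; exact: HN.
Qed.

Let kk j := projT1 (cid (choose_k j)).
Let W j := mol (kk j) V.
Let err j x : R := `|mol (kk j) (loc V j%:R) x - loc V j%:R x|.

Let err_intg j : intg leb (err j). Proof. by have [] := projT2 (cid (choose_k j)). Qed.
Let err_le j : Ex leb (err j) <= dyad j. Proof. by have [] := projT2 (cid (choose_k j)). Qed.

Let W_err j x : enorm x + n%:R <= j%:R -> `|W j x - V x| = err j x.
Proof.
move=> xj; rewrite /W (mol_loc LV (kk j) xj) /err {3}/loc ifT//.
by apply: le_trans xj; rewrite lerDl.
Qed.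

Let err_ae : {ae leb, forall x, err j x @[j --> \oo] --> 0}.
Proof.
pose S x := (\sum_(0 <= j <oo) (err j x)%:E)%E.
have e0 j x : (0 <= (err j x)%:E)%E by rewrite lee_fin normr_ge0.
have me j : measf (fun x => (err j x)%:E) by apply/measurable_EFinP; exact: intg_meas (err_intg j).
have mS : measf S by apply: ge0_emeasurable_sum => //.
have S0 x : (0 <= S x)%E by exact: nneseries_ge0.
have iS : leb.-integrable setT S.
  apply/integrableP; split => //; under eq_integral do rewrite gee0_abs//.
  rewrite integral_nneseries//; apply: (@le_lt_trans _ _ 1%E); last exact: ltry.
  apply: le_trans (epsilon_trick0 xpredT ler01); apply: lee_nneseries => [j _ _|j _].
    exact: integral_ge0.
  by rewrite (ExE (err_intg j)) lee_fin; exact: err_le.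
apply: filterS (integrable_ae measurableT iS) => x /(_ I) Sx.
apply: cvg_series_cvg_0; apply: nondecreasing_is_cvgn.
  by apply: nondecreasing_series => j _; rewrite /err.
exists (fine (S x)) => _ [m _ <-]; rewrite -lee_fin fineK// -sumEFin.
by apply: nneseries_lim_ge.
Qed.

Let W_ae : {ae leb, forall x, W j x @[j --> \oo] --> V x}.
Proof.
apply: filterS err_ae => x ex; apply/cvgrPdist_le => e e0.
have [N _ HN] := (cvgrPdist_le _ _).1 ex e e0.
exists (maxn N (Num.trunc (enorm x + n%:R)).+1) => // j /=; rewrite geq_max => /andP[Nj xj].
rewrite distrC W_err; first by have := HN j Nj; rewrite sub0r normrN normr_id.
by apply: (le_trans (ltW (truncnS_gt _))); rewrite ler_nat.
Qed.

(** Averaging midpoint convexity over a symmetric shift bounds [W j x] by a local mean, and so by a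
    local integral of [|V|] and the error, uniformly in [j]. *)
Let W_upper (M : R) : exists (C : R) (J : nat), forall j x, (J <= j)%N -> enorm x <= M -> W j x <= C.
Proof.
have [Mo Mo0 HM] := @molk_bounded R n 0; have Il := intg_abs (loc_intg LV (M + n%:R)).
exists (Mo * (1 + Ex leb (fun y => `|loc V (M + n%:R) y|))), (Num.trunc (M + n%:R + n%:R)).+1.
move=> j x jJ xM.
have jM : M + n%:R + n%:R <= j%:R by apply: (le_trans (ltW (truncnS_gt _))); rewrite ler_nat.
pose G y := err j y + `|loc V (M + n%:R) y|.
have IG : intg leb G by exact: intgD (err_intg j) Il.
have mW : measf (W j) by exact: measurable_mol.
have WG z : `|W j (x + z) * molk 0 z| <= Mo * G (z + x).
  have [->|z0] := eqVneq (molk 0 z) 0.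
    by rewrite mulr0 normr0; apply: mulr_ge0 => //; rewrite addr_ge0// normr_ge0.
  have zn := molk_enorm z0; have xz : enorm (x + z) <= M + n%:R.
    by rewrite (le_trans (enormD _ _))// lerD.
  rewrite normrM (ger0_norm (molk_ge0 _ _)) mulrC (addrC z x); apply: ler_pM => //; first exact: molk_ge0.
  rewrite /G -W_err; last by lra.
  rewrite /loc xz -{1}(subrK (V (x + z)) (W j (x + z))); exact: ler_normD.
have mx (s : 'rV[R]_n -> 'rV[R]_n) : measf s -> measf (fun z => W j (x + s z)).
  by move=> ms; apply: measurableT_comp mW _; apply: measurable_rVD => //; exact: measurable_cst.
have m1 := mx _ (@measurable_id _ _ setT).
have [[sG1 _] sG2] := leb_shift x (intg_meas IG).
have IW : intg (nu n 0) (fun z => W j (x + z)).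
  apply/(nu_intgE 0 m1); apply: intg_le (intgZ Mo (sG1 IG)) => //.
  by apply: measurable_funM => //; exact: measurable_molk.
have [[_ s1] s2] := nu_sym 0 m1.
have := Ex_le (intg_cst (nu n 0) (2 * W j x)) (intgD IW (s1 IW)) _; rewrite Ex_cst (ExD IW (s1 IW)) s2.
move=> H; have {H} : 2 * W j x <= Ex (nu n 0) (fun z => W j (x + z)) + Ex (nu n 0) (fun z => W j (x + z)).
  apply: H => z; apply: le_trans (mol_midpoint HV (kk j) x z).
  by rewrite lerDl dot_ge0.
rewrite (nu_Ex 0 m1) => H.
have : Ex leb (fun z => W j (x + z) * molk 0 z) <= Mo * Ex leb G.
  rewrite sG2 -ExZ; last exact: sG1.
  apply: Ex_le => [||z]; [exact/(nu_intgE 0 m1)|by apply: intgZ; exact: sG1|].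
  exact: le_trans (ler_norm _) (WG z).
have GE : Ex leb G <= 1 + Ex leb (fun y => `|loc V (M + n%:R) y|).
  have -> : Ex leb G = Ex leb (err j) + Ex leb (fun y => `|loc V (M + n%:R) y|) := ExD (err_intg j) Il.
  by apply: lerD => //; exact: le_trans (err_le j) (dyad_le1 j).
by move=> GE2; exact: half_trans H GE2 (ler_wpM2l Mo0 GE).
Qed.

Let ae_point : exists a, W j a @[j --> \oo] --> V a.
Proof.
apply: contrapT => H; have [A [mA A0 sA]] := W_ae.
have AT : A = setT by apply/seteqP; split => // x _; apply: sA => /= c; apply: H; exists x.
have := @box_integral R n 1 1 (fun=> 1) ltr01 ler01 (measurable_cst _) (fun=> ler01) (fun _ _ => lexx _).
rewrite integral_cst// -AT; move: A0 => /= ->; rewrite mule0 lee_fin leNgt => /negP; apply.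
by rewrite mulr_gt0// exprn_gt0// mulr_gt0.
Qed.

(** The upper bound at the reflection of [x] in a point [a] of convergence becomes, by midpoint
    convexity at [a], a lower bound at [x]; so the upper limit is finite. *)
Let W_limsup x : exists L, is_limsup (fun j => W j x) L.
Proof.
have [a ca] := ae_point; have [C [J HC]] := W_upper (enorm x).
have [C' [J' HC']] := W_upper (enorm (a - (x - a))).
have [N _ HN] := (cvgrPdist_le _ _).1 ca 1 ltr01.
apply: (@limsup_exists _ C (2 * (V a - 1) - C') (maxn J (maxn J' N))) => j.
rewrite !geq_max => /and3P[jJ jJ' jN]; rewrite HC// andbT.
have := HN j jN; rewrite ler_norml => /andP[_ h1].
have := HC' j (a - (x - a)) jJ' (lexx _); have := mol_midpoint HV (kk j) a (x - a).
by have -> : a + (x - a) = x by [rewrite addrC subrK]; rewrite -/(W j _) -/(W j _) -/(W j _); have := dot_ge0 (x - a); lra.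
Qed.

Let Vt x := projT1 (cid (W_limsup x)).
Let VtP x : is_limsup (fun j => W j x) (Vt x). Proof. exact: projT2 (cid (W_limsup x)). Qed.

Lemma potential_regular : exists F : 'rV[R]_n -> R,
  [/\ (forall x d, 2 * F x + dot d d <= F (x + d) + F (x - d)),
    (forall K : R, exists C : R, forall x : 'rV[R]_n, enorm x <= K -> F x <= C) &
    {ae leb, forall x, V x = F x}].
Proof.
exists Vt; split=> [x d|K|].
- apply: (@le_of_add_small _ _ _ 4 1) => // e e0 _.
  have [J1 H1] := (VtP (x + d)).1 e e0; have [J2 H2] := (VtP (x - d)).1 e e0.
  have [j] := (VtP x).2 e (maxn J1 J2) e0; rewrite geq_max => /andP[/H1 h1 /H2 h2] h3.
  have := mol_midpoint HV (kk j) x d; rewrite -/(W j _) -/(W j _) -/(W j _); lra.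
- have [C [J HC]] := W_upper K; exists (C + 1) => x xK.
  have [j jJ h] := (VtP x).2 1 J ltr01; have := HC j x jJ xK; lra.
- apply: filterS W_ae => x cx; apply/eqP; rewrite eq_le; apply/andP; split.
    apply: (@le_of_add_small _ _ _ 2 1) => // e e0 _.
    have [J1 H1] := (VtP x).1 e e0; have [N _ HN] := (cvgrPdist_le _ _).1 cx e e0.
    have := H1 _ (leq_maxl J1 N); have := HN _ (leq_maxr J1 N).
    by rewrite ler_norml => /andP[_ +]; lra.
  apply: (@le_of_add_small _ _ _ 2 1) => // e e0 _.
  have [N _ HN] := (cvgrPdist_le _ _).1 cx e e0.
  have [j jN h] := (VtP x).2 e N e0; have := HN j jN; rewrite ler_norml => /andP[+ _]; lra.
Qed.

Lemma sdens_of_Hess (mu : probability 'rV[R]_n R) :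
  has_density mu leb (fun x => expR (- V x)) -> exists F, sdens mu F.
Proof.
move=> dmu; have [F [fc fb VF]] := potential_regular.
have [gF sF] := midpoint_slc fc fb; exists (fun x => expR (- F x)); split=> // A mA.
rewrite dmu//; apply: ae_eq_integral => //.
- apply: measurable_funTS; apply/measurable_EFinP; apply: (measurableT_comp (@measurable_expR R)).
  exact: measurable_funN.
- by apply: measurable_funTS; apply/measurable_EFinP; exact: gdom_meas gF.
- by apply: filterS VF => x -> _.
Qed.

End potential_limit.

(** * Approximation of weakly differentiable functions *)

Section weak_approximation.
Context {R : realType} (n : nat).
Local Notation leb := (lebesgue_rV R n).
Local Notation ei i := (delta_mx 0 i : 'rV[R]_n).

(** Dilates of one cut-off, normalized to be one at the origin: they tend to one pointwise while
    their derivatives are of order [1 / (N + 1)]. *)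
Let chi (N : nat) (x : 'rV[R]_n) : R := (bump 1 0 (0 : 'rV[R]_n))^-1 * bump N.+1%:R 0 x.

Let b0 : 0 < bump 1 0 (0 : 'rV[R]_n).
Proof. by apply/(bump_gt0 _ _ ltr01) => i; rewrite subrr normr0. Qed.

Let chi_test N : test_function (chi N).
Proof.
apply: (test_mul (f := fun=> (bump 1 0 (0 : 'rV[R]_n))^-1)); last exact: test_bump.
by apply/smoothP => k; exact: smk_cst.
Qed.

Let chi_dil N x : chi N x = chi 0 (rad N *: x).
Proof.
rewrite /chi /bump; congr (_ * _); apply: eq_bigr => i _.
by rewrite !mxE !mulr0 invr1 !mul1r !mulN1r mulNr.
Qed.

Let chi_derive N v x : 'D_v (chi N) x = 'D_(rad N *: v) (chi 0) (rad N *: x).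
Proof.
rewrite /derive; set f1 := (fun h => _); set f2 := (fun h => _); suff -> : f1 = f2 by [].
apply/funext => h; rewrite /f1 /f2 /= (chi_dil N (h *: v + x)) (chi_dil N x).
have -> // : rad N *: (h *: v + x) = h *: (rad N *: v) + rad N *: x.
by rewrite (scalerDr (rad N) (h *: v)) scalerA scalerA mulrC.
Qed.

Let chi_bounds : exists2 K : R, 0 <= K & forall N v x,
  `|chi N x| <= K /\ `|'D_v (chi N) x| <= rad N * (K * enorm v).
Proof.
have [A A0 HA] := test_bounded (chi_test 0); have [B B0 HB] := test_derive_bound (chi_test 0).
exists (A + B) => [|N v x]; first exact: addr_ge0.
rewrite chi_dil chi_derive; split; first by apply: le_trans (HA _) _; rewrite lerDl.
apply: le_trans (HB _ _) _; have r0 := @rad_gt0 R N.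
rewrite enormZ (gtr0_norm r0) mulrCA; apply: ler_wpM2l; first exact: ltW.
by rewrite ler_wpM2r ?enorm_ge0// lerDr.
Qed.

Let rad_cvg : rad N @[N --> \oo] --> (0 : R).
Proof. exact: cvg_harmonic. Qed.

Let chi_cvg x : chi N x @[N --> \oo] --> (1 : R).
Proof.
have -> : (1 : R) = chi 0 (0 *: x) by rewrite scale0r /chi mulVf// gt_eqF.
under eq_fun do rewrite chi_dil.
have cz : rad N *: x @[N --> \oo] --> 0 *: x by apply: cvgZl; exact: rad_cvg.
have := @cvg_comp _ _ _ (fun N => rad N *: x) (chi 0) _ _ _ cz (@test_continuous R n _ (chi_test 0) (0 *: x)); exact: id.
Qed.

Let chi_D_cvg v x : 'D_v (chi N) x @[N --> \oo] --> (0 : R).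
Proof.
have [K K0 HK] := chi_bounds; apply/norm_cvg0P.
apply: (@squeeze_cvgr _ _ _ _ (fun=> 0) (fun N => rad N * (K * enorm v))).
- by apply: nearW => N; rewrite normr_ge0 (HK N v x).2.
- exact: cvg_cst.
- by rewrite -(mul0r (K * enorm v)); apply: cvgMl; exact: rad_cvg.
Qed.

Let rel (f : 'rV[R]_n -> R) (h : 'I_n -> 'rV[R]_n -> R) := forall phi, test_function phi -> forall i,
  Ex leb (fun x => f x * 'D_(ei i) phi x) = - Ex leb (fun x => h i x * phi x).

Lemma loc_test f s : loc_integrable leb f -> test_function s -> intg leb (fun x => f x * s x).
Proof.
move=> Lf ts; have [M _ HM] := test_support ts; have [B _ HB] := test_bounded ts.
have := loc_mul_intg Lf M (test_meas ts) HB; congr (intg leb _); apply/funext => x.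
by rewrite /loc; case: leP => // /HM ->; rewrite !mulr0.
Qed.

(** The product rule for weak gradients, by testing [u] against [chi N * phi]. *)
Let cut_rel u g N : is_weak_gradient u g -> rel (fun x => u x * chi N x)
  (fun i x => g x 0 i * chi N x + u x * 'D_(ei i) (chi N) x).
Proof.
move=> [Lu Lg H] phi tp i; have [sp _] := tp; have [sc _] := chi_test N.
have t1 : test_function (fun x => chi N x * phi x) by apply: test_mul.
have sD := (test_D (ei i) (chi_test N)).
have t2 : test_function (fun x => 'D_(ei i) (chi N) x * phi x) by apply: test_mul => //; case: sD.
have t3 : test_function (fun x => chi N x * 'D_(ei i) phi x) by apply: test_mul => //; exact: test_D.
have I1 := loc_test (Lg i) t1; have I2 := loc_test Lu t2; have I3 := loc_test Lu t3.
have E : Ex leb (fun x => u x * 'D_(ei i) (fun x => chi N x * phi x) x) =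
    - Ex leb (fun x => g x 0 i * (chi N x * phi x)) by rewrite /Ex -fineN -(H _ t1 i).
have -> : (fun x => (g x 0 i * chi N x + u x * 'D_(ei i) (chi N) x) * phi x) =
   (fun x => g x 0 i * (chi N x * phi x) + u x * ('D_(ei i) (chi N) x * phi x)).
  by apply/funext => x; ring.
have -> : (fun x => u x * chi N x * 'D_(ei i) phi x) = (fun x => u x * (chi N x * 'D_(ei i) phi x)).
  by apply/funext => x; ring.
rewrite (ExD I1 I2) opprD -E.
have -> : (fun x => u x * 'D_(ei i) (fun x => chi N x * phi x) x) =
   (fun x => u x * (chi N x * 'D_(ei i) phi x) + u x * ('D_(ei i) (chi N) x * phi x)).
  by apply/funext => x; rewrite derive_mul; [ring|exact: (sc [::])|exact: (sp [::])].
by rewrite (ExD I3 I2) addrK.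
Qed.

Let mol_bdd k f : intg leb f -> exists2 B : R, 0 <= B & forall x, `|mol k f x| <= B.
Proof.
move=> If; have mf := intg_meas If; have [M M0 HM] := @molk_bounded R n k.
have If' := intg_abs If; exists (M * Ex leb (fun x => `|f x|)) => [|x].
  by rewrite mulr_ge0// Ex_ge0.
have tb := test_bump x (@rad_gt0 R k); have [B B0 HB] := test_bounded tb.
have mb : measf (fun y => bump (rad k) x y / bmass n k).
  by apply: measurable_funM => //; exact: test_meas.
have bE y : bump (rad k) x y / bmass n k = molk k (y - x).
  by rewrite /molk -(bump_shift (rad k) (y - x) 0 x) add0r subrK.
have I : intg leb (fun y => f y * (bump (rad k) x y / bmass n k)).
  apply: intg_le (intgZ M If') => [|y]; first exact: measurable_funM.
  by rewrite normrM mulrC bE ger0_norm ?molk_ge0// ler_wpM2r.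
rewrite mol_bump//; apply: le_trans (Ex_abs I) _; rewrite -(ExZ M If').
apply: Ex_le (intg_abs I) (intgZ M If') _ => y.
by rewrite normrM mulrC bE (ger0_norm (molk_ge0 _ _)) ler_wpM2r.
Qed.

(** The gradient of a mollification is the mollified weak gradient. The remainder [e] in
    [first_diff] for the bump gives the two-point error, proportional to the integral of [|f|]. *)
Let mol_two_point k f h : intg leb f -> (forall i, intg leb (h i)) -> rel f h ->
  exists2 C : R, 0 <= C & forall x d : 'rV[R]_n, `|mol k f (x + d) - mol k f (x - d)| <=
    2 * enorm d * (enorm (\row_i mol k (h i) x) + C * enorm d).
Proof.
move=> If Ih frel; have mf := intg_meas If; have m0 := @bmass_gt0 R n k.
pose b := bump (rad k) (0 : 'rV[R]_n); have tb : test_function b by exact: test_bump (rad_gt0 k).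
have [M M0 HM] := first_diff tb; have [K K0 HK] := test_bounded tb.
have [K' K'0 HK'] := test_derive_bound tb.
pose A := Ex leb (fun x => `|f x|); have A0 : 0 <= A by exact: Ex_ge0.
exists (M * A / bmass n k) => [|x d]; first by rewrite divr_ge0 ?mulr_ge0// ltW.
have bE z y : bump (rad k) z y = b (y - z).
  by rewrite /b -(bump_shift (rad k) (y - z) 0 z) add0r subrK.
have tx : test_function (bump (rad k) x) by exact: test_bump (rad_gt0 k).
have If_test s : test_function s -> intg leb (fun y => f y * s y).
  move=> ts; have [B _ HB] := test_bounded ts; under eq_fun do rewrite mulrC.
  exact: intg_mul_bdd If (test_meas ts) HB.
have molE (q : 'rV[R]_n -> R) z : intg leb q -> mol k q z = (bmass n k)^-1 * Ex leb (fun y => q y * b (y - z)).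
  move=> Iq; have mq := intg_meas Iq; rewrite (mol_bump k z mq) -ExZ.
    by congr (Ex leb _); apply/funext => y; rewrite bE; ring.
  have tz := test_bump z (@rad_gt0 R k); have [B _ HB] := test_bounded tz.
  have := intg_mul_bdd Iq (test_meas tz) HB; congr (intg leb _); apply/funext => y.
  by rewrite bE mulrC.
have DE v : 'D_v (bump (rad k) x) = fun y => 'D_v b (y - x).
  have -> : bump (rad k) x = (fun y => b (y + - x)) by apply/funext => y; exact: bE.
  exact: derive_shift.
pose e y := b (y - x + d) - b (y - x - d) - 2 * 'D_d b (y - x).
have tt z : test_function (fun y => b (y - z)).
  by have := test_bump z (@rad_gt0 R k); congr test_function; apply/funext => y; rewrite bE.
have I1 := If_test _ (tt (x + d)); have I2 := If_test _ (tt (x - d)).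
have tD v : test_function (fun y => 'D_v b (y - x)) by rewrite -DE; exact: test_D.
have I3 := If_test _ (tD d).
have I4 : intg leb (fun y => f y * e y).
  have := intgB (intgB I2 I1) (intgZ 2 I3); congr (intg leb _); apply/funext => y.
  by rewrite /e !opprD !opprK !addrA; ring.
have E1 : Ex leb (fun y => f y * 'D_d b (y - x)) = - bmass n k * dot d (\row_i mol k (h i) x).
  have -> : (fun y => f y * 'D_d b (y - x)) = (fun y => \sum_i d 0 i * (f y * 'D_(ei i) b (y - x))).
    apply/funext => y; rewrite derive_coords; last by case: tb => /(_ [::]).
    by rewrite mulr_sumr; apply: eq_bigr => i _; rewrite mulrCA.
  rewrite Ex_sum => [|i _]; last by apply: intgZ; exact: If_test.
  rewrite /dot mulr_sumr; apply: eq_bigr => i _; rewrite ExZ; last exact: If_test.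
  have := frel _ tx i; have -> : (fun x0 => f x0 * 'D_(ei i) (bump (rad k) x) x0) = (fun x0 => f x0 * 'D_(ei i) b (x0 - x)).
    by have DEi := DE (ei i); apply/funext => y; congr (_ * _); exact: (congr1 (fun q => q y) DEi).
  move=> ->; rewrite mxE molE//.
  have -> : (fun y => h i y * bump (rad k) x y) = (fun y => h i y * b (y - x)).
    by apply/funext => y; rewrite bE.
  by move: (Ex _ _) => t; field; rewrite gt_eqF.
have E2 : mol k f (x + d) - mol k f (x - d) =
    2 * dot d (\row_i mol k (h i) x) - (bmass n k)^-1 * Ex leb (fun y => f y * e y).
  rewrite !molE// -mulrBr -(ExB I1 I2).
  have -> : (fun y => f y * b (y - (x + d)) - f y * b (y - (x - d))) =
     (fun y => (-2) * (f y * 'D_d b (y - x)) - f y * e y).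
    by apply/funext => y; rewrite /e !opprD !opprK !addrA; ring.
  rewrite (ExB (intgZ _ I3) I4) (ExZ _ I3) E1; move: (Ex _ _) (dot _ _) => p q.
  by field; rewrite gt_eqF.
have E3 : `|Ex leb (fun y => f y * e y)| <= M * dot d d * A.
  apply: le_trans (Ex_abs I4) _; rewrite -(ExZ _ (intg_abs If)).
  apply: Ex_le (intg_abs I4) (intgZ _ (intg_abs If)) _ => y.
  by rewrite normrM mulrC ler_wpM2r// HM.
rewrite E2; apply: le_trans (ler_normB _ _) _; rewrite !normrM (ger0_norm (ler0n _ 2)).
rewrite mulrDr -mulrA; apply: lerD; first by rewrite ler_pM2l// dot_le_enorm.
rewrite gtr0_norm ?invr_gt0//; apply: (le_trans (ler_wpM2l _ E3)); first by rewrite invr_ge0 ltW.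
have := mulr_ge0 (mulr_ge0 M0 A0) (dot_ge0 d); rewrite -enorm_sqr => h0.
have h1 : 0 <= (bmass n k)^-1 * (M * A * enorm d ^+ 2) by rewrite mulr_ge0// invr_ge0 ltW.
by move: (bmass n k)^-1 h1 => t; nra.
Qed.

Variables (P : probability 'rV[R]_n R) (F : 'rV[R]_n -> R).
Hypothesis PF : sdens P F.
Let gF : gdom F. Proof. by case: PF. Qed.

Let F_le : exists2 C : R, 0 <= C & forall x, F x <= C.
Proof.
have [_ F0 [C [c [c0 HF]]]] := gF.
have C0 : 0 <= C by have := lt_le_trans (F0 0) (HF 0); rewrite dot0l mulr0 oppr0 expR0 mulr1 => /ltW.
exists C => // x; apply: le_trans (HF x) _; rewrite ler_piMr// expR_le1 oppr_le0.
by rewrite mulr_ge0 ?dot_ge0// ltW.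
Qed.

(** [F] is bounded below by a positive number on a ball containing the support, so square
    integrability under [P] is locally that under Lebesgue measure. *)
Let local_sqr_intg w s : L2 P w -> test_function s -> intg leb (fun x => `|w x * s x| ^+ 2).
Proof.
move=> [mw Iw] ts; have [M M0 HM] := test_support ts; have [B B0 HB] := test_bounded ts.
have [cF F0 _] := gF.
have [|c _ Hc] := @EVT_min_rV R n F [set x | enorm x <= M] _ (@ball_compact R n M) (continuous_subspaceT cF).
  by exists 0; rewrite /= /enorm dot0l sqrtr0.
have Iw' : intg leb (fun x => w x ^+ 2 * F x) by apply/(sdens_intg PF) => //; exact: measurable_funX.
apply: intg_le (intgZ (B ^+ 2 / F c) Iw') => [|x].
  apply: measurable_funX; apply: measurableT_comp => //; apply: measurable_funM => //; exact: test_meas.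
rewrite ger0_norm ?sqr_ge0// normrM exprMn (real_normK (num_real (w x))).
have [xM|/HM ->] := leP (enorm x) M; last first.
  rewrite normr0 expr0n mulr0 mulr_ge0 ?divr_ge0 ?sqr_ge0//; first exact: ltW.
  by rewrite mulr_ge0 ?sqr_ge0// ltW.
have Fx : F c <= F x by apply: Hc; rewrite inE.
have sB : `|s x| ^+ 2 <= B ^+ 2 by rewrite lerXn2r ?nnegrE.
have -> : B ^+ 2 / F c * (w x ^+ 2 * F x) = w x ^+ 2 * (B ^+ 2 * (F x / F c)) by ring.
apply: ler_wpM2l; first exact: sqr_ge0.
by apply: le_trans sB _; rewrite ler_peMr ?sqr_ge0// ler_pdivlMr ?mul1r.
Qed.

Let dct2 a b (s t : nat -> 'rV[R]_n -> R) (K : R) : L2 P a -> L2 P b ->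
  (forall N, measf (s N)) -> (forall N, measf (t N)) ->
  (forall N x, `|s N x| <= K) -> (forall N x, `|t N x| <= K) ->
  (forall x, s N x @[N --> \oo] --> (0 : R)) -> (forall x, t N x @[N --> \oo] --> (0 : R)) ->
  forall e : R, 0 < e -> \forall N \near \oo, Ex P (fun x => (a x * s N x + b x * t N x) ^+ 2) <= e.
Proof.
move=> [ma Ia] [mb Ib] ms mt sK tK cs ct e e0.
suff : Ex P (fun x => (a x * s N x + b x * t N x) ^+ 2) @[N --> \oo] --> Ex P (fun=> 0).
  rewrite Ex0 => X; have {X} [N _ HN] := (cvgrPdist_le _ _).1 X e e0; exists N => // j /HN.
  by rewrite sub0r normrN ger0_norm//; apply: Ex_ge0 => x; exact: sqr_ge0.
have [] // := @Ex_dct _ _ _ P (fun N x => (a x * s N x + b x * t N x) ^+ 2) (fun=> 0)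
  (fun x => 2 * K ^+ 2 * (a x ^+ 2 + b x ^+ 2)).
- by move=> N; apply: measurable_funX; apply: measurable_funD; exact: measurable_funM.
- move=> x; have : a x * s N x + b x * t N x @[N --> \oo] --> a x * 0 + b x * 0.
    by apply: cvgD; apply: cvgMl_tmp.
  rewrite !mulr0 addr0 => c; rewrite -[X in _ --> X](mulr0 (0 : R)); by have := cvgM c c; apply.
- by apply: intgZ; exact: intgD.
- move=> N x; rewrite ger0_norm ?sqr_ge0//.
  have h1 : s N x ^+ 2 <= K ^+ 2 by rewrite -(real_normK (num_real (s N x))) lerXn2r ?nnegrE// (le_trans _ (sK N x)).
  have h2 : t N x ^+ 2 <= K ^+ 2 by rewrite -(real_normK (num_real (t N x))) lerXn2r ?nnegrE// (le_trans _ (tK N x)).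
  have := ler_wpM2l (sqr_ge0 (a x)) h1; have := ler_wpM2l (sqr_ge0 (b x)) h2.
  have := sqr_ge0 (a x * s N x - b x * t N x); lra.
Qed.

(** Cut-off followed by mollification. The cut-off converges by domination under [P]; mollification
    converges in the Lebesgue mean square, which dominates that of [P] because [F] is bounded. *)
Lemma weak_approximation u g (e : R) : is_weak_gradient u g -> L2 P u -> (forall i, L2 P (fun x => g x 0 i)) ->
  0 < e -> exists (w : 'rV[R]_n -> R) (G : 'rV[R]_n -> 'rV[R]_n) (B C : R),
  [/\ measf w /\ (forall i, measf (fun x => G x 0 i)),
      0 <= C /\ (forall x, `|w x| <= B /\ forall i, `|G x 0 i| <= B),
      forall x d, `|w (x + d) - w (x - d)| <= 2 * enorm d * (enorm (G x) + C * enorm d),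
      Ex P (fun x => (w x - u x) ^+ 2) <= e &
      forall i, Ex P (fun x => (G x 0 i - g x 0 i) ^+ 2) <= e].
Proof.
move=> ug Lu Lg e0; have [K K0 HK] := chi_bounds; have [Lu1 Lg1 _] := ug.
have mchi N := test_meas (chi_test N); have mDchi v N := test_meas (test_D v (chi_test N)).
pose f N x := u x * chi N x; pose h N i x := g x 0 i * chi N x + u x * 'D_(ei i) (chi N) x.
have en1 i : enorm (ei i) = 1 by rewrite /enorm dot_delta mxE !eqxx sqrtr1.
have rad1 N : rad N <= 1 :> R by rewrite invf_le1 ?ltr0n// ler1n.
have Dle N i x : `|'D_(ei i) (chi N) x| <= K + 1.
  have := (HK N (ei i) x).2; rewrite en1 mulr1 => /le_trans; apply.
  by apply: le_trans (ler_piMl K0 (rad1 N)) _; rewrite lerDl.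
have cle N x : `|chi N x - 1| <= K + 1.
  by apply: le_trans (ler_normB _ _) _; rewrite normr1 lerD2r (HK N 0 x).1.
have c1 x : chi N x - 1 @[N --> \oo] --> (0 : R) by rewrite -(subrr 1); exact: cvgB (chi_cvg x) (cvg_cst _).
have m1 N : measf (fun x => chi N x - 1).
  by apply: measurable_funB => //; exact: measurable_cst.
(* Each of the two approximations may err by [e / 4], since a squared sum is at most twice the sum
   of squares. *)
have e4 : 0 < e / 4 by rewrite divr_gt0.
have cf : \forall N \near \oo, Ex P (fun x => (f N x - u x) ^+ 2) <= e / 4.
  have K1 : `|0 : R| <= K + 1 by rewrite normr0 addr_ge0.
  have c0 (x : 'rV[R]_n) : (0 : R) @[_ --> \oo] --> (0 : R) by exact: cvg_cst.
  have := @dct2 u u (fun N x => chi N x - 1) (fun _ _ => 0) (K + 1) Lu Lu m1 (fun=> measurable_cst _) cle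
    (fun _ _ => K1) c1 c0 _ e4; apply: filterS => N.
  by apply: le_trans; rewrite le_eqVlt; apply/orP; left; apply/eqP; congr (Ex P _); apply/funext => x; rewrite /f; ring.
have ch i : \forall N \near \oo, Ex P (fun x => (h N i x - g x 0 i) ^+ 2) <= e / 4.
  have := @dct2 _ u (fun N x => chi N x - 1) _ (K + 1) (Lg i) Lu m1 (mDchi (ei i)) cle
    (fun N x => Dle N i x) c1 (chi_D_cvg (ei i)) _ e4; apply: filterS => N.
  by apply: le_trans; rewrite le_eqVlt; apply/orP; left; apply/eqP; congr (Ex P _); apply/funext => x; rewrite /h; ring.
have [N _ HN] := filterI cf (filter_forall _ ch); have {HN} [fN hN] := HN N (leqnn N).
have [T T0 HT] := test_support (chi_test N).
have Dsupp i : test_function ('D_(ei i) (chi N)) := test_D (ei i) (chi_test N).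
have [C C0 HC] := F_le; pose dl := e / 4 / (C + 1); have C1 : 0 < C + 1 by rewrite ltr_wpDl.
have dl0 : 0 < dl by rewrite divr_gt0.
have If : intg leb (f N) := loc_test Lu1 (chi_test N).
have If2 : intg leb (fun x => `|f N x| ^+ 2) := local_sqr_intg Lu (chi_test N).
have Ih i : intg leb (h N i) := intgD (loc_test (Lg1 i) (chi_test N)) (loc_test Lu1 (Dsupp i)).
have Ih2 i : intg leb (fun x => `|h N i x| ^+ 2).
  have a1 := local_sqr_intg (Lg i) (chi_test N); have a2 := local_sqr_intg Lu (Dsupp i).
  apply: intg_le (intgZ 2 (intgD a1 a2)) => [|x].
    by apply: measurable_funX; apply: measurableT_comp => //; exact: intg_meas (Ih i).
  rewrite ger0_norm ?sqr_ge0// !real_normK ?num_real// /h.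
  by have := sqr_ge0 (g x 0 i * chi N x - u x * 'D_(ei i) (chi N) x); lra.
have conv q : intg leb q -> intg leb (fun x => `|q x| ^+ 2) -> (exists2 M : R, 0 <= M & forall x, M < enorm x -> q x = 0) ->
    \forall k \near \oo, Ex P (fun x => (mol k q x - q x) ^+ 2) <= e / 4.
  move=> Iq Iq2 [M M0 HM]; have [k0 Hk0] := mol_cvg (isT : (0 < 2 <= 2)%N) Iq Iq2 M0 HM dl0.
  exists k0 => // k /= kk; have [J1 J2] := Hk0 k kk; have mq := intg_meas Iq.
  have md : measf (fun x => (mol k q x - q x) ^+ 2).
    by apply: measurable_funX; apply: measurable_funB => //; exact: measurable_mol.
  have le1 x : `|(mol k q x - q x) ^+ 2 * F x| <= C * `|mol k q x - q x| ^+ 2.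
    have Fx : 0 <= F x by case: gF => _ /(_ x)/ltW.
    by rewrite normrM normrX mulrC (ger0_norm Fx) ler_wpM2r// exprn_ge0.
  rewrite (sdens_Ex PF md); have J3 : intg leb (fun x => (mol k q x - q x) ^+ 2 * F x).
    apply: (intg_le _ le1 (intgZ C J1)); apply: measurable_funM => //; exact: gdom_meas gF.
  apply: (le_trans (Ex_le J3 (intgZ C J1) (fun x => le_trans (ler_norm _) (le1 x)))).
  rewrite (ExZ _ J1); apply: (@le_trans _ _ ((C + 1) * dl)); last by rewrite /dl mulrC divfK ?gt_eqF.
  by apply: ler_pM => //; [exact: Ex_ge0|rewrite lerDl].
have kf : \forall k \near \oo, Ex P (fun x => (mol k (f N) x - f N x) ^+ 2) <= e / 4.
  by apply: conv => //; exists T => // x xT; rewrite /f HT// mulr0.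
have kh i : \forall k \near \oo, Ex P (fun x => (mol k (h N i) x - h N i x) ^+ 2) <= e / 4.
  apply: conv => //; have [T' T'0 HT'] := test_support (Dsupp i).
  exists (T + T') => [|x xT]; first exact: addr_ge0.
  rewrite /h HT ?HT' ?mulr0 ?addr0//; apply: le_lt_trans xT; [by rewrite lerDr|by rewrite lerDl].
have [k _ Hk] := filterI kf (filter_forall _ kh); have {Hk} [fk hk] := Hk k (leqnn k).
have rl := cut_rel N ug; have [C' C'0 HC'] := mol_two_point k If Ih rl.
have [B1 B10 HB1] := mol_bdd k If.
have bh i : exists B : R, 0 <= B /\ forall x, `|mol k (h N i) x| <= B.
  by have [B B0 HB] := mol_bdd k (Ih i); exists B.
pose Bi i := projT1 (cid (bh i)); have Bi0 i : 0 <= Bi i := (projT2 (cid (bh i))).1.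
have HBi i : forall x, `|mol k (h N i) x| <= Bi i := (projT2 (cid (bh i))).2.
have comb (q r s : 'rV[R]_n -> R) : L2 P (fun x => q x - r x) -> L2 P (fun x => r x - s x) ->
    Ex P (fun x => (q x - r x) ^+ 2) <= e / 4 -> Ex P (fun x => (r x - s x) ^+ 2) <= e / 4 ->
    Ex P (fun x => (q x - s x) ^+ 2) <= e.
  move=> [m2 J1] [m3 J2] h1 h2.
  have J3 : intg P (fun x => (q x - s x) ^+ 2).
    have := intg_sqrD m2 m3 J1 J2; congr (intg P _); apply/funext => x; by rewrite subrKA.
  have H : Ex P (fun x => (q x - s x) ^+ 2) <= 2 * (Ex P (fun x => (q x - r x) ^+ 2) + Ex P (fun x => (r x - s x) ^+ 2)).
    rewrite -(ExD J1 J2) -(ExZ 2 (intgD J1 J2)); apply: (Ex_le J3 (intgZ 2 (intgD J1 J2))) => x.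
    by have := sqr_ge0 ((q x - r x) - (r x - s x)); lra.
  by move: (Ex _ _) (Ex _ _) (Ex _ _) H h1 h2 => a1 a2 a3; lra.
have Lbd (w s : 'rV[R]_n -> R) : L2 P w -> (exists B : R, forall x, `|s x| <= B) -> measf s -> L2 P (fun x => w x * s x).
  move=> [mw Iw] [B HB] ms; split; first exact: measurable_funM.
  apply: intg_le (intgZ (B ^+ 2) Iw) => [|x]; first by apply: measurable_funX; exact: measurable_funM.
  rewrite ger0_norm ?sqr_ge0// exprMn mulrC ler_wpM2r ?sqr_ge0//.
  by rewrite -(real_normK (num_real (s x))) lerXn2r ?nnegrE// (le_trans _ (HB x)).
have Lf : L2 P (f N) by apply: Lbd => //; exists K => x; exact: (HK N 0 x).1.
have Lh i : L2 P (h N i).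
  by apply: L2D; apply: Lbd => //; [exists K => x; exact: (HK N 0 x).1|exists (K + 1) => x].
have Lmf : L2 P (mol k (f N)) by apply: L2_bdd HB1; exact: measurable_mol (intg_meas If).
have Lmh i : L2 P (mol k (h N i)) by apply: L2_bdd (HBi i); exact: measurable_mol (intg_meas (Ih i)).
exists (mol k (f N)), (fun x => \row_i mol k (h N i) x), (B1 + \sum_i Bi i), C'; split=> //.
- split=> [|i]; first by case: Lmf.
  by under eq_fun do rewrite mxE; case: (Lmh i).
- split => // x; split=> [|i]; first by apply: le_trans (HB1 x) _; rewrite lerDl sumr_ge0.
  rewrite mxE; apply: le_trans (HBi i x) _; rewrite (bigD1 i)//= addrCA lerDl addr_ge0// sumr_ge0//.
- exact: comb (L2B Lmf Lf) (L2B Lf Lu) fk fN.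
- move=> i; have := comb _ _ _ (L2B (Lmh i) (Lh i)) (L2B (Lh i) (Lg i)) (hk i) (hN i).
  by apply: le_trans; rewrite le_eqVlt; apply/orP; left; apply/eqP; congr (Ex P _); apply/funext => x; rewrite mxE.
Qed.

End weak_approximation.

(** * Stability in the Sobolev space and the choice of the subspace *)

Section weak_stability.
Context {R : realType} (n : nat).
Variables (P : probability 'rV[R]_n R) (F : 'rV[R]_n -> R).
Hypothesis PF : sdens P F.
Implicit Types (u : 'rV[R]_n -> R) (g : 'rV[R]_n -> 'rV[R]_n).
Local Notation leb := (lebesgue_rV R n).

Let sq_perturb (a b : 'rV[R]_n -> R) (t : R) : 0 < t -> L2 P a -> L2 P b ->
  Ex P (fun x => (a x - b x) ^+ 2) <= t ^+ 2 ->
  Ex P (fun x => a x ^+ 2) <= (1 + t) * Ex P (fun x => b x ^+ 2) + (t + t ^+ 2).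
Proof.
move=> t0 La Lb h; have Lab := L2B La Lb.
have I := intgD (intgZ (1 + t) Lb.2) (intgZ (1 + t^-1) Lab.2).
have : Ex P (fun x => a x ^+ 2) <= (1 + t) * Ex P (fun x => b x ^+ 2) + (1 + t^-1) * Ex P (fun x => (a x - b x) ^+ 2).
  rewrite -(ExZ _ Lb.2) -(ExZ _ Lab.2) -(ExD (intgZ _ Lb.2) (intgZ _ Lab.2)).
  apply: (Ex_le La.2 I) => x; rewrite -subr_ge0.
  have -> : (1 + t) * b x ^+ 2 + (1 + t^-1) * (a x - b x) ^+ 2 - a x ^+ 2 = t^-1 * (t * b x - (a x - b x)) ^+ 2.
    by field; rewrite gt_eqF.
  by rewrite mulr_ge0 ?sqr_ge0// invr_ge0 ltW.
move=> /le_trans; apply; rewrite lerD2l.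
have t1 : 0 <= 1 + t^-1 by rewrite addr_ge0// invr_ge0 ltW.
apply: (le_trans (ler_wpM2l t1 h)); rewrite le_eqVlt; apply/orP; left; apply/eqP; field; by rewrite gt_eqF.
Qed.

Lemma var_dot_le (a : 'rV[R]_n) : var P (fun x => dot x a) <= dot a a.
Proof.
have [| | | | |_ h] := @sdens_poincare R n P F PF (fun x => dot x a) (fun=> enorm a) (enorm a) 0.
- by exists 0, (enorm a) => x; rewrite add0r mulrC dot_le_enorm.
- exact: measurable_cst.
- by move=> x; rewrite enorm_ge0 lexx.
- exact: lexx.
- move=> x d; rewrite mul0r addr0 !dotDl dotNl opprD opprK addrACA subrr add0r -mulr2n -[dot d a *+ 2]mulr_natl.
  by rewrite normrM (ger0_norm (ler0n _ 2)) -mulrA ler_wpM2l// dot_le_enorm.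
- by move: h; rewrite Ex_cst enorm_sqr.
Qed.

Lemma cov_dot u a : L2 P u -> Ex P u = 0 -> cov P u (fun x => dot x a) = dot (mom P u) a.
Proof. by move=> Lu u0; rewrite /cov u0 mul0r subr0 (dot_mom PF). Qed.

Let sqr_cancel (a b : R) : 0 <= a -> 0 <= b -> a ^+ 2 <= b * a -> a <= b.
Proof.
move=> a0 b0; have [->//|a1] := eqVneq a 0.
by rewrite expr2 ler_pM2r// lt_neqAle eq_sym a1.
Qed.

(** Cauchy-Schwarz for the covariance of [u] with the linear function of slope [mom P u], whose
    variance [var_dot_le] bounds. *)
Lemma mom_le u : L2 P u -> Ex P u = 0 -> dot (mom P u) (mom P u) <= Ex P (fun x => u x ^+ 2).
Proof.
move=> Lu u0; apply: sqr_cancel; [exact: dot_ge0|by apply: Ex_ge0 => x; exact: sqr_ge0|].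
rewrite -[X in X ^+ 2](cov_dot _ Lu u0); apply: le_trans (cov_sqr_le Lu (sdens_L2_dot PF _)) _.
apply: ler_pM (var_le _ _) (var_dot_le _); apply: var_ge0 => //; exact: sdens_L2_dot PF _.
Qed.

Let arith (t a aw m mw b bw N : R) : 0 < t -> t < 1 -> 0 <= m -> 0 <= b -> 0 <= N ->
  a <= (1 + t) * aw + (t + t ^+ 2) -> mw <= (1 + t) * m + (t + t ^+ 2) ->
  bw <= (1 + t) * b + N * (t + t ^+ 2) -> aw - mw <= 38 * (bw - aw) -> 0 <= aw ->
  39 * a <= m + 38 * b + (3 * m + 114 * b + 82 + 152 * N) * t.
Proof.
move=> t0 t1 m0 b0 N0 h1 h2 h3 h4 aw0.
have t2 : t ^+ 2 <= t by rewrite expr2 ler_piMr ?ltW.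
have k1 : 39 * aw <= (1 + t) * (m + 38 * b) + 2 * t + 76 * (N * t) by nra.
have : (1 + t) * (39 * aw) <= (1 + t) * ((1 + t) * (m + 38 * b) + 2 * t + 76 * (N * t)).
  by rewrite ler_wpM2l// addr_ge0// ltW.
have k2 : t ^+ 2 * (m + 38 * b) <= t * (m + 38 * b) by rewrite ler_wpM2r//; lra.
have k3 : t ^+ 2 * N <= t * N by rewrite ler_wpM2r.
nra.
Qed.

Lemma stability_weak u g : is_weak_gradient u g -> L2 P u -> (forall i, L2 P (fun x => g x 0 i)) ->
  Ex P u = 0 -> Ex P (fun x => u x ^+ 2) - dot (mom P u) (mom P u) <=
    38 * (Ex P (fun x => dot (g x) (g x)) - Ex P (fun x => u x ^+ 2)).
Proof.
move=> ug Lu Lg u0; set a := Ex P _; set m := dot _ _; set b := Ex P (fun x => dot (g x) (g x)).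
have m0 : 0 <= m by exact: dot_ge0.
have b0 : 0 <= b by apply: Ex_ge0 => x; exact: dot_ge0.
suff : 39 * a <= m + 38 * b by lra.
apply: (@le_of_add_small _ _ _ (3 * m + 114 * b + 82 + 152 * n%:R) 1 ltr01) => t t0 t1.
have t20 : 0 < t ^+ 2 by rewrite exprn_gt0.
have [w [G [B [C [[mw mG] [C0 bd] tp hw hG]]]]] := weak_approximation PF ug Lu Lg t20.
have Lw : L2 P w by apply: L2_bdd mw (fun x => (bd x).1).
have LG i : L2 P (fun x => G x 0 i) by apply: L2_bdd (mG i) (fun x => (bd x).2 i).
(* Centring the approximant does not increase its distance to the centred function [u]. *)
pose w0 x := w x - Ex P w; have Lw0 : L2 P w0 by exact: L2B Lw (L2_cst P _).
have Ew0 : Ex P w0 = 0 by rewrite (ExB (L2_intg Lw) (intg_cst P _)) Ex_cst subrr.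
have Lwu := L2B Lw Lu.
have hw0 : Ex P (fun x => (w0 x - u x) ^+ 2) <= t ^+ 2.
  have E : Ex P (fun x => w x - u x) = Ex P w by rewrite (ExB (L2_intg Lw) (L2_intg Lu)) u0 subr0.
  apply: le_trans hw; apply: le_trans (var_le _ _).
  rewrite -(var_shift (Ex P w) Lwu) varE (ExB (L2_intg Lwu) (intg_cst P _)) Ex_cst E subrr expr0n subr0.
  by rewrite le_eqVlt; apply/orP; left; apply/eqP; congr (Ex P _); apply/funext => x; rewrite /w0; ring.
have B0 : 0 <= B by exact: le_trans (bd 0).1.
have mG' : measf G by apply/measurable_rVP.
have w0B x : `|w0 x| <= B + `|Ex P w| by apply: le_trans (ler_normB _ _) _; rewrite lerD2r (bd x).1.
have GB x : 0 <= enorm (G x) <= n%:R * B by rewrite enorm_ge0 enorm_le_mul// => i; exact: (bd x).2.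
have tp0 x d : `|w0 (x + d) - w0 (x - d)| <= 2 * enorm d * (enorm (G x) + C * enorm d).
  by have := tp x d; rewrite /w0 opprB addrA subrK.
have st := stability_nice PF w0B (measurable_enorm mG') GB C0 tp0 Ew0.
have h1 : a <= (1 + t) * Ex P (fun x => w0 x ^+ 2) + (t + t ^+ 2).
  apply: sq_perturb => //; apply: le_trans hw0; rewrite le_eqVlt; apply/orP; left; apply/eqP.
  by congr (Ex P _); apply/funext => x; ring.
have h2 : dot (mom P w0) (mom P w0) <= (1 + t) * m + (t + t ^+ 2).
  have E0 : Ex P (fun x => w0 x - u x) = 0.
    by rewrite (ExB (L2_intg Lw0) (L2_intg Lu)) Ew0 u0 subr0.
  have := le_trans (mom_le (L2B Lw0 Lu) E0) hw0.
  have -> : mom P (fun x => w0 x - u x) = mom P w0 - mom P u.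
    apply/rowP => i; rewrite !mxE -ExB; try by apply: L2_mul => //; under eq_fun do rewrite coordE; exact: sdens_L2_dot PF _.
    by congr (Ex P _); apply/funext => x; rewrite mulrBl.
  move: (mom P w0) (mom P u) @m m0 {st} => p q m m0; rewrite /m => h.
  suff : 0 <= t * ((1 + t) * dot q q + (t + t ^+ 2) - dot p p) by rewrite pmulr_rge0// subr_ge0.
  have := dot_ge0 (t *: q - (p - q)); rewrite !(dotDl, dotDr, dotZl, dotZr, dotNl, dotNr).
  move: h; rewrite !(dotDl, dotDr, dotZl, dotZr, dotNl, dotNr) (dotC q p).
  by move: (dot p p) (dot p q) (dot q q) => pp pq qq h h'; nra.
have h3 : Ex P (fun x => enorm (G x) ^+ 2) <= (1 + t) * b + n%:R * (t + t ^+ 2).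
  have S (H : 'rV[R]_n -> 'rV[R]_n) : (forall i, L2 P (fun x => H x 0 i)) ->
      Ex P (fun x => dot (H x) (H x)) = \sum_i Ex P (fun x => H x 0 i ^+ 2).
    by move=> LH; rewrite /dot Ex_sum => // i _; exact: (LH i).2.
  under [X in Ex P X <= _]eq_fun do rewrite enorm_sqr.
  rewrite (S _ LG) /b (S _ Lg) mulr_sumr.
  have -> : n%:R * (t + t ^+ 2) = \sum_(i < n) (t + t ^+ 2) by rewrite sumr_const card_ord mulr_natl.
  by rewrite -big_split; apply: ler_sum => i _; exact: sq_perturb.
apply: arith t0 t1 m0 b0 (ler0n _ _) h1 h2 h3 st _; by apply: Ex_ge0 => x; exact: sqr_ge0.
Qed.

Lemma poincare_weak u g : is_weak_gradient u g -> L2 P u -> (forall i, L2 P (fun x => g x 0 i)) ->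
  Ex P u = 0 -> Ex P (fun x => u x ^+ 2) <= Ex P (fun x => dot (g x) (g x)).
Proof.
by move=> ug Lu Lg u0; have := stability_weak ug Lu Lg u0; have := mom_le Lu u0; lra.
Qed.

Let loc_comb (f h : 'rV[R]_n -> R) (a : R) : loc_integrable leb f -> loc_integrable leb h ->
  loc_integrable leb (fun x => a * f x + h x).
Proof.
move=> [mf If] [mh Ih]; split=> [|K cK].
  by apply: measurable_funD => //; apply: measurable_funM.
have mK : measurable K by exact: closed_measurable_rV (compact_closed (@norm_hausdorff _ _) cK).
have ma (q : 'rV[R]_n -> R) : measf q -> measurable_fun K (fun x => `|q x|%:E).
  by move=> mq; apply: measurable_funTS; apply/measurable_EFinP; exact: measurableT_comp.
have mc : measf (fun x => a * f x) by exact: measurable_funM.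
apply: (@le_lt_trans _ _ (\int[leb]_(x in K) (`|a|%:E * `|f x|%:E + `|h x|%:E))%E).
  apply: ge0_le_integral => //.
  - by apply: ma; exact: measurable_funD.
  - by apply: emeasurable_funD; [apply: measurable_funeM|]; exact: ma.
  - by move=> x _; rewrite -EFinM -EFinD lee_fin -normrM ler_normD.
rewrite ge0_integralD//; [|by apply: measurable_funeM; exact: ma|exact: ma].
rewrite ge0_integralZl//; last exact: ma.
by rewrite lte_add_pinfty ?Ih// lte_mul_pinfty ?If// ge0_fin_numE ?If// integral_ge0.
Qed.

Let grad_comb u g v h (a : R) : is_weak_gradient u g -> is_weak_gradient v h ->
  is_weak_gradient (fun x => a * u x + v x) (fun x => a *: g x + h x).
Proof.
move=> [Lu Lg Hu] [Lv Lh Hv]; split=> [|i|f tf i]; first exact: loc_comb.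
  have -> : (fun x => (a *: g x + h x) 0 i) = (fun x => a * g x 0 i + h x 0 i) by apply/funext => x; rewrite !mxE.
  exact: loc_comb.
have tD := test_D (delta_mx 0 i) tf.
have Iu := loc_test Lu tD; have Iv := loc_test Lv tD; have Ig := loc_test (Lg i) tf; have Ih := loc_test (Lh i) tf.
have := Hu _ tf i; have := Hv _ tf i; rewrite (ExE Iu) (ExE Iv) (ExE Ig) (ExE Ih) => -[e1] [e2].
have -> : (fun x => ((a * u x + v x) * 'D_(delta_mx 0 i) f x)%:E) =
  (fun x => (a * (u x * 'D_(delta_mx 0 i) f x) + v x * 'D_(delta_mx 0 i) f x)%:E).
  by apply/funext => x; congr EFin; ring.
have -> : (fun x => ((a *: g x + h x) 0 i * f x)%:E) = (fun x => (a * (g x 0 i * f x) + h x 0 i * f x)%:E).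
  by apply/funext => x; congr EFin; rewrite !mxE; ring.
rewrite (ExE (intgD (intgZ a Iu) Iv)) (ExE (intgD (intgZ a Ig) Ih)) (ExD (intgZ a Iu) Iv) (ExD (intgZ a Ig) Ih).
by rewrite (ExZ a Iu) (ExZ a Ig) e1 e2 -EFinN; congr EFin; ring.
Qed.

Let grad0 : is_weak_gradient (fun=> 0 : R) (fun=> 0 : 'rV[R]_n).
Proof.
have L0 : loc_integrable leb (fun=> 0 : R).
  by split=> [|K cK]; [exact: measurable_cst|under eq_integral do rewrite normr0; rewrite integral0].
split=> [//|i|f tf i]; first by under [X in loc_integrable _ X]eq_fun do rewrite mxE.
under eq_integral do rewrite mul0r; under [in RHS]eq_integral do rewrite mxE mul0r.
by rewrite integral0 oppe0.
Qed.

Lemma grad_sum k (s : 'I_k -> R) (u : 'I_k -> 'rV[R]_n -> R) (g : 'I_k -> 'rV[R]_n -> 'rV[R]_n) :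
  (forall i, is_weak_gradient (u i) (g i)) ->
  is_weak_gradient (fun x => \sum_i s i * u i x) (fun x => \sum_i s i *: g i x).
Proof.
move=> H; elim: (index_enum _) => [|i r IH].
  by under eq_fun do rewrite big_nil; under [X in is_weak_gradient _ X]eq_fun do rewrite big_nil; exact: grad0.
under eq_fun do rewrite big_cons; under [X in is_weak_gradient _ X]eq_fun do rewrite big_cons.
exact: grad_comb.
Qed.

Let pair_arith (s t : R) (i : bool) (q e : R) : (i -> s = t /\ q = 1) -> (~~ i -> `|q| <= e) ->
  (if i then (1 + e) * (s * s) else 0) - e * (`|s| * `|t|) <= s * (t * q).
Proof.
case: i => [/(_ isT) [-> ->] _|_ /(_ isT) h]; first by rewrite -normrM -expr2 ger0_norm ?sqr_ge0//; lra.
rewrite sub0r lerNl mulrA; apply: le_trans (ler_norm _) _.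
by rewrite normrN !normrM mulrC ler_wpM2r// mulr_ge0.
Qed.

Let sum_abs_sqr k (s : 'rV[R]_k) : (\sum_i `|s 0 i|) ^+ 2 <= k%:R * dot s s.
Proof.
pose a : 'rV[R]_k := \row_i `|s 0 i|; pose o : 'rV[R]_k := const_mx 1.
have -> : \sum_i `|s 0 i| = dot o a by apply: eq_bigr => i _; rewrite !mxE mul1r.
have -> : dot s s = dot a a by apply: eq_bigr => i _; rewrite !mxE -normrM ger0_norm// -expr2 sqr_ge0.
have -> : k%:R = dot o o by rewrite /dot; under eq_bigr do rewrite !mxE mulr1; rewrite sumr_const card_ord.
exact: dot_cauchy.
Qed.

Lemma image_dim k (C : 'M[R]_(k, n)) : (forall s : 'rV_k, s *m C = 0 -> s = 0) ->
  exists U : {vspace 'rV[R]_n}, \dim U = k /\ forall v, v \in U -> exists s : 'rV_k, v = s *m C.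
Proof.
move=> C0; pose f : 'Hom('rV[R]_k, 'rV[R]_n) := linfun (mulmxr C).
exists (limg f); split; last by move=> v /memv_imgP[s _ ->]; exists s; rewrite lfunE.
have := limg_ker_dim f fullv; rewrite capfv.
suff -> : lker f = 0%VS by rewrite dimv0 add0n dimvf /dim/= mul1n.
apply/eqP; rewrite -subv0; apply/subvP => s; rewrite memv_ker lfunE /= => /eqP/C0 ->.
exact: mem0v.
Qed.

Section selection.
Variables (k : nat) (u : 'I_k -> 'rV[R]_n -> R) (g : 'I_k -> 'rV[R]_n -> 'rV[R]_n) (eps : R).
Hypotheses (kn : (k <= n)%N) (eps0 : 0 <= eps) (ug : forall i, is_weak_gradient (u i) (g i)).
Hypotheses (Lu : forall i, L2 P (u i)) (Lg : forall i j, L2 P (fun x => g i x 0 j)).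
Hypotheses (u0 : forall i, Ex P (u i) = 0) (u1 : forall i, Ex P (fun x => u i x ^+ 2) = 1).
Hypotheses (go : forall i j, j != i -> Ex P (fun x => dot (g i x) (g j x)) = 0).
Hypothesis ge : forall i, Ex P (fun x => dot (g i x) (g i x)) <= 1 + eps.

Let us (s : 'I_k -> R) x := \sum_i s i * u i x.
Let gs (s : 'I_k -> R) x := \sum_i s i *: g i x.

Let Lus s : L2 P (us s). Proof. by apply: L2_sum => i; exact: L2Z. Qed.
Let Lgs s j : L2 P (fun x => gs s x 0 j).
Proof.
under eq_fun do rewrite summxE; apply: L2_sum => i; under eq_fun do rewrite mxE; exact: L2Z.
Qed.
Let Eus s : Ex P (us s) = 0.
Proof.
rewrite Ex_sum => [|i _]; last by apply: intgZ; exact: L2_intg.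
by rewrite big1// => i _; rewrite (ExZ _ (L2_intg (Lu i))) u0 mulr0.
Qed.

Let Igg i j : intg P (fun x => dot (g i x) (g j x)).
Proof. by apply: intg_sum => l _; exact: L2_mul. Qed.

Let Egs s : Ex P (fun x => dot (gs s x) (gs s x)) = \sum_i s i ^+ 2 * Ex P (fun x => dot (g i x) (g i x)).
Proof.
have -> : (fun x => dot (gs s x) (gs s x)) = fun x => \sum_i \sum_j s i * (s j * dot (g i x) (g j x)).
  apply/funext => x; rewrite {1}/gs dot_suml; apply: eq_bigr => i _.
  rewrite dotZl dotC dot_suml mulr_sumr; apply: eq_bigr => j _; by rewrite dotZl dotC.
have I i j : intg P (fun x => s i * (s j * dot (g i x) (g j x))) by do 2 apply: intgZ.
rewrite Ex_sum => [|i _]; last by apply: intg_sum.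
apply: eq_bigr => i _; rewrite Ex_sum// (bigD1 i)//= big1 => [|j ji].
  by rewrite addr0 ExZ ?ExZ//; [rewrite mulrA|exact: intgZ].
by rewrite ExZ ?ExZ ?go ?mulr0//; exact: intgZ.
Qed.

Let Egs_le s : Ex P (fun x => dot (gs s x) (gs s x)) <= (1 + eps) * \sum_i s i ^+ 2.
Proof. by rewrite Egs mulr_sumr; apply: ler_sum => i _; rewrite mulrC ler_wpM2r ?sqr_ge0. Qed.

Let Eus2 s : Ex P (fun x => us s x ^+ 2) = \sum_i \sum_j s i * (s j * Ex P (fun x => u i x * u j x)).
Proof.
have I i j : intg P (fun x => s i * (s j * (u i x * u j x))) by do 2 apply: intgZ; exact: L2_mul.
have -> : (fun x => us s x ^+ 2) = fun x => \sum_i \sum_j s i * (s j * (u i x * u j x)).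
  apply/funext => x; rewrite expr2 {1}/us mulr_suml; apply: eq_bigr => i _.
  by rewrite mulr_sumr; apply: eq_bigr => j _; ring.
rewrite Ex_sum => [|i _]; last by apply: intg_sum.
apply: eq_bigr => i _; rewrite Ex_sum//; apply: eq_bigr => j _.
by rewrite ExZ ?ExZ//; [exact: L2_mul|apply: intgZ; exact: L2_mul].
Qed.

(** The Poincare inequality for [u i - c * u j] with [c] equal to 1 and to -1: orthogonality of the
    gradients bounds the energy by [2 * (1 + eps)], while the mean square is [2 - 2 * c] times the
    correlation. *)
Let gram i j : i != j -> `|Ex P (fun x => u i x * u j x)| <= eps.
Proof.
move=> ij; have ji : j != i by rewrite eq_sym.
have key (c : R) : c ^+ 2 = 1 -> - c * Ex P (fun x => u i x * u j x) <= eps.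
  move=> c1; pose s l : R := if l == i then 1 else if l == j then - c else 0.
  have sE (T : 'I_k -> R) : \sum_l s l * T l = T i - c * T j.
    rewrite (bigD1 i)//= (bigD1 j)//= big1 => [|l /andP[li lj]].
      by rewrite /s !eqxx (negPf ji) mul1r addr0 mulNr.
    by rewrite /s (negPf li) (negPf lj) mul0r.
  have uE : us s = fun x => u i x - c * u j x by apply/funext => x; exact: sE.
  have := le_trans (poincare_weak (grad_sum s ug) (Lus s) (Lgs s) (Eus s)) (Egs_le s).
  have -> : \sum_i s i ^+ 2 = 2.
    under eq_bigr do rewrite expr2; rewrite sE /s !eqxx (negPf ji) mulrN opprK -expr2 c1; ring.
  have I := L2_mul (Lu i) (Lu j).
  have -> : Ex P (fun x => us s x ^+ 2) = 2 - 2 * c * Ex P (fun x => u i x * u j x).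
    rewrite uE.
    have -> : (fun x => (u i x - c * u j x) ^+ 2) = (fun x => (u i x ^+ 2 + u j x ^+ 2) + (- (2 * c)) * (u i x * u j x)).
      apply/funext => x; rewrite sqrrB exprMn c1 mul1r; ring.
    by rewrite (ExD (intgD (Lu i).2 (Lu j).2) (intgZ _ I)) (ExD (Lu i).2 (Lu j).2) (ExZ _ I) !u1; ring.
  lra.
rewrite ler_norml lerNl -mulN1r key ?expr1n//=.
by have := key (- 1); rewrite sqrrN expr1n opprK mul1r; apply.
Qed.

Let Eus_ge s : (1 + eps - k%:R * eps) * (\sum_i s i ^+ 2) <= Ex P (fun x => us s x ^+ 2).
Proof.
rewrite Eus2; apply: (@le_trans _ _ (\sum_i \sum_j ((if i == j then (1 + eps) * (s i * s i) else 0) - eps * (`|s i| * `|s j|)))).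
  have -> : \sum_i \sum_j ((if i == j then (1 + eps) * (s i * s i) else 0) - eps * (`|s i| * `|s j|)) =
      (1 + eps) * \sum_i s i ^+ 2 - eps * (\sum_i `|s i|) ^+ 2.
    rewrite mulr_sumr expr2 mulr_suml mulr_sumr -sumrB; apply: eq_bigr => i _.
    rewrite sumrB -big_mkcond /= (big_pred1 i) => [|j]; last by rewrite eq_sym.
    by rewrite expr2; congr (_ - _); rewrite mulr_sumr mulr_sumr.
  have := sum_abs_sqr (\row_i s i).
  have -> : \sum_i `|(\row_i s i) 0 i| = \sum_i `|s i| by apply: eq_bigr => i _; rewrite mxE.
  have -> : dot (\row_i s i) (\row_i s i) = \sum_i s i ^+ 2 by apply: eq_bigr => i _; rewrite mxE expr2.
  by move=> /(ler_wpM2l eps0); lra.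
apply: ler_sum => i _; apply: ler_sum => j _; apply: pair_arith => [/eqP <-|]; last exact: gram.
by split => //; rewrite -[RHS](u1 i).
Qed.

Let C : 'M[R]_(k, n) := \matrix_i mom P (u i).
Let momE (s : 'rV[R]_k) : s *m C = mom P (us (s 0)).
Proof.
apply/rowP => j; rewrite !mxE.
have Lj : L2 P (fun x => x 0 j) by under eq_fun do rewrite coordE; exact: sdens_L2_dot PF _.
have -> : (fun x : 'rV_n => us (s 0) x * x 0 j) = fun x => \sum_i s 0 i * (u i x * x 0 j).
  by apply/funext => x; rewrite mulr_suml; apply: eq_bigr => i _; rewrite mulrA.
rewrite Ex_sum => [|i _]; last by apply: intgZ; exact: L2_mul.
by apply: eq_bigr => i _; rewrite !mxE (ExZ _ (L2_mul (Lu i) Lj)).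
Qed.

(** The gap [a - m] is at most [38 * K * e * S], and [S] is at most [a / (1 - K * e)]; since
    [K * e < 1 / 39], the factor [38 / (1 - 1 / 39)] equals 39. *)
Let arith1 (K e a b m S : R) : 39 * K * e < 1 -> 0 <= e -> 1 <= K -> 0 <= S -> a - m <= 38 * (b - a) ->
  b <= (1 + e) * S -> (1 + e - K * e) * S <= a -> (1 - 39 * K * e) * S <= m /\ a - m <= 39 * K * e * a.
Proof.
move=> h1 h2 h3 h4 h5 h6 h7; have h8 : e * S <= K * e * S by rewrite ler_wpM2r// ler_peMl.
split; first by nra.
have : (1 + e - K * e) * S * (39 * K * e) <= a * (39 * K * e).
  by apply: ler_wpM2r h7; rewrite !mulr_ge0//; lra.
have k0 : 0 <= K * e by rewrite mulr_ge0//; lra.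
have : 0 <= (1 - 39 * (K * e)) * (K * e) * S by rewrite !mulr_ge0//; lra.
have : 0 <= 39 * e * (K * e) * S by rewrite !mulr_ge0//; lra.
nra.
Qed.

(** A vector [v = s *m C] is the covariance vector of [us s], so the squared norm of [v] is the
    covariance of [us s] with the linear function of slope [v]. Its square is at most the mean
    square of [us s] times the variance along [v], and that mean square exceeds the squared norm of
    [v] by a small proportion only. *)
Lemma exists_gaussian_directions : exists U : {vspace 'rV[R]_n}, \dim U = k /\
  forall v, v \in U -> dot v v - var P (fun x => dot x v) <= 39 * k%:R * eps * dot v v.
Proof.
(* When the right-hand factor is at least one, variances being nonnegative, any [k]-dimensional
   subspace will do; [k <= n] provides one spanned by coordinate vectors. *)
have [big|small] := leP 1 (39 * k%:R * eps).
  have [|U [dU _]] := @image_dim k (\matrix_(i, j) (i == j :> nat)%:R).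
    move=> s /rowP H; apply/rowP => i; have := H (widen_ord kn i); rewrite !mxE (bigD1 i)//= big1 => [|j ji].
      by rewrite !mxE eqxx mulr1 addr0.
    by rewrite !mxE (_ : (j == i :> nat) = false) ?mulr0//; apply/negbTE.
  exists U; split=> // v _; have := var_ge0 (sdens_L2_dot PF v).
  by have := ler_peMl (dot_ge0 v) big; lra.
have [k0|k1] := posnP k.
  have [|U [dU UC]] := @image_dim k (\matrix_(i, j) 0).
    by move=> s _; apply/rowP => -[i ik]; exfalso; rewrite k0 in ik.
  exists U; split=> // v /UC [s ->]; have -> : s *m (\matrix_(i, j) (0 : R)) = 0 :> 'rV_n.
    by apply/rowP => j; rewrite !mxE big1// => i _; rewrite mxE mulr0.
  by under eq_fun do rewrite dot0r; rewrite dot0r mulr0 sub0r oppr_le0; apply: var_ge0; exact: L2_cst.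
have K1 : 1 <= k%:R :> R by rewrite ler1n.
have st s := stability_weak (grad_sum s ug) (Lus s) (Lgs s) (Eus s).
have key (s : 'rV[R]_k) : (1 - 39 * k%:R * eps) * dot s s <= dot (s *m C) (s *m C) /\
    Ex P (fun x => us (s 0) x ^+ 2) - dot (s *m C) (s *m C) <= 39 * k%:R * eps * Ex P (fun x => us (s 0) x ^+ 2).
  have sE : dot s s = \sum_i s 0 i ^+ 2 by apply: eq_bigr => i _; rewrite expr2.
  rewrite momE; apply: (arith1 small eps0 K1 (dot_ge0 s) (st (s 0))); rewrite sE; [exact: Egs_le|exact: Eus_ge].
have [|U [dU UC]] := @image_dim k C.
  move=> s s0; apply: dot_eq0; have := (key s).1; rewrite s0 dot0l => h.
  by apply/eqP; rewrite eq_le dot_ge0 andbT -(pmulr_rle0 _ (x := 1 - 39 * k%:R * eps)) ?subr_gt0.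
exists U; split=> // v /UC [s ->]; have := (key s).2; set a := Ex P _.
have := cov_sqr_le (Lus (s 0)) (sdens_L2_dot PF (s *m C)); rewrite (cov_dot _ (Lus _) (Eus _)) -momE.
have a0 : 0 <= a by apply: Ex_ge0 => x; exact: sqr_ge0.
have va := var_le P (us (s 0)); rewrite -/a in va; have v0 := var_ge0 (sdens_L2_dot PF (s *m C)).
have := dot_ge0 (s *m C); move: (dot (s *m C) _) (var P (fun x => dot x _)) v0 => m w w0 m0 h1 h2.
have {h1} h1 : m ^+ 2 <= a * w by apply: le_trans h1 _; rewrite ler_wpM2r.
have c0 : 0 <= 39 * k%:R * eps by rewrite !mulr_ge0.
move: (39 * k%:R * eps) c0 h2 small => c c0 h2 c1.
have [m1|m1] := eqVneq m 0; first by rewrite m1 mulr0 sub0r oppr_le0.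
have mp : 0 < m by rewrite lt_neqAle eq_sym m1.
have ap : 0 < a by rewrite lt_neqAle a0 andbT eq_sym; apply: contraTneq h1 => ->; rewrite mul0r -ltNge exprn_gt0.
suff : 0 <= a * (c * m - (m - w)) by rewrite pmulr_rge0// subr_ge0.
by have : (a - m) * m <= c * a * m; [rewrite ler_wpM2r|nra].
Qed.

End selection.
End weak_stability.

(** * Rotating or resampling a block of Gaussian coordinates *)

Section block_coupling.
Context {R : realType} (n : nat).
Local Notation g2 := (pp (@gam R n) (@gam R n)).
Implicit Types (S : pred 'I_n) (f : 'rV[R]_n -> R).

Definition mix S (x y : 'rV[R]_n) : 'rV[R]_n := \row_i (if S i then y 0 i else x 0 i).

Lemma measurable_mix_fun S d (T : measurableType d) (p q : T -> 'rV[R]_n) :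
  measf p -> measf q -> measf (fun t => mix S (p t) (q t)).
Proof.
move=> /measurable_rVP mp /measurable_rVP mq; apply/measurable_rVP => i.
by under [X in measurable_fun _ X]eq_fun do rewrite mxE; case: (S i); [exact: mq|exact: mp].
Qed.

Lemma had4_law (a b c d : 'rV[R]_n) :
  (forall i, [/\ a 0 i ^+ 2 + c 0 i ^+ 2 = 1, b 0 i ^+ 2 + d 0 i ^+ 2 = 1 & a 0 i * b 0 i + c 0 i * d 0 i = 0]) ->
  is_law g2 (fun z => (had a z.1 + had b z.2, had c z.1 + had d z.2)) g2.
Proof.
move=> H; have mX : measf (fun z : 'rV[R]_n * 'rV[R]_n => (had a z.1 + had b z.2, had c z.1 + had d z.2)).
  by apply: measurable_fun_pair; apply: measurable_rVD; apply: measurable_had.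
apply: law_of_integral => // f mf f0.
pose A : 'M[R]_(n + n) := block_mx (diag_mx a) (diag_mx c) (diag_mx b) (diag_mx d).
have AA : orthm A.
  rewrite /orthm tr_block_mx !tr_diag_mx mulmx_block [RHS]scalar_mx_block.
  congr block_mx; apply/matrixP => i j; rewrite mxE !mul_diag_mx !mxE;
    have [->|ij] := eqVneq i j; rewrite ?mulr0n ?mulr1n ?mulr0 ?addr0//; case: (H j) => h1 h2 h3.
  - by rewrite -!expr2.
  - exact: h3.
  - by rewrite mulrC [d 0 j * _]mulrC.
  - by rewrite -!expr2.
have E (g : 'rV[R]_n * 'rV[R]_n -> \bar R) : measf g -> (forall z, 0 <= g z)%E ->
    (\int[g2]_z g z = \int[gam (n + n)]_w g (lsubmx w, rsubmx w))%E.
  move=> mg g0; rewrite (law_ge0_integral (gam_split_law n n))//.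
  - by apply: eq_integral => -[x y] _; rewrite /= row_mxKl row_mxKr.
  - apply: measurableT_comp => //.
    by apply: measurable_fun_pair; [exact: measurable_lsubmx|exact: measurable_rsubmx].
have mfs : measf (fun w : 'rV[R]_(n + n) => f (lsubmx w, rsubmx w)).
  apply: measurableT_comp => //.
  by apply: measurable_fun_pair; [exact: measurable_lsubmx|exact: measurable_rsubmx].
rewrite E// (law_ge0_integral (gam_orth_law AA))// (law_ge0_integral (gam_split_law n n))//; last first.
  exact: measurableT_comp mfs (measurable_mulmxr A).
apply: eq_integral => -[x y] _ /=; rewrite mul_row_block row_mxKl row_mxKr.
by congr f; congr pair; apply/rowP => i; rewrite !mxE; congr (_ + _); rewrite (bigD1 i)//= big1 ?addr0;
  rewrite ?mxE ?eqxx ?mulr1n 1?mulrC// => j /negPf ji; rewrite mxE ji mulr0n mulr0.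
Qed.

Lemma law_comp_fst (X : 'rV[R]_n * 'rV[R]_n -> 'rV[R]_n * 'rV[R]_n) : is_law g2 X g2 ->
  is_law g2 (fun z => (X z).1) (gam n).
Proof. by move=> lX; exact: law_trans lX (law_fst _ _). Qed.

Lemma swap_law S : is_law g2 (fun z => (mix S z.1 z.2, mix S z.2 z.1)) g2.
Proof.
pose p : 'rV[R]_n := \row_i (if S i then 0 else 1); pose q : 'rV[R]_n := \row_i (if S i then 1 else 0).
have := @had4_law p q q p; have -> : (fun z : 'rV[R]_n * 'rV[R]_n => (had p z.1 + had q z.2, had q z.1 + had p z.2)) =
    (fun z => (mix S z.1 z.2, mix S z.2 z.1)).
  by apply/funext => -[x y]; congr pair; apply/rowP => i; rewrite !mxE; case: (S i); ring.
by apply=> i; rewrite !mxE; case: (S i); split; ring.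
Qed.

Let mf_pair d (T : measurableType d) f (p q : T -> 'rV[R]_n) : measf f ->
  measf p -> measf q -> measf (fun z => (f (p z) - f (q z)) ^+ 2).
Proof.
by move=> mf mp mq; apply: measurable_funX; apply: measurable_funB; exact: measurableT_comp.
Qed.

Let sq_bound (B x y : R) : `|x| <= B -> `|y| <= B -> `|(x - y) ^+ 2| <= 4 * B ^+ 2.
Proof.
move=> a b; rewrite normrX; have -> : 4 * B ^+ 2 = (2 * B) ^+ 2 by ring.
have B0 := le_trans (normr_ge0 _) a; rewrite lerXn2r ?nnegrE// ?mulr_ge0//.
by apply: le_trans (ler_normB _ _) _; lra.
Qed.

(** [gebelein] with the covariances rewritten as mean squared differences; the independent copy
    corresponds to correlation zero. *)
Let gebelein_sq f (B rho sigma : R) : measf f -> (forall x, `|f x| <= B) ->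
  0 < rho -> 0 < sigma -> rho ^+ 2 + sigma ^+ 2 = 1 ->
  (1 - rho) * Ex g2 (fun z => (f z.1 - f z.2) ^+ 2) <= Ex g2 (fun z => (f z.1 - f (rho *: z.1 + sigma *: z.2)) ^+ 2).
Proof.
move=> mf fB r0 s0 rs; have := gebelein mf fB (lt0r_neq0 r0) s0 rs.
have Lf := L2_bdd (gam n) mf fB; have lw := law_comp_fst (gam_rot_law n rs).
have m1 : measf (fun z : 'rV[R]_n * 'rV[R]_n => f z.1) by exact: measurableT_comp mf measurable_fst.
have gen (Y : 'rV[R]_n * 'rV[R]_n -> 'rV[R]_n) : is_law g2 Y (gam n) ->
    Ex g2 (fun z => (f z.1 - f (Y z)) ^+ 2) = 2 * Ex (gam n) (fun x => f x ^+ 2) - 2 * Ex g2 (fun z => f z.1 * f (Y z)).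
  move=> lY; have mY : measf (fun z => f (Y z)) by exact: measurableT_comp mf lY.1.
  have L1 : L2 g2 (fun z => f z.1) by apply: L2_bdd m1 _ => z; exact: fB.
  have L2' : L2 g2 (fun z => f (Y z)) by apply: L2_bdd mY _ => z; exact: fB.
  have I := L2_mul L1 L2'; have I1 : intg g2 (fun z => f z.1 ^+ 2) := L1.2; have I2 : intg g2 (fun z => f (Y z) ^+ 2) := L2'.2.
  have -> : (fun z => (f z.1 - f (Y z)) ^+ 2) = (fun z => (f z.1 ^+ 2 + f (Y z) ^+ 2) - 2 * (f z.1 * f (Y z))).
    by apply/funext => z; ring.
  rewrite (ExB (intgD I1 I2) (intgZ 2 I)) (ExD I1 I2) (ExZ 2 I).
  have m2 : measf (fun x => f x ^+ 2) by exact: measurable_funX.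
  have -> := @Ex_fst _ _ _ _ _ (gam n) (gam n) (fun x => f x ^+ 2) m2.
  by have := law_Ex lY m2; rewrite /comp => <-; ring.
rewrite (gen _ (law_snd _ _)) (gen _ lw).
have -> : Ex g2 (fun z => f z.1 * f z.2) = Ex (gam n) f ^+ 2.
  rewrite (@pp_Ex _ _ _ _ _ _ _ _ (B ^+ 2)) /=; last first.
  - by move=> z; rewrite normrM expr2 ler_pM.
  - by apply: measurable_funM => //; exact: measurableT_comp mf measurable_snd.
  under eq_fun do rewrite (ExZ _ (L2_intg Lf)) mulrC; by rewrite (ExZ _ (L2_intg Lf)) expr2.
have -> : Ex g2 (fun z => f z.1 * f (rot rho sigma z).1) = Ex (gam n) (fun x => f x * sm rho sigma f x).
  rewrite (@pp_Ex _ _ _ _ _ _ _ _ (B ^+ 2)) /=; last first.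
  - by move=> z; rewrite normrM expr2 ler_pM.
  - by apply: measurable_funM => //; exact: measurableT_comp mf lw.1.
  by congr Ex; apply/funext => x; rewrite (ExZ _ (L2_intg (mix_L2 rho sigma mf fB x))).
rewrite /cov (gtr0_norm r0) -(Ex_mix _ _ (gam n) mf fB).
have -> : Ex g2 (fun p => f (rho *: p.1 + sigma *: p.2)) = Ex (gam n) f by have := law_Ex lw mf; rewrite /comp => ->.
rewrite varE; lra.
Qed.

(** Freezing the coordinates outside [S] at an independent sample [h] and averaging over [h] changes
    nothing, so a comparison may be proved with these coordinates fixed. *)
Let freeze S (phi : 'rV[R]_n * 'rV[R]_n -> R) (B : R) : measf phi -> (forall z, `|phi z| <= B) ->
  Ex (gam n) (fun h => Ex g2 (fun z => phi (mix S h z.1, z.2))) = Ex g2 phi.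
Proof.
move=> mphi pB; rewrite (pp_Ex _ _ mphi pB).
have mP : measf (fun x => Ex (gam n) (fun y => phi (x, y))) by exact: (@meas_Ex _ _ _ _ _ (gam n)) mphi.
have lw := law_comp_fst (swap_law S); rewrite (law_Ex lw mP).
have PB x : `|Ex (gam n) (fun y => phi (x, y))| <= B.
  have m1 : measf (fun y => phi (x, y)) by exact: measurableT_comp mphi (pair1_measurable x).
  have I := intg_bdd (gam n) m1 (fun y => pB (x, y)); apply: le_trans (Ex_abs I) _.
  by rewrite -[leRHS](Ex_cst (gam n)); apply: (Ex_le (intg_abs I) (intg_cst _ _)) => y; exact: pB.
rewrite (pp_Ex _ _ (measurableT_comp mP lw.1) (fun z => PB _)); congr Ex; apply/funext => h.
have mh : measf (fun z : 'rV[R]_n * 'rV[R]_n => phi (mix S h z.1, z.2)).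
  apply: measurableT_comp mphi _; apply: measurable_fun_pair => //.
  by apply: measurable_mix_fun; [exact: measurable_cst|exact: measurable_fst].
by rewrite (pp_Ex _ _ mh (fun z => pB _)).
Qed.

Let mixK S h x z : mix S (mix S h x) z = mix S h z.
Proof. by apply/rowP => i; rewrite !mxE; case: (S i). Qed.

(** Cosines, with the sines [sn], of a rotation that moves the coordinates in [S] only. *)
Definition cs S (c : R) : 'rV[R]_n := \row_i (if S i then c else 1).
Definition sn S (s : R) : 'rV[R]_n := \row_i (if S i then s else 0).

Let meas_cs S c s : measf (fun z : 'rV[R]_n * 'rV[R]_n => had (cs S c) z.1 + had (sn S s) z.2) /\
  measf (fun z : 'rV[R]_n * 'rV[R]_n => had (cs S c) z.1 - had (sn S s) z.2).
Proof.
by split; [apply: measurable_rVD|apply: measurable_rVB]; apply: measurable_had;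
  [exact: measurable_fst|exact: measurable_snd|exact: measurable_fst|exact: measurable_snd].
Qed.

(** With the coordinates outside [S] frozen, the two rotated points form a Gaussian pair with
    correlation [c ^+ 2 - s ^+ 2 = 1 - 2 * s ^+ 2], to which [gebelein_sq] applies. *)
Let block_bdd S f (B c s : R) : measf f -> (forall x, `|f x| <= B) ->
  0 < s -> s < c -> c ^+ 2 + s ^+ 2 = 1 ->
  2 * s ^+ 2 * Ex g2 (fun z => (f z.1 - f (mix S z.1 z.2)) ^+ 2) <=
  Ex g2 (fun z => (f (had (cs S c) z.1 + had (sn S s) z.2) - f (had (cs S c) z.1 - had (sn S s) z.2)) ^+ 2).
Proof.
move=> mf fB s0 sc cs1; have c0 := lt_trans s0 sc.
have [mp mm] := meas_cs S c s.
have mmix : measf (fun z : 'rV[R]_n * 'rV[R]_n => mix S z.1 z.2).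
  by apply: measurable_mix_fun; [exact: measurable_fst|exact: measurable_snd].
have m1 := mf_pair mf (@measurable_fst _ _ 'rV[R]_n 'rV[R]_n) mmix; have m2 := mf_pair mf mp mm.
have b1 z := sq_bound (fB z.1) (fB (mix S z.1 z.2)).
have b2 (z : 'rV[R]_n * 'rV[R]_n) := sq_bound (fB (had (cs S c) z.1 + had (sn S s) z.2)) (fB (had (cs S c) z.1 - had (sn S s) z.2)).
rewrite -(freeze S m1 b1) -(freeze S m2 b2) /=.
have mlim (phi : 'rV[R]_n * 'rV[R]_n -> R) : measf phi -> (forall z, `|phi z| <= 4 * B ^+ 2) ->
    intg (gam n) (fun h => Ex g2 (fun z => phi (mix S h z.1, z.2))).
  move=> mphi pB.
  have m3 : measf (fun w : 'rV[R]_n * ('rV[R]_n * 'rV[R]_n) => phi (mix S w.1 w.2.1, w.2.2)).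
    apply: measurableT_comp mphi _; apply: measurable_fun_pair.
      by apply: measurable_mix_fun; [exact: measurable_fst|exact: measurableT_comp measurable_fst measurable_snd].
    exact: measurableT_comp measurable_snd measurable_snd.
  apply: (@intg_bdd _ _ _ _ _ (4 * B ^+ 2)) => [|h]; first exact: (@meas_Ex _ _ _ _ _ g2) m3.
  have mh : measf (fun z => phi (mix S h z.1, z.2)) by exact: measurableT_comp m3 (pair1_measurable h).
  have I := intg_bdd g2 mh (fun z => pB _); apply: le_trans (Ex_abs I) _.
  by rewrite -[leRHS](Ex_cst g2); apply: (Ex_le (intg_abs I) (intg_cst _ _)) => z; exact: pB.
rewrite -(ExZ _ (mlim _ m1 b1)); apply: (Ex_le (intgZ _ (mlim _ m1 b1)) (mlim _ m2 b2)) => h /=.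
pose fh x := f (mix S h x); have mfh : measf fh.
  by apply: measurableT_comp mf _; apply: measurable_mix_fun => //; exact: measurable_cst.
have r0 : 0 < c ^+ 2 - s ^+ 2 by rewrite subr_gt0 ltrXn2r ?nnegrE ?ltW.
have := @gebelein_sq fh B (c ^+ 2 - s ^+ 2) (2 * (c * s)) mfh (fun x => fB _) r0.
have -> : 1 - (c ^+ 2 - s ^+ 2) = 2 * s ^+ 2 by move: cs1; lra.
have -> : (fun z : 'rV[R]_n * 'rV[R]_n => (f (mix S h z.1) - f (mix S (mix S h z.1) z.2)) ^+ 2) = fun z => (fh z.1 - fh z.2) ^+ 2.
  by apply/funext => z; rewrite mixK.
move=> G; apply: le_trans (G _ _) _; first by rewrite !mulr_gt0.
  by transitivity ((c ^+ 2 + s ^+ 2) ^+ 2); [ring|rewrite cs1 expr1n].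
(* Under this orthogonal substitution the pair in [gebelein_sq] becomes [(c x + s z, c x - s z)]. *)
pose cc : 'rV[R]_n := const_mx c; pose ss : 'rV[R]_n := const_mx s.
have [|lw1 lw2] := @had4_law cc ss ss (- cc).
  by move=> i; rewrite !mxE sqrrN cs1 [_ ^+ 2 + c ^+ 2]addrC cs1; split=> //; ring.
have lw : is_law g2 (fun z => (had cc z.1 + had ss z.2, had ss z.1 + had (- cc) z.2)) g2 by [].
have mF : measurable_fun setT
    (fun z : 'rV[R]_n * 'rV[R]_n => (fh z.1 - fh ((c ^+ 2 - s ^+ 2) *: z.1 + (2 * (c * s)) *: z.2)) ^+ 2).
  apply: mf_pair => //; apply: measurable_rVD; apply: measurable_rVZ => //; exact: measurable_cst.
rewrite (law_Ex lw mF).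
rewrite le_eqVlt; apply/orP; left; apply/eqP; congr Ex; apply/funext => -[x z] /=.
rewrite /fh; congr ((f _ - f _) ^+ 2); apply/rowP => i; rewrite !mxE; case: (S i); try ring.
by transitivity ((c ^+ 2 + s ^+ 2) * (c * x 0 i - s * z 0 i)); [ring|rewrite cs1 mul1r; ring].
Qed.

Definition clip (k : nat) (t : R) : R := Num.max (- k%:R) (Num.min t k%:R).

Let clip_le k t : `|clip k t| <= k%:R.
Proof.
have k0 : 0 <= k%:R :> R by exact: ler0n.
rewrite /clip ler_norml le_max lexx /= ge_max ge_min lexx orbT andbT; lra.
Qed.

Let clip_contr k s t : (clip k s - clip k t) ^+ 2 <= (s - t) ^+ 2.
Proof.
wlog st : s t / s <= t.
  by move=> H; case/orP: (le_total s t) => /H//; rewrite -sqrrN opprB -[leRHS]sqrrN opprB.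
have k0 : 0 <= k%:R :> R by exact: ler0n.
have : 0 <= clip k t - clip k s <= t - s.
  rewrite /clip /Num.max /Num.min; case: (ltP t) => a; case: (ltP s) => b; case: (ltP _ _) => c0; case: (ltP _ _) => d0; apply/andP; split; lra.
by move=> /andP[a b]; rewrite -sqrrN opprB -[leRHS]sqrrN opprB lerXn2r ?nnegrE// subr_ge0.
Qed.

Let clip_cvg t : clip k t @[k --> \oo] --> t.
Proof.
apply: cvg_near_cst; near=> k; have tk : `|t| <= k%:R by near: k; exact: nbhs_infty_ger.
by move: tk; rewrite ler_norml /clip => /andP[a b]; rewrite (min_idPl b); apply/max_idPr.
Unshelve. all: by end_near. Qed.

Let measurable_clip d (T : measurableType d) k (f : T -> R) : measf f -> measf (fun t => clip k (f t)).
Proof.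
move=> mf; apply: measurable_maxr; first exact: measurable_cst.
by apply: measurable_minr => //; exact: measurable_cst.
Qed.

(** Clipping contracts differences, so the right side only decreases, and the left side converges by
    domination. *)
Lemma block_gebelein S f (c s : R) : L2 (gam n) f ->
  0 < s -> s < c -> c ^+ 2 + s ^+ 2 = 1 ->
  let D := fun z => (f (had (cs S c) z.1 + had (sn S s) z.2) - f (had (cs S c) z.1 - had (sn S s) z.2)) ^+ 2 in
  intg g2 D -> intg g2 (fun z => (f z.1 - f (mix S z.1 z.2)) ^+ 2) ->
  2 * s ^+ 2 * Ex g2 (fun z => (f z.1 - f (mix S z.1 z.2)) ^+ 2) <= Ex g2 D.
Proof.
move=> [mf _] s0 sc cs1 D ID I0; have [mp mm] := meas_cs S c s.
have mmix : measf (fun z : 'rV[R]_n * 'rV[R]_n => mix S z.1 z.2).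
  by apply: measurable_mix_fun; [exact: measurable_fst|exact: measurable_snd].
have mc k := measurable_clip k mf.
have mk k : measf (fun z => (clip k (f z.1) - clip k (f (mix S z.1 z.2))) ^+ 2).
  exact: (mf_pair (mc k) measurable_fst mmix).
have cz z : (clip k (f z.1) - clip k (f (mix S z.1 z.2))) ^+ 2 @[k --> \oo] --> (f z.1 - f (mix S z.1 z.2)) ^+ 2.
  have h : clip k (f z.1) - clip k (f (mix S z.1 z.2)) @[k --> \oo] --> f z.1 - f (mix S z.1 z.2).
    by apply: cvgB; exact: clip_cvg.
  by have := cvgM h h; apply.
have bz (k : nat) z : `|(clip k (f z.1) - clip k (f (mix S z.1 z.2))) ^+ 2| <= (f z.1 - f (mix S z.1 z.2)) ^+ 2.
  by rewrite ger0_norm ?sqr_ge0//; exact: clip_contr.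
have [_ cv] := Ex_dct mk cz I0 bz.
apply: (@le_of_add_small _ _ _ (2 * s ^+ 2) 1 ltr01) => e e0 _.
have [N _ HN] := (cvgrPdist_le _ _).1 cv e e0; have := HN N (leqnn N).
have s2 : 0 <= 2 * s ^+ 2 by rewrite mulr_ge0 ?sqr_ge0.
rewrite ler_norml => /andP[_]; rewrite lerBlDr => /(ler_wpM2l s2) /le_trans; apply.
rewrite mulrDr addrC lerD2r; apply: le_trans (block_bdd S (mc N) (fun x => clip_le N _) s0 sc cs1) _.
have ID' : intg g2 (fun z => (clip N (f (had (cs S c) z.1 + had (sn S s) z.2)) - clip N (f (had (cs S c) z.1 - had (sn S s) z.2))) ^+ 2).
  apply: (intg_le _ _ ID) => [|z]; first exact: (mf_pair (mc N) mp mm).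
  by rewrite ger0_norm ?sqr_ge0//; exact: clip_contr.
by apply: (Ex_le ID' ID) => z; exact: clip_contr.
Qed.

End block_coupling.

(** * Energy of the Knothe map and the coupling *)

Section transport_coupling.
Context {R : realType} (n : nat).
Variables (P : probability 'rV[R]_n R) (F : 'rV[R]_n -> R).
Hypothesis PF : sdens P F.
Local Notation g2 := (pp (@gam R n) (@gam R n)).
Implicit Types (S : pred 'I_n) (f : 'rV[R]_n -> R).

Let gF : gdom F. Proof. by case: PF. Qed.
Let sF : slc 1 F. Proof. by case: PF. Qed.
Let T := KN F.

Lemma KN_law : is_law (gam n) (KN F) P.
Proof.
apply: law_of_integral => [|h mh h0]; first exact: measurable_KN.
have F0 x : 0 <= F x by case: gF => _ /(_ x)/ltW.
have [_ _ dF] := PF; rewrite (@dens_integral _ _ _ (lebesgue_rV R n) F F0 (gdom_meas gF) P h dF mh h0).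
by rewrite (KN_push gF mh h0) (sdens_Ex1 PF) mul1e.
Qed.

Let Lc i : L2 P (fun x => x 0 i). Proof. by under eq_fun do rewrite coordE; exact: sdens_L2_dot PF _. Qed.

Let LT i : L2 (gam n) (fun x => T x 0 i).
Proof.
split; first exact: measurableT_comp (Lc i).1 KN_law.1.
exact: (law_intg KN_law (measurable_funX 2 (Lc i).1)).1 (Lc i).2.
Qed.

Let Tvar i : var (gam n) (fun x => T x 0 i) = var P (fun x => x 0 i).
Proof. by rewrite !varE (law_Ex KN_law (measurable_funX 2 (Lc i).1)) (law_Ex KN_law (Lc i).1). Qed.

Let L2_law f (Y : 'rV[R]_n * 'rV[R]_n -> 'rV[R]_n) : is_law g2 Y (gam n) -> L2 (gam n) f -> L2 g2 (fun z => f (Y z)).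
Proof.
move=> lY [mf If]; split; first exact: measurableT_comp mf lY.1.
exact: (law_intg lY (measurable_funX 2 mf)).1 If.
Qed.

Let lmix S : is_law g2 (fun z => mix S z.1 z.2) (gam n) := law_comp_fst (@swap_law R n S).
Let lfst : is_law g2 fst (gam n) := law_fst _ _.
Let lsnd : is_law g2 snd (gam n) := law_snd _ _.

(** Twice the mean conditional variance of [f] given the coordinates outside [S]. *)
Definition block_energy S f : R := Ex g2 (fun z => (f z.1 - f (mix S z.1 z.2)) ^+ 2).

Let energy_intg S f : L2 (gam n) f -> intg g2 (fun z => (f z.1 - f (mix S z.1 z.2)) ^+ 2).
Proof. by move=> Lf; exact: (L2B (L2_law lfst Lf) (L2_law (lmix S) Lf)).2. Qed.

Let pair_var f : L2 (gam n) f -> Ex g2 (fun z => (f z.1 - f z.2) ^+ 2) = 2 * var (gam n) f.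
Proof.
move=> Lf; have L1 := L2_law lfst Lf; have L2' := L2_law lsnd Lf; have I := L2_mul L1 L2'.
have -> : (fun z : 'rV[R]_n * 'rV[R]_n => (f z.1 - f z.2) ^+ 2) = (fun z => (f z.1 ^+ 2 + f z.2 ^+ 2) - 2 * (f z.1 * f z.2)).
  by apply/funext => z; ring.
rewrite (ExB (intgD L1.2 L2'.2) (intgZ 2 I)) (ExD L1.2 L2'.2) (ExZ 2 I).
have m2 := measurable_funX 2 Lf.1.
have -> := @Ex_fst _ _ _ _ _ (gam n) (gam n) (fun x => f x ^+ 2) m2.
have -> := @Ex_snd _ _ _ _ _ (gam n) (gam n) (fun x => f x ^+ 2) m2.
have [|_ ->] := Ex_fub I; first by move=> x; exact: (intgZ (f x) (L2_intg Lf)).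
rewrite (eq_fun (fun x => ExZ (f x) (L2_intg Lf))) /=.
have -> : (fun x => f x * Ex (gam n) f) = (fun x => Ex (gam n) f * f x) by apply/funext => x; rewrite mulrC.
rewrite (ExZ _ (L2_intg Lf)) varE; ring.
Qed.

Let energy_dep S f : L2 (gam n) f -> (forall x y : 'rV[R]_n, (forall i, S i -> x 0 i = y 0 i) -> f x = f y) ->
  block_energy S f = 2 * var (gam n) f.
Proof.
move=> Lf dep; rewrite -(pair_var Lf); congr Ex; apply/funext => z; congr ((_ - _) ^+ 2).
by apply: dep => i Si; rewrite mxE Si.
Qed.

(** The Efron-Stein inequality for two blocks: the square of the mixed difference [p - q - r + t] is
    nonnegative, and each of its terms has the law of one of the four resamplings. *)
Let efron_stein S S' f : L2 (gam n) f -> (forall i, ~~ (S i && S' i)) ->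
  (forall x y : 'rV[R]_n, (forall i, S i || S' i -> x 0 i = y 0 i) -> f x = f y) ->
  2 * var (gam n) f <= block_energy S f + block_energy S' f.
Proof.
move=> Lf dis dep; have I0 := (L2B (L2_law lfst Lf) (L2_law lsnd Lf)).2.
have lw := @swap_law R n S.
have swap (phi : 'rV[R]_n * 'rV[R]_n -> R) : intg g2 phi ->
    intg g2 (fun z => phi (mix S z.1 z.2, mix S z.2 z.1)) /\ Ex g2 (fun z => phi (mix S z.1 z.2, mix S z.2 z.1)) = Ex g2 phi.
  by move=> I; have mp := intg_meas I; split; [exact: (law_intg lw mp).1|rewrite (law_Ex lw mp)].
have lsw : is_law g2 (fun z => (z.2, z.1)) g2.
  have := @swap_law R n predT; have -> : (fun z : 'rV[R]_n * 'rV[R]_n => (mix predT z.1 z.2, mix predT z.2 z.1)) = (fun z => (z.2, z.1)) => //.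
  by apply/funext => z; congr pair; apply/rowP => i; rewrite mxE.
have I1 := energy_intg S Lf; have I2 := energy_intg S' Lf.
have [J0 e0] := swap _ I0; have [J2 e2] := swap _ I2.
have J1 := (law_intg lsw (intg_meas I1)).1 I1; have e1 := law_Ex lsw (intg_meas I1).
rewrite /comp /= in J1 e1.
rewrite -(ler_pM2l (ltr0n R 2)) [leRHS]mulrDr.
have -> : 2 * (2 * var (gam n) f) = Ex g2 (fun z => (f z.1 - f z.2) ^+ 2 + (f (mix S z.1 z.2) - f (mix S z.2 z.1)) ^+ 2).
  by rewrite (ExD I0 J0) e0 (pair_var Lf) mulr_natl mulr2n.
have -> : 2 * block_energy S f + 2 * block_energy S' f = Ex g2 (fun z =>
   ((f z.1 - f (mix S z.1 z.2)) ^+ 2 + (f z.2 - f (mix S z.2 z.1)) ^+ 2) +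
   ((f z.1 - f (mix S' z.1 z.2)) ^+ 2 + (f (mix S z.1 z.2) - f (mix S' (mix S z.1 z.2) (mix S z.2 z.1))) ^+ 2)).
  by rewrite (ExD (intgD I1 J1) (intgD I2 J2)) (ExD I1 J1) (ExD I2 J2) -e1 e2 !mulr_natl !mulr2n.
apply: (Ex_le (intgD I0 J0) (intgD (intgD I1 J1) (intgD I2 J2))) => z.
have -> : f (mix S' z.1 z.2) = f (mix S z.2 z.1).
  by apply: dep => i; rewrite !mxE; have := dis i; case: (S i); case: (S' i).
have -> : f (mix S' (mix S z.1 z.2) (mix S z.2 z.1)) = f z.2.
  by apply: dep => i; rewrite !mxE; have := dis i; case: (S i); case: (S' i).
move: (f z.1) (f z.2) (f (mix S z.1 z.2)) (f (mix S z.2 z.1)) => p t q r.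
by have := sqr_ge0 (p - q - r + t); lra.
Qed.

(** The infinitesimal form of [KN_rotation]. The block turns by an angle of squared tangent [e], so
    the right side is [4 * m * ln (1 + e)] and the factor on the left is [2 * e / (1 + e)]; then [e]
    tends to zero. *)
Let rotation_sum S : \sum_l block_energy S (fun x => T x 0 l) <= 2 * \sum_i (S i)%:R.
Proof.
set m := \sum_i _; have m0 : 0 <= m by apply: sumr_ge0 => i _; exact: ler0n.
apply: (@le_of_add_small _ _ _ (2 * m) 1 ltr01) => e e0 e1.
have e1' : 0 < 1 + e by rewrite addr_gt0.
pose c : R := Num.sqrt (1 + e)^-1; pose s : R := Num.sqrt (e / (1 + e)).
have c2 : c ^+ 2 = (1 + e)^-1 by rewrite sqr_sqrtr// invr_ge0 ltW.
have s2 : s ^+ 2 = e / (1 + e) by rewrite sqr_sqrtr// divr_ge0// ltW.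
have c0 : 0 < c by rewrite sqrtr_gt0 invr_gt0.
have s0 : 0 < s by rewrite sqrtr_gt0 divr_gt0.
have sc : s < c.
  rewrite /s /c ltr_sqrt ?invr_gt0//; rewrite -[ltRHS]mul1r ltr_pM2r// invr_gt0//.
have cs1 : c ^+ 2 + s ^+ 2 = 1 by rewrite c2 s2 -[X in X + _]mul1r -mulrDl divff ?gt_eqF.
have cP i : 0 < cs S c 0 i by rewrite mxE; case: (S i).
have csP i : cs S c 0 i ^+ 2 + sn S s 0 i ^+ 2 = 1.
  by rewrite !mxE; case: (S i) => //; rewrite expr1n expr0n addr0.
have [ID HD] := KN_rotation gF sF cP csP.
pose D l (z : 'rV[R]_n * 'rV[R]_n) := (T (had (cs S c) z.1 + had (sn S s) z.2) 0 l - T (had (cs S c) z.1 - had (sn S s) z.2) 0 l) ^+ 2.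
have DE : (fun z => dot (KN F (had (cs S c) z.1 + had (sn S s) z.2) - KN F (had (cs S c) z.1 - had (sn S s) z.2))
     (KN F (had (cs S c) z.1 + had (sn S s) z.2) - KN F (had (cs S c) z.1 - had (sn S s) z.2))) = fun z => \sum_l D l z.
  by apply/funext => z; apply: eq_bigr => l _; rewrite /D expr2 !mxE.
rewrite DE in ID HD.
have mp : measf (fun z : 'rV[R]_n * 'rV[R]_n => had (cs S c) z.1 + had (sn S s) z.2).
  by apply: measurable_rVD; apply: measurable_had.
have mm : measf (fun z : 'rV[R]_n * 'rV[R]_n => had (cs S c) z.1 - had (sn S s) z.2).
  by apply: measurable_rVB; apply: measurable_had.
have IDl l : intg g2 (D l).
  apply: (intg_le _ _ ID) => [|z].
    apply: measurable_funX; apply: measurable_funB.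
      exact: measurableT_comp (LT l).1 mp.
    exact: measurableT_comp (LT l).1 mm.
  rewrite ger0_norm ?sqr_ge0// (bigD1 l)//= lerDl sumr_ge0// => i _; exact: sqr_ge0.
have key l : 2 * s ^+ 2 * block_energy S (fun x => T x 0 l) <= Ex g2 (D l).
  exact: (block_gebelein (LT l) s0 sc cs1 (IDl l) (energy_intg S (LT l))).
have H : 2 * s ^+ 2 * \sum_l block_energy S (fun x => T x 0 l) <= -8 * ln (\prod_i cs S c 0 i).
  apply: le_trans HD; rewrite mulr_sumr Ex_sum => [|l _]; last exact: IDl.
  by apply: ler_sum => l _; exact: key.
have E : -8 * ln (\prod_i cs S c 0 i) = 4 * m * ln (1 + e).
  have lc : ln c = - (ln (1 + e) / 2).
    have : ln (c ^+ 2) = - ln (1 + e) by rewrite c2 lnV.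
    by rewrite lnXn// mulr2n; lra.
  have -> : ln (\prod_i cs S c 0 i) = \sum_i (S i)%:R * ln c.
    elim: (index_enum _) => [|i r IH]; first by rewrite !big_nil ln1.
    rewrite !big_cons lnM ?posrE//; last by apply: prodr_gt0 => j _; exact: cP.
    by rewrite IH mxE; case: (S i); rewrite ?mul1r// mul0r ln1.
  by rewrite -mulr_suml -/m lc; field.
have ln1 : ln (1 + e) <= e by apply: le_ln1Dx; lra.
have s20 : 0 < 2 * s ^+ 2 by rewrite mulr_gt0 ?exprn_gt0.
rewrite -(ler_pM2l s20); apply: le_trans H _; rewrite E s2.
have -> : 2 * (e / (1 + e)) * (2 * m + 2 * m * e) = 4 * m * e by field; rewrite gt_eqF.
by rewrite ler_wpM2l// mulr_ge0.
Qed.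

Variable (q : R) (k : nat).
Hypotheses (kn : (k <= n)%N) (hq : forall i : 'I_n, (i < k)%N -> 1 - var P (fun x => x 0 i) <= q) (q0 : 0 <= q).

Let prefix_count (j : nat) : (j <= k)%N -> (\sum_(i < n) (i < j : nat) = j)%N.
Proof.
move=> jk;
  rewrite -(big_mkord xpredT (fun i => (i < j)%N : nat)) (big_cat_nat (n := j)) ?(leq_trans jk)//=.
  rewrite big_nat_cond (eq_bigr (fun=> 1%N)); last by move=> i /andP[/andP[_ ->]].
  rewrite -big_nat_cond sum_nat_const_nat subn0 muln1 big_nat_cond big1 ?addn0// => i /andP[/andP[ji _] _].
  by rewrite ltnNge ji.
Qed.

Let prefix_card (j : nat) : (j <= k)%N -> #|[pred l : 'I_n | (l < j)%N]| = j.
Proof.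
move=> jk; by rewrite -sum1_card big_mkcond -[RHS](prefix_count jk); apply: eq_bigr => i _; rewrite inE; case: ltnP.
Qed.

(** The first [j] outputs depend on the first [j] inputs only, so their energy is twice their
    variance and at least [2 * (1 - q)] each; out of the total [2 * j], at most [2 * j * q] is
    left. *)
Let prefix_sum (j : nat) : (j <= k)%N ->
  \sum_(l < n | (j <= l)%N) block_energy (fun i => (i < j)%N) (fun x => T x 0 l) <= 2 * j%:R * q.
Proof.
move=> jk; have := rotation_sum (fun i => (i < j)%N); rewrite (bigID (fun l : 'I_n => (l < j)%N)) /=.
rewrite -natr_sum prefix_count//.
have E (l : 'I_n) : (l < j)%N -> block_energy (fun i => (i < j)%N) (fun x => T x 0 l) = 2 * var P (fun x => x 0 l).
  move=> lj; rewrite (energy_dep (LT l)) ?Tvar// => x y xy.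
  by apply: KN_dep => i il; apply: xy; exact: leq_ltn_trans lj.
rewrite (eq_bigr _ E) => H.
have G : \sum_(l < n | (l < j)%N) 2 * (1 - q) <= \sum_(l < n | (l < j)%N) 2 * var P (fun x => x 0 l).
  apply: ler_sum => l lj; have := hq (leq_trans lj jk); lra.
move: G; rewrite sumr_const prefix_card// -[_ *+ j]mulr_natl => G.
under eq_bigl do rewrite leqNgt; lra.
Qed.

(** Let [x'] be [x] with coordinate [i] resampled. Monotone 1-Lipschitz dependence on that
    coordinate bounds the squared increment of [f] by its product with the increment of the
    coordinate, whose mean is twice the covariance. *)
Let sqr_cov f (i : 'I_n) : f = (fun x => T x 0 i) ->
  block_energy (pred1 i) f <= 2 * Ex (gam n) (fun x => f x * x 0 i).
Proof.
move=> fE; have Lf : L2 (gam n) f by rewrite fE.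
have Lx : L2 (gam n) (fun x : 'rV[R]_n => x 0 i) by exact: L2_coord.
have lw := lmix (pred1 i).
pose u (z : 'rV[R]_n * 'rV[R]_n) := f z.1 * z.1 0 i; pose v (z : 'rV[R]_n * 'rV[R]_n) : R := f z.1 * z.2 0 i.
have Iu : intg g2 u by exact: (L2_mul (L2_law lfst Lf) (L2_law lfst Lx)).
have Iv : intg g2 v by exact: (L2_mul (L2_law lfst Lf) (L2_law lsnd Lx)).
have Ev : Ex g2 v = 0.
  have [|_ ->] := Ex_fub Iv; first by move=> x; exact: (intgZ (f x) (L2_intg Lx)).
  rewrite (eq_fun (fun x => ExZ (f x) (L2_intg Lx))) /=.
  have -> : Ex (gam n) (fun y : 'rV[R]_n => y 0 i) = 0 by under eq_fun do rewrite coordE; exact: gam_mean.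
  by under eq_fun do rewrite mulr0; exact: Ex0.
have sw := @swap_law R n (pred1 i).
have Iu' := (law_intg sw (intg_meas Iu)).1 Iu; have Iv' := (law_intg sw (intg_meas Iv)).1 Iv.
have eu := law_Ex sw (intg_meas Iu); have ev := law_Ex sw (intg_meas Iv).
have Eu : Ex g2 u = Ex (gam n) (fun x => f x * x 0 i).
  by rewrite /u (@Ex_fst _ _ _ _ _ (gam n) (gam n) (fun x => f x * x 0 i))//; exact: measurable_funM Lf.1 Lx.1.
have -> : 2 * Ex (gam n) (fun x => f x * x 0 i) =
    Ex g2 (fun z => (u z + u (mix (pred1 i) z.1 z.2, mix (pred1 i) z.2 z.1)) - (v z + v (mix (pred1 i) z.1 z.2, mix (pred1 i) z.2 z.1))).
  rewrite (ExB (intgD Iu Iu') (intgD Iv Iv')) (ExD Iu Iu') (ExD Iv Iv'); rewrite /comp in eu ev.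
  by rewrite -eu -ev Ev Eu; ring.
apply: (Ex_le (energy_intg _ Lf) (intgB (intgD Iu Iu') (intgD Iv Iv'))) => -[x y] /=.
have mixi p r : mix (pred1 i) p r 0 i = r 0 i by rewrite mxE /= eqxx.
rewrite /u /v /= !mixi.
have ag (j : 'I_n) : (j < i)%N -> x 0 j = mix (pred1 i) x y 0 j.
  by move=> ji; rewrite mxE /= -val_eqE /= (ltn_eqF ji).
have [xy|yx] := leP (y 0 i) (x 0 i).
  have := KN_lip gF sF ag; rewrite mixi => /(_ xy) /andP[]; rewrite fE /T.
  by move: (KN F x 0 i) (KN F (mix _ x y) 0 i) => a b; nra.
have := KN_lip gF sF (fun j ji => esym (ag j ji)); rewrite mixi => /(_ (ltW yx)) /andP[]; rewrite fE /T.
by move: (KN F x 0 i) (KN F (mix _ x y) 0 i) => a b; nra.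
Qed.

(** The left side is [var f - 2 * cov + 1]. By [sqr_cov] and [efron_stein], [2 * cov] is at least
    [2 * var f] minus the energy of the earlier coordinates, which [prefix_sum] bounds by
    [2 * i * q]. *)
Let first_coords (i : 'I_n) : (i < k)%N ->
  Ex (gam n) (fun x => (T x 0 i - (x 0 i + Ex P (fun y => y 0 i))) ^+ 2) <= (2 * i%:R + 1) * q.
Proof.
move=> ik; pose f x := T x 0 i; have Lf : L2 (gam n) f by exact: LT.
have Lx : L2 (gam n) (fun x : 'rV[R]_n => x 0 i) by exact: L2_coord.
have Ef : Ex (gam n) f = Ex P (fun y => y 0 i) by rewrite (law_Ex KN_law (Lc i).1).
have Ex0' : Ex (gam n) (fun x : 'rV[R]_n => x 0 i) = 0 by under eq_fun do rewrite coordE; exact: gam_mean.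
have vx : var (gam n) (fun x : 'rV[R]_n => x 0 i) = 1.
  rewrite varE Ex0' expr0n subr0; have e1 : dot (delta_mx 0 i) (delta_mx 0 i : 'rV[R]_n) = 1 by rewrite dot_delta mxE !eqxx.
  have := @gam_dot_sqr R n (delta_mx 0 i); rewrite e1 => <-.
  by congr Ex; apply/funext => x; rewrite coordE.
have -> : Ex (gam n) (fun x => (T x 0 i - (x 0 i + Ex P (fun y => y 0 i))) ^+ 2) = var (gam n) (fun x => f x - x 0 i).
  have Lfx := L2B Lf Lx; rewrite -(var_shift (Ex P (fun y => y 0 i)) Lfx) varE.
  rewrite (ExB (L2_intg Lfx) (intg_cst _ _)) Ex_cst (ExB (L2_intg Lf) (L2_intg Lx)) Ef Ex0' subr0 subrr expr0n subr0.
  by congr Ex; apply/funext => x; rewrite /f; ring.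
rewrite (varB Lf Lx) vx; have := sqr_cov (erefl f); rewrite /cov Ex0' mulr0 subr0.
have := efron_stein (S := fun j => (j < i)%N) (S' := pred1 i) Lf.
move=> ES; have {ES} ES : 2 * var (gam n) f <= block_energy (fun j => (j < i)%N) f + block_energy (pred1 i) f.
  apply: ES => [j|x y xy]; first by rewrite /= -val_eqE; case: ltngtP.
  by apply: KN_dep => j; rewrite leq_eqVlt => ji; apply: xy; rewrite /= -val_eqE orbC.
have := prefix_sum (ltnW ik); rewrite (bigD1 i)//= => PS.
have B0 : 0 <= \sum_(l < n | (i <= l)%N && (l != i)) block_energy (fun j => (j < i)%N) (fun x => T x 0 l).
  by apply: sumr_ge0 => l _; apply: Ex_ge0 => z; exact: sqr_ge0.
have hv := hq ik; rewrite -Tvar -/f in hv.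
move: ES PS hv B0; rewrite -/f; move: (block_energy _ f) (block_energy _ f) (var _ f) (\sum_(l < n | _) _) (Ex _ _) => a b c d e; lra.
Qed.

(** Resampling the first [k] inputs in the second branch makes the two groups of coordinates
    independent. *)
Definition gaussian_partner (z : 'rV[R]_n * 'rV[R]_n) : 'rV[R]_n :=
  \row_i (if (i < k)%N then z.1 0 i + Ex P (fun y => y 0 i) else KN F (mix (fun j => (j < k)%N) z.1 z.2) 0 i).

(** Each of the first [k] coordinates costs at most [(2 * k - 1) * q] and the others together
    [2 * k * q]; the total [(2 * k ^ 2 + k) * q] is at most [3 * k ^ 2 * q]. *)
Lemma coupling_energy : (0 < k)%N ->
  intg g2 (fun z => dot (KN F z.1 - gaussian_partner z) (KN F z.1 - gaussian_partner z)) /\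
  Ex g2 (fun z => dot (KN F z.1 - gaussian_partner z) (KN F z.1 - gaussian_partner z)) <= 3 * k%:R ^+ 2 * q.
Proof.
move=> k0; pose S (j : 'I_n) := (j < k)%N.
pose c (i : 'I_n) (z : 'rV[R]_n * 'rV[R]_n) : R := if (i < k)%N then (T z.1 0 i - (z.1 0 i + Ex P (fun y => y 0 i))) ^+ 2
  else (T z.1 0 i - T (mix S z.1 z.2) 0 i) ^+ 2.
have -> : (fun z => dot (KN F z.1 - gaussian_partner z) (KN F z.1 - gaussian_partner z)) = fun z => \sum_i c i z.
  by apply/funext => z; apply: eq_bigr => i _; rewrite /c !mxE; case: ifP => _; rewrite -expr2.
have Lx i : L2 (gam n) (fun x : 'rV[R]_n => x 0 i) by exact: L2_coord.
have L1 i : L2 (gam n) (fun x : 'rV[R]_n => T x 0 i - (x 0 i + Ex P (fun y => y 0 i))).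
  by apply: L2B => //; apply: L2D => //; exact: L2_cst.
have Ic i : intg g2 (c i).
  rewrite /c; case: (i < k)%N; last exact: (energy_intg S (LT i)).
  exact: (intg_fst (gam n) (L1 i).2).
split; first by apply: intg_sum.
rewrite Ex_sum// (bigID (fun i : 'I_n => (i < k)%N)) /=.
have A : \sum_(i < n | (i < k)%N) Ex g2 (c i) <= k%:R * ((2 * k%:R - 1) * q).
  have -> : k%:R * ((2 * k%:R - 1) * q) = \sum_(i < n | (i < k)%N) (2 * k%:R - 1) * q.
    by rewrite sumr_const prefix_card// mulr_natl.
  apply: ler_sum => i ik; rewrite /c ik.
  have -> := @Ex_fst _ _ _ _ _ (gam n) (gam n) (fun x => (T x 0 i - (x 0 i + Ex P (fun y => y 0 i))) ^+ 2) (measurable_funX 2 (L1 i).1).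
  apply: le_trans (first_coords ik) _; rewrite ler_wpM2r//.
  have : (i.+1)%:R <= k%:R :> R by rewrite ler_nat.
  rewrite -natr1; lra.
have B : \sum_(i < n | ~~ (i < k)%N) Ex g2 (c i) <= 2 * k%:R * q.
  apply: le_trans (prefix_sum (leqnn k)); under eq_bigl do rewrite -leqNgt.
  by apply: ler_sum => i ik; rewrite /c ltnNge ik.
have k1 : 1 <= k%:R :> R by rewrite ler1n.
apply: (le_trans (lerD A B)); move: k%:R k1 => K K1; have : 0 <= (K ^+ 2 - K) * q by rewrite mulr_ge0//; nra.
by nra.
Qed.

(** The partner after exchanging the first [k] coordinates of the two samples: the law is the same,
    and each group of coordinates now reads a single sample, which shows the product structure. *)
Definition independent_partner (z : 'rV[R]_n * 'rV[R]_n) : 'rV[R]_n :=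
  \row_i (if (i < k)%N then z.2 0 i + Ex P (fun y => y 0 i) else KN F z.1 0 i).

Let measurable_independent_partner : measf independent_partner.
Proof.
apply/measurable_rVP => i; under [X in measurable_fun _ X]eq_fun do rewrite mxE; case: (i < k)%N.
  apply: measurable_funD; last exact: measurable_cst.
  exact: measurableT_comp (measurable_coord i) measurable_snd.
exact: measurableT_comp (measurable_coord i) (measurableT_comp (measurable_KN gF) measurable_fst).
Qed.

Let partnerE : gaussian_partner = independent_partner \o (fun z => (mix (fun j => (j < k)%N) z.1 z.2, mix (fun j => (j < k)%N) z.2 z.1)).
Proof. by apply/funext => z; apply/rowP => i; rewrite !mxE /=; case: ifP => // ik; rewrite mxE ik. Qed.

Lemma measurable_gaussian_partner : measf gaussian_partner.
Proof. by rewrite partnerE; exact: measurableT_comp measurable_independent_partner (@swap_law R n _).1. Qed.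

Lemma gaussian_partner_indep A : measurable A -> g2 (gaussian_partner @^-1` A) = g2 (independent_partner @^-1` A).
Proof.
move=> mA; rewrite partnerE comp_preimage -(@swap_law R n _).2//.
by rewrite -[X in measurable X]setTI; exact: measurable_independent_partner.
Qed.

End transport_coupling.

(** * The marginal potential and its distributional Hessian *)

Section marginal_potential.
Context {R : realType} (a b : nat).

Lemma row_mx_continuousl (w : 'rV[R]_b) : continuous (fun y : 'rV[R]_a => row_mx y w).
Proof.
apply: continuous_rV => i; under [X in continuous X]eq_fun do rewrite mxE.
by case: (fintype.split i) => j; [exact: coord_continuous|exact: cst_continuous].
Qed.

Variables (P : probability 'rV[R]_(a + b) R) (F : 'rV[R]_(a + b) -> R).
Hypothesis PF : sdens P F.

Let gF : gdom F. Proof. by case: PF. Qed.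
Let G (w : 'rV[R]_b) : R := Ex (lebesgue_rV R a) (fun y => F (row_mx y w)).

Let gdom_row (w : 'rV[R]_b) : gdom (fun y : 'rV[R]_a => F (row_mx y w)).
Proof.
have [cF F0 [C [c [c0 HF]]]] := gF; split=> [y|y|]; [|exact: F0|].
  by apply: (@continuous_comp _ _ _ (fun y => row_mx y w) F); [exact: row_mx_continuousl|exact: cF].
have C0 : 0 <= C by have := lt_le_trans (F0 0) (HF 0); rewrite dot0l mulr0 oppr0 expR0 mulr1 => /ltW.
exists C, c; split=> // y; apply: le_trans (HF _) _; rewrite ler_wpM2l// ler_expR lerN2.
by apply: ler_wpM2l; [exact: ltW|rewrite dot_row_mx lerDl dot_ge0].
Qed.

Let G0 w : 0 < G w. Proof. exact: gdom_Ex_gt0 (gdom_row w). Qed.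

Definition marginal_potential w := - ln (G w).

Let GE w : G w = expR (- marginal_potential w).
Proof. by rewrite opprK lnK// posrE. Qed.

(** Prekopa-Leindler in the variable integrated out; two points at separation [2 *: d] contribute
    the gain [dot (2 *: d) (2 *: d) / 8 = dot d d / 2]. *)
Lemma marginal_midpoint x d :
  2 * marginal_potential x + dot d d <= marginal_potential (x + d) + marginal_potential (x - d).
Proof.
have [_ sF _] := PF; have mx : measf (fun y => (F (row_mx y x))%:E).
  by apply/measurable_EFinP; exact: gdom_meas (gdom_row x).
have p1 y : (0 <= (F (row_mx y x))%:E)%E by rewrite lee_fin; case: (gdom_row x) => _ /(_ y)/ltW.
have p2 y y' : ((Num.sqrt (F (row_mx y (x + d)) * F (row_mx y' (x - d))) * expR (dot d d / 2))%:E <=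
    (F (row_mx (2^-1 *: (y + y')) x))%:E)%E.
  rewrite lee_fin; have := sF (row_mx y (x + d)) (row_mx y' (x - d)).
  rewrite opp_row_mx !add_row_mx scale_row_mx.
  have -> : 2^-1 *: (x + d + (x - d)) = x by apply/rowP => i; rewrite !mxE; field.
  have -> : x + d - (x - d) = 2 *: d by apply/rowP => i; rewrite !mxE; ring.
  apply: le_trans; rewrite ler_wpM2l ?sqrtr_ge0// ler_expR dot_row_mx dotZl dotZr.
  by have := dot_ge0 (y - y'); lra.
have := prekopa_leindler (gdom_row (x + d)) (gdom_row (x - d)) mx p1 p2.
rewrite (ExE (gdom_intg (gdom_row x))) lee_fin -/(G (x + d)) -/(G (x - d)) -/(G x) !GE -expRD.
have -> : expR (- marginal_potential (x + d) + - marginal_potential (x - d)) =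
    expR (- ((marginal_potential (x + d) + marginal_potential (x - d)) / 2)) ^+ 2.
  by rewrite -expRM_natl; congr expR; field.
by rewrite sqrtr_sqr ger0_norm ?expR_ge0// -expRD ler_expR; lra.
Qed.

Let W_up K : exists C : R, forall x : 'rV[R]_b, enorm x <= K -> marginal_potential x <= C.
Proof.
have [cF F0 _] := gF; pose A := [set z : 'rV[R]_(a + b) | enorm z <= a%:R + `|K|].
have [|c _ Hc] := @EVT_min_rV R _ F A _ (@ball_compact R _ _) (continuous_subspaceT cF).
  by exists 0; rewrite /A /= /enorm dot0l sqrtr0 addr_ge0.
exists (- ln (F c * 2 ^+ a)) => x xK; rewrite lerN2 ler_ln ?posrE//; last by rewrite mulr_gt0 ?exprn_gt0.
have := @box_integral R a 1 (F c) (fun y => F (row_mx y x)) ltr01 (ltW (F0 c)) (gdom_meas (gdom_row x)) (fun y => ltW (F0 _)).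
rewrite (ExE (gdom_intg (gdom_row x))) lee_fin mulr1; apply=> y y1; apply: Hc; rewrite inE /A /=.
have -> : row_mx y x = row_mx y 0 + row_mx 0 x by rewrite add_row_mx addr0 add0r.
apply: le_trans (enormD _ _) _; apply: lerD.
  rewrite /enorm dot_row_mx dot0l addr0 -/(enorm y) -[a%:R]mulr1; apply: enorm_le_mul => i; exact: ltW.
rewrite /enorm dot_row_mx dot0l add0r -/(enorm x); exact: le_trans (ler_norm _).
Qed.

Lemma marginal_continuous : continuous marginal_potential.
Proof. exact: midpoint_continuous marginal_midpoint W_up. Qed.

Lemma marginal_law (A : set 'rV[R]_b) : measurable A ->
  P (@rsubmx _ 1 a b @^-1` A) = (\int[lebesgue_rV R b]_(w in A) (expR (- marginal_potential w))%:E)%E.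
Proof.
move=> mA; have [_ _ dP] := PF; have mr := @measurable_rsubmx R a b.
have F0 z : 0 <= F z by case: gF => _ /(_ z)/ltW.
have mp : measurable (@rsubmx R 1 a b @^-1` A) by rewrite -[X in measurable X]setTI; exact: mr.
have mF : measf (fun z => (F z)%:E) by apply/measurable_EFinP; exact: gdom_meas gF.
have mFA : measf ((fun z => (F z)%:E) \_ (@rsubmx R 1 a b @^-1` A)).
  by apply/(measurable_restrictT _ mp); exact: measurable_funTS.
have FA0 z : (0 <= ((fun z => (F z)%:E) \_ (@rsubmx R 1 a b @^-1` A)) z)%E.
  by apply: erestrict_ge0 => y _; rewrite lee_fin.
rewrite dP// integral_mkcond (law_ge0_integral (lebesgue_split a b)); last 2 first.
- exact: mFA.
- exact: FA0.
rewrite tonelli2; last 2 first.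
- exact: measurableT_comp mFA (measurable_row_mx (@measurable_fst _ _ 'rV[R]_a 'rV[R]_b) measurable_snd).
- by move=> z; exact: FA0.
rewrite [RHS]integral_mkcond; apply: eq_integral => w _ /=; rewrite /patch -GE.
have iE y : (row_mx y w \in @rsubmx R 1 a b @^-1` A) = (w \in A).
  by apply/idP/idP; rewrite !inE /preimage /= row_mxKr.
under eq_integral do rewrite iE.
case: ifP => _; last by rewrite integral0.
by rewrite -(ExE (gdom_intg (gdom_row w))).
Qed.

End marginal_potential.

Section potential_hessian.
Context {R : realType} (b n : nat).
Variables (B : 'M[R]_(b, n)) (W : 'rV[R]_b -> R).
Hypotheses (BB : B *m B^T = 1%:M) (cW : continuous W).
Hypothesis Wm : forall x d, 2 * W x + dot d d <= W (x + d) + W (x - d).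
Local Notation leb := (lebesgue_rV R b).

Lemma dot_frame (x y : 'rV[R]_b) : dot (x *m B) (y *m B) = dot x y.
Proof. by rewrite !dotE trmx_mul mulmxA -[x *m B *m _]mulmxA BB mulmx1. Qed.

Lemma mulmx_continuous : continuous (fun w : 'rV[R]_b => w *m B).
Proof.
apply: continuous_rV => i w.
have H : \sum_j (x : 'rV[R]_b) 0 j * B j i @[x --> w] --> \sum_j w 0 j * B j i.
  by apply: (@cvg_bigsum _ _ _ (nbhs_filter w)) => j; apply: cvgMr_tmp; exact: coord_continuous.
rewrite /continuous_at mxE; under eq_fun do rewrite mxE; exact: H.
Qed.

Lemma potential_bounded (K : R) : exists2 A : R, 0 <= A & forall w, enorm w <= K -> `|W w| <= A.
Proof.
have [K0|K0] := ltP K 0.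
  by exists 0 => // w wK; have := le_lt_trans (le_trans (enorm_ge0 w) wK) K0; rewrite ltxx.
have ca : continuous (fun w => `|W w|).
  by move=> w; apply: (@continuous_comp _ _ _ W Num.norm); [exact: cW|exact: norm_continuous].
have [|c _ Hc] := @EVT_max_rV R _ _ [set w | enorm w <= K] _ (@ball_compact R _ _) (continuous_subspaceT ca).
  by exists 0; rewrite /= /enorm dot0l sqrtr0.
by exists `|W c| => // w wK; apply: Hc; rewrite inE.
Qed.

Lemma supp_potential (g : 'rV[R]_b -> R) (M K : R) : measf g -> (forall w, `|g w| <= M) ->
  (forall w, K < enorm w -> g w = 0) -> intg leb (fun w => W w * g w).
Proof.
move=> mg gM gK; have [A A0 HA] := potential_bounded `|K|.
apply: (@supp_intg _ _ _ (A * M) `|K|) => // [|w|w wK].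
- by apply: measurable_funM => //; exact: continuous_measurable_rV.
- have [wK|/gK ->] := leP (enorm w) K.
    by rewrite normrM; apply: ler_pM => //; apply: HA; exact: le_trans (ler_norm _).
  by rewrite mulr0 normr0 mulr_ge0// (le_trans _ (gM 0)).
- by rewrite gK ?mulr0//; exact: le_lt_trans (ler_norm _) wK.
Qed.

(** Midpoint convexity is integrated against [f], translation invariance moves the second difference
    onto [f], and [second_diff] turns it into a second derivative with error of order [h ^+ 3]. Test
    functions live on the ambient space and are read through the isometry [B]. *)
Lemma potential_hessian f s : test_function f -> (forall x, 0 <= f x) ->
  [/\ intg leb (fun w => f (w *m B)), intg leb (fun w => W w * 'D_(s *m B) ('D_(s *m B) f) (w *m B)) &
  dot s s * Ex leb (fun w => f (w *m B)) <= Ex leb (fun w => W w * 'D_(s *m B) ('D_(s *m B) f) (w *m B))].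
Proof.
move=> tf f0; set v := s *m B; have tD := test_D v (test_D v tf).
have en w : enorm (w *m B) = enorm w by rewrite /enorm dot_frame.
have mB : measf (fun w : 'rV[R]_b => w *m B) by exact: measurable_mulmxr.
have [M M0 HM] := second_diff v tf; have [Af Af0 HAf] := test_bounded tf; have [Ad Ad0 HAd] := test_bounded tD.
have [Kf Kf0 HKf] := test_support tf; have [Kd Kd0 HKd] := test_support tD.
pose phi w := f (w *m B); pose psi w := 'D_v ('D_v f) (w *m B).
have mphi : measf phi by exact: measurableT_comp (test_meas tf) mB.
have mpsi : measf psi by exact: measurableT_comp (test_meas tD) mB.
have Iphi : intg leb phi by apply: (@supp_intg _ _ _ Af Kf) => // [w|w wK]; [exact: HAf|apply: HKf; rewrite en].
have Ipsi : intg leb (fun w => W w * psi w) by apply: (@supp_potential _ Ad Kd) => // [w|w wK]; [exact: HAd|apply: HKd; rewrite en].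
split=> //; pose K := Kf + Kd + enorm s; have K0 : 0 <= K by rewrite !addr_ge0 ?enorm_ge0.
have [A A0 HA] := potential_bounded K.
pose ball1 (w : 'rV[R]_b) : R := if enorm w <= K then 1 else 0.
have mball : measf ball1.
  apply: measurable_fun_ifT; [|exact: measurable_cst|exact: measurable_cst].
  by apply: measurable_fun_ler; [exact: measurable_enorm|exact: measurable_cst].
have Iball : intg leb ball1.
  by apply: (@supp_intg _ _ _ 1 K) => // w; rewrite /ball1; [case: ifP; rewrite ?normr1 ?normr0|move=> wK; rewrite leNgt wK].
apply: (@le_of_add_small _ _ _ (M * A * Ex leb ball1) 1 ltr01) => h h0 h1.
have sh (z : 'rV[R]_b) : measf (fun w : 'rV[R]_b => phi (w + z)) /\ intg leb (fun w : 'rV[R]_b => W w * phi (w + z)).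
  have m : measf (fun w : 'rV[R]_b => phi (w + z)).
    by apply: measurableT_comp mphi _; apply: measurable_rVD => //; exact: measurable_cst.
  split=> //; apply: (@supp_potential _ Af (Kf + enorm z)) => // [w|w wK]; [exact: HAf|apply: HKf]; rewrite en ltNge.
  apply: contraL wK => wK; rewrite -leNgt -(addrK z w); apply: le_trans (enormD _ _) _.
  by rewrite -scaleN1r enormZ normrN1 mul1r lerD2r.
have shW (z : 'rV[R]_b) : measf (fun w : 'rV[R]_b => W (w + z) * phi w) /\ intg leb (fun w : 'rV[R]_b => W (w + z) * phi w) /\
    Ex leb (fun w : 'rV[R]_b => W (w + z) * phi w) = Ex leb (fun w : 'rV[R]_b => W w * phi (w - z)).
  have [m1 I1] := sh (- z); have [m2 e2] := leb_shift z (intg_meas I1).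
  have E : (fun w : 'rV[R]_b => W (w + z) * phi w) = (fun w => W (w + z) * phi (w + z - z)) by apply/funext => w; rewrite addrK.
  rewrite E; have I2 := m2.1 I1; split; [exact: intg_meas I2|split=> //].
have [_ [I1 e1]] := shW (h *: s); have [_ [I2 e2]] := shW (- (h *: s)).
have [_ I0] := sh 0; have I3 : intg leb (fun w => W w * phi w) by move: I0; under eq_fun do rewrite addr0.
rewrite opprK in e2; have [_ J1] := sh (h *: s); have [_ J2] := sh (- (h *: s)).
have low : h ^+ 2 * (dot s s * Ex leb phi) <= Ex leb (fun w => W w * (phi (w + h *: s) + phi (w - h *: s) - 2 * phi w)).
  have -> : (fun w => W w * (phi (w + h *: s) + phi (w - h *: s) - 2 * phi w)) =
     (fun w => (W w * phi (w - h *: s) + W w * phi (w + h *: s)) - 2 * (W w * phi w)) by apply/funext => w; ring.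
  rewrite (ExB (intgD J2 J1) (intgZ 2 I3)) (ExD J2 J1) -e1 -e2 -(ExD I1 I2) -(ExB (intgD I1 I2) (intgZ 2 I3)) mulrA -(ExZ _ Iphi).
  apply: (Ex_le (intgZ _ Iphi) (intgB (intgD I1 I2) (intgZ 2 I3))) => w.
  have := Wm w (h *: s); rewrite dotZl dotZr => /(ler_wpM2r (f0 (w *m B))); rewrite -/(phi w); lra.
have up : Ex leb (fun w => W w * (phi (w + h *: s) + phi (w - h *: s) - 2 * phi w)) <=
    h ^+ 2 * Ex leb (fun w => W w * psi w) + h ^+ 3 * (M * A) * Ex leb ball1.
  rewrite -(ExZ _ Ipsi) -(ExZ _ Iball) -(ExD (intgZ _ Ipsi) (intgZ _ Iball)).
  have I : intg leb (fun w => W w * (phi (w + h *: s) + phi (w - h *: s) - 2 * phi w)).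
    have := intgB (intgD J1 J2) (intgZ 2 I3); congr (intg leb _); apply/funext => w; ring.
  apply: (Ex_le I (intgD (intgZ _ Ipsi) (intgZ _ Iball))) => w; rewrite /ball1 -lerBlDl.
  have -> : W w * (phi (w + h *: s) + phi (w - h *: s) - 2 * phi w) - h ^+ 2 * (W w * psi w) =
     W w * (phi (w + h *: s) + phi (w - h *: s) - 2 * phi w - h ^+ 2 * psi w) by ring.
  have [wK|Kw] := leP (enorm w) K.
    rewrite mulr1; apply: le_trans (ler_norm _) _; rewrite normrM.
    have -> : h ^+ 3 * (M * A) = A * (M * h ^+ 3) by ring.
    apply: ler_pM => //; first exact: HA; have := HM (w *m B) h; rewrite (gtr0_norm h0).
    by rewrite /phi /psi mulmxDl mulmxBl -scalemxAl.
  have zz (c : R) : `|c| <= 1 -> phi (w + c *: s) = 0.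
    move=> c1; apply: HKf; rewrite en ltNge; apply: contraL Kw => wK; rewrite -leNgt -(addrK (c *: s) w).
    apply: le_trans (enormD _ _) _; rewrite -scaleNr enormZ normrN; apply: lerD.
      by apply: le_trans wK _; rewrite lerDl.
    by rewrite ler_piMl ?enorm_ge0.
  have -> : psi w = 0 by apply: HKd; rewrite en; apply: le_lt_trans Kw; rewrite /K; have := enorm_ge0 s; lra.
  have p0 : phi w = 0 by have := zz 0; rewrite scale0r addr0 normr0; apply.
  have hn : `|h| <= 1 by rewrite gtr0_norm// ltW.
  by rewrite zz// -scaleNr zz ?normrN// p0 !mulr0 subr0 addr0 subr0 mulr0.
have h2 : 0 < h ^+ 2 by rewrite exprn_gt0.
rewrite -(ler_pM2l h2); apply: le_trans (le_trans low up) _.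
rewrite le_eqVlt; apply/orP; left; apply/eqP; ring.
Qed.

End potential_hessian.

(** * Orthonormal coordinates adapted to the subspace *)

Section measure_kit.
Import HBNNSimple.
Context {R : realType}.

Lemma law_exists d1 d2 (T1 : measurableType d1) (T2 : measurableType d2) (P : probability T1 R) (X : T1 -> T2) :
  measf X -> exists Q : probability T2 R, is_law P X Q.
Proof.
move=> mX; pose Y : {mfun T1 >-> T2} := HB.pack X (isMeasurableFun.Build _ _ _ _ X mX).
by exists [the probability _ _ of distribution P Y].
Qed.

(** [gaussian_on] and [marginal_on] are plain set functions; integrals against them are identified
    with integrals against image measures through their values on measurable sets. *)
Lemma eq_integral_setfun d (T : measurableType d) (m1 m2 : set T -> \bar R) f :
  (forall A, measurable A -> m1 A = m2 A) -> (\int[m1]_x f x = \int[m2]_x f x)%E.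
Proof.
move=> m12; have E (h : {nnsfun T >-> R}) : sintegral m1 h = sintegral m2 h.
  by apply: eq_fsbigr => r _; rewrite m12//; exact: measurable_sfunP.
rewrite /integral; congr (ereal_sup _ - ereal_sup _)%E;
  by apply/seteqP; split => _ [h hf <-]; exists h => //; rewrite E.
Qed.

Lemma gaussian_translate_law n (m : 'rV[R]_n) A : measurable A ->
  (\int[lebesgue_rV R n]_(x in A) (gd (x - m))%:E)%E = gam n ((fun t => t + m) @^-1` A).
Proof.
move=> mA; have [mt _] := lebesgue_translation m.
have mp : measurable ((fun t => t + m) @^-1` A) by rewrite -[X in measurable X]setTI; exact: mt.
have mg : measf (fun x : 'rV[R]_n => (gd (x - m))%:E).
  apply/measurable_EFinP; apply: (measurableT_comp (@measurable_gd R n)).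
  by apply: measurable_rVB => //; exact: measurable_cst.
rewrite integral_mkcond (law_ge0_integral (lebesgue_translation m)); last 2 first.
- by apply/(measurable_restrictT _ mA); exact: measurable_funTS.
- by apply: erestrict_ge0 => y _; rewrite lee_fin gd_ge0.
transitivity (\int[lebesgue_rV R n]_(t in (fun t => (t + m)%R) @^-1` A) (gd t)%:E)%E => //.
rewrite [RHS]integral_mkcond.
by apply: eq_integral => t _; rewrite /patch addrK; congr (if _ then _ else _); apply/idP/idP; rewrite !inE.
Qed.

End measure_kit.

Section frames.
Context {R : realType} (n : nat) (U : {vspace 'rV[R]_n}).
Local Notation V := (orth_compl U).
Local Notation A := (frame U).
Local Notation B := (frame V).
Local Notation N := (\dim U + \dim V)%N.

(** Coordinates beginning with those of [U]. Their number equals [n] by a proved equation and not by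
    conversion, so the transported measure lives on row vectors of length [\dim U + \dim V]. *)
Definition frames : 'M[R]_(N, n) := col_mx A B.

Lemma frames_orth : frames *m frames^T = 1%:M.
Proof.
have [AA AU] := frameP U; have [BB BV] := frameP V.
have BA : B *m A^T = 0.
  apply/matrixP => i j; have /memv_orth_compl/(_ _ (AU j)) := BV i.
  by rewrite /dot !mxE => H; rewrite -[RHS]H; apply: eq_bigr => l _; rewrite !mxE.
rewrite /frames tr_col_mx mul_col_row AA BB BA -[A *m B^T]trmxK trmx_mul trmxK BA trmx0.
by rewrite -scalar_mx_block.
Qed.

(** Orthonormal rows cannot outnumber the dimension, and rank-nullity for the map whose kernel
    defines [orth_compl U] gives the other inequality. *)
Lemma frames_dim : N = n.
Proof.
apply/eqP; rewrite eqn_leq (mulmx1_min frames_orth) /=.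
have := limg_ker_dim (linfun (mulmxr (\matrix_(i < \dim U) (vbasis U)`_i)^T) : 'Hom('rV[R]_n, 'rV[R]_(\dim U))) fullv.
rewrite capfv dimvf /dim /= mul1n -/(orth_compl U); set d := \dim (limg _) => H.
apply: (@leq_trans (\dim V + d)); first by rewrite H.
by rewrite addnC leq_add2r; apply: leq_trans (dimvS (subvf _)) _; rewrite dimvf /dim /= mul1n.
Qed.

Lemma frames_law : is_law (lebesgue_rV R N) (fun y => y *m frames) (lebesgue_rV R n).
Proof.
move: frames frames_orth; rewrite frames_dim => M MM; exact: lebesgue_orth.
Qed.

Lemma frames_inv : frames^T *m frames = 1%:M.
Proof.
have key m (M : 'M[R]_(m, n)) : m = n -> M *m M^T = 1%:M -> M^T *m M = 1%:M.
  by move=> mn; case: n / mn M => M; exact: mulmx1C.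
exact: key frames_dim frames_orth.
Qed.

Lemma frames_mul (y : 'rV[R]_N) : y *m frames = lsubmx y *m A + rsubmx y *m B.
Proof. by rewrite -[y in LHS]hsubmxK mul_row_col. Qed.

Lemma orth_proj_frames (y : 'rV[R]_N) : orth_proj V (y *m frames) = rsubmx y *m B.
Proof.
rewrite /orth_proj; congr (_ *m _); have := congr1 (fun M => rsubmx (y *m M)) frames_orth.
by rewrite mulmx1 mulmxA {2}/frames tr_col_mx mul_mx_row row_mxKr.
Qed.

Variables (mu : probability 'rV[R]_n R) (F : 'rV[R]_n -> R).
Hypothesis muF : sdens mu F.

Lemma frames_sdens : exists2 P : probability 'rV[R]_N R,
  sdens P (fun y => F (y *m frames)) & is_law P (fun y => y *m frames) mu.
Proof.
have [gF sF dF] := muF; have [cF F0 [C [c [c0 HF]]]] := gF.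
have mM := @measurable_mulmxr R _ _ frames; have mT := @measurable_mulmxr R _ _ frames^T.
have [P [_ lP]] := law_exists mu mT.
have TK y : y *m frames *m frames^T = y by rewrite -mulmxA frames_orth mulmx1.
have KT x : x *m frames^T *m frames = x by rewrite -mulmxA frames_inv mulmx1.
have mpre S : measurable S -> measurable ((fun y => y *m frames) @^-1` S) by move=> mS; rewrite -[X in measurable X]setTI; exact: mM.
have mpreT S : measurable S -> measurable ((fun y => y *m frames^T) @^-1` S) by move=> mS; rewrite -[X in measurable X]setTI; exact: mT.
exists P; last first.
  split=> // S mS; rewrite (lP _ (mpre S mS)); congr (mu _); apply/seteqP.
  by split=> x /=; rewrite KT.
split.
- split=> [y|y|]; [|exact: F0|].
    by apply: (@continuous_comp _ _ _ (fun y : 'rV[R]_N => y *m frames) F); [exact: mulmx_continuous|exact: cF].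
  by exists C, c; split=> // y; rewrite -(dot_frame frames_orth); exact: HF.
- move=> x y; have := sF (x *m frames) (y *m frames).
  by rewrite -mulmxBl -mulmxDl scalemxAl (dot_frame frames_orth).
move=> S mS; apply: (etrans (lP S mS)); apply: (etrans (dF _ (mpreT S mS))).
rewrite integral_mkcond (law_ge0_integral frames_law); last 2 first.
- apply/(measurable_restrictT _ (mpreT _ mS)); apply: measurable_funTS; apply/measurable_EFinP; exact: gdom_meas gF.
- by apply: erestrict_ge0 => y _; rewrite lee_fin ltW.
rewrite [RHS]integral_mkcond; apply: eq_integral => y _; rewrite /patch.
by congr (if _ then _ else _); apply/idP/idP; rewrite !inE /= TK.
Qed.

Section projected.
Variable P : probability 'rV[R]_N R.
Hypotheses (PF : sdens P (fun y => F (y *m frames))) (lP : is_law P (fun y => y *m frames) mu).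
Let W := marginal_potential (fun y : 'rV[R]_N => F (y *m frames)).
Let BB : B *m B^T = 1%:M := (frameP V).1.
Let mB := @measurable_mulmxr R _ _ B.
Let mproj : measf (orth_proj V).
Proof. by apply: (measurableT_comp mB); exact: measurable_mulmxr. Qed.
Let mpre S : measurable S -> measurable ((fun w => w *m B) @^-1` S).
Proof. by move=> mS; rewrite -[X in measurable X]setTI; exact: mB. Qed.
Let cW : continuous W := marginal_continuous PF.
Let WK w : W (w *m B *m B^T) = W w. Proof. by rewrite -mulmxA BB mulmx1. Qed.
Let mW : measf (fun z : 'rV[R]_n => W (z *m B^T)).
Proof. by apply: measurableT_comp (continuous_measurable_rV cW) _; exact: measurable_mulmxr. Qed.

Lemma marginal_onE S : measurable S -> marginal_on V mu S = P ((fun y => rsubmx y *m B) @^-1` S).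
Proof.
move=> mS; rewrite /marginal_on /pushforward lP.2; last by rewrite -[X in measurable X]setTI; exact: mproj.
by congr (P _); apply/seteqP; split=> y /=; rewrite orth_proj_frames.
Qed.

Lemma projected_density : has_density (marginal_on V mu) (lebesgue_on V) (fun z => expR (- W (z *m B^T))).
Proof.
move=> S mS; rewrite (marginal_onE mS) (marginal_law PF (mpre mS)).
have mf : measurable_fun S (fun z : 'rV[R]_n => (expR (- W (z *m B^T)))%:E).
  apply: measurable_funTS; apply/measurable_EFinP; apply: (measurableT_comp (@measurable_expR R)).
  exact: measurable_funN.
have f0 : {in S, forall z : 'rV[R]_n, (0 <= (expR (- W (z *m B^T)))%:E)%E} by move=> z _; rewrite lee_fin expR_ge0.
apply: etrans (esym (ge0_integral_pushforward mB (lebesgue_rV R (\dim V)) mS mf f0)).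
by apply: eq_integral => w _ /=; rewrite WK.
Qed.

Lemma projected_Hess : Hess_ge_Id (lebesgue_on V) V (fun z => W (z *m B^T)).
Proof.
have Wm := marginal_midpoint PF; rewrite -/W in Wm.
split; first split=> // K cK.
  have mK : measurable K by exact: closed_measurable_rV (compact_closed (@norm_hausdorff _ _) cK).
  have [M [_ HM]] := compact_bounded cK; pose M1 : R := `|M| + 1.
  have KM z : K z -> enorm z <= n%:R * M1.
    move=> Kz; apply: enorm_le_mul => i; apply: le_trans (HM M1 _ _ Kz); last by rewrite /M1 (le_lt_trans (ler_norm _))// ltrDl.
    by rewrite -[leRHS]/(mx_norm _) /mx_norm; exact: (le_bigmax _ (fun ij : 'I_1 * 'I_n => `|z ij.1 ij.2|%:nng) (0, i)).
  rewrite /lebesgue_on ge0_integral_pushforward//; last first.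
    by apply: measurable_funTS; apply/measurable_EFinP; exact: measurableT_comp.
  have [A0 A00 HA] := potential_bounded cW (n%:R * M1).
  pose g (w : 'rV[R]_(\dim V)) : R := if `[< K (w *m B) >] then 1 else 0.
  have iE w : (w \in (fun w => w *m B) @^-1` K) = `[< K (w *m B) >] by apply/idP/asboolP; rewrite inE.
  have gE : (fun w => (g w)%:E) = (cst 1%E) \_ ((fun w => w *m B) @^-1` K).
    by apply/funext => w; rewrite /g /patch iE; case: ifP.
  have mg : measf g.
    by apply/measurable_EFinP; rewrite -[EFin \o g]/(fun w => (g w)%:E) gE; apply/(measurable_restrictT _ (mpre mK)); exact: measurable_cst.
  have I : intg (lebesgue_rV R (\dim V)) (fun w => W w * g w).
    apply: (supp_potential cW (M := 1) (K := n%:R * M1)) => // w; rewrite /g; case: asboolP => // h; rewrite ?normr1 ?normr0//.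
    by move=> /(le_lt_trans (KM _ h)); rewrite /enorm dot_frame// ltxx.
  have := ExE (intg_abs I); rewrite integral_mkcond => E; apply: le_lt_trans (ltry (Ex (lebesgue_rV R (\dim V)) (fun w => `|W w * g w|))).
  rewrite -E integral_mkcond le_eqVlt; apply/orP; left; apply/eqP; apply: eq_integral => w _; rewrite /patch /= WK.
  by rewrite /g in_setT iE; case: ifP => _; rewrite ?mulr1 ?mulr0 ?normr0.
move=> f tf f0 xi xiV.
(* A vector of [V] has no component along [U], so it is the image under [B] of its own coordinates,
   the form of direction that [potential_hessian] treats. *)
have xiE : xi = xi *m B^T *m B.
  have xA : lsubmx (xi *m frames^T) = 0.
    rewrite tr_col_mx mul_mx_row row_mxKl; apply/rowP => i; rewrite !mxE.
    have /memv_orth_compl/(_ _ ((frameP U).2 i)) := xiV => H; rewrite -[RHS]H.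
    by apply: eq_bigr => l _; rewrite !mxE.
  rewrite -[LHS]mulmx1 -frames_inv mulmxA frames_mul xA mul0mx add0r.
  by rewrite tr_col_mx mul_mx_row row_mxKr.
have [I1 I2 H] := potential_hessian BB cW Wm (xi *m B^T) tf f0.
have mf : measf (fun x => (f x)%:E) by apply/measurable_EFinP; exact: test_meas.
have f0' x : (0 <= (f x)%:E)%E by rewrite lee_fin.
have mD : measf (fun x => (W (x *m B^T) * 'D_xi ('D_xi f) x)%:E).
  by apply/measurable_EFinP; apply: measurable_funM => //; apply: test_meas; do 2 apply: test_D.
have E2 : (fun x => (W (x *m B^T) * 'D_xi ('D_xi f) x)%:E) \o (fun w => w *m B) =
    (fun w => (W w * 'D_(xi *m B^T *m B) ('D_(xi *m B^T *m B) f) (w *m B))%:E).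
  by apply/funext => w /=; rewrite WK -xiE.
have J1 := ge0_integral_pushforward mB (lebesgue_rV R (\dim V)) measurableT mf (fun x _ => f0' x).
have J2 := @integral_pushforward _ _ _ _ R _ mB (lebesgue_rV R (\dim V)) setT _ mD _ measurableT.
rewrite preimage_setT E2 in J2; have {}J2 := J2 I2; rewrite (ExE I2) in J2.
rewrite preimage_setT /comp (ExE I1) in J1; rewrite /lebesgue_on J1 J2 -EFinM lee_fin.
by apply: le_trans H; rewrite enorm_sqr [in leLHS]xiE (dot_frame BB).
Qed.

End projected.
End frames.

(** * The product measure as the law of the partner, and the transport bound *)

Section gaussian_marginal.
Context {R : realType} (n : nat) (U : {vspace 'rV[R]_n}).
Local Notation V := (orth_compl U).
Local Notation A := (frame U).
Local Notation B := (frame V).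
Local Notation N := (\dim U + \dim V)%N.
Local Notation g2 := (pp (@gam R N) (@gam R N)).
Variables (mu : probability 'rV[R]_n R) (F : 'rV[R]_n -> R) (P : probability 'rV[R]_N R).
Let FM (y : 'rV[R]_N) := F (y *m frames U).
Hypotheses (PF : sdens P FM) (lP : is_law P (fun y => y *m frames U) mu).

Let AA : A *m A^T = 1%:M := (frameP U).1.
Let m : 'rV[R]_(\dim U) := \row_i Ex P (fun y => y 0 (lshift _ i)).
(** The independent partner in ambient coordinates, as a function of two independent variables. *)
Let theta (z : 'rV[R]_(\dim U) * 'rV[R]_N) : 'rV[R]_n := (z.1 + m) *m A + rsubmx (KN FM z.2) *m B.

Let mK : measf (KN FM) := (KN_law PF).1.
Let mA := @measurable_mulmxr R _ _ A.
Let mT1 : measf (fun t : 'rV[R]_(\dim U) => (t + m) *m A).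
Proof. by apply: measurableT_comp mA _; apply: measurable_rVD => //; exact: measurable_cst. Qed.
Let mT2 : measf (fun x : 'rV[R]_N => rsubmx (KN FM x) *m B).
Proof. exact: measurableT_comp (@measurable_mulmxr R _ _ B) (measurableT_comp (@measurable_rsubmx R _ _) mK). Qed.
Let mtheta : measf theta.
Proof.
by apply: measurable_rVD; [exact: measurableT_comp mT1 measurable_fst|exact: measurableT_comp mT2 measurable_snd].
Qed.

Let split_law : is_law g2 (fun z => (lsubmx z.2, z.1)) (pp (gam (\dim U)) (gam N)).
Proof.
have ml := @measurable_lsubmx R (\dim U) (\dim V).
have lw : is_law (gam N) (@lsubmx R 1 (\dim U) (\dim V)) (gam (\dim U)).
  split=> // S mS; have mp : measurable (@lsubmx R 1 (\dim U) (\dim V) @^-1` S) by rewrite -[X in measurable X]setTI; exact: ml.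
  rewrite ((gam_split_law _ _).2 _ mp) ((law_fst _ (gam (\dim V))).2 _ mS); congr (pp _ _ _).
  by apply/seteqP; split=> z /=; rewrite row_mxKl.
have mX : measf (fun z : 'rV[R]_N * 'rV[R]_N => (lsubmx z.2, z.1)).
  by apply: measurable_fun_pair; [exact: measurableT_comp ml measurable_snd|exact: measurable_fst].
apply: law_of_integral => // f mf f0; rewrite tonelli2//.
have h := @tonelli1 _ _ _ _ _ (gam N) (gam N) _ (measurableT_comp mf mX) (fun z => f0 _).
apply: etrans (esym h); apply: eq_integral => x _ /=.
by rewrite (law_ge0_integral lw)//; exact: measurableT_comp mf (pair2_measurable x).
Qed.

Let gaussian_onE S : measurable S -> gaussian_on (m *m A) U S = gam (\dim U) ((fun t => (t + m) *m A) @^-1` S).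
Proof.
move=> mS; have mp : measurable ((fun t => t *m A) @^-1` S) by rewrite -[X in measurable X]setTI; exact: mA.
have f0 : {in S, forall x : 'rV[R]_n, (0 <= ((Num.sqrt (2 * pi) ^+ \dim U)^-1 * expR (- (enorm (x - m *m A) ^+ 2 / 2)))%:E)%E}.
  by move=> x _; rewrite lee_fin mulr_ge0 ?expR_ge0// invr_ge0 exprn_ge0// sqrtr_ge0.
have mf : measurable_fun S (fun x : 'rV[R]_n => ((Num.sqrt (2 * pi) ^+ \dim U)^-1 * expR (- (enorm (x - m *m A) ^+ 2 / 2)))%:E).
  apply: measurable_funTS; apply/measurable_EFinP; apply: measurable_funM; first exact: measurable_cst.
  apply: (measurableT_comp (@measurable_expR R)); apply: measurable_funN; apply: measurable_funM; last exact: measurable_cst.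
  by apply: measurable_funX; apply: measurable_enorm; apply: measurable_rVB => //; exact: measurable_cst.
apply: (etrans (ge0_integral_pushforward mA (lebesgue_rV R (\dim U)) mS mf f0)).
apply: etrans (gaussian_translate_law m mp); apply: eq_integral => t _ /=.
by rewrite /gd -mulmxBl enorm_sqr (dot_frame AA) exprVn.
Qed.

(** [tensor] is unfolded into an integral of measures of sections, in which both factors are
    replaced by image laws of Gaussians; the same iterated integral computes the law of [theta]. *)
Lemma partner_tensor S : measurable S ->
  g2 ((fun z => gaussian_partner P FM (\dim U) z *m frames U) @^-1` S) =
  tensor (gaussian_on (m *m A) U) (marginal_on V mu) S.
Proof.
move=> mS; have mp : measurable ((fun y => y *m frames U) @^-1` S) by rewrite -[X in measurable X]setTI; exact: measurable_mulmxr.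
have mth : measurable (theta @^-1` S) by rewrite -[X in measurable X]setTI; exact: mtheta.
rewrite (_ : _ @^-1` S = gaussian_partner P FM (\dim U) @^-1` ((fun y => y *m frames U) @^-1` S))//.
rewrite (gaussian_partner_indep PF _ mp).
rewrite (_ : _ @^-1` _ = (fun z => (lsubmx z.2, z.1)) @^-1` (theta @^-1` S)); last first.
  apply/seteqP; suff E z : independent_partner P FM (\dim U) z *m frames U = theta (lsubmx z.2, z.1) by split=> z /=; rewrite E.
  rewrite frames_mul /theta; suff [-> ->] : lsubmx (independent_partner P FM (\dim U) z) = lsubmx z.2 + m /\
    rsubmx (independent_partner P FM (\dim U) z) = rsubmx (KN FM z.1) by [].
  by split; apply/rowP => i; rewrite !mxE /= ?ltn_ord// ltnNge leq_addr.
rewrite -(split_law.2 _ mth).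
have msum : measf (fun yz : 'rV[R]_n * 'rV[R]_n => yz.1 + yz.2) by apply: measurable_rVD.
have mQ : measurable ((fun yz : 'rV[R]_n * 'rV[R]_n => yz.1 + yz.2) @^-1` S) by rewrite -[X in measurable X]setTI; exact: msum.
have [Q1 l1] := law_exists (gam (\dim U)) mT1; have [Q2 l2] := law_exists (gam N) mT2.
have E2 D : measurable D -> marginal_on V mu D = Q2 D.
  move=> mD; rewrite (marginal_onE lP mD) l2.2//.
  have mr : measurable ((fun y => @rsubmx R 1 (\dim U) (\dim V) y *m B) @^-1` D).
    rewrite -[X in measurable X]setTI; exact: (measurableT_comp (@measurable_mulmxr R _ _ B) (@measurable_rsubmx R _ _)).
  by rewrite (KN_law PF).2.
have -> : tensor (gaussian_on (m *m A) U) (marginal_on V mu) S =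
    (\int[Q1]_x Q2 (xsection ((fun yz : 'rV[R]_n * 'rV[R]_n => (yz.1 + yz.2)%R) @^-1` S) x))%E.
  rewrite /tensor /pushforward /product_measure1 (eq_integral_setfun (m2 := Q1)).
    by apply: eq_integral => x _ /=; rewrite E2//; exact: measurable_xsection.
  by move=> D mD; rewrite (gaussian_onE mD) l1.2.
have mxs := @measurable_fun_xsection _ _ _ _ _ Q2 _ mQ.
rewrite (law_ge0_integral l1 mxs) => [|x]; last exact: measure_ge0.
transitivity (\int[gam (\dim U)]_t gam N (xsection (theta @^-1` S) t))%E; first by [].
apply: eq_integral => t _; apply/esym; apply: etrans (l2.2 _ (measurable_xsection _ mQ)) _.
by congr (gam N _); apply/seteqP; split=> x; rewrite /xsection /= !inE.
Qed.

(** The image in ambient coordinates of the transported point and its partner is an admissible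
    coupling; the orthonormal frame preserves distances, and the mean distance is at most the root
    of the mean square in [coupling_energy]. *)
Lemma W1_le_partner (q : R) : (0 < \dim U)%N -> 0 <= q ->
  (forall v, v \in U -> dot v v - var mu (fun x => dot x v) <= q * dot v v) ->
  (W1 mu (tensor (gaussian_on (m *m A) U) (marginal_on V mu)) <= (Num.sqrt (3 * (\dim U)%:R ^+ 2 * q))%:E)%E.
Proof.
move=> d0 q0 hq; have MM := frames_orth U.
(* Coordinate [i] is the scalar product with row [i] of the frame, a unit vector of [U], so its
   variance is that of [mu] along this vector. *)
have hc (i : 'I_N) : (i < \dim U)%N -> 1 - var P (fun x => x 0 i) <= q.
  move=> iU; pose v := row i (frames U).
  have E y : dot (y *m frames U) v = y 0 i.
    rewrite -[y in RHS]mulmx1 -MM mulmxA [RHS]mxE; apply: eq_bigr => l _; by rewrite [row _ _ _ _]mxE [_^T _ _]mxE.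
  have vv : dot v v = 1 by rewrite {1}/v rowE E mxE !eqxx.
  have vU : v \in U.
    rewrite /v (_ : i = lshift _ (Ordinal iU)); last exact: val_inj.
    suff -> : row (lshift (\dim V) (Ordinal iU)) (frames U) = row (Ordinal iU) A by exact: (frameP U).2.
    by apply/rowP => j; rewrite mxE /frames col_mxEu mxE.
  have mdot : measf (fun x : 'rV[R]_n => dot x v).
    by apply: measurable_dot => //; exact: measurable_cst.
  have := hq v vU; rewrite vv mulr1; congr (1 - _ <= q).
  by rewrite !varE (law_Ex lP mdot) (law_Ex lP (measurable_funX 2 mdot)) /comp; under eq_fun do rewrite E;
    under [in X in _ - X]eq_fun do rewrite E.
have [I H] := coupling_energy PF (leq_addr _ _) hc q0 d0.
pose D z := KN FM z.1 - gaussian_partner P FM (\dim U) z; rewrite -/(D _) in I H.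
have mX : measf (fun z : 'rV[R]_N * 'rV[R]_N => KN FM z.1 *m frames U).
  exact: measurableT_comp (@measurable_mulmxr R _ _ _) (measurableT_comp mK measurable_fst).
have mY : measf (fun z => gaussian_partner P FM (\dim U) z *m frames U).
  exact: measurableT_comp (@measurable_mulmxr R _ _ _) (measurable_gaussian_partner PF _).
have [Q lQ] := law_exists g2 (measurable_fun_pair mX mY).
apply: (@le_trans _ _ (\int[Q]_xy (enorm (xy.1 - xy.2))%:E)%E).
  apply: ereal_inf_lbound; exists Q => // S mS; split.
    rewrite lQ.2; last exact: measurableX.
    rewrite lP.2//; have mp : measurable ((fun y => y *m frames U) @^-1` S) by rewrite -[X in measurable X]setTI; exact: measurable_mulmxr.
    rewrite (KN_law PF).2//; have mp' : measurable (KN FM @^-1` ((fun y => y *m frames U) @^-1` S)) by rewrite -[X in measurable X]setTI; exact: mK.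
    rewrite ((law_fst (gam N) (gam N)).2 _ mp'); congr (pp _ _ _).
    by apply/seteqP; split=> z /=; [case|].
  rewrite lQ.2; last exact: measurableX.
  by rewrite -(partner_tensor mS); congr (pp _ _ _); apply/seteqP; split=> z /=; [case|].
have mn : measf (fun xy : 'rV[R]_n * 'rV[R]_n => (enorm (xy.1 - xy.2))%:E).
  by apply/measurable_EFinP; apply: measurable_enorm; exact: measurable_rVB.
rewrite (law_ge0_integral lQ mn); last by move=> z; rewrite lee_fin enorm_ge0.
have E z : enorm (KN FM z.1 *m frames U - gaussian_partner P FM (\dim U) z *m frames U) = enorm (D z).
  by rewrite -mulmxBl /enorm (dot_frame MM).
have mD : measf (fun z => enorm (D z)).
  by apply: measurable_enorm; apply: measurable_rVB; [exact: measurableT_comp mK measurable_fst|exact: measurable_gaussian_partner PF _].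
have I2 : intg g2 (fun z => enorm (D z) ^+ 2) by under eq_fun do rewrite enorm_sqr.
under eq_integral do rewrite /= E.
rewrite (ExE (intg_sqr mD I2)) lee_fin -[leLHS]ger0_norm; last by apply: Ex_ge0 => z; exact: enorm_ge0.
rewrite -sqrtr_sqr ler_wsqrtr//; apply: le_trans (Ex_sqr_le mD I2) _; apply: le_trans H.
by rewrite le_eqVlt; apply/orP; left; apply/eqP; congr Ex; apply/funext => z; rewrite enorm_sqr.
Qed.

End gaussian_marginal.

(** * Assembly of the regularization, the choice of directions and the coupling *)

Theorem theorem1p2 (R : realType) :
  exists C : R, [/\ C = 18 * Num.sqrt 2, C < 26 &
    forall (n : nat) (mu : probability 'rV[R]_n R) (V : 'rV[R]_n -> R),
      has_density mu (lebesgue_rV R n) (fun x => expR (- V x)) ->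
      Hess_ge_Id (lebesgue_rV R n) fullv V ->
    forall (k : nat), (1 <= k <= n)%N ->
    forall (eps : R), 0 <= eps ->
    forall (u : 'I_k -> 'rV[R]_n -> R),
      (forall i, [/\ H1 mu (u i),
        (\int[mu]_x (u i x)%:E = 0)%E,
        (\int[mu]_x (u i x ^+ 2)%:E = 1)%E,
        forall j, j != i ->
          (\int[mu]_x (dot (weak_gradient (u i) x)
                           (weak_gradient (u j) x))%:E = 0)%E &
        (\int[mu]_x (enorm (weak_gradient (u i) x) ^+ 2)%:E
          <= (1 + eps)%:E)%E]) ->
    exists (U : {vspace 'rV[R]_n}) (p : 'rV[R]_n),
      [/\ \dim U = k, p \in U,
        (W1 mu (tensor (gaussian_on p U) (marginal_on (orth_compl U) mu))
          <= (C * (k%:R `^ (3 / 2)) * Num.sqrt eps)%:E)%E &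
        exists W : 'rV[R]_n -> R,
          has_density (marginal_on (orth_compl U) mu) (lebesgue_on (orth_compl U))
            (fun z => expR (- W z)) /\
          Hess_ge_Id (lebesgue_on (orth_compl U)) (orth_compl U) W]].
Proof.
have s2 : Num.sqrt 2 ^+ 2 = 2 :> R by rewrite sqr_sqrtr.
have s20 := sqrtr_ge0 (2 : R); exists (18 * Num.sqrt 2); split=> //.
  (* The squares are 648 and 676. *)
  by rewrite -(@ltr_pXn2r _ 2) ?nnegrE ?mulr_ge0// exprMn s2 -!natrX -natrM ltr_nat.
move=> n mu V dmu HV k /andP[k1 kn] eps eps0 u Hu.
have [F PF] := sdens_of_Hess HV dmu; pose g i := weak_gradient (u i).
(* Membership in [H1] guarantees that the chosen [weak_gradient] is a weak gradient and not the
   default value. *)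
have ug i : is_weak_gradient (u i) (g i) by have [[ex _] _ _ _ _] := Hu i; exact: xgetPex ex.
have mu_ i : measf (u i) by case: (ug i) => -[].
have mg i j : measf (fun x => g i x 0 j) by case: (ug i) => _ /(_ j) [].
have mg' i : measf (g i) by apply/measurable_rVP => j; exact: mg.
have men i : measf (fun x => enorm (g i x) ^+ 2) by apply: measurable_funX; exact: measurable_enorm.
have I i : intg mu (fun x => u i x ^+ 2 + enorm (g i x) ^+ 2).
  have [[_ fin] _ _ _ _] := Hu i; apply: intg_fin => [|x|]; last exact: fin.
    by apply: measurable_funD => //; exact: measurable_funX.
  by rewrite addr_ge0 ?sqr_ge0.
have Lu i : L2 mu (u i).
  split=> //; apply: (intg_le _ _ (I i)) => [|x]; first exact: measurable_funX.
  by rewrite ger0_norm ?sqr_ge0// lerDl sqr_ge0.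
have Lg i j : L2 mu (fun x => g i x 0 j).
  split=> //; apply: (intg_le _ _ (I i)) => [|x]; first exact: measurable_funX.
  rewrite ger0_norm ?sqr_ge0// enorm_sqr; apply: le_trans (coord_sqr_le _ _) _.
  by rewrite lerDr sqr_ge0.
have u0 i : Ex mu (u i) = 0 by have [_ e _ _ _] := Hu i; move: e; rewrite (ExE (L2_intg (Lu i))) => -[].
have u1 i : Ex mu (fun x => u i x ^+ 2) = 1 by have [_ _ e _ _] := Hu i; move: e; rewrite (ExE (Lu i).2) => -[].
have go i j : j != i -> Ex mu (fun x => dot (g i x) (g j x)) = 0.
  move=> ji; have [_ _ _ /(_ j ji) e _] := Hu i.
  have Ig : intg mu (fun x => dot (g i x) (g j x)) by apply: intg_sum => l _; exact: L2_mul.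
  by move: e; rewrite (ExE Ig) => -[].
have ge i : Ex mu (fun x => dot (g i x) (g i x)) <= 1 + eps.
  have [_ _ _ _ e] := Hu i; have Ig : intg mu (fun x => dot (g i x) (g i x)) by apply: intg_sum => j _; exact: L2_mul.
  by move: e; under eq_integral do rewrite enorm_sqr; rewrite (ExE Ig) lee_fin.
have [U [dU hq]] := exists_gaussian_directions PF kn eps0 ug Lu Lg u0 u1 go ge.
have [P PM lP] := frames_sdens U PF.
have q0 : 0 <= 39 * k%:R * eps by rewrite !mulr_ge0.
have dU0 : (0 < \dim U)%N by rewrite dU.
have W1le := W1_le_partner PM lP dU0 q0 hq.
(* The barycenter is the projection onto [U] of the mean of [mu], computed in the coordinates of the
   frame. *)
exists U, ((\row_i Ex P (fun y => y 0 (lshift _ i))) *m frame U); split=> //.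
- rewrite mulmx_sum_row; apply: memv_suml => i _; apply: memvZ; exact: (frameP U).2.
- apply: le_trans W1le _; rewrite lee_fin dU.
  rewrite -[leRHS]ger0_norm; last by rewrite !mulr_ge0 ?powR_ge0 ?sqrtr_ge0.
  rewrite -sqrtr_sqr ler_wsqrtr// !exprMn s2 sqr_sqrtr//.
  have -> : (k%:R `^ (3 / 2)) ^+ 2 = k%:R ^+ 3 :> R.
    by rewrite -powR_mulrn ?powR_ge0// -powRrM divfK// powR_mulrn.
  have : 0 <= k%:R ^+ 3 * eps by rewrite mulr_ge0// exprn_ge0.
  have -> : 3 * k%:R ^+ 2 * (39 * k%:R * eps) = 117 * (k%:R ^+ 3 * eps) by ring.
  have -> : 18 ^+ 2 * 2 * k%:R ^+ 3 * eps = 648 * (k%:R ^+ 3 * eps) by ring.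
  by move: (_ * eps) => t; lra.
- exists (fun z => marginal_potential (fun y => F (y *m frames U)) (z *m (frame (orth_compl U))^T)).
  by split; [exact: (projected_density PM lP)|exact: (projected_Hess PM)].
Qed.
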